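(* Let $n\ge1$, $\alpha\in(\frac{n-1}{n},1]$, $C_\alpha\ge0$, $\delta>0$. There exists a constant $C_1=C_1(n,\alpha,C_\alpha,\delta)\ge1$ and, for each integer $N\ge1$, a constant $C_2=C_2(n,\alpha,C_\alpha,\delta,N)\ge1$ such that the following holds. Let $\Omega\subset\mathbb{R}^n$ be a bounded domain, $N\geq 1$ an integer, $a:\Omega\to(0,+\infty)$ a Borel function, and let $G:\mathcal{F}_w(\Omega)\to\mathbb{R}$ satisfy $|G(\mathbf{W})-G(\mathbf{W}')|\le C_\alpha\,\mathrm{dist}(\mathbf{W},\mathbf{W}')^\alpha$ for $\mathbf{W},\mathbf{W}'\in\mathcal{F}_w(\Omega)$. Let $\Omega'\subset\Omega$ be open with $\delta\le a(x)\le1$ for $x\in\Omega'$, and let $\mathbf{W}\in\mathcal{F}_w(\Omega)$ be a minimizer of $J_w=F_w+G$ in $\mathcal{F}_w(\Omega)$, with associated sets $\partial_i$, $\partial$ and $W_i^\sharp$ as defined in the context. Write $I=\{1,\dots,N\}$. (1) For every $x\in\partial\cap\Omega'$ and $0<r\le\min(1,\mathrm{dist}(x,\partial\Omega'))$, there are two indices $i,j\in I$ with $i\ne j$, and points $x_i\in W_i^\sharp$ and $x_j\in W_j^\sharp$, such that $$B(x_i,C_1^{-1}r)\subset W_i^\sharp\cap B(x,r)\quad\text{and}\quad B(x_j,C_1^{-1}r)\subset W_j^\sharp\cap B(x,r).$$ (2) For every $i\in I$, every $x\in\partial_i\cap\Omega'$ and $0<r\le\min(1,\mathrm{dist}(x,\partial\Omega'))$,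 there is $x_i\in W_i^\sharp$ such that $$B(x_i,C_2^{-1}r)\subset W_i^\sharp\cap B(x,r).$$
   Context: Throughout, $|A|$ is Lebesgue measure on $\mathbb{R}^n$, and $B(x,r)$ is the open ball. A Borel set $W\subset\Omega$ has locally finite perimeter in $\Omega$ if the distributional gradient $\nabla\mathbf{1}_W$ of its characteristic function is a locally finite vector-valued measure on $\Omega$; its total variation measure is denoted $\mu_W=|D\mathbf{1}_W|$. The (De Giorgi) reduced boundary of $W$ in $\Omega$ is denoted $\partial^*W\subset\Omega$. $\mathcal{F}_w=\mathcal{F}_w(\Omega)$ is the set of $N$-tuples $\mathbf{W}=(W_1,\dots,W_N)$ of Borel subsets of $\Omega$ of locally finite perimeter in $\Omega$ such that $\sum_{i=1}^N\mathbf{1}_{W_i}=\mathbf{1}_\Omega$ almost everywhere; two $N$-tuples are identified if their components agree up to Lebesgue-null sets. Some $W_i$ may be empty. $\mathrm{dist}(\mathbf{W},\mathbf{W}')=\sum_{i=1}^N|W_i\triangle W_i'|$, where $A\triangle B=(A\setminus B)\cup(B\setminus A)$. $F_w(\mathbf{W})=\sum_{i=1}^N\int_\Omega a(x)\,d\mu_{W_i}(x)\in[0,+\infty]$, and $J_w(\mathbf{W})=F_w(\mathbf{W})+G(\mathbf{W})$. A minimizer of $J_w$ in $\mathcal{F}_w(\Omega)$ is a $\mathbf{W}\in\mathcal{F}_w(\Omega)$ with $J_w(\mathbf{W})\le J_w(\mathbf{W}')$ for all $\mathbf{W}'\in\mathcal{F}_w(\Omega)$. Given $\mathbf{W}\in\mathcal{F}_w$,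 set $\partial_i=\Omega\cap\overline{\partial^*W_i}$, $\partial=\Omega\cap\overline{\bigcup_i\partial^*W_i}=\bigcup_i\partial_i$, and define the open sets $$W_i^\sharp=\{x\in\Omega\setminus\partial:\ |B(x,r)\setminus W_i|=0\text{ for some }r>0\}.$$ ($\partial\Omega'$ denotes the topological boundary of $\Omega'$.) *)

(* Defs.v *)
From HB Require Import structures.
From mathcomp Require Import all_boot all_order all_algebra.
From mathcomp Require Import all_classical all_reals all_analysis.

Set Implicit Arguments.
Unset Strict Implicit.
Unset Printing Implicit Defensive.

Import Order.TTheory GRing.Theory Num.Theory.
Import numFieldNormedType.Exports.

Local Open Scope classical_set_scope.
Local Open Scope ring_scope.

Notation borelRn R n := (g_sigma_algebraType (@open 'rV[R]_n)).

Section lebesgue_Rn.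
Variable R : realType.

Lemma measurable_coord n (i : 'I_n) :
  measurable_fun [set: borelRn R n] (fun v : 'rV[R]_n => v ord0 i).
Proof.
apply: (@measurability _ _ _ _ _ _ _ (measurable_realfun.RGenOpens.measurableE R)).
move=> _ [_ [a [b ->]] <-]; rewrite setTI; apply: sub_sigma_algebra.
apply: open_comp; last exact: interval_open.
by move=> v _; exact: coord_continuous.
Qed.

Definition rat_box n (c : {ffun 'I_n -> rat} * {ffun 'I_n -> rat}) :
    set 'rV[R]_n :=
  [set v | forall i, ratr (c.1 i) < v ord0 i < ratr (c.2 i)].

Lemma measurable_fun_borelRn d (T : measurableType d) n (f : T -> borelRn R n) :
  (forall i, measurable_fun setT (fun t => (f t : 'rV[R]_n) ord0 i)) ->
  measurable_fun setT f.
Proof.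
move=> mf; apply: (@measurability _ _ _ _ _ f (@open 'rV[R]_n) erefl).
move=> _ [U oU <-]; rewrite setTI.
have rat_between (x y : R) : x < y -> {q | x < ratr q < y}.
  by move=> xy; apply: cid; have [q] := rat_in_itvoo xy; exists q.
have -> : f @^-1` U =
    \bigcup_c f @^-1` (if `[< rat_box c `<=` U >] then rat_box c else set0).
  apply/seteqP; split => [t Ut|t [c _]]; last first.
    by case: asboolP => [cU|_]; [exact: cU|].
  have /nbhs_ballP[e /= e0 eU] : nbhs (f t : 'rV[R]_n) U.
    by apply: open_nbhs_nbhs; split.
  pose x i := (f t : 'rV[R]_n) ord0 i.
  have lo i : {q | x i - e < ratr q < x i}.
    by apply: rat_between; rewrite gtrBl.
  have hi i : {q | x i < ratr q < x i + e}.
    by apply: rat_between; rewrite ltrDl.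
  exists ([ffun i => sval (lo i)], [ffun i => sval (hi i)]) => //.
  rewrite ifT.
    move=> i /=; rewrite !ffunE; case: (lo i) (hi i) => p /= /andP[_ p2].
    by move=> [q /= /andP[q1 _]]; rewrite p2 q1.
  apply/asboolP => v vb; apply: eU; split => // i j; rewrite ord1.
  move: (vb j); rewrite /= !ffunE.
  case: (lo j) (hi j) => p /= /andP[p1 p2] [q /= /andP[q1 q2]] /andP[pv vq].
  rewrite /ball /= ltr_distlC -/(x j); apply/andP; split.
    exact: lt_trans p1 pv.
  exact: lt_trans vq q2.
apply: countable_bigcupT_measurable => [|c]; first exact: countableP.
case: asboolP => _; last by rewrite preimage_set0.
have -> : f @^-1` rat_box c = \bigcap_(i in setT)
    ((fun t => (f t : 'rV[R]_n) ord0 i) @^-1` `]ratr (c.1 i), ratr (c.2 i)[).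
  apply/seteqP; split => t /= ct i; first by move=> _; rewrite /= in_itv; exact: ct.
  by have := ct i I; rewrite /= in_itv.
apply: fin_bigcap_measurable => // i _.
by rewrite -[X in measurable X]setTI; exact: mf.
Qed.

Definition cons_rV n (p : R * 'rV[R]_n) : 'rV[R]_n.+1 :=
  \row_i (if unlift ord0 i is Some j then p.2 ord0 j else p.1).

Definition uncons_rV n (v : 'rV[R]_n.+1) : R * 'rV[R]_n :=
  (v ord0 ord0, \row_i v ord0 (lift ord0 i)).

Lemma cons_rVK n : cancel (@cons_rV n) (@uncons_rV n).
Proof.
move=> [x v]; rewrite /uncons_rV /cons_rV /=.
congr (_, _); first by rewrite mxE unlift_none.
by apply/rowP => i; rewrite !mxE liftK.
Qed.

Lemma measurable_cons_rV n :
  measurable_fun setT (@cons_rV n : measurableTypeR R * borelRn R n -> borelRn R n.+1).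
Proof.
apply: measurable_fun_borelRn => i; case: (unliftP ord0 i) => [j|] ->.
  apply: (eq_measurable_fun (fun p : measurableTypeR R * borelRn R n => (p.2 : 'rV[R]_n) ord0 j)).
    by move=> p _; rewrite mxE liftK.
  exact: measurableT_comp (@measurable_coord n j) measurable_snd.
apply: (eq_measurable_fun fst) => [p _|]; last exact: measurable_fst.
by rewrite mxE unlift_none.
Qed.

Lemma measurable_uncons_rV n :
  measurable_fun setT (@uncons_rV n : borelRn R n.+1 -> measurableTypeR R * borelRn R n).
Proof.
apply/measurable_fun_pairP; split; first exact: measurable_coord.
apply: measurable_fun_borelRn => i.
rewrite (_ : (fun _ => _) = (fun v : 'rV[R]_n.+1 => v ord0 (lift ord0 i))).
  exact: measurable_coord.
by apply/funext => v /=; rewrite mxE.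
Qed.

Section lebesgue_rVS.
Variables (n : nat) (m : {sigma_finite_measure set (borelRn R n) -> \bar R}).

Definition lebesgue_rVS : set (borelRn R n.+1) -> \bar R :=
  pushforward (lebesgue_measure \x m)%E
    (@cons_rV n : measurableTypeR R * borelRn R n -> borelRn R n.+1).

Let lebesgue_rVS0 : lebesgue_rVS set0 = 0%E.
Proof. by rewrite /lebesgue_rVS /pushforward preimage_set0 measure0. Qed.

Let lebesgue_rVS_ge0 A : (0 <= lebesgue_rVS A)%E.
Proof. by rewrite /lebesgue_rVS /pushforward measure_ge0. Qed.

Let lebesgue_rVS_sigma_additive : semi_sigma_additive lebesgue_rVS.
Proof.
have mcons (B : set (borelRn R n.+1)) : measurable B ->
    measurable ((@cons_rV n : measurableTypeR R * borelRn R n -> _) @^-1` B).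
  by move=> mB; rewrite -[X in measurable X]setTI; exact: measurable_cons_rV.
move=> F mF tF mUF; rewrite /lebesgue_rVS /pushforward preimage_bigcup.
apply: measure_semi_sigma_additive => [k||]; first exact: mcons.
- apply/trivIsetP => i j _ _ ij; rewrite -preimage_setI.
  by move/trivIsetP : tF => ->//; rewrite preimage_set0.
- by rewrite -preimage_bigcup; exact: mcons.
Qed.

HB.instance Definition _ := isMeasure.Build _ _ _ lebesgue_rVS
  lebesgue_rVS0 lebesgue_rVS_ge0 lebesgue_rVS_sigma_additive.

Let lebesgue_rVS_sigma_finite : sigma_finite setT lebesgue_rVS.
Proof.
have /sigma_finiteP[F [TF ndF Foo]] :=
  sigma_finiteT (@lebesgue_measure R : {sigma_finite_measure set _ -> \bar R}).
have /sigma_finiteP[G [TG ndG Goo]] := sigma_finiteT m.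
exists (fun k => (@uncons_rV n : borelRn R n.+1 -> _) @^-1` (F k `*` G k)).
  rewrite -preimage_bigcup (_ : \bigcup_k _ = setT) ?preimage_setT//.
  apply/seteqP; split => // -[x y] _.
  have : setT x by []. have : setT y by [].
  rewrite {1}TG {1}TF => -[j _ Gj] [i _ Fi]; exists (maxn i j) => //; split.
    by move: Fi; exact/subsetPset/ndF/leq_maxl.
  by move: Gj; exact/subsetPset/ndG/leq_maxr.
move=> k; have [mF Fk] := Foo k; have [mG Gk] := Goo k; split.
  rewrite -[X in measurable X]setTI; apply: measurable_uncons_rV => //.
  exact: measurableX.
rewrite /lebesgue_rVS /pushforward -comp_preimage.
rewrite (_ : _ \o _ = id); last by apply/funext => p; exact: cons_rVK.
by rewrite preimage_id product_measure1E// lte_mul_pinfty// ge0_fin_numE.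
Qed.

HB.instance Definition _ := Measure_isSigmaFinite.Build _ _ _ lebesgue_rVS
  lebesgue_rVS_sigma_finite.

End lebesgue_rVS.

Fixpoint lebesgue_rV n : {sigma_finite_measure set (borelRn R n) -> \bar R} :=
  match n with
  | 0 => @dirac _ (borelRn R 0) 0 R
  | n'.+1 => @lebesgue_rVS n' (lebesgue_rV n')
  end.

Lemma lebesgue_rV_box n (a b : 'I_n -> R) : (forall i, a i <= b i) ->
  lebesgue_rV n [set v | forall i, v ord0 i \in `]a i, b i]] =
  (\prod_(i < n) (b i - a i))%:E.
Proof.
elim: n a b => [|n IHn] a b ab.
  rewrite big_ord0 /= diracE mem_set//; by case.
rewrite big_ord_recl EFinM -(IHn _ _ (fun i => ab (lift ord0 i))).
have -> : (b ord0 - a ord0)%:E = lebesgue_measure `]a ord0, b ord0]%classic.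
  rewrite lebesgue_measure_itv /= lte_fin EFinB.
  by case: ltgtP (ab ord0) => // ->; rewrite subee.
set B := (X in (_ * lebesgue_rV n X)%E).
have mB : measurable (B : set (borelRn R n)).
  rewrite (_ : B = \bigcap_(i in setT) ((fun v : 'rV[R]_n => v ord0 i) @^-1`
      `]a (lift ord0 i), b (lift ord0 i)])); last first.
    by apply/seteqP; split => v vab i; [move=> _|]; exact: vab.
  apply: fin_bigcap_measurable => // i _.
  by rewrite -[X in measurable X]setTI; exact: measurable_coord.
rewrite -product_measure1E// /= /lebesgue_rVS /pushforward.
congr (product_measure1 _ _ _); apply/seteqP; split => -[x v] /=.
  move=> H; split; first by have := H ord0; rewrite mxE unlift_none.
  by move=> i; have := H (lift ord0 i); rewrite mxE liftK.
move=> [xab vab] i; rewrite mxE.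
by case: (unliftP ord0 i) => [j|] ->; [exact: vab|].
Qed.

End lebesgue_Rn.

Section euclidean.
Variables (R : realType) (n : nat).
Implicit Types (x y v : 'rV[R]_n) (A : set 'rV[R]_n).

(* The library norm of 'rV[R]_n is the sup norm; it induces the right topology
   but the balls and distances below must be Euclidean. *)
Definition enorm v : R := Num.sqrt (\sum_(i < n) v ord0 i ^+ 2).

Definition eball x (r : R) : set 'rV[R]_n := [set y | enorm (y - x) < r].

Definition eucl_dist x A : \bar R := ereal_inf [set (enorm (y - x))%:E | y in A].

Definition boundary A : set 'rV[R]_n := closure A `\` interior A.

Definition rel_compact_in (O : set 'rV[R]_n) A :=
  compact (closure A) /\ closure A `<=` O.

Definition partial (i : 'I_n) (f : 'rV[R]_n -> R) : 'rV[R]_n -> R :=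
  fun x => 'D_(delta_mx ord0 i) f x.

Definition partials (s : seq 'I_n) (f : 'rV[R]_n -> R) := foldr partial f s.

Definition smooth (f : 'rV[R]_n -> R) := forall s : seq 'I_n,
  continuous (partials s f) /\
  forall i x, derivable (partials s f) x (delta_mx ord0 i).

Definition test_function (O : set 'rV[R]_n) (f : 'rV[R]_n -> R) :=
  smooth f /\ rel_compact_in O [set x | f x != 0].

End euclidean.

Section perimeter.
Variables (R : realType) (n : nat).
Local Notation V := 'rV[R]_n.
Local Notation leb := (lebesgue_rV R n).
Implicit Types (O W A K : set (borelRn R n)) (D : set V -> V).

Definition locally_finite O (m : {measure set (borelRn R n) -> \bar R}) :=
  forall K, compact (K : set V) -> K `<=` O -> (m K < +oo)%E.

(* A locally finite R^n-valued measure on O need not be defined on all Borel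
   subsets of O (components may be of the form +oo - oo), so it is a set
   function D of which only the values on Borel sets relatively compact in O
   are meaningful. Its i-th component is the difference P i - M i of two
   locally finite positive measures, and integrals against it are differences
   of integrals against P i and M i. *)
Definition is_gradient_measure O W D :=
  exists P M : 'I_n -> {measure set (borelRn R n) -> \bar R},
  [/\ forall i, locally_finite O (P i) /\ locally_finite O (M i),
      forall A, measurable A -> rel_compact_in O A ->
        D A = \row_i (fine (P i A) - fine (M i A)) &
      forall i (f : V -> R), test_function O f ->
        (\int[leb]_(x in W) (partial i f x)%:E =
         - (\int[P i]_(x in O) (f x)%:E - \int[M i]_(x in O) (f x)%:E))%E].

Definition locally_finite_perimeter O W := exists D, is_gradient_measure O W D.

(* Unique on the meaningful sets, by density of the test functions. *)
Definition gradient_measure O W : set V -> V :=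
  xget (fun=> 0) [set D | is_gradient_measure O W D].

(* |D|(A `&` O), the supremum being over the countable Borel partitions of
   A `&` O into sets relatively compact in O. *)
Definition total_variation O D (A : set (borelRn R n)) : \bar R :=
  ereal_sup [set (\sum_(0 <= k <oo) (enorm (D (F k)))%:E)%E
    | F in [set F : (set (borelRn R n))^nat |
        [/\ forall k, measurable (F k) /\ rel_compact_in O (F k),
            trivIset setT F & \bigcup_k F k = A `&` O]]].

Definition perimeter_measure O W : set (borelRn R n) -> \bar R :=
  total_variation O (gradient_measure O W).

Definition reduced_boundary O W : set V :=
  [set x | [/\ O x,
    forall r : R, 0 < r -> (0 < perimeter_measure O W (eball x r))%E &
    exists nu : V, enorm nu = 1 /\
      (fine (perimeter_measure O W (eball x r)))^-1 *:
        gradient_measure O W (eball x r) @[r --> 0^'+] --> nu]].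

End perimeter.

Section partition_problem.
Variables (R : realType) (n N : nat).
Local Notation V := 'rV[R]_n.
Local Notation leb := (lebesgue_rV R n).
Implicit Types (O : set V) (W : 'I_N -> set V).

Definition weak_partition O W :=
  (forall i, [/\ measurable (W i : set (borelRn R n)), W i `<=` O &
     locally_finite_perimeter O (W i)]) /\
  {ae leb, forall x, \sum_(i < N) \1_(W i) x = \1_O x :> R}.

Definition partition_dist W W' : \bar R :=
  (\sum_(i < N) leb ((W i `\` W' i) `|` (W' i `\` W i)))%E.

Definition F_w O (a : V -> R) W : \bar R :=
  (\sum_(i < N)
     \int[perimeter_measure O (W i)]_(x in (O : set (borelRn R n))) (a x)%:E)%E.

Definition J_w O (a : V -> R) (G : ('I_N -> set V) -> R) W : \bar R :=
  (F_w O a W + (G W)%:E)%E.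

Definition is_minimizer O a G W := weak_partition O W /\
  forall W', weak_partition O W' -> (J_w O a G W <= J_w O a G W')%E.

Definition bdry_i O W (i : 'I_N) : set V :=
  O `&` closure (reduced_boundary O (W i)).

Definition bdry O W : set V :=
  O `&` closure (\bigcup_i reduced_boundary O (W i)).

Definition sharp O W (i : 'I_N) : set V :=
  [set x | [/\ O x, ~ bdry O W x &
    exists r : R, 0 < r /\ leb (eball x r `\` W i) = 0%E]].

End partition_problem.

(* Main.v *)
Require Import Defs.
From HB Require Import structures.
From mathcomp Require Import all_boot all_order all_algebra.
From mathcomp Require Import all_classical all_reals all_analysis.
From mathcomp Require Import measurable_realfun ring lra.

Set Implicit Arguments.
Unset Strict Implicit.
Unset Printing Implicit Defensive.

Import Order.TTheory GRing.Theory Num.Theory.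
Import numFieldNormedType.Exports.

Local Open Scope classical_set_scope.
Local Open Scope ring_scope.

(* Only the perimeter measures enter: a point of the reduced boundary is a point all of whose
   balls have positive perimeter. For almost every coordinate hyperplane the gradient of the part
   of a set on one side of it is the restriction of the gradient plus the trace, because the trace
   is the limit of the averages over thin strips. Hence a cube can be replaced, up to a shell of
   width s, by one for which giving all of it to [W_i], or giving [W_i] inside it to another
   [W_j], costs new perimeter at most C b / s, where b is the volume transferred. Minimality bounds
   the perimeter inside by C (b / s + b^alpha). In the first case the constant does not depend on
   N. In the second one, the competitors for all j are summed and the strict triangle inequality
   [enorm_gap] is used.

   The isoperimetric inequality and an iteration on shrinking cubes turn this into density
   estimates: if [W_i] (or its complement) has small volume in a cube then it is null in the half
   cube. A cube is then divided into L^n cells. If no cell is nearly filled by a [W_k] with k in a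
   given set, the Poincare inequality in each cell bounds the volume of the union of these [W_k] by
   C / L times the volume of the cube. So for L large there is a cell nearly filled by such a
   [W_k], and its half cell lies in the interior. *)

(** The gradient of a set is known only through smooth test functions, while cuts need indicators of
    half-spaces and volume estimates need translates of Borel sets. The bridge is [sweep_identity]:
    the defining identity, integrated over the segment from [x] to [x - u e_k], becomes an equality
    of finite measures without derivatives, hence valid on Borel sets. Divided by [u], as [u] tends
    to 0, it gives the gradient of a set cut by a half-space. For fixed [u] it bounds the volume
    that leaves a set under a translation; averaged over translations, this yields the isoperimetric
    and Poincare inequalities by one double counting. Cubes are used instead of balls because their
    faces can be cut one coordinate at a time.

    The constant of (1) is chosen before [N]: its density estimate concerns the complement of some
    [W_i], which is given to [W_i], whereas (2) needs the density of [W_i] itself, where [enorm_gap]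
    costs a factor [(N - 1)^2]. In (1) the second index comes from the same search among the sets
    other than the first one found, since near a point of [bdry] no single set nearly fills a
    cube. *)

Section enorm_theory.
Variables (R : realType) (n : nat).
Implicit Types u v : 'rV[R]_n.

Lemma cauchy_schwarz_sum (a b : 'I_n -> R) :
  (\sum_i a i * b i) ^+ 2 <= (\sum_i a i ^+ 2) * (\sum_i b i ^+ 2).
Proof.
set A := \sum_i a i ^+ 2; set B := \sum_i b i ^+ 2; set C := \sum_i a i * b i.
have A0 : 0 <= A by apply: sumr_ge0 => i _; exact: sqr_ge0.
have H t : 0 <= A * t ^+ 2 + 2 * C * t + B.
  have -> : A * t ^+ 2 + 2 * C * t + B = \sum_i (a i * t + b i) ^+ 2.
    rewrite /A /B /C mulr_sumr !mulr_suml -!big_split/=.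
    by apply: eq_bigr => i _; ring.
  by apply: sumr_ge0 => i _; exact: sqr_ge0.
have [A00|Ap] := eqVneq A 0.
  (* With [A = 0] the polynomial is affine in [t], and at this point it would take the value -1
     unless [C = 0]. *)
  have := H (- (B + 1) / (2 * C)); rewrite A00 mul0r add0r mul0r.
  have [->|C0] := eqVneq C 0; first by rewrite expr0n.
  rewrite (_ : 2 * C * _ = - (B + 1)); first by lra.
  by field; rewrite C0.
have {}Ap : 0 < A by rewrite lt_neqAle eq_sym Ap.
have := H (- C / A).
rewrite (_ : _ + _ = (A * B - C ^+ 2) / A); last by field; rewrite gt_eqF.
by rewrite pmulr_lge0 ?invr_gt0// subr_ge0.
Qed.

Lemma enorm_ge0 v : 0 <= enorm v.
Proof. exact: sqrtr_ge0. Qed.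

Lemma sqr_enorm v : enorm v ^+ 2 = \sum_i v ord0 i ^+ 2.
Proof. by rewrite sqr_sqrtr// sumr_ge0// => i _; exact: sqr_ge0. Qed.

Lemma enorm0 : enorm (0 : 'rV[R]_n) = 0.
Proof. by rewrite /enorm big1 ?sqrtr0// => i _; rewrite mxE expr0n. Qed.

Lemma enormN v : enorm (- v) = enorm v.
Proof. by rewrite /enorm; congr Num.sqrt; apply: eq_bigr => i _; rewrite mxE sqrrN. Qed.

Lemma inner_le_enorm u v :
  `|\sum_i u ord0 i * v ord0 i| <= enorm u * enorm v.
Proof.
rewrite -ler_sqr ?nnegrE ?mulr_ge0 ?enorm_ge0//.
by rewrite -normrX ger0_norm ?sqr_ge0// exprMn !sqr_enorm cauchy_schwarz_sum.
Qed.

Lemma sqr_enormD u v :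
  enorm (u + v) ^+ 2 =
  enorm u ^+ 2 + 2 * (\sum_i u ord0 i * v ord0 i) + enorm v ^+ 2.
Proof.
rewrite !sqr_enorm mulr_sumr -!big_split/=.
by apply: eq_bigr => i _; rewrite mxE; ring.
Qed.

Lemma enormD u v : enorm (u + v) <= enorm u + enorm v.
Proof.
rewrite -ler_sqr ?nnegrE ?addr_ge0 ?enorm_ge0// sqr_enormD.
have := le_trans (ler_norm _) (inner_le_enorm u v); lra.
Qed.

Lemma enormB u v : enorm (u - v) <= enorm u + enorm v.
Proof. by rewrite -(enormN v) enormD. Qed.

Lemma enorm_sum (I : Type) (s : seq I) (P : pred I) (f : I -> 'rV[R]_n) :
  enorm (\sum_(i <- s | P i) f i) <= \sum_(i <- s | P i) enorm (f i).
Proof.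
elim/big_ind2: _ => [|x1 x2 y1 y2 h1 h2|//]; first by rewrite enorm0.
by rewrite (le_trans (enormD _ _))// lerD.
Qed.

Lemma coord_le_enorm v i : `|v ord0 i| <= enorm v.
Proof.
rewrite -ler_sqr ?nnegrE ?enorm_ge0// sqr_enorm -normrX ger0_norm ?sqr_ge0//.
by rewrite (bigD1 i)//= lerDl sumr_ge0// => j _; exact: sqr_ge0.
Qed.

Lemma enorm_le_sum v : enorm v <= \sum_i `|v ord0 i|.
Proof.
rewrite -ler_sqr ?nnegrE ?enorm_ge0 ?sumr_ge0// sqr_enorm.
elim: (index_enum _) => [|i s IH]; first by rewrite !big_nil expr0n.
rewrite !big_cons.
have : 0 <= \sum_(j <- s) `|v ord0 j| by exact: sumr_ge0.
have := normr_ge0 (v ord0 i); have := real_normK (num_real (v ord0 i)).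
rewrite sqrrD => <- x0 y0; rewrite lerD//.
by rewrite lerDl mulrn_wge0// mulr_ge0.
Qed.

(* If the v_j, j <> i, sum up to - v_i then at least one of them satisfies
   <v_i, v_j> <= - |v_i|^2 / p, which makes the triangle inequality for
   v_i + v_j strict by |v_i| / p. *)
Lemma enorm_gap (N : nat) (v : 'I_N -> 'rV[R]_n) (i : 'I_N) :
  \sum_j v j = 0 ->
  enorm (v i) + (\sum_(j | j != i) enorm (v i + v j)) *+ N.-1 <=
  (\sum_(j | j != i) (enorm (v i) + enorm (v j))) *+ N.-1.
Proof.
move=> v0; set p := N.-1.
have cardp : #|[pred j | j != i]| = p.
  by have := cardC (pred1 i); rewrite card1 card_ord /p => /(congr1 predn) <-.
pose ip (u w : 'rV[R]_n) := \sum_k u ord0 k * w ord0 k.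
have ips : \sum_(j | j != i) ip (v i) (v j) = - enorm (v i) ^+ 2.
  rewrite /ip exchange_big/= sqr_enorm -sumrN; apply: eq_bigr => k _.
  rewrite -mulr_sumr expr2 -mulrN; congr (_ * _).
  have : (\sum_j v j) ord0 k = 0 by rewrite v0 mxE.
  rewrite summxE (bigD1 i)//= => /eqP; rewrite addrC addr_eq0 => /eqP.
  by [].
have [vi0|vi0] := eqVneq (enorm (v i)) 0.
  rewrite vi0 add0r lerMn2r; apply/orP; right; apply: ler_sum => j _.
  by rewrite -[X in X + enorm (v j)]vi0 enormD.
have vip : 0 < enorm (v i) by rewrite lt_neqAle eq_sym vi0 enorm_ge0.
have [j ji jip] : exists2 j, j != i & ip (v i) (v j) *+ p <= - enorm (v i) ^+ 2.
  apply: contrapT => /forall2NP H.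
  have : \sum_(j | j != i) - enorm (v i) ^+ 2 < \sum_(j | j != i) ip (v i) (v j) *+ p.
    have Hs j : j != i -> - enorm (v i) ^+ 2 < ip (v i) (v j) *+ p.
      by move=> ji; case: (H j) => [//|/negP]; rewrite -ltNge.
    apply: ltr_sum => //.
    (* Strictness of the sum needs an index [j != i]: without one the sum in [ips] is empty and
       [v i = 0]. *)
    apply/hasP; apply: contrapT => Hh.
    have : \sum_(j | j != i) ip (v i) (v j) = 0.
      rewrite big_hasC//; apply/hasPn => x xs; apply/negP => xi.
      by apply: Hh; exists x.
    rewrite ips => /eqP; rewrite oppr_eq0 sqrf_eq0.
    by apply/negP.
  by rewrite sumrMnl ips sumr_const cardp mulNrn ltxx.
have p0 : (0 < p)%N.
  by rewrite -cardp; apply/card_gt0P; exists j; rewrite inE.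
rewrite (bigD1 j)//= [in leRHS](bigD1 j)//= !mulrnDl addrA; apply: lerD; last first.
  by rewrite lerMn2r; apply/orP; right; apply: ler_sum => k _; exact: enormD.

set a := enorm (v i) in vip jip *; set b := enorm (v j).
have b0 : 0 <= b by exact: enorm_ge0.
have p1 : 1 <= p%:R :> R by rewrite (ler_nat R 1).
have key : p%:R * enorm (v i + v j) <= p%:R * (a + b) - a.
  rewrite -ler_sqr ?nnegrE ?mulr_ge0 ?enorm_ge0//; last first.
    rewrite subr_ge0 (le_trans _ (ler_peMl _ p1)) ?lerDl//.
    by rewrite addr_ge0// ltW.
  rewrite exprMn sqr_enormD -/(ip _ _) -/a -/b.
  move: jip; rewrite -mulr_natr; set c := ip _ _ => jip.
  have h1 : p%:R * (c * p%:R) <= p%:R * (- a ^+ 2) by rewrite ler_pM2l ?(lt_le_trans ltr01).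
  have h2 : 0 <= (p%:R - 1) * (a * b) * p%:R.
    by rewrite !mulr_ge0 ?ler0n ?subr_ge0// ltW.
  rewrite -subr_ge0 (_ : _ - _ = 2 * ((p%:R - 1) * (a * b) * p%:R) +
      2 * (p%:R * (- a ^+ 2) - p%:R * (c * p%:R)) + a ^+ 2); last by ring.
  by rewrite addr_ge0 ?sqr_ge0// addr_ge0// mulr_ge0// subr_ge0.
by rewrite -mulrnDl -[X in _ + X <= _]mulr_natl -[leRHS]mulr_natl -lerBrDl.
Qed.

End enorm_theory.

(** * Smooth functions flat at 0 *)

Section theta.
Variable R : realType.
Implicit Types (p : {poly R}) (x y : R).

(** Indexed by all polynomials because the family is then stable under differentiation: [theta p]
    has derivative [theta (theta_poly p)]. For [p = 1] it is the usual smooth function vanishing on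
    the negative half-line. *)
Definition theta p x : R := if 0 < x then p.[x^-1] * expR (- x^-1) else 0.

Definition theta_poly p : {poly R} := 'X^2 * (p - p^`()).

Lemma horner_le_expR p : exists2 C : R, 0 <= C &
  forall y, 0 <= y -> `|p.[y]| <= C * expR y.
Proof.
elim/poly_ind: p => [|p c _].
  by exists 0 => // y _; rewrite horner0 normr0 mul0r.
have Xn k : exists2 C : R, 0 <= C & forall y, 0 <= y -> y ^+ k <= C * expR y.
  case: k => [|k].
    exists 1 => // y y0; rewrite expr0 mul1r -expR0 ler_expR//.
  exists (k.+1`!%:R) => // y y0.
  have k0 : 0 < k.+1`!%:R :> R by rewrite ltr0n fact_gt0.
  rewrite mulrC -ler_pdivrMr// (le_trans _ (expR_ge1Dxn k y0))//.
  by rewrite lerDr.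
set q := p * 'X + c%:P.
have [C C0 CP] : exists2 C : nat -> R, forall i, 0 <= C i &
    forall i y, 0 <= y -> y ^+ i <= C i * expR y.
  by exists (fun i => sval (cid2 (Xn i))) => i; case: cid2.
exists (\sum_(i < size q) `|q`_i| * C i).
  by apply: sumr_ge0 => i _; rewrite mulr_ge0.
move=> y y0; rewrite horner_coef mulr_suml (le_trans (ler_norm_sum _ _ _))//.
apply: ler_sum => i _; rewrite normrM -mulrA ler_wpM2l//.
by rewrite ger0_norm ?exprn_ge0// CP.
Qed.

(** The exponential growth bound for ['X^2 * p] at [x^-1]. A quadratic bound is what gives [theta p]
    the derivative 0 at 0. *)
Lemma theta_le_sqr p : exists2 C : R, 0 <= C &
  forall x, `|theta p x| <= C * `|x| ^+ 2.
Proof.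
have [C C0 CP] := horner_le_expR ('X^2 * p); exists C => // x.
rewrite /theta; case: ifPn => x0; last by rewrite normr0 mulr_ge0// sqr_ge0.
have := CP x^-1; rewrite invr_ge0 ltW// => /(_ isT).
rewrite hornerM hornerXn (normrM (_ ^+ _)) [X in X * _ <= _]ger0_norm; last first.
  by rewrite exprn_ge0// invr_ge0 ltW.
rewrite exprVn => H.
rewrite normrM (gtr0_norm x0) [X in _ * X <= _]ger0_norm ?expR_ge0// expRN.
rewrite ler_pdivrMr ?expR_gt0// mulrAC -ler_pdivrMr ?exprn_gt0//.
by rewrite mulrC.
Qed.

Lemma is_derive_theta p x : is_derive x (1 : R) (theta p) (theta (theta_poly p) x).
Proof.
have [x0|x0|->] := ltgtP x 0.
- apply: (@near_eq_is_derive _ _ _ (cst 0)).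
    near=> y; rewrite /theta ifF//; apply/negbTE; rewrite -leNgt ltW//.
    by near: y; apply: lt_nbhsl.
  by rewrite /theta ifF; [exact: is_derive_cst | apply/negbTE; rewrite -leNgt ltW].
- apply: (@near_eq_is_derive _ _ _ (fun y => p.[y^-1] * expR (- y^-1))).
    near=> y; rewrite /theta ifT//.
    by near: y; apply: lt_nbhsr.
  rewrite /theta x0.
  have xN0 : x != 0 by rewrite gt_eqF.
  have dinv : is_derive x 1 (fun y : R => y^-1) (- x^-2).
    apply: is_derive_eq; first exact: (@is_deriveV _ id).
    by rewrite scaler1.
  have d1 : is_derive x 1 (fun y : R => p.[y^-1]) (p^`().[x^-1] * (- x^-2)).
    exact: (@is_derive1_comp _ (horner p) (fun y : R => y^-1)).
  have d3 : is_derive x 1 (fun y : R => - y^-1) (x^-2).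
    by apply: (is_derive_eq (is_deriveN dinv)); rewrite opprK.
  have d2 : is_derive x 1 (fun y : R => expR (- y^-1)) (expR (- x^-1) * x^-2).
    exact: (@is_derive1_comp _ expR (fun y : R => - y^-1)).
  apply: (is_derive_eq (is_deriveM d1 d2)).
  by rewrite /theta_poly !hornerE /GRing.scale/= exprVn; ring.
- have [C C0 CP] := theta_le_sqr p.
  have t0 q : theta q 0 = 0 by rewrite /theta ltxx.
  have H : h^-1 *: (theta p (h *: 1 + 0) - theta p 0) @[h --> 0^'] --> (0 : R).
    apply/cvgr0Pnorm_le => e e0; near=> h.
    rewrite t0 subr0 addr0 normrZ normfV [_ *: 1]mulr1.
    have h0 : h != 0 by near: h; exact: nbhs_dnbhs_neq.
    rewrite mulrC ler_pdivrMr ?normr_gt0// (le_trans (CP h))//.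
    rewrite expr2 mulrA ler_wpM2r//.
    have : `|h| <= e / (C + 1).
      near: h; apply: dnbhs0_le; by rewrite divr_gt0// ltr_wpDl.
    rewrite ler_pdivlMr ?ltr_wpDl// => H; rewrite (le_trans _ H)// mulrC ler_wpM2l//.
    by rewrite lerDl.
  apply: DeriveDef.
    by apply/cvg_ex; exists 0.
  by rewrite t0 /derive; apply/cvg_lim.
Unshelve. all: by end_near. Qed.

End theta.

(* The filter instance of 'rV[R]_n is not found through its nbhsType structure. *)
Global Instance nbhs_rV_proper (R : realType) n (x : 'rV[R]_n) :
  ProperFilter (nbhs x).
Proof. exact: nbhs_pfilter. Qed.

(** * Smooth functions, and test functions increasing to the indicator of an open set *)

Section smooth_functions.
Variables (R : realType) (n : nat).
Local Notation V := 'rV[R]_n.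
Local Notation e_ i := (delta_mx ord0 i : V).

(** Reduces partial derivatives to functions of one variable, for which the chain rule and the
    fundamental theorem of calculus are at hand. *)
Lemma is_derive_line (f : V -> R) (x v : V) (a df : R) :
  is_derive a (1 : R) (fun s => f (x + s *: v)) df <->
  is_derive (x + a *: v) v f df.
Proof.
pose g : R -> R := fun s => f (x + s *: v).
pose F (h : R) := h^-1 *: ((f \o shift (x + a *: v)) (h *: v) - f (x + a *: v)).
pose G (h : R) := h^-1 *: ((g \o shift a) (h *: (1 : R)) - g a).
have FG : F = G.
  apply/funext => h; rewrite /F /G /=; congr (_ *: (f _ - _)).
  by rewrite [h *: 1]mulr1 scalerDl addrCA.
have E1 : derivable f (x + a *: v) v = derivable g a (1 : R).
  by rewrite /derivable -[X in cvg (X @ _)]/F -[X in _ = cvg (X @ _)]/G FG.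
have E2 : 'D_v f (x + a *: v) = 'D_(1 : R) g a.
  by rewrite /derive -[X in lim (X @ _)]/F -[X in _ = lim (X @ _)]/G FG.
split => -[d1 d2]; apply: DeriveDef.
- by rewrite E1.
- by rewrite E2.
- by move: d1; rewrite E1.
- by move: d2; rewrite E2.
Qed.

Lemma derive_translate (f : V -> R) (x y v : V) :
  'D_v (fun z => f (z + y)) x = 'D_v f (x + y).
Proof.
rewrite /derive (_ : (fun h => _) =
  (fun h => h^-1 *: ((f \o shift (x + y)) (h *: v) - f (x + y))))//.
by apply/funext => h /=; rewrite addrA.
Qed.

Lemma derivable_translate (f : V -> R) (x y v : V) :
  derivable (fun z => f (z + y)) x v <-> derivable f (x + y) v.
Proof.
rewrite /derivable (_ : (fun h => _) =
  (fun h => h^-1 *: ((f \o shift (x + y)) (h *: v) - f (x + y))))//.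
by apply/funext => h /=; rewrite addrA.
Qed.

Lemma continuous_addr (y : V) : continuous (fun z : V => z + y).
Proof. by move=> x; apply: cvgD; [exact: cvg_id|exact: cvg_cst]. Qed.

Lemma smooth_shift (f : V -> R) (y : V) : smooth f -> smooth (fun z => f (z + y)).
Proof.
move=> sf s.
have -> : partials s (fun z => f (z + y)) = fun z => partials s f (z + y).
  elim: s => //= i s ->; by apply/funext => z; rewrite /partial derive_translate.
have [c d] := sf s; split => [x|i x]; last exact/derivable_translate.
by move=> A nA; have := continuous_addr (c (x + y) A nA).
Qed.

(** A class stable under partial derivatives that contains all the cutoffs below. Smoothness
    quantifies over all iterated partial derivatives, so this stability gives it by induction on the
    list of indices. *)
Inductive elementary : (V -> R) -> Prop :=
| elementary_cst c : elementary (fun=> c)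
| elementaryD f g : elementary f -> elementary g -> elementary (fun x => f x + g x)
| elementaryM f g : elementary f -> elementary g -> elementary (fun x => f x * g x)
| elementary_theta p i a b : elementary (fun x => theta p (a * x ord0 i + b)).

Lemma elementary_derive f (i : 'I_n) : elementary f ->
  exists2 df, elementary df & forall x, is_derive x (e_ i) f (df x).
Proof.
elim => [c|g h _ [dg eg Dg] _ [dh eh Dh]|g h eg [dg edg Dg] eh [dh edh Dh]|p j a b].
- by exists (fun=> 0); [exact: elementary_cst|move=> x; exact: is_derive_cst].
- exists (fun x => dg x + dh x); first exact: elementaryD.
  by move=> x; exact: (is_deriveD (Dg x) (Dh x)).
- exists (fun x => g x * dh x + h x * dg x).
    by apply: elementaryD; exact: elementaryM.
  by move=> x; exact: (is_deriveM (Dg x) (Dh x)).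
- exists (fun x => (a * (i == j)%:R) * theta (theta_poly p) (a * x ord0 j + b)).
    by apply: elementaryM; [exact: elementary_cst|exact: elementary_theta].
  move=> x.
  have -> : x = x + 0 *: e_ i by rewrite scale0r addr0.
  apply/is_derive_line.
  have d1 : is_derive (0 : R) (1 : R)
      (fun s => a * (x + s *: e_ i) ord0 j + b) (a * (i == j)%:R).
    rewrite (_ : (fun s => _) = (fun s : R => (a * (i == j)%:R) * s + (a * x ord0 j + b))).
      apply: is_derive_eq.
      by rewrite addr0 [_ *: 1]mulr1.
    apply/funext => s; rewrite !mxE eqxx/= (eq_sym j); ring.
  have := @is_derive1_comp _ (theta p) _ _ _ _ (is_derive_theta p _) d1.
  by rewrite mulrC.
Qed.

Lemma elementary_continuous f : elementary f -> continuous f.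
Proof.
move=> ef; suff H (x : V) : f @ x --> f x by [].
elim: ef => [c|g h _ cg _ ch|g h _ cg _ ch|p j a b]; first exact: cvg_cst.
- by apply: cvgD; [exact: cg|exact: ch].
- by apply: cvgM; [exact: cg|exact: ch].
- have h (t : R) : theta p (a * u + b) @[u --> t] --> theta p (a * t + b).
    have l : (a * u + b) @[u --> t] --> a * t + b.
      by apply: cvgD; [apply: cvgM; [exact: cvg_cst|exact: cvg_id]|exact: cvg_cst].
    apply: (cvg_comp _ _ l); apply: differentiable_continuous.
    by apply/derivable1_diffP; case: (is_derive_theta p (a * t + b)).
  by move=> A nA; have := @coord_continuous _ _ _ ord0 j x _ (h (x ord0 j) A nA).
Qed.

Lemma elementary_smooth f : elementary f -> smooth f.
Proof.
move=> ef s.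
have es : elementary (partials s f).
  elim: s => //= i s IH; have [df edf H] := elementary_derive i IH.
  rewrite (_ : partial i _ = df)//; apply/funext => x.
  by rewrite /partial; case: (H x).
split; first exact: elementary_continuous.
by move=> i x; have [df _ H] := elementary_derive i es; case: (H x).
Qed.

Lemma elementaryX f m : elementary f -> elementary (fun x => f x ^+ m).
Proof.
move=> ef; elim: m => [|m IH].
  by under eq_fun do rewrite expr0; exact: elementary_cst.
by under eq_fun do rewrite exprS; exact: elementaryM.
Qed.

Lemma elementary_prod (I : Type) (s : seq I) (P : pred I) (f : I -> V -> R) :
  (forall i, elementary (f i)) -> elementary (fun x => \prod_(i <- s | P i) f i x).
Proof.
move=> ef; elim: s => [|i s IH].
  rewrite (_ : (fun x => _) = fun=> 1); first exact: elementary_cst.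
  by apply/funext => x; rewrite big_nil.
rewrite (_ : (fun x => _) = fun x => (if P i then f i x else 1) * \prod_(i <- s | P i) f i x).
  by apply: elementaryM => //; case: (P i) => //; exact: elementary_cst.
by apply/funext => x; rewrite big_cons; case: ifP => // _; rewrite mul1r.
Qed.

Lemma prod_itv01_le1 (I : Type) (s : seq I) (P : pred I) (f : I -> R) :
  (forall i, P i -> 0 <= f i <= 1) -> \prod_(i <- s | P i) f i <= 1.
Proof.
move=> f01; suff /andP[] : 0 <= \prod_(i <- s | P i) f i <= 1 by [].
elim/big_ind: _ => [|x y /andP[x0 x1] /andP[y0 y1]|//]; first by rewrite ler01 lexx.
by rewrite mulr_ge0// mulr_ile1.
Qed.

(** The coefficients [1] and [-1] make each factor literally an instance of [elementary_theta]. *)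
Definition box_bump (c : {ffun 'I_n -> rat} * {ffun 'I_n -> rat}) (x : V) : R :=
  \prod_i (theta 1 (1 * x ord0 i + - ratr (c.1 i)) *
           theta 1 (-1 * x ord0 i + ratr (c.2 i))).

Lemma theta1_ge0 (y : R) : 0 <= theta 1 y.
Proof. by rewrite /theta; case: ifP => // _; rewrite hornerC mul1r expR_ge0. Qed.

Lemma theta1_le1 (y : R) : theta 1 y <= 1.
Proof.
rewrite /theta; case: ifP => // y0; rewrite hornerC mul1r -[leRHS]expR0 ler_expR.
by rewrite oppr_le0 invr_ge0 ltW.
Qed.

Lemma theta1_gt0 (y : R) : (0 < theta 1 y) = (0 < y).
Proof.
rewrite /theta; case: ifP => y0; last by rewrite ltxx.
by rewrite hornerC mul1r expR_gt0.
Qed.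

Lemma box_bump_ge0 c x : 0 <= box_bump c x.
Proof. by apply: prodr_ge0 => i _; rewrite mulr_ge0 ?theta1_ge0. Qed.

Lemma box_bump_le1 c x : box_bump c x <= 1.
Proof.
apply: prod_itv01_le1 => i _; rewrite mulr_ge0 ?theta1_ge0//=.
by rewrite mulr_ile1 ?theta1_ge0 ?theta1_le1.
Qed.

Lemma box_bump_gt0 c x : (rat_box c : set V) x <-> 0 < box_bump c x.
Proof.
rewrite /box_bump; split => [H|].
  apply: prodr_gt0 => i _; have /andP[h1 h2] := H i.
  by rewrite mulr_gt0// theta1_gt0; lra.
rewrite lt_neqAle => /andP[+ _] i; rewrite eq_sym => /prodf_neq0/(_ i isT).
rewrite mulf_eq0 negb_or => /andP[h1 h2]; apply/andP.
have {}h1 : 0 < theta 1 (1 * x ord0 i + - ratr (c.1 i)) by rewrite lt_neqAle eq_sym h1 theta1_ge0.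
have {}h2 : 0 < theta 1 (-1 * x ord0 i + ratr (c.2 i)) by rewrite lt_neqAle eq_sym h2 theta1_ge0.
by move: h1 h2; rewrite !theta1_gt0; lra.
Qed.

Lemma elementary_box_bump c : elementary (box_bump c).
Proof.
apply: elementary_prod => i.
by apply: elementaryM; exact: elementary_theta.
Qed.

Definition closed_rat_box (c : {ffun 'I_n -> rat} * {ffun 'I_n -> rat}) : set V :=
  [set v | forall i, ratr (c.1 i) <= v ord0 i <= ratr (c.2 i)].

Lemma compact_closed_rat_box c : compact (closed_rat_box c).
Proof.
have := @rV_compact R n (fun i => `[ratr (c.1 i), ratr (c.2 i)]%classic)
  (fun i => @segment_compact _ _ _).
congr compact; apply/seteqP; split => v H i; have := H i; by rewrite /= in_itv.
Qed.

Lemma rat_box_sub_closed c : (rat_box c : set V) `<=` closed_rat_box c.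
Proof. by move=> v H i; have /andP[h1 h2] := H i; rewrite !ltW. Qed.

Lemma open_rat_box_nbhs (U : set V) x : open U -> U x ->
  exists c, (rat_box c : set V) x /\ closed_rat_box c `<=` U.
Proof.
move=> oU Ux; have /nbhs_ballP[e /= e0 eU] : nbhs x U by apply: open_nbhs_nbhs; split.
have rat_between (a b : R) : a < b -> {q | a < ratr q < b}.
  by move=> ab; apply: cid; have [q] := rat_in_itvoo ab; exists q.
have lo i : {q | x ord0 i - e < ratr q < x ord0 i}.
  by apply: rat_between; rewrite gtrBl.
have hi i : {q | x ord0 i < ratr q < x ord0 i + e}.
  by apply: rat_between; rewrite ltrDl.
exists ([ffun i => sval (lo i)], [ffun i => sval (hi i)]); split.
  move=> i /=; rewrite !ffunE; case: (lo i) (hi i) => p /= /andP[_ p2].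
  by move=> [q /= /andP[q1 _]]; rewrite p2 q1.
move=> v vb; apply: eU; split => // i j; rewrite ord1.
move: (vb j); rewrite /= !ffunE.
case: (lo j) (hi j) => p /= /andP[p1 p2] [q /= /andP[q1 q2]] /andP[pv vq].
by rewrite /ball /= ltr_distlC; apply/andP; split; lra.
Qed.

(* The complement of f_m is the product of the (1 - bump)^m over the first m
   rational boxes contained in U, so that f_m increases to the indicator of U. *)
Definition bump_factor (U : set V) (m : nat) (x : V) (k : nat) : R :=
  (if @unpickle ({ffun 'I_n -> rat} * {ffun 'I_n -> rat})%type k is Some c then
      if `[< closed_rat_box c `<=` U >] then (1 - box_bump c x) ^+ m else 1
    else 1).

Definition open_bump (U : set V) (m : nat) (x : V) : R :=
  1 - \prod_(k < m) bump_factor U m x k.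

Lemma bump_factor01 U m x k : 0 <= bump_factor U m x k <= 1.
Proof.
rewrite /bump_factor; case: unpickle => [c|]; last by rewrite ler01 lexx.
case: ifP => _; last by rewrite ler01 lexx.
have h0 := box_bump_ge0 c x; have h1 := box_bump_le1 c x.
by rewrite exprn_ge0 ?subr_ge0//= exprn_ile1 ?subr_ge0// gerBl.
Qed.

Lemma open_bump_itv U m x : 0 <= open_bump U m x <= 1.
Proof.
rewrite /open_bump; apply/andP; split.
  by rewrite subr_ge0 prod_itv01_le1// => k _; exact: bump_factor01.
by rewrite gerBl prodr_ge0// => k _; case/andP: (bump_factor01 U m x k).
Qed.

Lemma nondecreasing_open_bump U x : nondecreasing_seq (open_bump U ^~ x).
Proof.
apply/nondecreasing_seqP => m; rewrite lerD2l lerN2.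
rewrite big_ord_recr/= (@le_trans _ _ (\prod_(k < m) bump_factor U m.+1 x k))//.
  apply: ler_piMr; last by case/andP: (bump_factor01 U m.+1 x m).
  by apply: prodr_ge0 => k _; case/andP: (bump_factor01 U m.+1 x k).
apply: ler_prod => k _; rewrite (andP (bump_factor01 _ _ _ _)).1/= /bump_factor.
case: unpickle => [c|//]; case: ifP => // _.
have h0 := box_bump_ge0 c x; have h1 := box_bump_le1 c x.
by rewrite exprS ler_piMl// ?exprn_ge0 ?subr_ge0// gerBl.
Qed.

Lemma open_bump_out U m x : ~ U x -> open_bump U m x = 0.
Proof.
move=> Ux; rewrite /open_bump big1 ?subrr// => k _; rewrite /bump_factor.
case: unpickle => [c|//]; case: asboolP => // cU.
have /eqP -> : box_bump c x == 0; last by rewrite subr0 expr1n.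
rewrite eq_le box_bump_ge0 andbT leNgt; apply/negP => /box_bump_gt0 cx.
exact/Ux/cU/rat_box_sub_closed.
Qed.

Lemma cvg_open_bump U x : open U -> open_bump U ^~ x @ \oo --> (\1_U x : R).
Proof.
move=> oU; have [Ux|Ux] := pselect (U x); last first.
  rewrite indicE memNset//.
  by under eq_fun do rewrite open_bump_out//; exact: cvg_cst.
have [c [cx cU]] := open_rat_box_nbhs oU Ux.
have b0 : 0 < box_bump c x by apply/box_bump_gt0.
have b1 := box_bump_le1 c x.
rewrite indicE mem_set//=.
have H : (1 - (1 - box_bump c x) ^+ m) @[m --> \oo] --> (1 : R).
  rewrite -[X in _ --> X]subr0; apply: cvgB; first exact: cvg_cst.
  apply: cvg_expr; rewrite ger0_norm ?subr_ge0//. by rewrite gtrBl.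
(* Once [m] exceeds the code of [c], the factor of [c] alone bounds the product by
   [(1 - box_bump c x) ^+ m], which tends to 0. *)
apply: (@squeeze_cvgr _ _ _ _ (fun m => 1 - (1 - box_bump c x) ^+ m) (fun=> 1)) => //.
  near=> m; rewrite (andP (open_bump_itv U m x)).2 andbT lerD2l lerN2.
    have cm : (pickle c < m)%N by near: m; exact: nbhs_infty_gt.
  rewrite (bigD1 (Ordinal cm))//= {1}/bump_factor pickleK; case: asboolP => // _.
  rewrite ler_piMr ?exprn_ge0 ?subr_ge0// prod_itv01_le1// => k _; exact: bump_factor01.
exact: cvg_cst.
Unshelve. all: by end_near. Qed.

Lemma elementary_open_bump U m : elementary (open_bump U m).
Proof.
rewrite (_ : open_bump U m = fun x => 1 + -1 * \prod_(k < m) bump_factor U m x k); last first.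
  by apply/funext => x; rewrite mulN1r.
apply: elementaryD; first exact: elementary_cst.
apply: elementaryM; first exact: elementary_cst.
apply: (@elementary_prod _ _ xpredT (fun (k : 'I_m) x => bump_factor U m x k)) => k.
rewrite /bump_factor; case: unpickle => [c|]; last exact: elementary_cst.
case: `[< _ >]; last exact: elementary_cst.
apply: (@elementaryX (fun x => 1 - box_bump c x) m).
rewrite (_ : (fun x => 1 - box_bump c x) = fun x => 1 + -1 * box_bump c x); last first.
  by apply/funext => x; rewrite mulN1r.
apply: elementaryD; first exact: elementary_cst.
by apply: elementaryM; [exact: elementary_cst|exact: elementary_box_bump].
Qed.

Lemma test_function_open_bump U m : test_function U (open_bump U m).
Proof.
split; first exact/elementary_smooth/elementary_open_bump.
pose K := \big[setU/set0]_(k < m)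
  (if @unpickle ({ffun 'I_n -> rat} * {ffun 'I_n -> rat})%type k is Some c then
   if `[< closed_rat_box c `<=` U >] then closed_rat_box c else set0 else set0).
have cK : compact K.
  rewrite /K; elim/big_ind: _ => [|A B|k _]; [exact: compact0|exact: compactU|].
  case: unpickle => [c|]; last exact: compact0.
  by case: ifP => _; [exact: compact_closed_rat_box|exact: compact0].
have KU : K `<=` U.
  rewrite /K; elim/big_ind: _ => [//|A B AU BU x [/AU|/BU]//|k _].
  case: unpickle => [c|]; last exact: sub0set.
  by case: asboolP => [//|_]; exact: sub0set.
have clK : closed K by apply: compact_closed => //; exact: norm_hausdorff.
have sK : [set x | open_bump U m x != 0] `<=` K.
  move=> x /=; apply: contra_neqP => Kx.
  rewrite /open_bump big1 ?subrr// => k _; rewrite /bump_factor.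
  move: Kx; rewrite /K (bigD1 k)//= => /not_orP[+ _].
  case: unpickle => [c|//]; case: asboolP => // cU cx.
  have /eqP -> : box_bump c x == 0; last by rewrite subr0 expr1n.
  rewrite eq_le box_bump_ge0 andbT leNgt; apply/negP => /box_bump_gt0 c'x.
  exact/cx/rat_box_sub_closed.
have csK : closure [set x | open_bump U m x != 0] `<=` K.
  by rewrite [X in _ `<=` X](closure_id _).1//; exact: closure_subset.
split; last exact: subset_trans csK KU.
by apply: subclosed_compact csK => //; exact: closed_closure.
Qed.

End smooth_functions.

(** * Borel measures determined by test functions *)

Section measure_uniqueness.
Variables (R : realType) (n : nat).
Local Notation V := 'rV[R]_n.
Local Notation B := (borelRn R n).

Lemma open_measurable_rV (U : set V) : open U -> measurable (U : set B).
Proof. by move=> oU; exact: sub_sigma_algebra. Qed.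

Lemma closed_measurable_rV (U : set V) : closed U -> measurable (U : set B).
Proof.
move=> cU; rewrite -[U]setCK; apply: measurableC; apply: open_measurable_rV.
exact: closed_openC.
Qed.

Lemma continuous_measurable_rV (f : V -> R) :
  continuous f -> measurable_fun [set: B] (f : B -> R).
Proof.
move=> cf.
apply: (@measurability _ _ _ _ _ _ _ (measurable_realfun.RGenOpens.measurableE R)).
move=> _ [_ [a [b ->]] <-]; rewrite setTI; apply: open_measurable_rV.
by apply: open_comp; [move=> v _; exact: cf|exact: interval_open].
Qed.

(** Monotone convergence along [open_bump U k], which increases to the indicator of [U]. *)
Lemma measure_eq_open (U : set V) (m1 m2 : {measure set B -> \bar R}) :
  open U ->
  (forall f, test_function U f -> (forall x, 0 <= f x <= 1) ->
    (\int[m1]_(x in (U : set B)) (f x)%:E = \int[m2]_(x in (U : set B)) (f x)%:E)%E) ->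
  m1 U = m2 U.
Proof.
move=> oU H; have mU := open_measurable_rV oU.
have E (m : {measure set B -> \bar R}) :
    (\int[m]_(x in (U : set B)) (open_bump U k x)%:E)%E @[k --> \oo] --> m U.
  rewrite (_ : m U = (\int[m]_(x in (U : set B)) (\1_U x)%:E)%E); last first.
    by rewrite integral_indic// setIid.
  rewrite (_ : (\int[m]_(x in _) _)%E =
      (\int[m]_(x in (U : set B)) limn (fun k => (open_bump U k x)%:E))%E).
    apply: cvg_monotone_convergence => //.
    - move=> k; apply/measurable_EFinP; apply: measurable_funTS.
      exact: (continuous_measurable_rV (elementary_continuous (elementary_open_bump U k))).
    - by move=> k x _; rewrite lee_fin; case/andP: (open_bump_itv U k x).
    - by move=> x _ a b ab; rewrite lee_fin nondecreasing_open_bump.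
  apply: eq_integral => x _; apply/esym/cvg_lim => //.
  by apply: cvg_EFin; [exact: nearW|exact: cvg_open_bump].
have E12 : (fun k => \int[m1]_(x in (U : set B)) (open_bump U k x)%:E)%E =
    (fun k => \int[m2]_(x in (U : set B)) (open_bump U k x)%:E)%E.
  apply/funext => k; apply: H; first exact: test_function_open_bump.
  by move=> x; exact: open_bump_itv.
by have := E m1; rewrite E12 => /cvg_lim <-//; exact/cvg_lim/E.
Qed.

Lemma test_function_sub (U O : set V) f :
  U `<=` O -> test_function U f -> test_function O f.
Proof. by move=> UO [sf [cf fU]]; split=> //; split=> //; exact: subset_trans UO. Qed.

Lemma test_function_out (U : set V) f x : test_function U f -> ~ U x -> f x = 0.
Proof.
move=> [_ [_ fU]] Ux; apply: contra_notP Ux => /eqP fx.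
by apply: fU; exact: subset_closure.
Qed.

Lemma integral_test_function_sub (U O : set V) (m : {measure set B -> \bar R}) f :
  open O -> open U -> U `<=` O -> test_function U f ->
  (\int[m]_(x in (O : set B)) (f x)%:E = \int[m]_(x in (U : set B)) (f x)%:E)%E.
Proof.
move=> oO oU UO tf.
rewrite [LHS]integral_mkcond [RHS]integral_mkcond; apply: eq_integral => x _.
rewrite /patch; have [Ux|Ux] := pselect (U x).
  by rewrite !mem_set//; exact: UO.
by rewrite (memNset Ux) (test_function_out tf Ux); case: ifP.
Qed.

(** The open sets form a pi-system, and a test function of an open subset of [U] is one of [U].
    Finiteness on [U] makes the uniqueness theorem applicable to the restrictions. *)
Lemma measure_eq_test (U : set V) (m1 m2 : {measure set B -> \bar R}) :
  open U -> (m1 U < +oo)%E -> (m2 U < +oo)%E ->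
  (forall f, test_function U f -> (forall x, 0 <= f x <= 1) ->
    (\int[m1]_(x in (U : set B)) (f x)%:E = \int[m2]_(x in (U : set B)) (f x)%:E)%E) ->
  forall A : set B, measurable A -> A `<=` U -> m1 A = m2 A.
Proof.
move=> oU m1U m2U H A mA AU; have mU := open_measurable_rV oU.
suff : mrestr m1 mU A = mrestr m2 mU A by rewrite /mrestr setIidl.
apply: (@measure_unique _ R B (@open V) (fun=> setT) _ _ _ _
  (mrestr m1 mU) (mrestr m2 mU)) => //.
- by move=> C D; exact: openI.
- by move=> _; exact: openT.
- by rewrite bigcup_const//; exists 0%N.
- move=> C oC; rewrite /= /mrestr; apply: measure_eq_open; first exact: openI.
  move=> f tf f01; have oCU : open (C `&` U) by exact: openI.
  have CU : C `&` U `<=` U by exact: subIsetr.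
  rewrite -!(integral_test_function_sub _ oU oCU CU tf).
  by apply: H => //; exact: test_function_sub tf.
- by move=> _; rewrite /= /mrestr setTI.
Qed.

End measure_uniqueness.

(** * Lebesgue measure on boxes, its translations and its slices *)

Section lebesgue_boxes.
Variables (R : realType) (n : nat).
Local Notation V := 'rV[R]_n.
Local Notation B := (borelRn R n).
Local Notation leb := (lebesgue_rV R n).

Definition hbox (a b : 'I_n -> R) : set B := [set v | forall i, v ord0 i \in `]a i, b i]].

Lemma measurable_hbox a b : measurable (hbox a b).
Proof.
rewrite (_ : hbox a b = \bigcap_(i in setT)
    ((fun v : V => v ord0 i) @^-1` `]a i, b i]) :> set B); last first.
  by apply/seteqP; split => v H i; [move=> _|]; exact: H.
apply: fin_bigcap_measurable => // i _.
by rewrite -[X in measurable X]setTI; exact: measurable_coord.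
Qed.

Lemma hbox_setI a b a' b' : hbox a b `&` hbox a' b' =
  hbox (fun i => Num.max (a i) (a' i)) (fun i => Num.min (b i) (b' i)).
Proof.
apply/seteqP; split => [v [H H'] i|v H]; last split => i.
- have := H i; have := H' i; rewrite !in_itv/= => /andP[h1 h2] /andP[h3 h4].
  by rewrite gt_max le_min h1 h2 h3 h4.
- by have := H i; rewrite !in_itv/= gt_max le_min => /andP[/andP[-> _] /andP[-> _]].
- by have := H i; rewrite !in_itv/= gt_max le_min => /andP[/andP[_ ->] /andP[_ ->]].
Qed.

Lemma hbox_empty a b i : b i <= a i -> hbox a b = set0.
Proof.
move=> ba; apply/seteqP; split => // v /(_ i); rewrite in_itv/= => /andP[h1 h2].
by have := lt_le_trans h1 (le_trans h2 ba); rewrite ltxx.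
Qed.

Definition boxes : set (set B) := [set A | exists a b, A = hbox a b].

(** An open set is the countable union of the half-open rational boxes whose closed boxes it
    contains. *)
Lemma measurable_boxesE : @measurable _ B = <<s boxes >>.
Proof.
apply/seteqP; split; last first.
  apply: smallest_sub; first exact: sigma_algebra_measurable.
  by move=> _ [a [b ->]]; exact: measurable_hbox.
apply: smallest_sub; first exact: smallest_sigma_algebra.
move=> U oU.
rewrite (_ : U = \bigcup_k
  (if @unpickle ({ffun 'I_n -> rat} * {ffun 'I_n -> rat})%type k is Some c then
   if `[< closed_rat_box c `<=` U >] then
     hbox (fun i => ratr (c.1 i)) (fun i => ratr (c.2 i)) else set0 else set0)).
  apply: sigma_algebra_bigcup => k.
  case: unpickle => [c|]; last exact: sigma_algebra0.
  case: ifP => _; last exact: sigma_algebra0.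
  by apply: sub_sigma_algebra; eexists; eexists.
apply/seteqP; split => [x Ux|x [k _]].
  have [c [cx cU]] := open_rat_box_nbhs oU Ux.
  exists (pickle c) => //; rewrite pickleK; case: asboolP => // _ i.
  by have /andP[h1 h2] := cx i; rewrite in_itv/= h1 ltW.
case: unpickle => [c|//]; case: asboolP => // cU cx; apply: cU => i.
by have := cx i; rewrite in_itv/= => /andP[h1 h2]; rewrite h2 ltW.
Qed.

Lemma measure_eq_boxes (m1 m2 : {measure set B -> \bar R}) :
  (forall a b, (forall i, a i <= b i) -> m1 (hbox a b) = m2 (hbox a b)) ->
  (forall a b, (forall i, a i <= b i) -> (m1 (hbox a b) < +oo)%E) ->
  forall A, measurable A -> m1 A = m2 A.
Proof.
move=> H fin.
apply: (@measure_unique _ R B boxes (fun k => hbox (fun=> - k%:R) (fun=> k%:R))).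
- exact: measurable_boxesE.
- by move=> _ _ [a [b ->]] [a' [b' ->]]; rewrite hbox_setI; eexists; eexists.
- by move=> k; eexists; eexists.
- apply/seteqP; split => // v _.
  pose M := \sum_i `|v ord0 i|.
  have vM i : `|v ord0 i| <= M by rewrite /M (bigD1 i)//= lerDl sumr_ge0.
  exists (Num.bound M).+1 => // i.
  have M0 : 0 <= M by rewrite /M sumr_ge0.
  have Mk : M < (Num.bound M).+1%:R.
    by rewrite (lt_trans (archi_boundP M0))// ltr_nat.
  rewrite in_itv/=; have := le_lt_trans (vM i) Mk; rewrite ltr_norml => /andP[-> h].
  by rewrite ltW.
- move=> _ [a [b ->]]; have [ab|/existsNP[i]] := pselect (forall i, a i <= b i).
    exact: H.
  by move/negP; rewrite -ltNge => /ltW/hbox_empty ->; rewrite !measure0.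
- move=> k; apply: fin => i; have := ler0n R k; lra.
Qed.

Lemma lebesgue_hbox a b : (forall i, a i <= b i) ->
  leb (hbox a b) = (\prod_(i < n) (b i - a i))%:E.
Proof. by move=> ab; rewrite -lebesgue_rV_box. Qed.

Lemma measurable_addr (v : V) : measurable_fun setT ((fun x : V => x + v) : B -> B).
Proof.
apply: measurable_fun_borelRn => i.
apply: (eq_measurable_fun (fun x : B => (x : V) ord0 i + v ord0 i)).
  by move=> x _; rewrite mxE.
by apply: measurable_funD => //; exact: measurable_coord.
Qed.

Lemma measurable_setT_preimage d d' (T : measurableType d) (T' : measurableType d')
  (f : T -> T') (A : set T') : measurable_fun setT f -> measurable A ->
  measurable (f @^-1` A).
Proof. by move=> mf mA; rewrite -[X in measurable X]setTI; exact: mf. Qed.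

Lemma lebesgue_translate (v : V) (A : set B) :
  measurable A -> leb ((fun x : V => x + v) @^-1` A) = leb A.
Proof.
move=> mA; have mv := measurable_addr v.
pose f : {mfun B >-> B} := HB.pack ((fun x : V => x + v) : B -> B) (isMeasurableFun.Build _ _ _ _ _ mv).
have E a b : (fun x : V => x + v) @^-1` (hbox a b) =
    hbox (fun i => a i - v ord0 i) (fun i => b i - v ord0 i).
  by apply/seteqP; split => x /= H i; have := H i; rewrite !in_itv/= mxE ltrBlDr lerBrDr.
apply: (@measure_eq_boxes (pushforward leb f) leb) => // a b ab.
  rewrite /= /pushforward/= E !lebesgue_hbox//; last by move=> i; rewrite lerD2r.
  by congr EFin; apply: eq_bigr => i _; ring.
by rewrite /= /pushforward/= E lebesgue_hbox ?ltry// => i; rewrite lerD2r.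
Qed.

Definition setc (k : 'I_n) (t : R) (x : V) : V :=
  \row_i (if i == k then t else x ord0 i).

(** Encodes hyperplane measure without changing the dimension: the (n-1)-dimensional measure of a
    subset of [x_k = t] is the volume of the part of the slab that [setc k t] maps into it. *)
Definition slab (k : 'I_n) : set B := [set y | 0 < (y : V) ord0 k <= 1].

Lemma measurable_slab k : measurable (slab k).
Proof.
rewrite (_ : slab k = (fun v : V => v ord0 k) @^-1` `]0, 1] :> set B); last first.
  by apply/seteqP; split => x; rewrite /slab/= in_itv.
by apply: measurable_setT_preimage => //; exact: measurable_coord.
Qed.

Lemma measurable_setc (k : 'I_n) (t : R) :
  measurable_fun setT ((fun p => setc k (t + p.1) p.2) : measurableTypeR R * B -> B).
Proof.
apply: measurable_fun_borelRn => i; have [->|ik] := eqVneq i k.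
  apply: (eq_measurable_fun (fun p : measurableTypeR R * B => t + p.1)).
    by move=> p _; rewrite mxE eqxx.
  exact: measurable_funD.
apply: (eq_measurable_fun (fun p : measurableTypeR R * B => (p.2 : V) ord0 i)).
  by move=> p _; rewrite mxE (negbTE ik).
exact: measurableT_comp (@measurable_coord R n i) measurable_snd.
Qed.

(** Fubini in the direction [k], checked on half-open boxes. The [k]-th coordinate is written
    [t + h] so that [h] is later the height above the hyperplane at [t]. *)
Lemma lebesgue_slice (k : 'I_n) (t : R) (A : set B) : measurable A ->
  leb A = (@lebesgue_measure R \x leb)%E
   [set p : measurableTypeR R * B | slab k p.2 /\ A (setc k (t + p.1) p.2)].
Proof.
move=> mA; have mf := measurable_setc k t.
pose f : {mfun (measurableTypeR R * B)%type >-> B} :=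
  HB.pack ((fun p => setc k (t + p.1) p.2) : measurableTypeR R * B -> B) (isMeasurableFun.Build _ _ _ _ _ mf).
have mS : measurable ([set: measurableTypeR R] `*` slab k).
  by apply: measurableX => //; exact: measurable_slab.
pose m := pushforward (mrestr (@lebesgue_measure R \x leb)%E mS) f.
have mE A' : m A' = (@lebesgue_measure R \x leb)%E
   [set p : measurableTypeR R * B | slab k p.2 /\ A' (setc k (t + p.1) p.2)].
  rewrite /m /pushforward /mrestr; congr (_ _).
  by apply/seteqP; split => -[x y]/= => [[H [_ H2]]|[H1 H2]].
rewrite -mE; apply: (@measure_eq_boxes leb m) => // a b ab; last first.
  by rewrite [X in (X < _)%E](lebesgue_hbox ab) ltry.
transitivity (m (hbox a b)) => //; rewrite mE [LHS](lebesgue_hbox ab).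
pose a' i := if i == k then 0 else a i; pose b' i := if i == k then 1 else b i.
rewrite (_ : [set p | _] = `]a k - t, b k - t]%classic `*` hbox a' b'); last first.
  apply/seteqP; split => -[x y] /= => [[/andP[s1 s2] H]|[H1 H2]].
    split.
      by have := H k; rewrite mxE eqxx !in_itv/= ltrBlDl lerBrDl.
    move=> i; rewrite /a' /b'; have [->|ik] := eqVneq i k; first by rewrite in_itv/= s1 s2.
    by have := H i; rewrite mxE (negbTE ik).
  split; first by have := H2 k; rewrite /a' /b' eqxx in_itv.
  move=> i; rewrite mxE; have [->|ik] := eqVneq i k.
    by move: H1; rewrite !in_itv/= ltrBlDl lerBrDl.
  by have := H2 i; rewrite /a' /b' (negbTE ik).
have ab' i : a' i <= b' i by rewrite /a' /b'; case: ifP.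
rewrite product_measure1E//; last exact: measurable_hbox.
rewrite [X in (_ * X)%E](lebesgue_hbox ab').
rewrite [X in (X * _)%E](lebesgue_measure_itv `]a k - t, b k - t])/= lte_fin ltrD2r.
rewrite (bigD1 k)//= [in RHS](bigD1 k)//=.
have -> : \prod_(i < n | i != k) (b' i - a' i) = \prod_(i < n | i != k) (b i - a i).
  by apply: eq_bigr => i /negbTE ik; rewrite /a' /b' ik.
rewrite /a' /b' eqxx subr0 mul1r.
case: ltgtP (ab k) => // [akbk _|-> _]; last by rewrite subrr mul0r mul0e.
by rewrite -EFinB -EFinM; congr (_ * _)%:E; ring.
Qed.

End lebesgue_boxes.

Lemma integral_mrestr d (T : measurableType d) (R : realType)
    (m : {measure set T -> \bar R}) (D E : set T) (mD : measurable D) (f : T -> \bar R) :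
  measurable E -> measurable_fun E f ->
  (\int[mrestr m mD]_(x in E) f x = \int[m]_(x in E `&` D) f x)%E.
Proof.
move=> mE mf.
have mED : measurable (E `&` D) by exact: measurableI.
have mEcD : measurable (E `\` D) by exact: measurableD.
have EU : E = (E `&` D) `|` (E `\` D) by rewrite setDE -setIUr setUv setIT.
rewrite {1}EU integral_setU//; last 2 first.
- by rewrite -EU.
- by apply/disj_setPS => x [[_ Dx] [_ nDx]].
rewrite [X in (_ + X)%E]null_set_integral//; last 2 first.
- exact: measurable_funS mf.
- by rewrite /= /mrestr (_ : (E `\` D) `&` D = set0) ?measure0// -subset0 => x [[]].
rewrite adde0; apply: eq_measure_integral => A mA AED.
by rewrite /= /mrestr setIidl// => x /AED[].
Qed.

Lemma measure_exhaust d (T : measurableType d) (R : realType)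
    (m : {measure set T -> \bar R}) (F : (set T)^nat) (X : set T) (e : R) :
  (forall i, measurable (F i)) -> nondecreasing_seq F -> X = \bigcup_i F i ->
  (m X < +oo)%E -> 0 < e -> exists N, (m (X `\` F N) <= e%:E)%E.
Proof.
move=> mF ndF XE mX e0.
have mX' : measurable X by rewrite XE; exact: bigcupT_measurable.
have cv : m (X `\` F i) @[i --> \oo] --> m (\bigcap_i (X `\` F i)).
  apply: nonincreasing_cvg_mu.
  - apply: le_lt_trans mX; apply: le_measure; rewrite ?inE//; exact: measurableD.
  - by move=> i; exact: measurableD.
  - by apply: bigcapT_measurable => i; exact: measurableD.
  - move=> i j ij; apply/subsetPset => x [Xx nF]; split => // Fx; apply: nF.
    by move: x Fx {Xx}; exact/subsetPset/ndF.
rewrite (_ : \bigcap_i _ = set0) ?measure0 in cv; last first.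
  rewrite -subset0 => x H; have [+ _] := H 0%N I.
  by rewrite XE => -[i _ Fx]; have [_] := H i I.
have [N _ HN] : \forall i \near \oo, (m (X `\` F i) < e%:E)%E.
  have h : (0%:E < e%:E)%E by rewrite lte_fin.
  exact: (cv [set y | (y < e%:E)%E] (open_ereal_lt' h)).
by exists N; rewrite ltW//; apply: HN => /=.
Qed.

(** * Integration by slices, and continuity of translations in L^1 *)

Section lebesgue_translations.
Variables (R : realType) (n : nat).
Local Notation V := 'rV[R]_n.
Local Notation B := (borelRn R n).
Local Notation leb := (lebesgue_rV R n).

Lemma integral_slice (k : 'I_n) (t : R) (f : V -> \bar R) :
  measurable_fun setT (f : B -> \bar R) -> (forall x, 0 <= f x)%E ->
  (\int[leb]_x f x =
   \int[@lebesgue_measure R]_h \int[leb]_(y in slab k) f (setc k (t + h) y))%E.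
Proof.
move=> mf f0; have ms := @measurable_setc R n k t.
pose s : {mfun (measurableTypeR R * B)%type >-> B} :=
  HB.pack ((fun p => setc k (t + p.1) p.2) : measurableTypeR R * B -> B) (isMeasurableFun.Build _ _ _ _ _ ms).
have mS : measurable ([set: measurableTypeR R] `*` @slab R n k).
  by apply: measurableX => //; exact: measurable_slab.
pose m := pushforward (mrestr (@lebesgue_measure R \x leb)%E mS) s.
transitivity (\int[m]_x f x)%E.
  apply: eq_measure_integral => A mA _; apply: (etrans (lebesgue_slice k t mA)).
  rewrite /m/= /pushforward /mrestr; congr (product_measure1 _ _ _).
  by apply/seteqP; split => -[x y]/= => [[H1 H2]|[H [_ H2]]].
have mfs : measurable_fun setT (f \o s) by apply: measurableT_comp.
rewrite ge0_integral_pushforward// preimage_setT.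
rewrite [LHS]integral_mrestr// setTI.
pose g : measurableTypeR R * B -> \bar R :=
  patch (fun=> 0%E) ([set: measurableTypeR R] `*` @slab R n k) (f \o s).
have mg : measurable_fun setT g.
  by apply/(measurable_restrictT _ _).1 => //; exact: measurable_funTS.
have g0 p : (0 <= g p)%E by rewrite /g /patch; case: ifP => // _; exact: f0.
rewrite integral_mkcond.
apply: (etrans (@fubini_tonelli1 _ _ _ _ _ (@lebesgue_measure R) leb g mg g0)).
apply: eq_integral => h _; rewrite /fubini_F [RHS]integral_mkcond.
apply: eq_integral => y _; rewrite /g /patch/=.
have [Sy|Sy] := pselect (slab k y).
  by rewrite (mem_set Sy) (mem_set (conj I Sy : (_ `*` _) (h, y))).
by rewrite (memNset Sy) memNset// => -[].
Qed.

Lemma setcD (k : 'I_n) (t h : R) (y : V) :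
  setc k (t + h) y = setc k t y + h *: delta_mx ord0 k.
Proof.
apply/rowP => i; rewrite !mxE eqxx/=; case: eqVneq => _; first by rewrite mulr1.
by rewrite mulr0 addr0.
Qed.

(** The symmetric difference of [E] and [E - v]. *)
Definition shift_diff (E : set V) (v : V) : set V :=
  [set x | E x /\ ~ E (x + v)] `|` [set x | ~ E x /\ E (x + v)].

Lemma measurable_shift (E : set B) (v : V) : measurable E ->
  measurable ([set x | E (x + v)] : set B).
Proof. by move=> mE; exact: measurable_setT_preimage (measurable_addr v) mE. Qed.

Lemma measurable_shift_diff (E : set B) (v : V) :
  measurable E -> measurable (shift_diff E v : set B).
Proof.
move=> mE; have mEv := measurable_shift v mE.
rewrite (_ : shift_diff E v = (E `&` ~` [set x : V | E (x + v)]) `|`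
  (~` E `&` [set x : V | E (x + v)]) :> set B)//.
by apply: measurableU; apply: measurableI => //; exact: measurableC.
Qed.

Lemma shift_diffU (X Y : set V) v :
  shift_diff (X `|` Y) v `<=` shift_diff X v `|` shift_diff Y v.
Proof.
move=> x; rewrite /shift_diff /setU /=.
by have [] := pselect (X x); have [] := pselect (X (x + v));
  have [] := pselect (Y x); have [] := pselect (Y (x + v)); tauto.
Qed.

Lemma shift_diff_sub (X : set V) v :
  shift_diff X v `<=` X `|` [set x | X (x + v)].
Proof. by move=> x [[]|[]]; [left|right]. Qed.

Lemma lebesgue_shift_diff_le (X : set B) v : measurable X ->
  (leb (shift_diff X v) <= leb X + leb X)%E.
Proof.
move=> mX; have mXv := measurable_shift v mX.
apply: (@le_trans _ _ (leb (X `|` [set x | X (x + v)]))).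
  apply: le_measure; rewrite ?inE; [exact: measurable_shift_diff|exact: measurableU|].
  exact: shift_diff_sub.
rewrite (le_trans (measureU2 _ _ _))//.
by apply: leeD => //; rewrite [leLHS](lebesgue_translate v mX).
Qed.

Section continuity_of_translations.
Variable Q : set V.
Hypotheses (oQ : open Q) (fQ : (leb Q < +oo)%E).

Let tcont (A : set B) := forall e : R, 0 < e -> exists2 d : R, 0 < d &
  forall v : V, `|v| < d -> (leb (shift_diff (A `&` Q) v) <= e%:E)%E.

Let mQ : measurable (Q : set B). Proof. exact: open_measurable_rV. Qed.

Let finQ (A : set B) : measurable A -> leb (A `&` Q) \is a fin_num.
Proof.
move=> mA; rewrite ge0_fin_numE//; apply: le_lt_trans fQ.
by apply: le_measure; rewrite ?inE//; exact: measurableI.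
Qed.

Let tcont_open (A : set V) : open A -> tcont A.
Proof.
move=> oA e e0; pose U := A `&` Q; have oU : open U by exact: openI.
have mU : measurable (U : set B) by exact: open_measurable_rV.
(* The points at distance at least [1 / (m + 1)] from the complement of [U]. A shorter translation
   keeps them in [U], so the shift difference is covered by the small remainder [T] below and its
   translate. *)
pose C m := [set x : V | forall y, ~ U y -> m.+1%:R^-1 <= `|x - y|].
have C_U m : C m `<=` U.
  move=> x Cx; apply: contrapT => Ux; have := Cx x Ux.
  by rewrite subrr normr0 leNgt invr_gt0 ltr0n.
have mC m : measurable (C m : set B).
  rewrite (_ : C m = ~` \bigcup_(y in ~` U) ball y (m.+1%:R^-1)).
    apply: measurableC; apply: open_measurable_rV.
    by apply: bigcup_open => y _; exact: ball_open.
  apply/seteqP; split => x.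
    by move=> Cx [y Uy]; rewrite -ball_normE/= distrC ltNge Cx.
  move=> nx y Uy; rewrite leNgt; apply/negP => xy; apply: nx.
  by exists y => //; rewrite -ball_normE/= distrC.
have CE : \bigcup_m C m = U.
  apply/seteqP; split => [x [m _]|x Ux]; first exact: C_U.
  have /nbhs_ballP[r /= r0 rU] : nbhs x U by apply: open_nbhs_nbhs.
  exists (Num.truncn r^-1) => // y Uy.
  rewrite leNgt; apply/negP => xy; apply/Uy/rU; rewrite -ball_normE/=.
  apply: lt_le_trans xy _; rewrite -[leRHS]invrK lef_pV2 ?posrE ?ltr0n ?invr_gt0//.
  by rewrite ltW// truncnS_gt.
have ndC : nondecreasing_seq C.
  move=> i j ij; apply/subsetPset => x Cx y Uy; apply: le_trans (Cx y Uy).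
  by rewrite lef_pV2 ?posrE ?ltr0n// ler_nat.
have fU : (leb U < +oo)%E.
  by rewrite -ge0_fin_numE//; apply: finQ; exact: open_measurable_rV.
have e20 : 0 < e / 2 by rewrite divr_gt0.
have [m Cm] := measure_exhaust mC ndC (esym CE) fU e20.
exists (m.+1%:R^-1); first by rewrite invr_gt0 ltr0n.
move=> v vm; pose T : set B := U `\` C m.
have mT : measurable T by exact: measurableD.
have mTv := measurable_shift v mT.
apply: (@le_trans _ _ (leb (T `|` [set x | T (x + v)]))).
  apply: le_measure; rewrite ?inE; [exact: measurable_shift_diff|exact: measurableU|].
  move=> x [[Ux Uxv]|[Ux Uxv]]; [left|right]; split => // Cx.
    by have := Cx _ Uxv; rewrite opprD addrA subrr sub0r normrN leNgt vm.
  by have := Cx _ Ux; rewrite addrC addKr leNgt vm.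
rewrite (le_trans (measureU2 _ _ _))//.
rewrite (_ : e = e / 2 + e / 2); last by lra.
rewrite EFinD; apply: leeD; first exact: Cm.
by rewrite [leLHS](lebesgue_translate v mT); exact: Cm.
Qed.

Let tcont_setC (A : set B) : measurable A -> tcont A -> tcont (~` A).
Proof.
move=> mA tA e e0; have e20 : 0 < e / 2 by rewrite divr_gt0.
have [d1 d10 H1] := tA _ e20; have [d2 d20 H2] := tcont_open openT e20.
exists (Num.min d1 d2); first by rewrite lt_min d10.
move=> v; rewrite lt_min => /andP[/H1 {}H1 /H2]; rewrite setTI => {}H2.
have mAQ : measurable (A `&` Q) by exact: measurableI.
apply: (@le_trans _ _ (leb (shift_diff (A `&` Q) v `|` shift_diff Q v))).
  apply: le_measure; rewrite ?inE.
  - by apply: measurable_shift_diff; apply: measurableI => //; exact: measurableC.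
  - by apply: measurableU; exact: measurable_shift_diff.
  - move=> x; rewrite /shift_diff /setU /setI /setC /=.
    by have [] := pselect (A x); have [] := pselect (A (x + v));
      have [] := pselect (Q x); have [] := pselect (Q (x + v)); tauto.
rewrite (le_trans (measureU2 _ _ _))//; [exact: measurable_shift_diff..|].
by rewrite (_ : e = e / 2 + e / 2); [rewrite EFinD leeD|lra].
Qed.

Let tcont_bigcup (F : (set B)^nat) : (forall k, measurable (F k)) ->
  (forall k, tcont (F k)) -> tcont (\bigcup_k F k).
Proof.
move=> mF tF e e0.
pose G N := \big[setU/set0]_(k < N) F k.
have mG N : measurable (G N) by exact: bigsetU_measurable.
have tG N : tcont (G N).
  rewrite /G; elim: N => [|N IH] {e e0} e e0.
    exists 1 => // v _; rewrite big_ord0 set0I (_ : shift_diff _ _ = set0).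
      by rewrite measure0 lee_fin ltW.
    by rewrite -subset0 => x [[]|[]].
  have e20 : 0 < e / 2 by rewrite divr_gt0.
  have [d1 d10 H1] := IH _ e20; have [d2 d20 H2] := tF N _ e20.
  exists (Num.min d1 d2); first by rewrite lt_min d10.
  move=> v; rewrite lt_min => /andP[/H1 {}H1 /H2 {}H2].
  rewrite big_ord_recr/= setIUl.
  set X := (_ `&` Q) in H1 *; set Y := (_ `&` Q) in H2 *.
  have mX : measurable (X : set B) by apply: measurableI => //; exact: mG.
  have mY : measurable (Y : set B) by apply: measurableI.
  apply: (@le_trans _ _ (leb (shift_diff X v `|` shift_diff Y v))).
    apply: le_measure; rewrite ?inE; last exact: shift_diffU.
      by apply: measurable_shift_diff; exact: measurableU.
    by apply: measurableU; exact: measurable_shift_diff.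
  rewrite (le_trans (measureU2 _ _ _))//; [exact: measurable_shift_diff..|].
  by rewrite (_ : e = e / 2 + e / 2); [rewrite EFinD leeD|lra].
have mU : measurable (\bigcup_k F k) by exact: bigcupT_measurable.
(* The tail of the union contributes up to twice its volume, by [lebesgue_shift_diff_le]; hence a
   quarter of [e]. *)
have e40 : 0 < e / 4 by rewrite divr_gt0.
have [N HN] : exists N, (leb ((\bigcup_k F k) `&` Q `\` (G N `&` Q)) <= (e / 4)%:E)%E.
  apply: measure_exhaust => //.
  - by move=> i; exact: measurableI.
  - move=> i j ij; apply/subsetPset; apply: setSI.
    by rewrite /G => x; rewrite -!bigcup_mkord => -[l /= li Fx]; exists l => //=; exact: leq_trans ij.
  - rewrite -setI_bigcupl; congr (_ `&` _); apply/seteqP; split => [x [k _ Fx]|x [k _]].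
      by exists k.+1 => //; rewrite /G big_ord_recr/=; right.
    by rewrite /G -bigcup_mkord => -[i _ Fx]; exists i.
  - by rewrite -ge0_fin_numE// finQ.
have e20 : 0 < e / 2 by rewrite divr_gt0.
have [d d0 Hd] := tG N _ e20; exists d => // v /Hd {}Hd.
set X := (\bigcup_k F k) `&` Q in HN *; set Y := (G N `&` Q) in Hd HN *.
have mX : measurable (X : set B) by exact: measurableI.
have mY : measurable (Y : set B) by exact: measurableI.
have mXY : measurable (X `\` Y : set B) by exact: measurableD.
have XE : X = Y `|` (X `\` Y).
  rewrite setDUK// /X /Y; apply: setSI => x; rewrite /G -bigcup_mkord => -[i _ Fx].
  by exists i.
apply: (@le_trans _ _ (leb (shift_diff Y v `|` shift_diff (X `\` Y) v))).
  apply: le_measure; rewrite ?inE.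
  - exact: measurable_shift_diff.
  - by apply: measurableU; exact: measurable_shift_diff.
  - by rewrite {1}XE; exact: shift_diffU.
rewrite (le_trans (measureU2 _ _ _))//; [exact: measurable_shift_diff..|].
rewrite (_ : e = e / 2 + (e / 4 + e / 4)); last by lra.
rewrite EFinD leeD// (le_trans (lebesgue_shift_diff_le _ _))//.
by rewrite EFinD leeD.
Qed.

(** A Dynkin argument: the sets whose intersection with [Q] has this property include the open sets
    and are stable under complements and countable unions. *)
Lemma lebesgue_shift_continuous (E : set B) : measurable E -> E `<=` Q ->
  forall e : R, 0 < e -> exists2 d : R, 0 < d &
  forall v : V, `|v| < d -> (leb (shift_diff E v) <= e%:E)%E.
Proof.
move=> mE EQ; rewrite -(setIidl EQ); apply: (@dynkin_induction _ B (@open V) tcont) => //.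
- by move=> C D; exact: openI.
- exact: tcont_open openT.
- by move=> F mF _ tF; exact: tcont_bigcup.
Qed.

End continuity_of_translations.

End lebesgue_translations.

(** The sum of the [f j] is integrable, hence finite almost everywhere, and the terms of a
    convergent series tend to 0. This is how convergence in mean becomes convergence almost
    everywhere along a well chosen sequence. *)
Lemma ae_cvg0_summable d (T : measurableType d) (R : realType)
    (m : {measure set T -> \bar R}) (f : nat -> T -> \bar R) :
  (forall j, measurable_fun setT (f j)) -> (forall j x, 0 <= f j x)%E ->
  (\sum_(0 <= j <oo) \int[m]_x f j x < +oo)%E ->
  {ae m, forall x, f j x @[j --> \oo] --> 0%E}.
Proof.
move=> mf f0 fS; pose g x := (\sum_(0 <= j <oo) f j x)%E.
have g0 x : (0 <= g x)%E by exact: nneseries_ge0.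
have mg : measurable_fun setT g by apply: ge0_emeasurable_sum.
have ig : m.-integrable setT g.
  apply/integrableP; split => //.
  rewrite (eq_integral g); last by move=> x _; rewrite gee0_abs.
  by rewrite integral_nneseries.
have := integrable_ae measurableT ig; apply: filterS => x /(_ I) gx.
have gy : (g x < +oo)%E by rewrite -ge0_fin_numE.
have tl := nneseries_tail_cvg gy (fun k _ => f0 k x).
apply: (squeeze_cvge _ (cvg_cst _) tl); near=> N.
rewrite f0/=.
have := @nneseries_lim_ge R (fun k => f k x) xpredT N N.+1.
by rewrite big_nat1; apply.
Unshelve. all: by end_near. Qed.

Lemma norm_delta_mx (R : realType) n (k : 'I_n) (h : R) :
  `|h *: (delta_mx ord0 k : 'rV[R]_n)| <= `|h|.
Proof.
rewrite normrZ -[leRHS]mulr1 ler_wpM2l// [leLHS]/Num.Def.normr/= mx_normrE.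
by apply: bigmax_le => // -[i j] _; rewrite !mxE; case: (_ && _); rewrite ?normr1 ?normr0.
Qed.

(** * Almost every hyperplane is a Lebesgue point for the slices of a set *)

Section slices.
Variables (R : realType) (n : nat).
Local Notation V := 'rV[R]_n.
Local Notation B := (borelRn R n).
Local Notation leb := (lebesgue_rV R n).
Local Notation e_ k := (delta_mx ord0 k : V).
Variables (k : 'I_n) (E : set B).
Hypothesis mE : measurable E.

(** The (n-1)-dimensional measure of the symmetric difference of the slices of [E] at the heights
    [t] and [t + h]. *)
Definition slice_diff (t h : R) : \bar R :=
  leb [set y : B | slab k y /\ shift_diff E (h *: e_ k) (setc k t y)].

Let S : set (measurableTypeR R * measurableTypeR R * B) :=
  [set p | slab k p.2 /\ shift_diff E (p.1.2 *: e_ k) (setc k p.1.1 p.2)].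

Let T := (measurableTypeR R * measurableTypeR R * B)%type.

Let mS : measurable S.
Proof.
have m1 : measurable_fun setT ((fun p => setc k p.1.1 p.2) : T -> B).
  rewrite (_ : (fun p : T => _) =
    (fun p => setc k (0 + p.1) p.2) \o (fun p : T => (p.1.1, p.2))); last first.
    by apply/funext => p /=; rewrite add0r.
  apply: (measurableT_comp (@measurable_setc R n k 0)).
  apply/measurable_fun_pairP; split => //=; last exact: measurable_snd.
  exact: measurableT_comp measurable_fst measurable_fst.
have m2 : measurable_fun setT ((fun p => setc k p.1.1 p.2 + p.1.2 *: e_ k) : T -> B).
  rewrite (_ : (fun p : T => _) =
    (fun p => setc k (0 + p.1) p.2) \o (fun p : T => (p.1.1 + p.1.2, p.2))); last first.
    by apply/funext => p /=; rewrite add0r -setcD.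
  apply: (measurableT_comp (@measurable_setc R n k 0)).
  apply/measurable_fun_pairP; split => //=; last exact: measurable_snd.
  apply: measurable_funD; first exact: measurableT_comp measurable_fst measurable_fst.
  exact: measurableT_comp measurable_snd measurable_fst.
have ms : measurable ((fun p : T => p.2) @^-1` (@slab R n k)).
  by apply: measurable_setT_preimage; [exact: measurable_snd|exact: measurable_slab].
have h1 := measurable_setT_preimage m1 mE.
have h2 := measurable_setT_preimage m2 mE.
apply: measurableI => //; apply: measurableU; apply: measurableI => //.
- exact: measurableC h2.
- exact: measurableC h1.
Qed.

Let slice_diffE t h : slice_diff t h = leb (xsection S (t, h)).
Proof.
by rewrite /slice_diff; congr (leb _); apply/seteqP; split => y;
  rewrite xsectionE.
Qed.

Lemma measurable_slice_diff : measurable_fun setT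
  ((fun p => slice_diff p.1 p.2) : measurableTypeR R * measurableTypeR R -> \bar R).
Proof.
have := measurable_fun_xsection leb mS.
by congr measurable_fun; apply/funext => -[t h]; rewrite slice_diffE.
Qed.

Lemma slice_diff_ge0 t h : (0 <= slice_diff t h)%E.
Proof. exact: measure_ge0. Qed.

Lemma integral_slice_diff h :
  (\int[@lebesgue_measure R]_t slice_diff t h = leb (shift_diff E (h *: e_ k)))%E.
Proof.
have mD := measurable_shift_diff (h *: e_ k) mE.
rewrite (lebesgue_slice k 0 mD) /product_measure1/=.
apply: eq_integral => t _; rewrite /slice_diff; congr (leb _).
by apply/seteqP; split => y; rewrite xsectionE/= add0r.
Qed.

(** Its convergence to 0 as [u] decreases says that [t] is a one-sided Lebesgue point of the map
    that sends a height to the slice of [E], seen in L^1. *)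
Definition slice_osc (u t : R) : \bar R :=
  (u^-1%:E * \int[@lebesgue_measure R]_(h in `]0%R, u]) slice_diff t h)%E.

Let g (u : R) (p : measurableTypeR R * measurableTypeR R) : \bar R :=
  patch (fun=> 0%E) ([set: measurableTypeR R] `*` (`]0%R, u]%classic : set (measurableTypeR R)))
   (fun p => slice_diff p.1 p.2) p.

Let mg u : measurable_fun setT (g u).
Proof.
apply/(measurable_restrictT _ _).1; first by apply: measurableX.
apply: measurable_funTS; exact: measurable_slice_diff.
Qed.

Let g0 u p : (0 <= g u p)%E.
Proof. by rewrite /g /patch; case: ifP => // _; exact: slice_diff_ge0. Qed.

Let gE u t : (\int[@lebesgue_measure R]_(h in `]0%R, u]) slice_diff t h =
  \int[@lebesgue_measure R]_h g u (t, h))%E.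
Proof.
rewrite integral_mkcond; apply: eq_integral => h _; rewrite /patch /g /patch/=.
have [hu|hu] := pselect (`]0%R, u]%classic h).
  by rewrite (mem_set hu) (mem_set (conj I hu : (_ `*` _) (t, h))).
by rewrite (memNset hu) memNset// => -[].
Qed.

Lemma measurable_slice_osc u : measurable_fun setT (slice_osc u : measurableTypeR R -> \bar R).
Proof.
apply: measurable_funeM; rewrite (_ : (fun t => _) = (fun t => \int[@lebesgue_measure R]_h g u (t, h))%E).
  exact: (measurable_fun_fubini_tonelli_F (g u) (mg u) (g0 u)).
by apply/funext => t; exact: gE.
Qed.

Lemma slice_osc_ge0 u t : 0 < u -> (0 <= slice_osc u t)%E.
Proof.
move=> u0; apply: mule_ge0; first by rewrite lee_fin invr_ge0 ltW.
by apply: integral_ge0 => h _; exact: slice_diff_ge0.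
Qed.

Lemma integral_slice_osc (u e : R) : 0 < u ->
  (forall h : R, 0 < h <= u -> (leb (shift_diff E (h *: e_ k)) <= e%:E)%E) ->
  (\int[@lebesgue_measure R]_t slice_osc u t <= e%:E)%E.
Proof.
move=> u0 H; rewrite /slice_osc ge0_integralZl//; last 3 first.
- rewrite (_ : (fun t => _) = (fun t => \int[@lebesgue_measure R]_h g u (t, h))%E).
    exact: (measurable_fun_fubini_tonelli_F (g u) (mg u) (g0 u)).
  by apply/funext => t; exact: gE.
- by move=> t _; apply: integral_ge0 => h _; exact: slice_diff_ge0.
- by rewrite lee_fin invr_ge0 ltW.
under eq_integral do rewrite gE.
rewrite (fubini_tonelli (g u) (mg u) (g0 u)).
rewrite muleC -lee_pdivlMr ?lte_fin ?invr_gt0// invrK.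
apply: (@le_trans _ _ (\int[@lebesgue_measure R]_(h in `]0%R, u]) (cst e%:E) h)%E).
  rewrite [leRHS]integral_mkcond; apply: ge0_le_integral => //.
  - by move=> h _; apply: integral_ge0 => t _.
  - exact: (measurable_fun_fubini_tonelli_G (g u) (mg u) (g0 u)).
  - by apply/(measurable_restrictT _ _).1 => //; exact: measurable_cst.
  - move=> h _; rewrite /patch; case: ifPn => hu; last first.
      rewrite (eq_integral (fun=> 0%E)) ?integral0// => t _.
      by rewrite /g /patch memNset// => -[_ /mem_set]/=; apply/negP.
    rewrite [leLHS](_ : _ = \int[@lebesgue_measure R]_t slice_diff t h)%E.
      rewrite integral_slice_diff; apply: H.
      by move: hu; rewrite inE/= in_itv.
    apply: eq_integral => t _; rewrite /g /patch mem_set//.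
    by split => //; move: hu; rewrite inE.
by rewrite integral_cst// [X in (_ * X <= _)%E](lebesgue_measure_itv `]0%R, u])/= lte_fin u0 sube0.
Qed.

(** Convergence along one sequence is enough to define traces. The sequence is such that
    translations of length at most [u j] change [E] by at most [2^-(j+1)] in volume, which makes the
    integrals of [slice_osc (u j)] summable. *)
Lemma ae_good_slices (Q : set V) : open Q -> (leb Q < +oo)%E -> E `<=` Q ->
  exists u : nat -> R, (forall j, 0 < u j <= j.+1%:R^-1) /\
  {ae @lebesgue_measure R, forall t, slice_osc (u j) t @[j --> \oo] --> 0%E}.
Proof.
move=> oQ fQ EQ.
have /choice[d Hd] (j : nat) : exists d : R, 0 < d /\
    forall v : V, `|v| < d -> (leb (shift_diff E v) <= (1 / (2 ^ j.+1)%:R)%:E)%E.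
  have e0 : 0 < 1 / (2 ^ j.+1)%:R :> R by rewrite divr_gt0// ltr0n expn_gt0.
  by have [d d0 H] := lebesgue_shift_continuous oQ fQ mE EQ e0; exists d.
pose u j := Num.min (d j / 2) (j.+1%:R^-1).
have u0 j : 0 < u j.
  by rewrite lt_min invr_gt0 ltr0n andbT divr_gt0//; exact: (Hd j).1.
exists u; split; first by move=> j; rewrite u0/= ge_min lexx orbT.
apply: ae_cvg0_summable => [j|j t|]; first exact: measurable_slice_osc.
  exact: slice_osc_ge0.
apply: (@le_lt_trans _ _ (\sum_(0 <= j <oo) (1 / (2 ^ j.+1)%:R)%:E)%E).
  apply: lee_nneseries => [j _ _|j _].
    by apply: integral_ge0 => t _; exact: slice_osc_ge0.
  apply: integral_slice_osc => // h /andP[h0 hu]; apply: (Hd j).2.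
  apply: le_lt_trans (norm_delta_mx k h) _; rewrite gtr0_norm//.
  apply: (le_lt_trans hu); rewrite gt_min; apply/orP; left.
  by have := (Hd j).1; lra.
apply: le_lt_trans (epsilon_trick0 _ _) _; first exact: ler01.
exact: ltry.
Qed.

End slices.

Local Open Scope card_scope.
Local Open Scope ring_scope.

(** The bijection does not depend on [a], because it also has to enumerate the pieces of the
    partition in [variation_ge_double]. *)
Lemma nneseries_prod (R : realType) : exists e : nat -> nat * nat,
  set_bij setT setT e /\ forall a : nat -> nat -> \bar R,
  (forall i j, 0 <= a i j)%E ->
  (\sum_(0 <= i <oo) \sum_(0 <= j <oo) a i j =
   \sum_(0 <= k <oo) a (e k).1 (e k).2)%E.
Proof.
have /card_set_bijP[e be] : [set: nat] #= [set: nat * nat].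
  by rewrite card_eq_sym; exact: card_nat2.
exists e; split => // a a0.
rewrite !nneseries_esumT//; last by move=> i; exact: nneseries_ge0.
under eq_esum => i _ do rewrite nneseries_esumT//.
rewrite (@esum_esum _ _ _ setT (fun=> setT))//.
rewrite -(@reindex_esum R _ _ setT setT e (fun k => a k.1 k.2))//.
set S := (X in esum X _); set T := (X in _ = esum X _).
have -> : S = T by apply/seteqP; split.
by [].
Qed.

Lemma ereal_supD_le (R : realType) (S T : set (\bar R)) (c : \bar R) :
  S !=set0 -> T !=set0 -> (forall x, S x -> 0 <= x)%E -> (forall x, T x -> 0 <= x)%E ->
  (forall x y, S x -> T y -> x + y <= c)%E ->
  (ereal_sup S + ereal_sup T <= c)%E.
Proof.
move=> [x0 Sx0] [y0 Ty0] S0 T0 H.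
have [->|cf] := eqVneq c +oo%E; first by rewrite leey.
have c0 : (0 <= c)%E.
  by apply: le_trans (H _ _ Sx0 Ty0); apply: adde_ge0; [exact: S0|exact: T0].
have {}cf : c \is a fin_num by rewrite ge0_fin_numE// ltey.
have cy : (c < +oo)%E by rewrite -ge0_fin_numE.
have Tfin y : T y -> y \is a fin_num.
  move=> Ty; rewrite ge0_fin_numE; last exact: T0.
  apply: le_lt_trans cy; apply: le_trans (H _ _ Sx0 Ty).
  by rewrite leeDr//; exact: S0.
have sS0 : (0 <= ereal_sup S)%E.
  by apply: (le_trans (S0 _ Sx0)); exact: ereal_sup_ubound.
have sSc y : T y -> (ereal_sup S <= c - y)%E.
  by move=> Ty; apply: ge_ereal_sup => x Sx; rewrite leeBrDr ?Tfin//; exact: H.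
have sSf : ereal_sup S \is a fin_num.
  rewrite ge0_fin_numE//; apply: (le_lt_trans (sSc _ Ty0)).
  by rewrite -ge0_fin_numE; [rewrite fin_numB cf Tfin|exact: le_trans (sSc _ Ty0)].
rewrite -leeBrDl//; apply: ge_ereal_sup => y Ty.
by rewrite leeBrDl// -leeBrDr ?Tfin//; exact: sSc.
Qed.

(** * Total variation as a measure *)

Section variation.
Variables (R : realType) (n : nat) (O : set 'rV[R]_n).
Local Notation V := 'rV[R]_n.
Local Notation B := (borelRn R n).
Hypothesis oO : open O.
Implicit Types (A : set B) (phi : set V -> \bar R).

Definition rc_measurable A := measurable A /\ rel_compact_in O A.

Definition rc_partition A (F : (set B)^nat) :=
  [/\ forall k, measurable (F k) /\ rel_compact_in O (F k),
      trivIset setT F & \bigcup_k F k = A `&` O].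

(** [total_variation] with the norm of a vector measure replaced by a general [phi], so that sums of
    norms of several gradients are covered too. *)
Definition variation phi A : \bar R :=
  ereal_sup [set (\sum_(0 <= k <oo) phi (F k))%E | F in rc_partition A].

(** The properties of the norm of a vector measure that make its variation countably additive. *)
Definition subadditive_charge phi :=
  [/\ forall A, (0 <= phi A)%E, phi set0 = 0%E &
     forall A (F : (set B)^nat), rc_measurable A -> (forall k, measurable (F k)) ->
       trivIset setT F -> A = \bigcup_k F k ->
       (phi A <= \sum_(0 <= k <oo) phi (F k))%E].

Lemma rel_compact_in_sub (A C : set V) :
  A `<=` C -> rel_compact_in O C -> rel_compact_in O A.
Proof.
move=> AC [cC CO]; have clAC := closure_subset AC; split.
  by apply: subclosed_compact clAC => //; exact: closed_closure.
exact: subset_trans CO.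
Qed.

Lemma rel_compact_in0 : rel_compact_in O set0.
Proof. by rewrite /rel_compact_in closure0; split; [exact: compact0|exact: sub0set]. Qed.

Lemma rel_compact_in_subO (A : set V) : rel_compact_in O A -> A `<=` O.
Proof. by move=> [_ AO]; exact: subset_trans (@subset_closure _ A) AO. Qed.

(** Rational boxes whose closed boxes lie in [O], made disjoint. Without such a partition
    [variation] would be a supremum over the empty set. *)
Lemma exists_rc_partition A : measurable A -> exists F, rc_partition A F.
Proof.
move=> mA.
pose K k : set B :=
  if @unpickle ({ffun 'I_n -> rat} * {ffun 'I_n -> rat})%type k is Some c then
   if `[< closed_rat_box c `<=` O >] then rat_box c else set0 else set0.
have mK k : measurable (K k).
  rewrite /K; case: unpickle => [c|]; last exact: measurable0.
  case: ifP => _; last exact: measurable0.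
  apply: open_measurable_rV.
  rewrite (_ : rat_box c = [set x : V | 0 < box_bump c x]); last first.
    by apply/seteqP; split => x /box_bump_gt0.
  have := elementary_continuous (elementary_box_bump R c).
  by move/continuousP => /(_ _ (@open_gt R 0)).
have rK k : rel_compact_in O (K k).
  rewrite /K; case: unpickle => [c|]; last exact: rel_compact_in0.
  case: asboolP => cO; last exact: rel_compact_in0.
  apply: (@rel_compact_in_sub _ (closed_rat_box c)); first exact: rat_box_sub_closed.
  have cc := @compact_closed_rat_box R n c.
  have clc : closure (closed_rat_box c : set V) = closed_rat_box c.
    by apply/esym/(closure_id _).1; apply: compact_closed => //; exact: norm_hausdorff.
  by rewrite /rel_compact_in clc.
have KO : \bigcup_k K k = O.
  apply/seteqP; split=> [x [k _]|x Ox].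
    exact: rel_compact_in_subO.
  have [c [cx cO]] := open_rat_box_nbhs oO Ox.
  by exists (pickle c) => //; rewrite /K pickleK; case: asboolP.
exists (fun k => seqDU K k `&` A); split => [k||].
- split.
    apply: measurableI => //; apply: measurableD => //.
    exact: bigsetU_measurable.
  by apply: rel_compact_in_sub (rK k) => x [[]].
- by apply: trivIset_setIr; exact: trivIset_seqDU.
- by rewrite -setI_bigcupl -seqDU_bigcup_eq KO setIC.
Qed.

Lemma variation_ge phi A (F : (set B)^nat) :
  rc_partition A F -> (\sum_(0 <= k <oo) phi (F k) <= variation phi A)%E.
Proof. by move=> pF; apply: ereal_sup_ubound; exists F. Qed.

Lemma variation_ge_double phi A (H : nat -> nat -> set B) :
  subadditive_charge phi ->
  (forall i j, measurable (H i j) /\ rel_compact_in O (H i j)) ->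
  (forall i j i' j', H i j `&` H i' j' !=set0 -> i = i' /\ j = j') ->
  \bigcup_i \bigcup_j H i j = A `&` O ->
  (\sum_(0 <= i <oo) \sum_(0 <= j <oo) phi (H i j) <= variation phi A)%E.
Proof.
move=> [phi0 _ _] mH tH UH; have [e [[_ injE surjE] ->]] := nneseries_prod R; last by [].
apply: variation_ge; split => [k|i j _ _ /tH[E1 E2]|]; first exact: mH.
  by apply: injE; rewrite ?inE// [LHS]surjective_pairing [RHS]surjective_pairing E1 E2.
rewrite -UH; apply/seteqP; split => [x [k _ Hx]|x [i _ [j _ Hx]]].
  by exists (e k).1 => //; exists (e k).2.
by have [k _ ek] := surjE (i, j) I; exists k => //; rewrite ek.
Qed.

Lemma variation_ge0 phi A : subadditive_charge phi -> measurable A -> (0 <= variation phi A)%E.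
Proof.
move=> [phi0 _ _] /exists_rc_partition[F pF]; apply: le_trans (variation_ge _ pF).
exact: nneseries_ge0.
Qed.

Lemma nneseries2 (a : nat -> \bar R) : (forall k, (2 <= k)%N -> a k = 0%E) ->
  (\sum_(0 <= k <oo) a k = a 0%N + a 1%N)%E.
Proof.
move=> a2; rewrite (_ : (a 0%N + a 1%N)%E = (\sum_(0 <= k < 2) a k)%E); last first.
  by rewrite big_nat_recl// big_nat1.
apply/cvg_lim => //; apply: cvg_near_cst; near=> N.
rewrite (@big_cat_nat _ _ _ 2)//=; last by near: N; exact: nbhs_infty_ge.
rewrite [X in (_ + X)%E]big_nat_cond [X in (_ + X)%E]big1 ?adde0// => k.
by rewrite andbT => /andP[/a2 ->].
Unshelve. all: by end_near. Qed.

Lemma variation_superadditive phi A C : subadditive_charge phi ->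
  measurable A -> measurable C -> A `&` C = set0 ->
  (variation phi A + variation phi C <= variation phi (A `|` C))%E.
Proof.
move=> sphi mA mC AC0; have [phi0 phi00 _] := sphi.
have ne D : measurable D ->
    [set (\sum_(0 <= k <oo) phi (F k))%E | F in rc_partition D] !=set0.
  by move=> /exists_rc_partition[F pF]; eexists; exists F.
have ge0 D x : [set (\sum_(0 <= k <oo) phi (F k))%E | F in rc_partition D] x -> (0 <= x)%E.
  by move=> [F _ <-]; exact: nneseries_ge0.
apply: ereal_supD_le; [exact: ne|exact: ne|exact: ge0|exact: ge0|].
move=> _ _ [F [mF tF UF] <-] [G [mG tG UG] <-].
pose H i : nat -> set B := if i == 0%N then F else if i == 1%N then G else fun=> set0.
have <- : (\sum_(0 <= i <oo) \sum_(0 <= j <oo) phi (H i j) =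
   \sum_(0 <= k <oo) phi (F k) + \sum_(0 <= k <oo) phi (G k))%E.
  have H2 i : (2 <= i)%N -> (\sum_(0 <= j <oo) phi (H i j))%E = 0%E.
    by case: i => [|[|i]]// _; rewrite eseries0.
  by rewrite (nneseries2 H2).
have HA i j x : H i j x -> (i = 0%N /\ A x) \/ (i = 1%N /\ C x).
  rewrite /H; case: i => [|[|i]]//= ?; [left|right]; split => //.
    by have : (A `&` O) x by [rewrite -UF; exists j]; case.
  by have : (C `&` O) x by [rewrite -UG; exists j]; case.
apply: variation_ge_double => //.
- move=> [|[|i]] j; rewrite /H//=; split; [exact: measurable0|exact: rel_compact_in0].
- move=> i j i' j' [x [Hx H'x]].
  have := HA _ _ _ Hx; have := HA _ _ _ H'x.
  move=> [[i'E Ax]|[i'E Cx]] [[iE A'x]|[iE C'x]]; subst i i'; split => //.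
  + by apply: tF => //; exists x.
  + by have : (A `&` C) x by []; rewrite AC0.
  + by have : (A `&` C) x by []; rewrite AC0.
  + by have : (A `&` C) x by []; rewrite AC0.
  + by have : (A `&` C) x by []; rewrite AC0.
  + by apply: tG => //; exists x.
- rewrite setIUl -UF -UG; apply/seteqP; split => [x [i _ [j _]]|x [[j _ Fx]|[j _ Gx]]].
  + by case: i => [|[|i]]//= Hx; [left|right]; exists j.
  + by exists 0%N => //; exists j.
  + by exists 1%N => //; exists j.
Qed.

Lemma variation_mono phi A C : subadditive_charge phi ->
  measurable A -> measurable C -> A `<=` C -> (variation phi A <= variation phi C)%E.
Proof.
move=> sphi mA mC AC; have mCA : measurable (C `\` A) by exact: measurableD.
have := variation_superadditive sphi mA mCA; rewrite setDIK => /(_ erefl).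
rewrite setDUK//; apply: le_trans; rewrite leeDl//; exact: variation_ge0.
Qed.

Lemma variation_set0 phi : subadditive_charge phi -> variation phi set0 = 0%E.
Proof.
move=> sphi; have [phi0 phi00 _] := sphi; apply/eqP; rewrite eq_le variation_ge0// andbT.
apply: ge_ereal_sup => _ [F [_ _ UF] <-].
rewrite eseries0// => k _ _; rewrite -phi00; congr phi.
by apply/seteqP; split => // x Fx; rewrite -(set0I O) -UF; exists k.
Qed.

(** A partition of the union is refined along the [A k], which increases its sum by countable
    subadditivity; the other inequality is superadditivity on the finite unions. *)
Lemma variation_measure phi : subadditive_charge phi ->
  exists m : {measure set B -> \bar R}, forall A, measurable A -> m A = variation phi A.
Proof.
move=> sphi; have [phi0 phi00 phiS] := sphi.
(* A nonmeasurable set may have no partition, and the supremum is then [-oo]; the default value 0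
   keeps [f] nonnegative on all sets. *)
pose f A := if `[< measurable A >] then variation phi A else 0%E.
have fE A : measurable A -> f A = variation phi A by move=> mA; rewrite /f asboolT.
have f0 : f set0 = 0%E by rewrite fE ?variation_set0//; exact: measurable0.
have f_ge0 A : (0 <= f A)%E.
  by rewrite /f; case: asboolP => // mA; exact: variation_ge0.
have fS : semi_sigma_additive f.
  move=> A mA tA mUA.
  rewrite (_ : f (\bigcup_k A k) = (\sum_(0 <= k <oo) f (A k))%E).
    by apply: is_cvg_nneseries => k _ _; exact: f_ge0.
  under eq_eseriesr => k _ do rewrite fE//.
  rewrite fE//; apply/eqP; rewrite eq_le; apply/andP; split.
    apply: ge_ereal_sup => _ [F [mF tF UF] <-].
    apply: (@le_trans _ _ (\sum_(0 <= k <oo) \sum_(0 <= j <oo) phi (F k `&` A j))%E).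
      apply: lee_nneseries => [k _ _|k _]; first exact: phi0.
      apply: phiS; first exact: mF.
      - by move=> j; apply: measurableI => //; exact: (mF k).1.
      - exact: trivIset_setIl.
      - rewrite -setI_bigcupr; apply/esym/setIidl => x Fx.
        by have : (\bigcup_k A k `&` O) x by [rewrite -UF; exists k]; case.
    rewrite nneseries_interchange//; apply: lee_nneseries => [j _ _|j _].
      exact: nneseries_ge0.
    apply: variation_ge; split => [k||].
    - split; first by apply: measurableI => //; exact: (mF k).1.
      by apply: rel_compact_in_sub (mF k).2 => x [].
    - exact: trivIset_setIr.
    - rewrite -setI_bigcupl UF -setIA (setIC O) setIA; congr (_ `&` _).
      by apply/setIidr => x Ax; exists j.
  apply: lime_le => [|]; first by apply: is_cvg_nneseries => k _ _; exact: variation_ge0.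
  apply: nearW => N; rewrite big_mkord.
  apply: (@le_trans _ _ (variation phi (\big[setU/set0]_(k < N) A k))); last first.
    apply: variation_mono => //; first exact: bigsetU_measurable.
    by move=> x; rewrite -bigcup_mkord => -[k _ Ax]; exists k.
  elim: N => [|N IH]; first by rewrite !big_ord0 variation_set0.
  rewrite !big_ord_recr/=; apply: le_trans (variation_superadditive _ _ _ _) => //.
  - by rewrite leeD2r.
  - exact: bigsetU_measurable.
  - apply/seteqP; split => // x [+ Ax]; rewrite -bigcup_mkord => -[k /= kN Akx].
    have kE : k = N by apply: (tA k N I I); exists x.
    by move: kN; rewrite kE ltnn.
pose m := isMeasure.Build _ _ _ f f0 f_ge0 fS.
pose mu : {measure set B -> \bar R} := HB.pack f m.
by exists mu.
Qed.

Lemma rc_partition1 A : measurable A -> rel_compact_in O A ->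
  rc_partition A (fun k => if k == 0%N then A else set0).
Proof.
move=> mA rA; split => [k||].
- by case: ifP => // _; split; [exact: measurable0|exact: rel_compact_in0].
- apply/trivIsetP => i j _ _ ij; case: ifP => [/eqP i0|_]; last by rewrite set0I.
  by rewrite ifF ?setI0//; apply/negbTE; rewrite -i0 eq_sym.
- rewrite setIidl; last exact: rel_compact_in_subO.
  apply/seteqP; split => [x [k _]|x Ax]; first by case: ifP.
  by exists 0%N.
Qed.

Lemma le_variation phi A : subadditive_charge phi ->
  measurable A -> rel_compact_in O A -> (phi A <= variation phi A)%E.
Proof.
move=> [phi0 phi00 _] mA rA; apply: le_trans (variation_ge _ (rc_partition1 mA rA)).
rewrite nneseries2; last by move=> [|[|k]].
by rewrite phi00 adde0.
Qed.

Lemma variation_le_measure phi A (m : {measure set B -> \bar R}) :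
  measurable A ->
  (forall F : set B, measurable F -> rel_compact_in O F -> F `<=` A -> phi F <= m F)%E ->
  (forall F, 0 <= phi F)%E ->
  (variation phi A <= m A)%E.
Proof.
move=> mA H phi0; apply: ge_ereal_sup => _ [F [mF tF UF] <-].
apply: (@le_trans _ _ (m (A `&` O))); last first.
  by apply: le_measure; rewrite ?inE//; apply: measurableI => //; exact: open_measurable_rV.
have FA k : F k `<=` A.
  by move=> x Fx; have : (A `&` O) x by [rewrite -UF; exists k]; case.
rewrite -UF measure_semi_bigcup//; last by rewrite UF; apply: measurableI => //; exact: open_measurable_rV.
  by apply: lee_nneseries => // k _; have [? ?] := mF k; exact: H.
by move=> k; exact: (mF k).1.
Qed.

(** Passing to the common refinement of two partitions increases both sums. Additivity is what turns
    a pointwise inequality between norms of gradients, such as [enorm_gap], into an inequality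
    between perimeter measures. *)
Lemma variationD phi psi A : subadditive_charge phi -> subadditive_charge psi ->
  measurable A ->
  (variation (fun F => phi F + psi F)%E A = variation phi A + variation psi A)%E.
Proof.
move=> sphi spsi mA; have [phi0 phi00 phiS] := sphi; have [psi0 psi00 psiS] := spsi.
apply/eqP; rewrite eq_le; apply/andP; split.
  apply: ge_ereal_sup => _ [F pF <-].
  by rewrite nneseriesD//; apply: leeD; exact: variation_ge.
have ne f : [set (\sum_(0 <= k <oo) f (F k))%E | F in rc_partition A] !=set0.
  by have [F pF] := exists_rc_partition mA; eexists; exists F.
apply: ereal_supD_le; [exact: ne|exact: ne|by move=> _ [F _ <-]; exact: nneseries_ge0..|].
move=> _ _ [F [mF tF UF] <-] [G [mG tG UG] <-].
have sD : subadditive_charge (fun F => phi F + psi F)%E.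
  split => [C||C D rC mD tD CE]; first by rewrite adde_ge0.
  - by rewrite phi00 psi00 adde0.
  - by rewrite nneseriesD//; apply: leeD; [exact: phiS|exact: psiS].
apply: (@le_trans _ _ (\sum_(0 <= i <oo) \sum_(0 <= j <oo)
    (phi (F i `&` G j) + psi (F i `&` G j)))%E); last first.
  apply: (variation_ge_double sD).
  - move=> i j; split; first by apply: measurableI; [exact: (mF i).1|exact: (mG j).1].
    by apply: rel_compact_in_sub (mF i).2 => x [].
  - by move=> i j i' j' [x [[Fx Gx] [F'x G'x]]]; split; [apply: tF|apply: tG] => //; exists x.
  - under eq_bigcupr do rewrite -setI_bigcupr.
    by rewrite -setI_bigcupl UF UG setIid.
rewrite (_ : (\sum_(0 <= i <oo) _)%E = (\sum_(0 <= i <oo) \sum_(0 <= j <oo)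
    phi (F i `&` G j) + \sum_(0 <= i <oo) \sum_(0 <= j <oo) psi (F i `&` G j))%E); last first.
  rewrite -nneseriesD; [|by move=> *; exact: nneseries_ge0..].
  by apply: eq_eseriesr => i _; rewrite nneseriesD.
have FO k : F k `<=` A `&` O by move=> x Fx; rewrite -UF; exists k.
have GO k : G k `<=` A `&` O by move=> x Fx; rewrite -UG; exists k.
apply: leeD.
  apply: lee_nneseries => // i _; apply: phiS; first exact: mF.
  - by move=> j; apply: measurableI; [exact: (mF i).1|exact: (mG j).1].
  - exact: trivIset_setIl.
  - by rewrite -setI_bigcupr UG; apply/esym/setIidl; exact: FO.
rewrite nneseries_interchange//.
apply: lee_nneseries => // i _; apply: psiS; first exact: mG.
- by move=> j; apply: measurableI; [exact: (mF j).1|exact: (mG i).1].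
- exact: trivIset_setIr.
- by rewrite -setI_bigcupl UF; apply/esym/setIidr; exact: GO.
Qed.

Lemma subadditive_chargeD phi psi :
  subadditive_charge phi -> subadditive_charge psi ->
  subadditive_charge (fun F => phi F + psi F)%E.
Proof.
move=> [phi0 phi00 phiS] [psi0 psi00 psiS].
split => [C||C D rC mD tD CE]; first by rewrite adde_ge0.
- by rewrite phi00 psi00 adde0.
- by rewrite nneseriesD//; apply: leeD; [exact: phiS|exact: psiS].
Qed.

Lemma subadditive_charge_cst0 : subadditive_charge (fun=> 0%E).
Proof. by split => // *; rewrite eseries0. Qed.

Lemma variation_cst0 A : measurable A -> variation (fun=> 0%E) A = 0%E.
Proof.
move=> mA; apply/eqP; rewrite eq_le (variation_ge0 subadditive_charge_cst0)// andbT.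
by apply: ge_ereal_sup => _ [F _ <-]; rewrite eseries0.
Qed.

Lemma subadditive_charge_sum (I : Type) (s : seq I) (P : pred I) (phi : I -> set V -> \bar R) :
  (forall i, subadditive_charge (phi i)) ->
  subadditive_charge (fun F => \sum_(i <- s | P i) phi i F)%E.
Proof.
move=> sphi; elim: s => [|i s IH].
  under eq_fun do rewrite big_nil; exact: subadditive_charge_cst0.
under eq_fun do rewrite big_cons; case: (P i) => //; exact: subadditive_chargeD.
Qed.

Lemma variation_sum (I : Type) (s : seq I) (P : pred I) (phi : I -> set V -> \bar R) A :
  (forall i, subadditive_charge (phi i)) -> measurable A ->
  (variation (fun F => \sum_(i <- s | P i) phi i F) A =
   \sum_(i <- s | P i) variation (phi i) A)%E.
Proof.
move=> sphi mA; elim: s => [|i s IH].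
  by under eq_fun do rewrite big_nil; rewrite variation_cst0// big_nil.
rewrite big_cons -IH; under eq_fun do rewrite big_cons.
case: (P i) => //; rewrite variationD//; exact: subadditive_charge_sum.
Qed.

Lemma le_variation2 phi psi A : (forall F, phi F <= psi F)%E -> (forall F, 0 <= phi F)%E ->
  (variation phi A <= variation psi A)%E.
Proof.
move=> H phi0; apply: ge_ereal_sup => _ [F pF <-].
by apply: le_trans (variation_ge psi pF); exact: lee_nneseries.
Qed.

End variation.

(** * Neighbourhoods of compact sets, supports and integrability of test functions *)

Section neighbourhoods.
Variables (R : realType) (n : nat).
Local Notation V := 'rV[R]_n.
Local Notation B := (borelRn R n).
Local Notation leb := (lebesgue_rV R n).

Definition thicken (K : set V) (d : R) : set V := \bigcup_(x in K) ball x d.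

Lemma open_thicken K d : open (thicken K d).
Proof. by apply: bigcup_open => x _; exact: ball_open. Qed.

Lemma thicken_add K d d' (x v : V) : thicken K d x -> `|v| < d' -> thicken K (d + d') (x + v).
Proof.
move=> [y Ky]; rewrite -ball_normE/= => yx vd; exists y => //; rewrite -ball_normE/=.
by rewrite opprD addrA (le_lt_trans (ler_normB _ _))// ltrD.
Qed.

Lemma sub_thicken K d : 0 < d -> K `<=` thicken K d.
Proof. by move=> d0 x Kx; exists x => //; exact: ballxx. Qed.

Lemma thicken_le K d d' : d <= d' -> thicken K d `<=` thicken K d'.
Proof. by move=> dd' x [y Ky yx]; exists y => //; exact: le_ball yx. Qed.

Lemma compact_thicken (K O : set V) : compact K -> open O -> K `<=` O ->
  exists2 d : R, 0 < d & thicken K d `<=` O.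
Proof.
move=> /compact_near_coveringP cK oO KO.
have : \forall d \near 0^'+, K `<=` [set x | ball x d `<=` O].
  apply: (cK R (0^'+) (fun d x => ball x d `<=` O)) => x Kx.
  have /nbhs_ballP[r /= r0 rO] : nbhs x O by apply: open_nbhs_nbhs; split => //; exact: KO.
  have r20 : 0 < r / 2 by rewrite divr_gt0.
  exists (ball x (r / 2), [set d | d < r / 2]) => /=.
    by split; [exact: nbhsx_ballx|exact: nbhs_right_lt].
  move=> [y d]/= [xy dr] z yz; apply: rO; rewrite (_ : r = r / 2 + r / 2); last by lra.
  by apply: ball_triangle xy _; apply: le_ball yz; rewrite ltW.
case=> e /= e0 H; exists (e / 2); first by rewrite divr_gt0.
have e2 : 0 < e / 2 by rewrite divr_gt0.
move=> y [x Kx xy]; apply: (H (e / 2) _ _ x Kx) => //=.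
by rewrite sub0r normrN gtr0_norm//; lra.
Qed.

Lemma bounded_thicken K d : compact K -> exists M, forall x, thicken K d x -> `|x| <= M.
Proof.
move=> /compact_bounded[M [_ MK]]; exists (M + 1 + d) => x [y Ky].
rewrite -ball_normE/= => yx; have := MK (M + 1) _ y Ky; rewrite ltrDl ltr01 => /(_ isT) yM.
rewrite -(subrK y x) (le_trans (ler_normD _ _))// addrC lerD// ltW//.
by rewrite -normrN opprB.
Qed.

Lemma rel_compact_thicken (K O : set V) d : 0 < d -> compact K ->
  thicken K (d + d) `<=` O -> rel_compact_in O (thicken K d).
Proof.
move=> d0 cK KO.
have clK : closure (thicken K d) `<=` thicken K (d + d).
  move=> x /(_ (ball x d) (nbhsx_ballx _ _ d0))[y [[z Kz zy] xy]].
  by exists z => //; apply: ball_triangle zy _; exact: ball_sym.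
split; last exact: subset_trans KO.
apply: bounded_closed_compact; last exact: closed_closure.
have [M HM] := bounded_thicken (d + d) cK.
exists M; split; first exact: num_real.
by move=> y My x /clK /HM xM; exact: le_trans xM (ltW My).
Qed.

Lemma coord_le_norm (v : V) i : `|v ord0 i| <= `|v|.
Proof.
rewrite [leRHS]/Num.Def.normr/= mx_normrE.
by apply/bigmax_geP; right; exists (ord0, i).
Qed.

Lemma lebesgue_bounded (A : set B) M : (forall x, A x -> `|x : V| <= M) ->
  measurable A -> (leb A < +oo)%E.
Proof.
move=> AM mA; pose a := Num.max 0 M + 1.
have aM : M < a by rewrite /a; case: (lerP 0 M) => h; [rewrite ltrDl|rewrite add0r (lt_trans h)].
have a0 : 0 <= a by rewrite /a addr_ge0// le_max lexx.
apply: (@le_lt_trans _ _ (leb (hbox (fun=> - a) (fun=> a)))).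
  apply: le_measure; rewrite ?inE//; first exact: measurable_hbox.
  move=> x /AM xM i; rewrite in_itv/=.
  have := le_lt_trans (le_trans (coord_le_norm x i) xM) aM.
  by rewrite ltr_norml => /andP[-> /ltW].
by rewrite [ltLHS]lebesgue_hbox ?ltry// => i; rewrite ge0_cp.
Qed.

Lemma lebesgue_thicken K d : compact K -> (leb (thicken K d) < +oo)%E.
Proof.
move=> cK; have [M HM] := bounded_thicken d cK.
apply: (@lebesgue_bounded _ M) => //.
by apply: open_measurable_rV; exact: open_thicken.
Qed.

Lemma test_function_bounded (O : set V) f : test_function O f ->
  exists2 C : R, 0 <= C & forall x, `|f x| <= C.
Proof.
move=> [sf [cK _]]; set K := closure _ in cK.
have cf : continuous f by exact: (sf [::]).1.
have : compact (f @` K).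
  by apply: continuous_compact => //; exact: continuous_subspaceT.
move=> /compact_bounded[M [_ HM]].
exists (Num.max 0 (M + 1)); first by rewrite le_max lexx.
move=> x; rewrite le_max; have [->|fx] := eqVneq (f x) 0; first by rewrite normr0 lexx.
apply/orP; right; apply: (HM (M + 1)); first by rewrite ltrDl.
by exists x => //; exact: subset_closure.
Qed.

Lemma test_function_continuous (O : set V) f : test_function O f -> continuous f.
Proof. by move=> [sf _]; exact: (sf [::]).1. Qed.

Lemma test_function_partial (O : set V) f i : test_function O f ->
  test_function O (partial i f).
Proof.
move=> [sf [cK KO]].
have -> : test_function O (partial i f) =
  (smooth (partial i f) /\ rel_compact_in O [set x | partial i f x != 0]) by [].
split.
  move=> s; have := sf (rcons s i).
  by rewrite /partials foldr_rcons.
have sub : [set x | partial i f x != 0] `<=` closure [set x | f x != 0].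
  move=> x; apply: contra_neqP => nx.
  have : \forall y \near x, f y = 0.
    have : nbhs x (~` closure [set x | f x != 0]).
      by apply: open_nbhs_nbhs; split => //; exact/closed_openC/closed_closure.
    apply: filterS => y ny; apply: contra_notP ny => /eqP fy.
    exact: subset_closure.
  move=> H; rewrite /partial (@near_eq_derive _ _ _ _ (cst 0))//.
  exact: derive_cst.
have cl : closure [set x | partial i f x != 0] `<=` closure [set x | f x != 0].
  by rewrite [X in _ `<=` X](closure_id _).1; [exact: closure_subset|exact: closed_closure].
split; last exact: subset_trans KO.
by apply: subclosed_compact cl => //; exact: closed_closure.
Qed.

Lemma test_function_support (O : set V) f : test_function O f ->
  exists2 K, compact K & K `<=` O /\ forall x, ~ K x -> f x = 0.
Proof.
move=> [_ [cK KO]]; exists (closure [set x | f x != 0]) => //; split => // x Kx.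
by apply: contra_notP Kx => /eqP fx; exact: subset_closure.
Qed.

Lemma integrable_compact_support (O K : set V) (m : {measure set B -> \bar R}) (f : V -> R) C :
  measurable (O : set B) -> measurable (K : set B) -> (m K < +oo)%E ->
  measurable_fun setT (f : B -> R) ->
  (forall x, ~ K x -> f x = 0) -> (forall x, `|f x| <= C) ->
  m.-integrable (O : set B) (EFin \o f).
Proof.
move=> mO mK fK mf f0 fC; apply/integrableP; split.
  by apply/measurable_EFinP; exact: measurable_funTS.
have C0 : 0 <= C by rewrite (le_trans _ (fC 0)).
apply: (@le_lt_trans _ _ (\int[m]_(x in (O : set B)) (C%:E * (\1_(K : set B) x)%:E))%E).
  apply: ge0_le_integral => //.
  - by apply: measurableT_comp => //; apply/measurable_EFinP; exact: measurable_funTS.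
  - by apply: measurable_funeM; apply/measurable_EFinP; exact: measurable_indic.
  - move=> x _; rewrite /= -EFinM lee_fin indicE; have [Kx|Kx] := pselect (K x).
      by rewrite mem_set// mulr1.
    by rewrite memNset// mulr0 f0// normr0.
rewrite ge0_integralZl//; last by apply/measurable_EFinP; exact: measurable_indic.
rewrite integral_indic// lte_mul_pinfty//.
by apply: le_lt_trans fK; apply: le_measure; rewrite ?inE//; exact: measurableI.
Qed.

Lemma compact_measurable_rV (K : set V) : compact K -> measurable (K : set B).
Proof.
move=> cK; apply: closed_measurable_rV; apply: compact_closed => //; exact: norm_hausdorff.
Qed.

Lemma test_function_integrable (O : set V) (m : {measure set B -> \bar R}) (f : V -> R) :
  open O -> locally_finite O m -> test_function O f -> m.-integrable (O : set B) (EFin \o f).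
Proof.
move=> oO fm tf; have [C C0 fC] := test_function_bounded tf.
have [K cK [KO Kf]] := test_function_support tf.
apply: (@integrable_compact_support O K _ _ C) => //.
- exact: open_measurable_rV.
- exact: compact_measurable_rV.
- exact: fm.
- exact: continuous_measurable_rV (test_function_continuous tf).
Qed.

Lemma locally_finite_lebesgue (O : set V) : locally_finite O leb.
Proof.
move=> K cK _; have /compact_bounded[M [_ HM]] := cK.
apply: (@lebesgue_bounded _ (M + 1)); last exact: compact_measurable_rV.
by move=> x Kx; apply: HM => //; rewrite ltrDl.
Qed.

Lemma test_function_lebesgue_integrable (O : set V) (E : set B) (f : V -> R) :
  measurable E -> test_function O f -> leb.-integrable E (EFin \o f).
Proof.
move=> mE tf; have [C C0 fC] := test_function_bounded tf.
have [K cK [KO Kf]] := test_function_support tf.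
apply: (@integrable_compact_support E K _ _ C) => //.
- exact: compact_measurable_rV.
- exact: (@locally_finite_lebesgue setT).
- exact: continuous_measurable_rV (test_function_continuous tf).
Qed.

Lemma test_function_shift (U O : set V) (v : V) f :
  test_function U f -> (forall x, U x -> O (x - v)) ->
  test_function O (fun x => f (x + v)).
Proof.
move=> tf UO; have [K cK [KU Kf]] := test_function_support tf.
split; first by apply: smooth_shift; case: tf.
pose K' := (fun x : V => x - v) @` K.
have cK' : compact K'.
  apply: continuous_compact => //; apply: continuous_subspaceT.
  exact: (@continuous_addr R n (- v)).
have sK' : [set x | f (x + v) != 0] `<=` K'.
  move=> x; apply: contra_neqP => K'x; apply: Kf => Kxv; apply: K'x.
  by exists (x + v) => //; rewrite addrK.
have clK' : closure [set x | f (x + v) != 0] `<=` K'.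
  rewrite [X in _ `<=` X](closure_id _).1; first exact: closure_subset.
  by apply: compact_closed => //; exact: norm_hausdorff.
split; first by apply: subclosed_compact clK' => //; exact: closed_closure.
by move=> x /clK'[y Ky <-]; exact/UO/KU.
Qed.

End neighbourhoods.

(** * Bounded measurable functions and finite measures *)

Section bounded_measurable.
Context d (T : measurableType d) (R : realType).
Implicit Types (f g : T -> R).

(** Such functions are integrable for every finite measure, so real-valued integrals obey linearity,
    Fubini and dominated convergence without any further integrability condition. *)
Definition bmeas f := measurable_fun setT f /\ exists C, forall x, `|f x| <= C.

Lemma bmeas_cst c : bmeas (fun=> c).
Proof. by split; [exact: measurable_cst|exists `|c|]. Qed.

Lemma bmeasD f g : bmeas f -> bmeas g -> bmeas (fun x => f x + g x).
Proof.
move=> [mf [C fC]] [mg [D gD]]; split; first exact: measurable_funD.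
by exists (C + D) => x; rewrite (le_trans (ler_normD _ _))// lerD.
Qed.

Lemma bmeasM f g : bmeas f -> bmeas g -> bmeas (fun x => f x * g x).
Proof.
move=> [mf [C fC]] [mg [D gD]]; split; first exact: measurable_funM.
by exists (C * D) => x; rewrite normrM ler_pM.
Qed.

Lemma bmeasN f : bmeas f -> bmeas (fun x => - f x).
Proof.
move=> bf; have := bmeasM (bmeas_cst (-1)) bf.
by congr bmeas; apply/funext => x; rewrite mulN1r.
Qed.

Lemma bmeasB f g : bmeas f -> bmeas g -> bmeas (fun x => f x - g x).
Proof. by move=> bf bg; apply: bmeasD => //; exact: bmeasN. Qed.

Lemma bmeas_indic (A : set T) : measurable A -> bmeas (\1_A : T -> R).
Proof.
move=> mA; split; first exact: measurable_indic.
by exists 1 => x; rewrite indicE; case: (_ \in _); rewrite ?normr1 ?normr0.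
Qed.

Variable m : {finite_measure set T -> \bar R}.

Lemma bmeas_integrable f : bmeas f -> m.-integrable setT (EFin \o f).
Proof.
move=> [mf [C fC]]; apply: measurable_bounded_integrable => //.
  by rewrite ltey_eq fin_num_measure.
exists C; split; first exact: num_real.
by move=> y Cy x _; exact: le_trans (fC x) (ltW Cy).
Qed.

Lemma bmeas_RintegralE f : bmeas f ->
  ((\int[m]_x f x)%R%:E = \int[m]_x (f x)%:E)%E.
Proof.
by move=> bf; rewrite /Rintegral fineK//; apply: integrable_fin_num => //; exact: bmeas_integrable.
Qed.

Lemma bmeas_RintegralD f g : bmeas f -> bmeas g ->
  \int[m]_x (f x + g x) = \int[m]_x f x + \int[m]_x g x.
Proof. by move=> bf bg; rewrite RintegralD//; exact: bmeas_integrable. Qed.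

Lemma bmeas_RintegralB f g : bmeas f -> bmeas g ->
  \int[m]_x (f x - g x) = \int[m]_x f x - \int[m]_x g x.
Proof. by move=> bf bg; rewrite RintegralB//; exact: bmeas_integrable. Qed.

Lemma bmeas_RintegralZl f c : bmeas f ->
  \int[m]_x (c * f x) = c * \int[m]_x f x.
Proof. by move=> bf; rewrite RintegralZl//; exact: bmeas_integrable. Qed.

Lemma bmeas_le_Rintegral f g : bmeas f -> bmeas g -> (forall x, f x <= g x) ->
  \int[m]_x f x <= \int[m]_x g x.
Proof. by move=> bf bg fg; apply: le_Rintegral => //; exact: bmeas_integrable. Qed.

Lemma bmeas_norm f : bmeas f -> bmeas (fun x => `|f x|).
Proof.
move=> [mf [C fC]]; split; first exact: measurableT_comp.
by exists C => x; rewrite normr_id.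
Qed.

Lemma bmeas_le_norm f g : bmeas f -> bmeas g -> (forall x, `|f x| <= g x) ->
  `|\int[m]_x f x| <= \int[m]_x g x.
Proof.
move=> bf bg fg; apply: le_trans (le_normr_Rintegral _ (bmeas_integrable bf)) _ => //.
by apply: bmeas_le_Rintegral => //; exact: bmeas_norm.
Qed.

Lemma bmeas_norm_le f C : bmeas f -> (forall x, `|f x| <= C) ->
  `|\int[m]_x f x| <= C * fine (m setT).
Proof.
move=> bf fC; rewrite -Rintegral_cst//.
exact: (bmeas_le_norm bf (bmeas_cst C)).
Qed.

Lemma bmeas_dominated_convergence (f_ : nat -> T -> R) f C :
  (forall j, measurable_fun setT (f_ j)) -> measurable_fun setT f ->
  (forall j x, `|f_ j x| <= C) -> (forall x, f_ j x @[j --> \oo] --> f x) ->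
  \int[m]_x f_ j x @[j --> \oo] --> \int[m]_x f x.
Proof.
move=> mf_ mf f_C f_f.
have fC x : `|f x| <= C.
  have := cvg_norm (f_f x); rewrite -(cvg_lim _ (cvg_norm (f_f x)))// => h.
  apply: limr_le; first by apply/cvg_ex; exists `|f x|; exact: cvg_norm (f_f x).
  exact: nearW.
have bf : bmeas f by split => //; exists C.
have bf_ j : bmeas (f_ j) by split => //; exists C.
have H : (\int[m]_x (f_ j x)%:E)%E @[j --> \oo] --> (\int[m]_x (f x)%:E)%E.
  have := @dominated_convergence _ _ _ m setT measurableT
    (fun j x => (f_ j x)%:E) (fun x => (f x)%:E) (cst C%:E).
  case => //.
  - by move=> j; exact/measurable_EFinP.
  - exact/measurable_EFinP.
  - by apply: aeW => x _; apply: cvg_EFin; [exact: nearW|exact: f_f].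
  - exact: (bmeas_integrable (bmeas_cst C)).
  - by apply: aeW => x j _; rewrite /= lee_fin.
by apply: fine_cvg; rewrite bmeas_RintegralE.
Qed.
End bounded_measurable.

Section bounded_fubini.
Context d1 d2 (T1 : measurableType d1) (T2 : measurableType d2) (R : realType).
Variables (m1 : {finite_measure set T1 -> \bar R}) (m2 : {finite_measure set T2 -> \bar R}).
Variable f : T1 * T2 -> R.
Hypothesis bf : bmeas f.

Let iF : (m1 \x m2)%E.-integrable setT (EFin \o f).
Proof.
have [mf [C fC]] := bf.
apply/integrable12ltyP; first exact/measurable_EFinP.
have C0 : 0 <= C by rewrite (le_trans _ (fC point)).
apply: (@le_lt_trans _ _ (\int[m1]_x (cst (C * fine (m2 setT))%:E x))%E).
  apply: ge0_le_integral => //.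
  - by move=> x _; apply: integral_ge0 => y _.
  - apply: (measurable_fun_fubini_tonelli_F (fun z => `|(f z)%:E|%E)) => //.
    by apply: measurableT_comp => //; exact/measurable_EFinP.
  - move=> x _; rewrite /= EFinM fineK ?fin_num_measure// -integral_cst//.
    apply: ge0_le_integral => //.
    + apply/measurable_EFinP; apply: measurableT_comp => //.
      exact: measurableT_comp mf (pair1_measurable x).
    + by move=> y _ /=; rewrite lee_fin.
rewrite integral_cst//= lte_mul_pinfty// ?lee_fin ?mulr_ge0 ?fine_ge0//.
by rewrite ltey_eq fin_num_measure.
Qed.

Lemma bmeas_pair1 x : bmeas (fun y => f (x, y)).
Proof.
have [mf [C fC]] := bf; split; last by exists C.
exact: measurableT_comp mf (pair1_measurable x).
Qed.

Lemma bmeas_pair2 y : bmeas (fun x => f (x, y)).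
Proof.
have [mf [C fC]] := bf; split; last by exists C.
exact: measurableT_comp mf (pair2_measurable y).
Qed.

Lemma bmeas_fubini_F : bmeas (fun x => \int[m2]_y f (x, y)).
Proof.
split.
  apply: (measurableT_comp (@fine_measurable R setT measurableT)).
  exact: measurable_fubini_F iF.
have [mf [C fC]] := bf; exists (C * fine (m2 setT)) => x.
by apply: bmeas_norm_le => //; exact: bmeas_pair1.
Qed.

Lemma bmeas_fubini_G : bmeas (fun y => \int[m1]_x f (x, y)).
Proof.
split.
  apply: (measurableT_comp (@fine_measurable R setT measurableT)).
  exact: measurable_fubini_G iF.
have [mf [C fC]] := bf; exists (C * fine (m1 setT)) => y.
by apply: bmeas_norm_le => //; exact: bmeas_pair2.
Qed.

Lemma bmeas_fubini :
  \int[m1]_x \int[m2]_y f (x, y) = \int[m2]_y \int[m1]_x f (x, y).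
Proof.
apply: EFin_inj; rewrite !bmeas_RintegralE; [|exact: bmeas_fubini_G|exact: bmeas_fubini_F].
under eq_integral do rewrite (bmeas_RintegralE _ (bmeas_pair1 _)).
under [RHS]eq_integral do rewrite (bmeas_RintegralE _ (bmeas_pair2 _)).
exact: (Fubini iF).
Qed.

Lemma bmeas_product :
  (\int[(m1 \x m2)%E]_z (f z)%:E)%E = (\int[m1]_x \int[m2]_y f (x, y))%:E.
Proof.
rewrite bmeas_RintegralE; last exact: bmeas_fubini_F.
under [RHS]eq_integral do rewrite (bmeas_RintegralE _ (bmeas_pair1 _)).
by rewrite -(integral12_prod_meas1 iF).
Qed.

End bounded_fubini.

(** Turns a locally finite measure, restricted to a relatively compact set, into an object of the
    type of finite measures, to which the results on [bmeas] apply. *)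
Lemma finite_measure_restr d (T : measurableType d) (R : realType)
    (m : {measure set T -> \bar R}) (D : set T) : measurable D -> (m D < +oo)%E ->
  exists m' : {finite_measure set T -> \bar R}, forall A, m' A = m (A `&` D).
Proof.
move=> mD fD; pose mu := mrestr m mD.
have fmu : fin_num_fun mu.
  move=> A mA; rewrite ge0_fin_numE//; apply: le_lt_trans fD.
  by rewrite /mu /mrestr; apply: le_measure; rewrite ?inE//; exact: measurableI.
pose m' := HB.pack_for (FiniteMeasure.type T R) mu (Measure_isFinite.Build _ _ _ mu fmu).
by exists m'.
Qed.

Lemma Rintegral_restr d (T : measurableType d) (R : realType)
    (m m' : {measure set T -> \bar R}) (D E : set T) (f : T -> R) :
  measurable D -> measurable E -> (forall A, m' A = m (A `&` D)) ->
  measurable_fun setT f -> (forall x, E x -> ~ D x -> f x = 0) ->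
  (\int[m']_(x in E) (f x)%:E = \int[m]_(x in E) (f x)%:E)%E.
Proof.
move=> mD mE H mf f0.
have mf' F : measurable_fun F (fun x => (f x)%:E).
  by apply/measurable_EFinP; exact: measurable_funTS.
transitivity (\int[mrestr m mD]_(x in E) (f x)%:E)%E.
  by apply: eq_measure_integral => A mA _; rewrite H.
rewrite integral_mrestr//.
rewrite [LHS]integral_mkcond [RHS]integral_mkcond; apply: eq_integral => x _.
rewrite /patch; have [Ex|Ex] := pselect (E x); last first.
  by rewrite (memNset Ex) memNset// => -[].
have [Dx|Dx] := pselect (D x); first by rewrite !mem_set.
by rewrite memNset ?(mem_set Ex) ?f0// => -[].
Qed.

Lemma exists_pushforward d1 d2 (T1 : measurableType d1) (T2 : measurableType d2) (R : realType)
    (m : {measure set T1 -> \bar R}) (f : T1 -> T2) : measurable_fun setT f ->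
  exists m' : {measure set T2 -> \bar R}, (forall A, m' A = m (f @^-1` A)) /\
    forall g : T2 -> \bar R, measurable_fun setT g -> (forall x, 0 <= g x)%E ->
    (\int[m']_x g x = \int[m]_x g (f x))%E.
Proof.
move=> mf; pose mu (A : set T2) := m (f @^-1` A).
have mu0 : mu set0 = 0%E by rewrite /mu preimage_set0 measure0.
have mu_ge0 A : (0 <= mu A)%E by rewrite /mu measure_ge0.
have mpre A : measurable A -> measurable (f @^-1` A).
  by move=> mA; rewrite -[X in measurable X]setTI; exact: mf.
have muS : semi_sigma_additive mu.
  move=> F mF tF mUF; rewrite /mu preimage_bigcup.
  apply: measure_semi_sigma_additive => [k||]; first exact: mpre.
  - apply/trivIsetP => i j _ _ ij; rewrite -preimage_setI.
    by move/trivIsetP : tF => ->//; rewrite preimage_set0.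
  - by rewrite -preimage_bigcup; exact: mpre.
pose m' : {measure set T2 -> \bar R} := HB.pack mu (isMeasure.Build _ _ _ mu mu0 mu_ge0 muS).
exists m'; split => // g mg g0.
transitivity (\int[pushforward m f]_x g x)%E; first by apply: eq_measure_integral.
by rewrite ge0_integral_pushforward.
Qed.

Lemma integral_restr d (T : measurableType d) (R : realType)
    (m m' : {measure set T -> \bar R}) (D : set T) (f : T -> \bar R) :
  measurable D -> (forall A, m' A = m (A `&` D)) -> measurable_fun setT f ->
  (\int[m']_x f x = \int[m]_(x in D) f x)%E.
Proof.
move=> mD H mf; transitivity (\int[mrestr m mD]_x f x)%E.
  by apply: eq_measure_integral => A mA _; rewrite H.
by rewrite integral_mrestr// setTI.
Qed.

Lemma integral_support d (T : measurableType d) (R : realType)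
    (m : {measure set T -> \bar R}) (D E : set T) (f : T -> \bar R) :
  D `<=` E -> (forall x, E x -> ~ D x -> f x = 0%E) ->
  (\int[m]_(x in D) f x = \int[m]_(x in E) f x)%E.
Proof.
move=> DE f0; rewrite [LHS]integral_mkcond [RHS]integral_mkcond.
apply: eq_integral => x _; rewrite /patch.
have [Dx|Dx] := pselect (D x); first by rewrite !mem_set//; exact: DE.
rewrite (memNset Dx); have [Ex|Ex] := pselect (E x); last by rewrite memNset.
by rewrite mem_set// f0.
Qed.

Section unit_interval.
Variable R : realType.

Let f01 : (@lebesgue_measure R (`[0%R, 1%R]%classic : set R) < +oo)%E.
Proof. by rewrite lebesgue_measure_itv/= lte_fin ltr01 -EFinB ltry. Qed.

(** Lebesgue measure on [[0, 1]] as a finite measure on the whole line; it carries the parameter of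
    the segment along which functions are translated. *)
Definition unit_measure : {finite_measure set (measurableTypeR R) -> \bar R} :=
  sval (cid (finite_measure_restr (measurable_itv `[0%R, 1%R] : measurable (_ : set (measurableTypeR R))) f01)).

Lemma unit_measureE A : unit_measure A = lebesgue_measure (A `&` `[0, 1]%classic).
Proof. by rewrite /unit_measure; case: cid. Qed.

Lemma unit_measureT : unit_measure setT = 1%E.
Proof.
by rewrite unit_measureE setTI lebesgue_measure_itv/= lte_fin ltr01 sube0.
Qed.

Lemma unit_Rintegral (f : R -> R) : measurable_fun setT f ->
  \int[unit_measure]_s f s = \int[lebesgue_measure]_(s in `[0, 1]) f s.
Proof.
move=> mf; congr fine; apply: integral_restr => //.
  exact: unit_measureE.
exact/measurable_EFinP.
Qed.

Lemma eq_unit_Rintegral (f g : R -> R) : measurable_fun setT f -> measurable_fun setT g ->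
  (forall s, 0 <= s <= 1 -> f s = g s) ->
  \int[unit_measure]_s f s = \int[unit_measure]_s g s.
Proof.
move=> mf mg fg; rewrite !unit_Rintegral//; apply: eq_Rintegral => s.
by rewrite inE/= in_itv/=; exact: fg.
Qed.

End unit_interval.

(** * The gradient identity integrated along a translation *)

Section shift_identity.
Variables (R : realType) (n : nat).
Local Notation V := 'rV[R]_n.
Local Notation B := (borelRn R n).
Local Notation leb := (lebesgue_rV R n).
Local Notation e_ k := (delta_mx ord0 k : V).
Local Notation lam := (unit_measure R).

Lemma continuous_along (f : V -> R) (x v : V) : continuous f ->
  continuous (fun s : R => f (x + s *: v)).
Proof.
move=> cf s; apply: (@continuous_comp _ _ _ (fun s : R => x + s *: v) f); last exact: cf.
apply: cvgD; first exact: cvg_cst.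
by apply: cvgZl; exact: cvg_id.
Qed.

Lemma shift_ftc (O : set V) (f : V -> R) (k : 'I_n) (u : R) (x : V) : test_function O f ->
  f (x - u *: e_ k) - f x =
  - u * \int[lam]_s partial k f (x - (s * u) *: e_ k).
Proof.
move=> tf; have tdf := test_function_partial k tf.
have cdf := test_function_continuous tdf; have sf := tf.1.
pose v : V := - u *: e_ k.
have lineE s : x - (s * u) *: e_ k = x + s *: v.
  by rewrite /v scalerA -scaleNr mulrN.
pose F (s : R) : R := f (x + s *: v).
have dF s : is_derive s (1 : R) F (- u * partial k f (x + s *: v)).
  have d1 : is_derive (s * - u) (1 : R) (fun a => f (x + a *: e_ k)) (partial k f (x + s *: v)).
    rewrite (_ : x + s *: v = x + (s * - u) *: e_ k); last by rewrite /v scalerA.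
    by apply/is_derive_line; apply: DeriveDef => //; exact: (sf [::]).2.
  have d2 : is_derive s (1 : R) (fun a : R => a * - u) (- u).
    apply: (is_derive_eq (is_deriveM (is_derive_id s (1 : R)) (is_derive_cst (- u) s (1 : R)))).
    by rewrite scaler0 add0r [_ *: 1]mulr1.
  have := @is_derive1_comp _ (fun a => f (x + a *: e_ k)) (fun a : R => a * - u) s _ _ d1 d2.
  rewrite mulrC; congr is_derive; apply/funext => a; rewrite /F /v /=.
  by rewrite scalerA.
have cF' : continuous (fun s : R => - u * partial k f (x + s *: v)).
  move=> s; apply: cvgM; first exact: cvg_cst.
  exact: continuous_along.
have mdf : measurable_fun setT (fun s : R => partial k f (x + s *: v)).
  by apply: continuous_measurable_fun; exact: continuous_along.
have mdf' : measurable_fun setT (fun s : R => partial k f (x - (s * u) *: e_ k)).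
  by under eq_fun do rewrite lineE.
have cF : continuous F.
  by move=> s; apply/differentiable_continuous/derivable1_diffP; case: (dF s).
have ftc : (\int[lebesgue_measure]_(s in `[0%R, 1%R]) (- u * partial k f (x + s *: v))%:E =
    (F 1)%:E - (F 0)%:E)%E.
  apply: continuous_FTC2 => //.
  - exact: continuous_subspaceT.
  - split.
    + by move=> s _; case: (dF s).
    + by apply: cvg_at_right_filter; exact: cF.
    + by apply: cvg_at_left_filter; exact: cF.
  - by move=> s _; rewrite derive1E; case: (dF s).
have -> : f (x - u *: e_ k) - f x = F 1 - F 0.
  by rewrite /F scale1r scale0r addr0 /v scaleNr.
have [C C0 dC] := test_function_bounded tdf.
rewrite -bmeas_RintegralZl; last by split => //; exists C.
apply: EFin_inj; rewrite EFinB -ftc /Rintegral.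
rewrite (_ : \int[lam]_x _ = \int[lebesgue_measure]_(s in `[0%R, 1%R]) (- u * partial k f (x + s *: v))%:E)%E; first by rewrite ftc.
under [LHS]eq_integral do rewrite lineE.
apply: integral_restr => //; first exact: unit_measureE.
by apply/measurable_EFinP; exact: measurable_funM.
Qed.

(** Pushing [lam \x m] forward along this map spreads [m] over the segment from 0 to [- u e_k]. *)
Definition sweep (k : 'I_n) (u : R) (p : measurableTypeR R * B) : B :=
  p.2 - (p.1 * u) *: e_ k.

Lemma measurable_sweep k u : measurable_fun setT (sweep k u).
Proof.
apply: measurable_fun_borelRn => i.
apply: (eq_measurable_fun (fun p : measurableTypeR R * B =>
   (p.2 : V) ord0 i - (p.1 * (u * (i == k)%:R)))).
  by move=> p _; rewrite !mxE eqxx/= mulrA.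
apply: measurable_funB.
  exact: measurableT_comp (@measurable_coord R n i) measurable_snd.
by apply: measurable_funM => //; exact: measurable_fst.
Qed.

Variables (O : set V) (E : set B) (P M : {measure set B -> \bar R}) (k : 'I_n) (u : R).
Variables (U W : set V).
Variables (PV MV EV : {finite_measure set B -> \bar R}).
Hypotheses (u0 : 0 <= u) (oO : open O) (mE : measurable E).
Hypotheses (oU : open U) (oW : open W) (WO : W `<=` O).
Hypothesis UW : forall x s, U x -> 0 <= s <= 1 -> W (x + (s * u) *: e_ k).
Hypothesis PVE : forall A, PV A = P (A `&` W).
Hypothesis MVE : forall A, MV A = M (A `&` W).
Hypothesis EVE : forall A, EV A = leb (A `&` (E `&` W)).
Hypothesis grad_k : forall f, test_function O f ->
  (\int[leb]_(x in E) (partial k f x)%:E =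
   - (\int[P]_(x in (O : set B)) (f x)%:E - \int[M]_(x in (O : set B)) (f x)%:E))%E.

Let mW : measurable (W : set B). Proof. exact: open_measurable_rV. Qed.
Let mO : measurable (O : set B). Proof. exact: open_measurable_rV. Qed.

Let sub_sweep f s x : (forall y, ~ U y -> f y = 0 :> R) -> 0 <= s <= 1 ->
  ~ W x -> f (x - (s * u) *: e_ k) = 0.
Proof.
move=> f0 s01 Wx; apply: f0 => Ux; apply: Wx.
by have := UW Ux s01; rewrite subrK.
Qed.

Lemma bmeas_continuous (f : V -> R) : continuous f -> (exists C, forall x, `|f x| <= C) ->
  bmeas (f : B -> R).
Proof. by move=> cf bf; split => //; exact: continuous_measurable_rV. Qed.

Lemma bmeas_test (Q : set V) f : test_function Q f -> bmeas (f : B -> R).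
Proof.
move=> tf; apply: bmeas_continuous; first exact: test_function_continuous tf.
by have [C _ H] := test_function_bounded tf; exists C.
Qed.

Lemma bmeas_sweep (f : B -> R) : bmeas f -> bmeas (f \o sweep k u).
Proof.
move=> [mf [C fC]]; split; last by exists C => p; exact: fC.
exact: measurableT_comp mf (measurable_sweep k u).
Qed.

Lemma bmeas_swap (f : measurableTypeR R * B -> R) : bmeas f ->
  bmeas (fun p : B * measurableTypeR R => f (p.2, p.1)).
Proof.
move=> [mf [C fC]]; split; last by exists C.
apply: (measurableT_comp mf); apply/measurable_fun_pairP; split => //=.
  exact: measurable_snd.
exact: measurable_fst.
Qed.

(** The gradient identity for the translates [f (x - (s * u) e_k)], averaged over [s]; by
    [shift_ftc] the averaged partial derivative is a difference of values of [f]. The translates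
    stay supported in [W], so the locally finite measures may be replaced by their finite
    restrictions and Fubini applies. The terms with [MV] are moved to the left so that both sides
    are positive measures, and uniqueness then extends the identity from test functions to Borel
    sets. *)
Lemma smooth_sweep_identity f : test_function U f ->
  \int[EV]_x f (x - u *: e_ k) +
    u * \int[lam]_s \int[MV]_x f (sweep k u (s, x)) =
  \int[EV]_x f x + u * \int[lam]_s \int[PV]_x f (sweep k u (s, x)).
Proof.
move=> tf; have tdf := test_function_partial k tf.
have bf := bmeas_test tf; have bdf := bmeas_test tdf.
have f0 x : ~ U x -> f x = 0 by exact: test_function_out.
have df0 x : ~ U x -> partial k f x = 0 by exact: test_function_out.
have bs := bmeas_sweep bf; have bds := bmeas_sweep bdf.
have bfu : bmeas (fun x : B => f (x - u *: e_ k)).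
  have := bmeas_pair1 bs 1; congr bmeas; apply/funext => x.
  by rewrite /sweep/= mul1r.
have H s : 0 <= s <= 1 -> \int[EV]_x partial k f (sweep k u (s, x)) =
    - (\int[PV]_x f (sweep k u (s, x)) - \int[MV]_x f (sweep k u (s, x))).
  move=> s01; pose fs x := f (x - (s * u) *: e_ k).
  have tfs : test_function O fs.
    apply: (@test_function_shift _ _ U) => // x Ux; apply: WO.
    by rewrite opprK; exact: UW.
  have dfs x : partial k fs x = partial k f (sweep k u (s, x)).
    have := derive_translate f x (- ((s * u) *: e_ k)) (e_ k).
    by [].
  have cfs : measurable_fun setT (fs : B -> R).
    exact: continuous_measurable_rV (test_function_continuous tfs).
  have cdfs : measurable_fun setT (partial k fs : B -> R).
    exact: continuous_measurable_rV (test_function_continuous (test_function_partial k tfs)).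
  have fs0 x : ~ W x -> fs x = 0 by exact: sub_sweep.
  have mEW : measurable (E `&` W) by exact: measurableI.
  have E1 : (\int[EV]_x (partial k fs x)%:E = \int[leb]_(x in E) (partial k fs x)%:E)%E.
    rewrite (integral_restr mEW EVE); last exact/measurable_EFinP.
    apply: integral_support => x Ex; first by case: Ex.
    move=> EWx; rewrite dfs /sweep/= sub_sweep// => Wx; exact: EWx.
  have E2 (m : {measure set B -> \bar R}) (m' : {finite_measure set B -> \bar R}) :
      (forall A, m' A = m (A `&` W)) ->
      (\int[m']_x (fs x)%:E = \int[m]_(x in (O : set B)) (fs x)%:E)%E.
    move=> mm'; rewrite (integral_restr mW mm'); last exact/measurable_EFinP.
    by apply: integral_support => // x _ Wx; rewrite fs0.
  have bfs := bmeas_pair1 bs s; have bdfs := bmeas_pair1 bds s.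
  apply: EFin_inj; rewrite EFinN EFinB !bmeas_RintegralE//.
  rewrite -(_ : (\int[EV]_x (partial k fs x)%:E = \int[EV]_x (partial k f (sweep k u (s, x)))%:E)%E); last first.
    by apply: eq_integral => x _; rewrite dfs.
  by rewrite E1 (grad_k tfs) -(E2 _ _ PVE) -(E2 _ _ MVE).
have bP := bmeas_fubini_F lam PV bs; have bM := bmeas_fubini_F lam MV bs.
have bEd := bmeas_fubini_F lam EV bds.
suff : \int[EV]_x f (x - u *: e_ k) - \int[EV]_x f x =
    u * (\int[lam]_s \int[PV]_x f (sweep k u (s, x)) -
         \int[lam]_s \int[MV]_x f (sweep k u (s, x))) by lra.
rewrite -bmeas_RintegralB//.
under eq_Rintegral do rewrite (shift_ftc k u _ tf).
have bsw := bmeas_swap bds.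
rewrite bmeas_RintegralZl; last exact: (bmeas_fubini_F EV lam bsw).
rewrite (bmeas_fubini EV lam bsw)/= mulNr -mulrN; congr (_ * _).
rewrite -bmeas_RintegralB// -mulN1r -bmeas_RintegralZl; last first.
  exact: (bmeas_fubini_G EV lam bsw).
apply: eq_unit_Rintegral.
- by case: (bmeasM (bmeas_cst _ (-1)) (bmeas_fubini_G EV lam bsw)).
- by case: (bmeasB bP bM).
- by move=> s s01; rewrite [X in -1 * X](H s s01) mulN1r opprK.
Qed.

Lemma bmeas_shift (f : B -> R) : bmeas f -> bmeas (fun x : B => f ((x : V) - u *: e_ k)).
Proof.
move=> bf; have := bmeas_pair1 (bmeas_sweep bf) 1; congr bmeas; apply/funext => x.
by rewrite /sweep/= mul1r.
Qed.

Let sweep_measures : exists m1 m2 : {measure set B -> \bar R},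
  [/\ forall C, (m1 C = EV [set x : V | C (x - u *: e_ k)%R] + u%:E * (lam \x MV) (sweep k u @^-1` C))%E,
    forall C, (m2 C = EV C + u%:E * (lam \x PV) (sweep k u @^-1` C))%E &
    forall f : B -> R, bmeas f -> (forall x, 0 <= f x) -> (forall x, ~ U x -> f x = 0) ->
      (\int[m1]_(x in (U : set B)) (f x)%:E = (\int[EV]_x f (x - u *: e_ k) +
        u * \int[lam]_s \int[MV]_x f (sweep k u (s, x)))%:E)%E /\
      (\int[m2]_(x in (U : set B)) (f x)%:E = (\int[EV]_x f x +
        u * \int[lam]_s \int[PV]_x f (sweep k u (s, x)))%:E)%E].
Proof.
pose q := NngNum u0.
have [qM [qME qMI]] := exists_pushforward (lam \x MV)%E (measurable_sweep k u).
have [qP [qPE qPI]] := exists_pushforward (lam \x PV)%E (measurable_sweep k u).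
have [pE [pEE pEI]] := exists_pushforward EV (measurable_addr (- (u *: e_ k))).
pose m1 : {measure set B -> \bar R} := measure_add pE (mscale q qM).
pose m2 : {measure set B -> \bar R} := measure_add EV (mscale q qP).
have E1 C : (m1 C = EV [set x : V | C (x - u *: e_ k)%R] + u%:E * (lam \x MV) (sweep k u @^-1` C))%E.
  by apply: (etrans (measure_addE pE (mscale q qM) C)); rewrite pEE; congr (_ + _ * _)%E; exact: qME.
have E2 C : (m2 C = EV C + u%:E * (lam \x PV) (sweep k u @^-1` C))%E.
  by apply: (etrans (measure_addE EV (mscale q qP) C)); congr (_ + _ * _)%E; exact: qPE.
exists m1, m2; split => //.
move=> f bf fge0 fU.
have bs := bmeas_sweep bf; have bfu := bmeas_shift bf.
have mf : measurable_fun setT (fun x : B => (f x)%:E).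
  by apply/measurable_EFinP; case: bf.
have f0 x : (0 <= (f x)%:E)%E by rewrite lee_fin.
have toT (m : {measure set B -> \bar R}) :
    (\int[m]_(x in (U : set B)) (f x)%:E = \int[m]_x (f x)%:E)%E.
  by apply: integral_support => // x _ Ux; rewrite fU.
have push (m : {finite_measure set B -> \bar R}) (qm : {measure set B -> \bar R}) :
    (forall g : B -> \bar R, measurable_fun setT g -> (forall x, 0 <= g x)%E ->
    (\int[qm]_x g x = \int[(lam \x m)%E]_p g (sweep k u p))%E) ->
    (\int[mscale q qm]_x (f x)%:E =
     (u * \int[lam]_s \int[m]_x f (sweep k u (s, x)))%:E)%E.
  move=> H; rewrite ge0_integral_mscale//= H//.
  by rewrite EFinM -(bmeas_product lam m bs).
rewrite !toT !ge0_integral_measure_add// (push _ _ qMI) (push _ _ qPI) pEI//.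
by rewrite -(bmeas_RintegralE EV bfu) -(bmeas_RintegralE EV bf) -!EFinD.
Qed.

Lemma sweep_identity (A : set B) : measurable A -> A `<=` U ->
  (EV [set x : V | A (x - u *: e_ k)%R] + u%:E * (lam \x MV) (sweep k u @^-1` A) =
   EV A + u%:E * (lam \x PV) (sweep k u @^-1` A))%E.
Proof.
move=> mA AU; have [m1 [m2 [E1 E2 I12]]] := sweep_measures.
rewrite -E1 -E2.
have fin (m : {finite_measure set B -> \bar R}) : ((lam \x m) setT < +oo)%E.
  rewrite -setXTT product_measure1E// lte_mul_pinfty// ?fin_num_measure//.
  by rewrite ltey_eq fin_num_measure.
have mswU : measurable (sweep k u @^-1` (U : set B)).
  by apply: measurable_setT_preimage; [exact: measurable_sweep|exact: open_measurable_rV].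
have finU (m : {finite_measure set B -> \bar R}) :
    (u%:E * (lam \x m) (sweep k u @^-1` (U : set B)) < +oo)%E.
  rewrite lte_mul_pinfty ?lee_fin//; apply: le_lt_trans (fin m).
  by apply: le_measure; rewrite ?inE.
apply: (@measure_eq_test R n U m1 m2) => //.
- rewrite [ltLHS]E1 lte_add_pinfty// ltey_eq fin_num_measure//.
  by apply: measurable_shift; exact: open_measurable_rV.
- rewrite [ltLHS]E2 lte_add_pinfty// ltey_eq fin_num_measure//.
  exact: open_measurable_rV.
move=> f tf f01.
have [|x Ux|-> ->] := I12 f (bmeas_test tf); first by move=> x; case/andP: (f01 x).
  exact: test_function_out tf Ux.
by rewrite (smooth_sweep_identity tf).
Qed.

Lemma sweep_identity_fun (g : B -> R) : bmeas g -> (forall x, ~ U x -> g x = 0) ->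
  \int[EV]_x g (x - u *: e_ k) +
    u * \int[lam]_s \int[MV]_x g (sweep k u (s, x)) =
  \int[EV]_x g x + u * \int[lam]_s \int[PV]_x g (sweep k u (s, x)).
Proof.
move=> bg gU.
have pos (f : B -> R) : bmeas f -> (forall x, 0 <= f x) -> (forall x, ~ U x -> f x = 0) ->
  \int[EV]_x f (x - u *: e_ k) +
    u * \int[lam]_s \int[MV]_x f (sweep k u (s, x)) =
  \int[EV]_x f x + u * \int[lam]_s \int[PV]_x f (sweep k u (s, x)).
  move=> bf f0 fU; have [m1 [m2 [E1 E2 I12]]] := sweep_measures.
  have [I1 I2] := I12 f bf f0 fU; apply: EFin_inj; rewrite -I1 -I2.
  by apply: eq_measure_integral => A mA AU; rewrite E1 E2 sweep_identity.
have [mg [C gC]] := bg.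
have mU : measurable (U : set B) by exact: open_measurable_rV.
(* Adding this function makes [g] nonnegative while still vanishing off [U]; the identity is
   linear. *)
pose c : B -> R := fun x => C * \1_(U : set B) x.
have bc : bmeas c by apply: bmeasM; [exact: bmeas_cst|exact: bmeas_indic].
have bgc : bmeas (fun x => g x + c x) by exact: bmeasD.
have C0 : 0 <= C by rewrite (le_trans _ (gC 0)).
have cU x : ~ U x -> c x = 0 by move=> Ux; rewrite /c indicE memNset// mulr0.
have c0 x : 0 <= c x by rewrite /c mulr_ge0// indicE.
have h1 := pos _ bc c0 cU.
have gc0 x : 0 <= g x + c x.
  have [Ux|Ux] := pselect (U x); last by rewrite gU// cU// addr0.
  rewrite /c indicE mem_set// mulr1 -lerBlDr sub0r.
  by have := gC x; rewrite ler_norml => /andP[].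
have h2 := pos _ bgc gc0 (fun x Ux => etrans (congr2 +%R (gU x Ux) (cU x Ux)) (addr0 _)).
have dbl (m : {finite_measure set B -> \bar R}) :
    \int[lam]_s \int[m]_x (g (sweep k u (s, x)) + c (sweep k u (s, x))) =
    \int[lam]_s \int[m]_x g (sweep k u (s, x)) + \int[lam]_s \int[m]_x c (sweep k u (s, x)).
  rewrite -bmeas_RintegralD; last 2 first.
  - exact: (bmeas_fubini_F lam m (bmeas_sweep bg)).
  - exact: (bmeas_fubini_F lam m (bmeas_sweep bc)).
  apply: eq_Rintegral => s _; rewrite bmeas_RintegralD//.
  - exact: (bmeas_pair1 (bmeas_sweep bg) s).
  - exact: (bmeas_pair1 (bmeas_sweep bc) s).
move: h2; rewrite !dbl !bmeas_RintegralD//; [|exact: bmeas_shift..].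
by move: h1; lra.
Qed.

End shift_identity.

(** * Gradients as differences of positive measures: uniqueness and locality *)

Section gradients.
Variables (R : realType) (n : nat).
Local Notation V := 'rV[R]_n.
Local Notation B := (borelRn R n).
Local Notation leb := (lebesgue_rV R n).
Local Notation e_ k := (delta_mx ord0 k : V).
Local Notation lam := (unit_measure R).
Local Notation meas := {measure set B -> \bar R}.

Lemma integral_translate (v : V) (g : B -> \bar R) : measurable_fun setT g ->
  (\int[leb]_x g ((x : V) + v)%R = \int[leb]_x g x)%E.
Proof.
have [m [mE mI]] := exists_pushforward leb (measurable_addr v).
have ge0 (f : B -> \bar R) : measurable_fun setT f -> (forall x, 0 <= f x)%E ->
    (\int[leb]_x f ((x : V) + v)%R = \int[leb]_x f x)%E.
  move=> mf f0; rewrite -mI//; apply: eq_measure_integral => A mA _.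
  by rewrite mE; exact: lebesgue_translate.
move=> mg; rewrite [LHS]integralE [RHS]integralE.
have hp := ge0 (g^\+)%E (measurable_funepos mg) (fun x => funepos_ge0 g x).
have hn := ge0 (g^\-)%E (measurable_funeneg mg) (fun x => funeneg_ge0 g x).
rewrite -hp -hn.
by congr (_ - _)%E; apply: eq_integral => x _; rewrite !(funeposE, funenegE).
Qed.

(** The integral of [f] does not change under the translation by [e_k], and the difference of [f]
    and its translate is an average of translates of [partial k f]. The thickness 2 of [D] leaves
    room for translations of length at most 1. *)
Lemma integral_partial0 (O : set V) (f : V -> R) k : test_function O f ->
  (\int[leb]_x (partial k f x)%:E = 0)%E.
Proof.
move=> tf; have tdf := test_function_partial k tf.
have [K cK [_ fK]] := test_function_support tf.
have [K' cK' [_ dfK]] := test_function_support tdf.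
pose D := thicken K 2 `|` thicken K' 2.
have oD : open D by apply: openU; exact: open_thicken.
have mD : measurable (D : set B) by exact: open_measurable_rV.
have fD : (leb D < +oo)%E.
  have mT (K0 : set V) : measurable (thicken K0 2 : set B).
    by apply: open_measurable_rV; exact: open_thicken.
  apply: (le_lt_trans (measureU2 leb (mT K) (mT K'))).
  by apply: lte_add_pinfty; exact: lebesgue_thicken.
have [ev evE] := finite_measure_restr mD fD.
have bf := bmeas_test tf; have bdf := bmeas_test tdf.
have bds := bmeas_sweep k 1 bdf.
have out (K0 : set V) (g : V -> R) (s : R) (x : V) : (forall x, ~ K0 x -> g x = 0) -> 0 <= s <= 1 ->
    ~ thicken K0 2 x -> g (x - s *: e_ k) = 0.
  move=> g0 /andP[s0 s1] nx; apply: g0 => Kx; apply: nx; exists (x - s *: e_ k) => //.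
  rewrite -ball_normE/= addrAC subrr add0r normrN.
  apply: le_lt_trans (norm_delta_mx k s) _; rewrite ger0_norm//; lra.
have toD (K0 : set V) (g : V -> R) (s : R) : (forall x, ~ K0 x -> g x = 0) -> 0 <= s <= 1 ->
    thicken K0 2 `<=` D -> bmeas (g : B -> R) ->
    (\int[ev]_x (g (x - s *: e_ k))%:E = \int[leb]_x (g x)%:E)%E.
  move=> g0 s01 KD [mg _].
  have mgs : measurable_fun setT (fun x : B => (g ((x : V) + - (s *: e_ k)))%:E).
    apply/measurable_EFinP.
    exact: (measurableT_comp mg (measurable_addr (- (s *: e_ k)))).
  rewrite (integral_restr mD evE)//.
  rewrite (@integral_support _ _ _ _ _ setT)//.
    by apply: (integral_translate (- (s *: e_ k)) (g := fun x => (g x)%:E)); exact/measurable_EFinP.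
  by move=> x _ Dx; rewrite (out K0 g)// => /KD.
have H : \int[ev]_x (f (x - 1 *: e_ k) - f x) = 0.
  have bf1 : bmeas (fun x : B => f (x - 1 *: e_ k)).
    have := bmeas_pair1 (bmeas_sweep k 1 bf) 1; congr bmeas; apply/funext => x.
    by rewrite /sweep/= mul1r.
  rewrite bmeas_RintegralB//; apply/eqP; rewrite subr_eq0; apply/eqP.
  apply: EFin_inj; rewrite !bmeas_RintegralE//.
  rewrite (toD K)//; last by move=> x Kx; left.
    rewrite -(toD K f 0)//; [|by rewrite lexx ler01|by move=> x Kx; left].
    by apply: eq_integral => x _; rewrite scale0r subr0.
  by rewrite lexx ler01.
have {}H : \int[ev]_x (- 1 * \int[lam]_s partial k f (x - (s * 1) *: e_ k)) = 0.
  by rewrite -[RHS]H; apply: eq_Rintegral => x _; rewrite (shift_ftc k 1 _ tf).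
have bsw := bmeas_swap bds.
rewrite bmeas_RintegralZl in H; last exact: (bmeas_fubini_F ev lam bsw).
rewrite (bmeas_fubini ev lam bsw)/= in H.
pose c := fine (\int[leb]_x (partial k f x)%:E)%E.
have ic : leb.-integrable setT (EFin \o partial k f).
  exact: test_function_lebesgue_integrable tdf.
have cE : (c%:E = \int[leb]_x (partial k f x)%:E)%E.
  by rewrite fineK//; exact: integrable_fin_num.
have : \int[lam]_s \int[ev]_x partial k f (x - (s * 1) *: e_ k) = \int[lam]_s (fun=> c) s.
  apply: eq_unit_Rintegral.
  - by case: (bmeas_fubini_G ev lam bsw).
  - exact: measurable_cst.
  - move=> s s01; apply: EFin_inj; rewrite bmeas_RintegralE; last exact: (bmeas_pair1 bds s).
    by rewrite cE mulr1 (toD K')// => x Kx; right.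
rewrite Rintegral_cst//= => E; rewrite -cE; congr EFin.
move: H; rewrite -[X in _ * X]/(\int[lam]_s \int[ev]_x partial k f (x - (s * 1) *: e_ k)) E.
by rewrite [X in fine X](unit_measureT R) mulr1 mulN1r => /eqP; rewrite oppr_eq0 => /eqP.
Qed.

(** [is_gradient_measure] with the decomposition exhibited: a cut acts on the two positive measures
    separately, and may charge only one of them. *)
Definition grad (O : set V) (W : set B) (P M : 'I_n -> meas) :=
  (forall i, locally_finite O (P i) /\ locally_finite O (M i)) /\
  forall i f, test_function O f ->
    (\int[leb]_(x in W) (partial i f x)%:E =
     - (\int[P i]_(x in (O : set B)) (f x)%:E - \int[M i]_(x in (O : set B)) (f x)%:E))%E.

Definition gradm (P M : 'I_n -> meas) (A : set V) : V :=
  \row_i (fine (P i A) - fine (M i A)).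

Lemma grad_is_gradient O W P M : grad O W P M -> is_gradient_measure O W (gradm P M).
Proof. by move=> [lf H]; exists P, M. Qed.

Lemma is_gradient_grad O W D : is_gradient_measure O W D ->
  exists P M, grad O W P M /\
    forall A : set B, measurable A -> rel_compact_in O A -> D A = gradm P M A.
Proof. by move=> [P [M [lf DE H]]]; exists P, M. Qed.

Lemma rc_finite (O : set V) (m : meas) (A : set B) : locally_finite O m -> measurable A ->
  rel_compact_in O A -> (m A < +oo)%E.
Proof.
move=> fm mA [cA AO]; apply: le_lt_trans (fm _ cA AO).
apply: le_measure; rewrite ?inE//; last exact: subset_closure.
exact: compact_measurable_rV.
Qed.

Lemma rc_fin_num (O : set V) (m : meas) (A : set B) : locally_finite O m -> measurable A ->
  rel_compact_in O A -> m A \is a fin_num.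
Proof. by move=> fm mA rA; rewrite ge0_fin_numE//; exact: rc_finite rA. Qed.

Lemma rel_compact_open (O : set V) (A : set V) : open O -> rel_compact_in O A ->
  exists2 T, open T & A `<=` T /\ rel_compact_in O T.
Proof.
move=> oO [cA AO]; have [d d0 dO] := compact_thicken cA oO AO.
have d20 : 0 < d / 2 by rewrite divr_gt0.
exists (thicken (closure A) (d / 2)); first exact: open_thicken.
split; first by move=> x Ax; apply: sub_thicken => //; exact: subset_closure.
by apply: rel_compact_thicken => //; rewrite (_ : d / 2 + d / 2 = d)//; lra.
Qed.

Lemma integral_partial_ae_eq (O U : set V) (W W' : set B) f i :
  open U -> measurable W -> measurable W' ->
  leb (((W `\` W') `|` (W' `\` W)) `&` U) = 0%E -> test_function U f ->
  (\int[leb]_(x in W) (partial i f x)%:E = \int[leb]_(x in W') (partial i f x)%:E)%E.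
Proof.
move=> oU mW mW' W0 tf; have tdf := test_function_partial i tf.
rewrite [LHS]integral_mkcond [RHS]integral_mkcond.
have mf : measurable_fun setT (fun x : B => (partial i f x)%:E).
  by apply/measurable_EFinP; case: (bmeas_test tdf).
apply: ae_eq_integral => //.
- by apply/(measurable_restrictT _ _).1 => //; exact: measurable_funTS.
- by apply/(measurable_restrictT _ _).1 => //; exact: measurable_funTS.
exists (((W `\` W') `|` (W' `\` W)) `&` U); split => //.
  apply: measurableI; last exact: open_measurable_rV.
  by apply: measurableU; exact: measurableD.
move=> x /= /not_implyP[_]; rewrite /patch => H.
have Ux : U x.
  by apply: contrapT => Ux; apply: H; rewrite (test_function_out tdf Ux); case: ifP; case: ifP.
split => //; have [Wx|Wx] := pselect (W x); have [W'x|W'x] := pselect (W' x).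
- by exfalso; apply: H; rewrite !mem_set.
- by left.
- by right.
- by exfalso; apply: H; rewrite !memNset.
Qed.

(** Test functions supported in [U] do not see the sets outside [U], nor null sets. This gives at
    once the independence of the decomposition and the locality of the gradient. *)
Lemma grad_unique (O U : set V) (W W' : set B) P M P' M' :
  open O -> open U -> U `<=` O -> measurable W -> measurable W' ->
  grad O W P M -> grad O W' P' M' ->
  leb (((W `\` W') `|` (W' `\` W)) `&` U) = 0%E ->
  forall A : set B, measurable A -> A `<=` U -> rel_compact_in O A ->
  gradm P M A = gradm P' M' A.
Proof.
move=> oO oU UO mW mW' [lf H] [lf' H'] WW' A mA AU rA; apply/rowP => i; rewrite !mxE.
have [T oT [AT rT]] := rel_compact_open oO rA.
have oQ : open (T `&` U) by exact: openI.
have QO : T `&` U `<=` O by move=> x [_ /UO].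
have mQ : measurable (T `&` U : set B) by exact: open_measurable_rV.
have rQ : rel_compact_in O (T `&` U) by apply: rel_compact_in_sub rT => x [].
have [[fP fM] [fP' fM']] := (lf i, lf' i).
(* The decompositions are not unique, so the terms are regrouped into sums of positive measures
   before the uniqueness theorem is applied. *)
suff E : (measure_add (P i) (M' i) A = measure_add (P' i) (M i) A)%E.
  move: E; rewrite !measure_addE.
  rewrite -(fineK (rc_fin_num fP mA rA)) -(fineK (rc_fin_num fM mA rA)).
  rewrite -(fineK (rc_fin_num fP' mA rA)) -(fineK (rc_fin_num fM' mA rA)).
  by rewrite -!EFinD => -[]/=; lra.
apply: (@measure_eq_test R n (T `&` U) (measure_add (P i) (M' i)) (measure_add (P' i) (M i))) => //.
- by rewrite [ltLHS]measure_addE lte_add_pinfty//; exact: rc_finite rQ.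
- by rewrite [ltLHS]measure_addE lte_add_pinfty//; exact: rc_finite rQ.
- move=> f tf f01.
  have tfO := test_function_sub QO tf.
  have tfU : test_function U f by apply: test_function_sub tf => x [].
  have := integral_partial_ae_eq O i oU mW mW' WW' tfU.
  rewrite (H _ _ tfO) (H' _ _ tfO).
  rewrite !(integral_test_function_sub _ oO oQ QO tf).
  have mf : measurable_fun (T `&` U : set B) (fun x => (f x)%:E).
    by apply/measurable_EFinP; apply: measurable_funTS; case: (bmeas_test tf).
  rewrite !ge0_integral_measure_add//; try by move=> x _; rewrite lee_fin; case/andP: (f01 x).
  have fin (m : meas) : locally_finite O m -> (\int[m]_(x in (T `&` U : set B)) (f x)%:E)%E \is a fin_num.
    move=> fm; rewrite -(integral_test_function_sub _ oO oQ QO tf).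
    by apply: integrable_fin_num; [exact: open_measurable_rV|exact: test_function_integrable].
  rewrite -(fineK (fin _ fP)) -(fineK (fin _ fM)) -(fineK (fin _ fP')) -(fineK (fin _ fM')).
  by rewrite -!EFinB -!EFinN -!EFinD => -[]/= E; congr EFin; lra.
- by move=> x Ax; split; [exact: AT|exact: AU].
Qed.

Lemma integral_partial_open0 (O : set V) f k : measurable (O : set B) -> test_function O f ->
  (\int[leb]_(x in (O : set B)) (partial k f x)%:E = 0)%E.
Proof.
move=> mO tf; rewrite -(integral_partial0 k tf).
apply: integral_support => // x _ Ox.
by rewrite (test_function_out (test_function_partial k tf) Ox).
Qed.

Lemma locally_finite_mzero (O : set V) : locally_finite O (mzero : meas).
Proof. by move=> K _ _; rewrite /= /mzero. Qed.

Lemma grad_full (O : set V) : open O -> grad O (O : set B) (fun=> mzero) (fun=> mzero).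
Proof.
move=> oO; split => [i|i f tf]; first by split; exact: locally_finite_mzero.
rewrite integral_partial_open0//; last exact: open_measurable_rV.
by rewrite integral_measure_zero subee// oppe0.
Qed.

Lemma grad_empty (O : set V) : grad O (set0 : set B) (fun=> mzero) (fun=> mzero).
Proof.
split => [i|i f tf]; first by split; exact: locally_finite_mzero.
by rewrite integral_set0 integral_measure_zero subee// oppe0.
Qed.

End gradients.

Lemma exists_sum_measure d (T : measurableType d) (R : realType) (I : Type) (s : seq I)
    (p : pred I) (m : I -> {measure set T -> \bar R}) :
  exists q : {measure set T -> \bar R}, (forall A, q A = \sum_(i <- s | p i) m i A)%E /\
    forall (D : set T) f, measurable D -> measurable_fun D f -> (forall x, D x -> 0 <= f x)%E ->
    (\int[q]_(x in D) f x = \sum_(i <- s | p i) \int[m i]_(x in D) f x)%E.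
Proof.
elim: s => [|i s [q [qE qI]]].
  exists mzero; split => [A|D f mD mf f0]; rewrite big_nil//.
  exact: integral_measure_zero.
have [pi|pi] := boolP (p i); last first.
  exists q; split => [A|D f mD mf f0]; rewrite big_cons (negbTE pi); [exact: qE|exact: qI].
exists (measure_add (m i) q); split => [A|D f mD mf f0]; rewrite big_cons pi.
  by apply: (etrans (measure_addE _ _ _)); rewrite qE.
by rewrite ge0_integral_measure_add// qI.
Qed.

Section raw_integral.
Import HBNNSimple.

(** The integral in [F_w] is taken with respect to a bare set function; it is compared with that of
    a genuine measure at the level of simple functions. *)
Lemma eq_measure_integral_raw d (T : measurableType d) (R : realType) (mu nu : set T -> \bar R) (D : set T)
    (f : T -> \bar R) : (forall A, measurable A -> mu A = nu A) ->
  (\int[mu]_(x in D) f x = \int[nu]_(x in D) f x)%E.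
Proof.
move=> H; have S (h : {nnsfun T >-> R}) : sintegral mu h = sintegral nu h.
  by rewrite !sintegralET; apply: eq_fsbigr => r _; rewrite H//; exact: measurable_sfunP.
rewrite /integral; congr (_ - _)%E; congr ereal_sup;
  by apply/seteqP; split => _ [h hf <-]; exists h => //; rewrite S.
Qed.

End raw_integral.

(** * Perimeter measures *)

Section perimeters.
Variables (R : realType) (n : nat).
Local Notation V := 'rV[R]_n.
Local Notation B := (borelRn R n).
Local Notation leb := (lebesgue_rV R n).
Local Notation meas := {measure set B -> \bar R}.
Implicit Types (O : set V) (W E : set B) (P M : 'I_n -> meas).

Definition gradv P M (F : set V) : \bar R := (enorm (gradm P M F))%:E.

Lemma gradv_ge0 P M F : (0 <= gradv P M F)%E.
Proof. by rewrite lee_fin enorm_ge0. Qed.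

Lemma gradmN P M F : gradm M P F = - gradm P M F.
Proof. by apply/rowP => i; rewrite !mxE opprB. Qed.

Lemma gradvC P M : gradv M P = gradv P M.
Proof. by apply/funext => F; rewrite /gradv gradmN enormN. Qed.

Lemma gradm_set0 P M : gradm P M set0 = 0.
Proof. by apply/rowP => i; rewrite !mxE !measure0 subrr. Qed.

Lemma rc_sum_cvg O (m : meas) (A : set B) (F : (set B)^nat) : locally_finite O m ->
  measurable A -> rel_compact_in O A -> (forall k, measurable (F k)) -> trivIset setT F ->
  A = \bigcup_k F k -> \sum_(k < j) fine (m (F k)) @[j --> \oo] --> fine (m A).
Proof.
move=> lf mA rA mF tF AE.
have finA := rc_fin_num lf mA rA.
have FA k : F k `<=` A by rewrite AE => x Fx; exists k.
have finF k : m (F k) \is a fin_num.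
  by apply: rc_fin_num lf (mF k) _; exact: rel_compact_in_sub rA.
have mUF : measurable (\bigcup_k F k) by rewrite -AE.
have := @measure_semi_sigma_additive _ _ _ m F mF tF mUF.
rewrite -AE -(fineK finA) => /fine_cvgP[_]; apply: cvg_trans.
apply: near_eq_cvg; apply: nearW => j; rewrite /= big_mkord.
by rewrite (eq_bigr (fun k : 'I_j => (fine (m (F k)))%:E)) ?sumEFin// => k _; rewrite fineK.
Qed.

Lemma gradm_subadditive_charge O P M :
  (forall i, locally_finite O (P i) /\ locally_finite O (M i)) ->
  subadditive_charge O (gradv P M).
Proof.
move=> lf; split => [F||A F [mA rA] mF tF AE]; first exact: gradv_ge0.
  by rewrite /gradv gradm_set0 enorm0.
set S := (\sum_(0 <= k <oo) gradv P M (F k))%E.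
have [->|Sfin] := eqVneq S +oo%E; first by rewrite leey.
have S0 : (0 <= S)%E by apply: nneseries_ge0 => k _ _; exact: gradv_ge0.
have SE : S = (fine S)%:E.
  by rewrite fineK// ge0_fin_numE// ltey.
rewrite SE lee_fin.
(* The [i]-th component of what is left of the gradient after the first [j] pieces. It tends to 0
   because [P i] and [M i] are finite on the relatively compact set [A]. *)
pose g i j : R := (gradm P M A) ord0 i - \sum_(k < j) (gradm P M (F k)) ord0 i.
have gc i : g i j @[j --> \oo] --> (0 : R).
  rewrite -[X in _ --> X](subrr ((gradm P M A) ord0 i)).
  apply: cvgB; first exact: cvg_cst.
  rewrite (_ : (fun j : nat => _) = (fun j : nat => \sum_(k < j) fine (P i (F k)) -
      \sum_(k < j) fine (M i (F k)))); last first.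
    by apply/funext => j; rewrite -sumrB; apply: eq_bigr => k _; rewrite mxE.
  have [lP lM] := lf i; rewrite mxE; apply: cvgB.
    exact: rc_sum_cvg lP mA rA mF tF AE.
  exact: rc_sum_cvg lM mA rA mF tF AE.
have bound j : enorm (gradm P M A) <= fine S + \sum_i `|g i j|.
  rewrite -[gradm P M A](subrK (\sum_(k < j) gradm P M (F k))) addrC.
  apply: le_trans (enormD _ _) _; apply: lerD; last first.
    apply: le_trans (enorm_le_sum _) _; apply: ler_sum => i _.
    by rewrite mxE [X in _ + X]mxE summxE.
  apply: le_trans (enorm_sum _ _ _) _.
  rewrite -lee_fin -SE -sumEFin -(big_mkord xpredT (fun k => gradv P M (F k))).
  by apply: nneseries_lim_ge => k _ _; exact: gradv_ge0.
have lim : fine S + \sum_i `|g i j| @[j --> \oo] --> fine S + \sum_(i < n) `|0 : R|.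
  apply: cvgD; first exact: cvg_cst.
  by apply: cvg_big => [|i _]; [exact: add_continuous|apply: cvg_norm; exact: gc].
have -> : fine S = fine S + \sum_(i < n) `|0 : R|.
  by rewrite big1 ?addr0// => i _; rewrite normr0.
rewrite -(cvg_lim (@Rhausdorff R) lim); apply: limr_ge; first by apply/cvg_ex; eexists; exact: lim.
exact: nearW.
Qed.

Lemma grad_charge O W P M : grad O W P M -> subadditive_charge O (gradv P M).
Proof. by move=> [lf _]; exact: gradm_subadditive_charge. Qed.

Lemma eq_variation O (phi psi : set V -> \bar R) (A : set B) :
  (forall F : set B, measurable F -> rel_compact_in O F -> F `<=` A -> phi F = psi F) ->
  variation O phi A = variation O psi A.
Proof.
move=> H; rewrite /variation; congr ereal_sup; apply/seteqP; split => _ [F [mF tF UF] <-];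
  exists F => //; apply: eq_eseriesr => k _; [apply/esym|]; apply: H; case: (mF k) => //.
- by move=> _ _ x Fx; have [] : (setI A O) x by rewrite -UF; exists k.
- by move=> _ _ x Fx; have [] : (setI A O) x by rewrite -UF; exists k.
Qed.

(** [gradient_measure] is an arbitrary choice, but any two gradients agree on relatively compact
    Borel sets, and the variation evaluates them on no others. *)
Lemma perimeter_measureE O W P M (A : set B) : open O -> measurable W -> grad O W P M ->
  perimeter_measure O W A = variation O (gradv P M) A.
Proof.
move=> oO mW gW; have := grad_is_gradient gW => isg.
have : is_gradient_measure O W (gradient_measure O W).
  by apply: (@xgetPex _ (fun=> 0) [set D | is_gradient_measure O W D]); exists (gradm P M).
move=> /is_gradient_grad[P0 [M0 [g0 DE]]].
rewrite /perimeter_measure -[LHS]/(variation O (fun F => (enorm (gradient_measure O W F))%:E) A).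
apply: eq_variation => F mF rF _; rewrite DE// /gradv; congr (enorm _)%:E.
apply: (grad_unique oO oO _ mW mW g0 gW) => //; last exact: rel_compact_in_subO rF.
by rewrite setDv setU0 set0I measure0.
Qed.

Lemma perimeter_local O (U : set V) W W' (A : set B) :
  open O -> open U -> U `<=` O -> measurable W -> measurable W' ->
  locally_finite_perimeter O W -> locally_finite_perimeter O W' ->
  leb (((W `\` W') `|` (W' `\` W)) `&` U) = 0%E -> A `<=` U ->
  perimeter_measure O W A = perimeter_measure O W' A.
Proof.
move=> oO oU UO mW mW' [D /is_gradient_grad[P [M [g _]]]] [D' /is_gradient_grad[P' [M' [g' _]]]] WW' AU.
rewrite (perimeter_measureE _ oO mW g) (perimeter_measureE _ oO mW' g').
apply: eq_variation => F mF rF FA; rewrite /gradv; congr (enorm _)%:E.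
by apply: (grad_unique oO oU UO mW mW' g g' WW') => //; exact: subset_trans AU.
Qed.

Lemma grad_lfp O W P M : grad O W P M -> locally_finite_perimeter O W.
Proof. by move=> g; exists (gradm P M); exact: grad_is_gradient. Qed.

Lemma variation_mzero O (A : set B) : open O -> measurable A ->
  variation O (gradv (fun=> mzero) (fun=> mzero)) A = 0%E.
Proof.
move=> oO mA; rewrite -(variation_cst0 oO mA); apply: eq_variation => F _ _ _.
rewrite /gradv (_ : gradm _ _ _ = 0) ?enorm0//.
by apply/rowP => i; rewrite !mxE subrr.
Qed.

Lemma perimeter_full0 O (A : set B) : open O -> measurable A -> perimeter_measure O O A = 0%E.
Proof.
move=> oO mA; have mO : measurable (O : set B) by exact: open_measurable_rV.
by rewrite (perimeter_measureE _ oO mO (grad_full oO)) variation_mzero.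
Qed.

Lemma perimeter_empty0 O (A : set B) : open O -> measurable A -> perimeter_measure O set0 A = 0%E.
Proof.
move=> oO mA; rewrite (perimeter_measureE _ oO (@measurable0 _ _) (grad_empty O)).
by rewrite variation_mzero.
Qed.

Lemma perimeter_finite O W P M (A : set B) : open O -> grad O W P M ->
  measurable A -> rel_compact_in O A -> (variation O (gradv P M) A < +oo)%E.
Proof.
move=> oO [lf _] mA rA.
have [Q [QE _]] := exists_sum_measure (enum 'I_n) xpredT (fun i => measure_add (P i) (M i)).
have fin (F : set B) i : measurable F -> F `<=` A -> P i F \is a fin_num /\ M i F \is a fin_num.
  move=> mF FA; have rF := rel_compact_in_sub FA rA.
  by split; apply: rc_fin_num _ mF rF; case: (lf i).
apply: (@le_lt_trans _ _ (Q A)).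
  apply: variation_le_measure => //; last by move=> F; exact: gradv_ge0.
  move=> F mF _ FA; rewrite [leRHS]QE.
  have -> : (\sum_(i <- enum 'I_n) measure_add (P i) (M i) F =
      (\sum_(i <- enum 'I_n) (fine (P i F) + fine (M i F)))%:E)%E.
    rewrite -sumEFin; apply: eq_bigr => i _; have [f1 f2] := fin F i mF FA.
    by rewrite EFinD !fineK//; exact: measure_addE.
  rewrite lee_fin big_enum/=; apply: le_trans (enorm_le_sum _) _; apply: ler_sum => i _.
  rewrite mxE; apply: le_trans (ler_normB _ _) _.
  by rewrite !ger0_norm// fine_ge0.
rewrite [ltLHS]QE; apply: lte_sum_pinfty => i _; have [f1 f2] := fin A i mA (@subset_refl _ A).
by rewrite [ltLHS]measure_addE ltey_eq fin_numD f1 f2.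
Qed.

(* The perimeter measure is only a set function on all sets. *)
Lemma exists_perimeter_measure O W P M : open O -> measurable W -> grad O W P M ->
  exists mu : meas, [/\ forall A : set B, measurable A -> mu A = variation O (gradv P M) A,
    forall A : set B, measurable A -> mu A = perimeter_measure O W A &
    forall f : B -> \bar R, (\int[perimeter_measure O W]_(x in (O : set B)) f x =
      \int[mu]_(x in (O : set B)) f x)%E].
Proof.
move=> oO mW g; have [mu muE] := variation_measure oO (grad_charge g).
have muP A : measurable A -> mu A = perimeter_measure O W A.
  by move=> mA; rewrite muE// (perimeter_measureE _ oO mW g).
exists mu; split => // f; apply: eq_measure_integral_raw => A mA.
by rewrite muP.
Qed.

End perimeters.

(** * Volume displaced by a translation along a coordinate *)

Section translation.
Variables (R : realType) (n : nat).
Local Notation V := 'rV[R]_n.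
Local Notation B := (borelRn R n).
Local Notation leb := (lebesgue_rV R n).
Local Notation e_ k := (delta_mx ord0 k : V).
Local Notation lam := (unit_measure R).
Local Notation meas := {measure set B -> \bar R}.

Lemma thicken_subset (K L : set V) d : K `<=` L -> thicken K d `<=` thicken L d.
Proof. by move=> KL x [y Ky xy]; exists y => //; exact: KL. Qed.

Lemma exists_thicken_rc (O Q : set V) : open O -> rel_compact_in O Q ->
  exists2 d : R, 0 < d & rel_compact_in O (thicken Q d) /\ (leb (thicken Q d) < +oo)%E.
Proof.
move=> oO [cQ QO]; have [d d0 dO] := compact_thicken cQ oO QO.
have sub e : thicken Q e `<=` thicken (closure Q) e by apply: thicken_subset; exact: subset_closure.
exists (d / 2); first by rewrite divr_gt0.
split.
  apply: rel_compact_in_sub (sub _) _; apply: rel_compact_thicken => //; first by rewrite divr_gt0.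
  by rewrite (_ : d / 2 + d / 2 = d)//; lra.
apply: le_lt_trans (lebesgue_thicken (d / 2) cQ).
by apply: le_measure; rewrite ?inE//; apply: open_measurable_rV; exact: open_thicken.
Qed.

Variables (O : set V) (E Q : set B) (P M : 'I_n -> meas) (k : 'I_n) (u c : R).
Hypotheses (oO : open O) (mE : measurable E) (gE : grad O E P M).
Hypotheses (mQ : measurable Q) (rQ : rel_compact_in O Q) (u0 : 0 <= u) (c0 : 0 <= c).
Hypothesis convQ : forall x s : _, Q x -> Q (x + u *: e_ k) -> 0 <= s <= 1 -> Q (x + (s * u) *: e_ k).
Hypothesis bQ : forall F : set B, measurable F -> F `<=` Q ->
  `|fine (P k F) - fine (M k F)| <= c.

Let le_section (m1 m2 m1' m2' : {measure set B -> \bar R}) (W : set V) (F : set B) :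
  (forall A, m1' A = m1 (A `&` W)) -> (forall A, m2' A = m2 (A `&` W)) ->
  locally_finite O m1 -> locally_finite O m2 ->
  (forall F : set B, measurable F -> F `<=` Q -> `|fine (m1 F) - fine (m2 F)| <= c) ->
  measurable F -> F `<=` Q -> Q `<=` W -> (m1' F <= m2' F + c%:E)%E.
Proof.
move=> E1 E2 f1 f2 b12 mF FQ QW.
rewrite E1 E2 setIidl; last exact: subset_trans QW.
have rF := rel_compact_in_sub FQ rQ.
rewrite -(fineK (rc_fin_num f1 mF rF)) -(fineK (rc_fin_num f2 mF rF)) -EFinD lee_fin.
by have := b12 F mF FQ; rewrite ler_norml => /andP[]; lra.
Qed.

(** By [convQ] all the translates of [A] that occur in [sweep_identity] stay in [Q], where the two
    measures differ by at most [c]; hence the two swept terms differ by at most [u * c]. *)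
Lemma sweep_bound (A : set B) : measurable A -> A `<=` Q `&` [set x : V | Q (x + u *: e_ k)] ->
  (leb ([set x : V | A (x - u *: e_ k)%R] `&` E) <= leb (A `&` E) + (u * c)%:E)%E /\
  (leb (A `&` E) <= leb ([set x : V | A (x - u *: e_ k)%R] `&` E) + (u * c)%:E)%E.
Proof.
move=> mA AQ; have [d d0 [rW fW]] := exists_thicken_rc oO rQ.
set W := thicken Q d in rW fW.
have oW : open W by exact: open_thicken.
have mW : measurable (W : set B) by exact: open_measurable_rV.
have QW : Q `<=` W by exact: sub_thicken.
have lf := gE.1 k.
have [PV PVE] := finite_measure_restr mW (rc_finite lf.1 mW rW).
have [MV MVE] := finite_measure_restr mW (rc_finite lf.2 mW rW).
have mEW : measurable (E `&` W) by exact: measurableI.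
have fEW : (leb (E `&` W) < +oo)%E.
  by apply: le_lt_trans fW; apply: le_measure; rewrite ?inE.
have [EV EVE] := finite_measure_restr mEW fEW.
set Qs := Q `&` _ in AQ.
have oU : open (thicken Qs d) by exact: open_thicken.
have UW x s : thicken Qs d x -> 0 <= s <= 1 -> W (x + (s * u) *: e_ k).
  move=> [y [Qy Qyu] yx] s01; exists (y + (s * u) *: e_ k); first exact: convQ.
  by move: yx; rewrite -!ball_normE /ball_/= opprD addrACA subrr addr0.
have AU : A `<=` thicken Qs d by apply: subset_trans AQ _; exact: sub_thicken.
have := @sweep_identity _ _ O E (P k) (M k) k u _ W PV MV EV u0 mE oU oW (rel_compact_in_subO rW)
  UW PVE MVE EVE (gE.2 k) A mA AU.
have mS := measurable_sweep k u.
have mSA : measurable (sweep k u @^-1` A) by exact: measurable_setT_preimage.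
have msh v : measurable ([set x : V | A (x + v)] : set B) by exact: measurable_shift.
have Asub s : 0 <= s <= 1 -> [set x : V | A (x - (s * u) *: e_ k)] `<=` Q.
  by move=> s01 x /AQ[Q1 Q2]; have := convQ Q1 Q2 s01; rewrite subrK.
have EVleb (D : set B) : D `<=` Q -> EV D = leb (D `&` E).
  by move=> DQ; rewrite EVE setIA setIAC (setIidl (subset_trans DQ QW)).
have Asub1 : [set x : V | A (x - u *: e_ k)] `<=` Q.
  by have := Asub 1; rewrite mul1r; apply; rewrite ler01 lexx.
have AQ' : A `<=` Q by move=> x /AQ[].
rewrite EVleb// EVleb//.
have secle (m1 m2 : {finite_measure set B -> \bar R}) :
    (forall F : set B, measurable F -> F `<=` Q -> m1 F <= m2 F + c%:E)%E ->
    ((lam \x m1) (sweep k u @^-1` A) <= (lam \x m2) (sweep k u @^-1` A) + c%:E)%E.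
  move=> H; rewrite /product_measure1.
  have sE s : xsection (sweep k u @^-1` A) s = [set x : V | A (x - (s * u) *: e_ k)].
    by apply/seteqP; split => x; rewrite /xsection/= inE.
  have mx (m : {finite_measure set B -> \bar R}) :
      measurable_fun setT (m \o xsection (sweep k u @^-1` A) : measurableTypeR R -> \bar R).
    exact: measurable_fun_xsection.
  have mI : measurable (`[0, 1]%classic : set (measurableTypeR R)) by exact: measurable_itv.
  rewrite -[X in (_ <= _ + X)%E](_ : (\int[lam]_s c%:E)%E = _); last first.
    by rewrite integral_cst// [X in (_ * X)%E](unit_measureT R) mule1.
  rewrite -ge0_integralD//.
  have mr : measurable_fun setT (fun x : measurableTypeR R => ((m2 \o xsection (sweep k u @^-1` A)) x + c%:E)%E).
    by apply: emeasurable_funD => //; exact: mx.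
  rewrite !(integral_restr mI (@unit_measureE R))//.
  apply: ge0_le_integral => //.
  all: try by [apply: measurable_funTS; exact: mx | move=> s _; rewrite adde_ge0 | exact: measurable_funTS].
  move=> s; rewrite /= in_itv/= => s01; rewrite sE; apply: H; first exact: msh.
  exact: Asub.
have fprod (m : {finite_measure set B -> \bar R}) : (lam \x m)%E (sweep k u @^-1` A) \is a fin_num.
  rewrite ge0_fin_numE//; apply: (@le_lt_trans _ _ ((lam \x m)%E setT)).
    by apply: le_measure; rewrite ?inE.
  rewrite -setXTT product_measure1E// lte_mul_pinfty// ?fin_num_measure//.
  by rewrite ltey_eq fin_num_measure.
have [lP lM] := lf.
have h1 := secle MV PV; have h2 := secle PV MV.
have {}h1 : ((lam \x MV) (sweep k u @^-1` A) <= (lam \x PV) (sweep k u @^-1` A) + c%:E)%E.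
  apply: h1 => F mF FQ; apply: (le_section MVE PVE lM lP _ mF FQ QW) => F' mF' FQ'.
  by rewrite distrC; exact: bQ.
have {}h2 : ((lam \x PV) (sweep k u @^-1` A) <= (lam \x MV) (sweep k u @^-1` A) + c%:E)%E.
  by apply: h2 => F mF FQ; exact: (le_section PVE MVE lP lM bQ mF FQ QW).
have fl D : D `<=` Q -> measurable D -> leb (D `&` E) \is a fin_num.
  move=> DQ mD; rewrite ge0_fin_numE//; apply: le_lt_trans fW.
  by apply: le_measure; rewrite ?inE//; [exact: measurableI|move=> x [/DQ/QW]].
move: h1 h2; rewrite -(fineK (fprod PV)) -(fineK (fprod MV)).
rewrite -(fineK (fl _ AQ' mA)) -(fineK (fl _ Asub1 (msh _))).
rewrite -!EFinM -!EFinD !lee_fin => h1 h2 [] H.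
have h1' := ler_wpM2l u0 h1; have h2' := ler_wpM2l u0 h2.
by split; move: h1' h2' H; rewrite !mulrDr; lra.
Qed.

(** The set in question lies in [E] and its translate misses [E], so [sweep_bound] compares its
    volume with 0. *)
Lemma translate_out :
  (leb [set x : V | [/\ Q x, Q (x + u *: e_ k)%R, E x & ~ E (x + u *: e_ k)%R]] <= (u * c)%:E)%E.
Proof.
set A := (X in leb X).
have mA : measurable (A : set B).
  rewrite (_ : A = (Q `&` [set x : V | Q (x + u *: e_ k)]) `&` (E `\` [set x : V | E (x + u *: e_ k)])).
    by apply: measurableI; [apply: measurableI|apply: measurableD] => //; exact: measurable_shift.
  by apply/seteqP; split => x /=; [move=> [? ? ? ?]|move=> [[? ?] [? ?]]].
have [|_] := sweep_bound mA; first by move=> x [].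
rewrite setIidl; last by move=> x [].
rewrite (_ : _ `&` E = set0) ?measure0 ?add0e//.
by apply/seteqP; split => // x [[_ _ _]]; rewrite subrK.
Qed.

Lemma translate_in :
  (leb [set x : V | [/\ Q x, Q (x + u *: e_ k)%R, ~ E x & E (x + u *: e_ k)%R]] <= (u * c)%:E)%E.
Proof.
set A := (X in leb X).
have mA : measurable (A : set B).
  rewrite (_ : A = (Q `&` [set x : V | Q (x + u *: e_ k)]) `&` ([set x : V | E (x + u *: e_ k)] `\` E)).
    by apply: measurableI; [apply: measurableI|apply: measurableD] => //; exact: measurable_shift.
  by apply/seteqP; split => x /=; [move=> [? ? ? ?]|move=> [[? ?] [? ?]]].
have [|+ _] := sweep_bound mA; first by move=> x [].
rewrite (_ : A `&` E = set0) ?measure0 ?add0e; last by apply/seteqP; split => // x [[]].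
rewrite setIidl; last by move=> x [_ _ _]; rewrite subrK.
by rewrite (lebesgue_translate (- (u *: e_ k)) mA).
Qed.

End translation.

Section affine_bound.
Context d (T : measurableType d) (R : realType) (m : {measure set T -> \bar R}).

Lemma le_integral_affine (D : set T) (f1 f2 f3 f4 : T -> \bar R) (a b : R) :
  measurable D -> 0 <= a -> 0 <= b ->
  measurable_fun D f1 -> measurable_fun D f2 -> measurable_fun D f3 -> measurable_fun D f4 ->
  (forall x, 0 <= f1 x)%E -> (forall x, 0 <= f2 x)%E -> (forall x, 0 <= f3 x)%E ->
  (forall x, 0 <= f4 x)%E ->
  (forall x, D x -> f1 x <= f2 x + a%:E * f3 x + b%:E * f4 x)%E ->
  (\int[m]_(x in D) f1 x <= \int[m]_(x in D) f2 x + a%:E * \int[m]_(x in D) f3 x +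
    b%:E * \int[m]_(x in D) f4 x)%E.
Proof.
move=> mD a0 b0 m1 m2 m3 m4 f10 f20 f30 f40 H.
have a3 x : (0 <= a%:E * f3 x)%E by rewrite mule_ge0.
have b4 x : (0 <= b%:E * f4 x)%E by rewrite mule_ge0.
have ma : measurable_fun D (fun x => a%:E * f3 x)%E by exact: measurable_funeM.
have mb : measurable_fun D (fun x => b%:E * f4 x)%E by exact: measurable_funeM.
have mc : measurable_fun D (fun x => f2 x + a%:E * f3 x)%E by exact: emeasurable_funD.
have md : measurable_fun D (fun x => f2 x + a%:E * f3 x + b%:E * f4 x)%E by exact: emeasurable_funD.
rewrite -!ge0_integralZl// -ge0_integralD// -ge0_integralD//; last by move=> x _; rewrite adde_ge0.
by apply: ge0_le_integral => // x _; rewrite !adde_ge0.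
Qed.

Lemma integral_indicM (D : set T) (f : T -> R) : measurable D ->
  (\int[m]_(x in D) (f x)%:E = \int[m]_x (\1_D x * f x)%:E)%E.
Proof.
move=> mD; rewrite [LHS]integral_mkcond; apply: eq_integral => x _.
by rewrite /patch indicE; case: (x \in D); rewrite ?mul1r ?mul0r.
Qed.

End affine_bound.

(** * Traces on hyperplanes as limits of averages over strips *)

Section trace.
Variables (R : realType) (n : nat).
Local Notation V := 'rV[R]_n.
Local Notation B := (borelRn R n).
Local Notation leb := (lebesgue_rV R n).
Local Notation e_ k := (delta_mx ord0 k : V).

Lemma measurable_setc1 (k : 'I_n) (t : R) : measurable_fun setT (setc k t : B -> B).
Proof.
apply: measurable_fun_borelRn => i.
have [->|ik] := eqVneq i k.
  by apply: (eq_measurable_fun (cst t : B -> R)) => [y _|]; [rewrite mxE eqxx|].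
apply: (eq_measurable_fun ((fun y : V => y ord0 i) : B -> R)) => [y _|]; last exact: measurable_coord.
by rewrite mxE (negbTE ik).
Qed.

Lemma setc_coord (k : 'I_n) t (y : V) : setc k t y ord0 k = t.
Proof. by rewrite mxE eqxx. Qed.

Definition strip (k : 'I_n) (t u : R) : set B := [set x | t < (x : V) ord0 k <= t + u].

Lemma measurable_strip k t u : measurable (strip k t u).
Proof.
rewrite (_ : strip k t u = (fun x : V => x ord0 k) @^-1` `]t, (t + u)]); last first.
  by apply/seteqP; split => x; rewrite /strip/= in_itv.
by rewrite -[X in measurable X]setTI; exact: measurable_coord.
Qed.

Variables (E : set B) (k : 'I_n) (t u C L : R) (phi : B -> R).
Hypotheses (mE : measurable E) (u0 : 0 < u) (L0 : 0 <= L).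
Hypotheses (bphi : bmeas phi) (phi01 : forall x, 0 <= phi x <= C).
Hypothesis lip : forall (x : V) (h : R), `|phi (x + h *: e_ k) - phi x| <= L * `|h|.

Let C0 : 0 <= C. Proof. by have /andP[] := phi01 0; exact: le_trans. Qed.

Let mphi : measurable_fun setT phi. Proof. by case: bphi. Qed.

(** The integral of [phi] over the slice of [E] at height [t]. In [strip_integral] the function is
    shifted by [u] because this is how the strip arises when the indicator of a half-space is
    translated. *)
Definition trace_integral : \bar R :=
  (\int[leb]_y (\1_(slab k) y * (\1_E (setc k t y) * phi (setc k t y)))%:E)%E.

Definition trace_mass : \bar R :=
  (\int[leb]_y (\1_(slab k) y * \1_E (setc k t y))%:E)%E.

Definition strip_integral : \bar R :=
  (\int[leb]_x (\1_E x * (\1_(strip k t u) x * phi ((x : V) - u *: e_ k)))%:E)%E.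

Let F (p : measurableTypeR R * B) : R :=
  \1_(slab k) p.2 * (\1_E (setc k (t + p.1) p.2) * phi (setc k (t + p.1 - u) p.2)).

Let mind (A : set B) : measurable A -> measurable_fun setT (\1_A : B -> R).
Proof. by move=> mA; exact: measurable_indic. Qed.

Let mphiu : measurable_fun setT (fun x : B => phi ((x : V) - u *: e_ k)).
Proof. exact: measurableT_comp mphi (measurable_addr _). Qed.

Let setcB h y : setc k (t + h - u) y = setc k (t + h) y - u *: e_ k.
Proof. by rewrite (setcD k (t + h) (- u)) scaleNr. Qed.

Let mF : measurable_fun setT F.
Proof.
have ms := measurable_setc k t.
apply: measurable_funM; first exact: measurableT_comp (mind (measurable_slab k)) measurable_snd.
apply: measurable_funM; first exact: measurableT_comp (mind mE) ms.
apply: (eq_measurable_fun (fun p : measurableTypeR R * B => phi ((setc k (t + p.1) p.2 : V) - u *: e_ k))).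
  by move=> p _; rewrite setcB.
exact: measurableT_comp mphiu ms.
Qed.

Let F0 p : 0 <= F p.
Proof.
by rewrite /F !mulr_ge0// ?indicE//; have /andP[] := phi01 (setc k (t + p.1 - u) p.2).
Qed.

Let I h : \bar R := (\int[leb]_y (F (h, y))%:E)%E.

Let mI : measurable_fun setT (I : measurableTypeR R -> \bar R).
Proof.
have mF' : measurable_fun setT (fun p => (F p)%:E) by exact/measurable_EFinP.
exact: (measurable_fun_fubini_tonelli_F (fun p => (F p)%:E) mF' (fun p => F0 p)).
Qed.

Let I0 h : (0 <= I h)%E.
Proof. by apply: integral_ge0 => y _; rewrite lee_fin. Qed.

Let strip_integralE : strip_integral = (\int[@lebesgue_measure R]_(h in `]0%R, u]) I h)%E.
Proof.
have mf : measurable_fun setT (fun x : B =>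
    (\1_E x * (\1_(strip k t u) x * phi ((x : V) - u *: e_ k)))%:E).
  apply/measurable_EFinP; apply: measurable_funM; first exact: mind.
  by apply: measurable_funM => //; apply: mind; exact: measurable_strip.
rewrite /strip_integral (integral_slice k t mf); last first.
  move=> x; rewrite lee_fin !mulr_ge0// ?indicE//.
  by have /andP[] := phi01 ((x : V) - u *: e_ k).
rewrite [RHS]integral_mkcond; apply: eq_integral => h _; rewrite /patch.
rewrite integral_indicM; last exact: measurable_slab.
have hE y : \1_(strip k t u) (setc k (t + h) y) = ((h : R) \in `]0, u])%:R :> R.
  by rewrite indicE; congr (_%:R); congr nat_of_bool; rewrite in_itv/=; apply/idP/idP;
    [move/set_mem; rewrite /strip/= setc_coord|move=> hh; apply/mem_set; rewrite /strip/= setc_coord]; lra.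
have -> : (h \in `]0, u]%classic) = ((h : R) \in `]0, u]) by rewrite mem_setE.
case: ifP => hu; last first.
  by apply: integral0_eq => y _; rewrite hE hu mul0r !mulr0.
by apply: eq_integral => y _; rewrite hE hu mul1r /F/= setcB.
Qed.

Let G y : R := \1_(slab k) y * (\1_E (setc k t y) * phi (setc k t y)).
Let Tn y : R := \1_(slab k) y * \1_E (setc k t y).
Let Sd h y : R := \1_[set y : B | slab k y /\ shift_diff E (h *: e_ k) (setc k t y)] y.

Let mTn : measurable_fun setT (fun y : B => (Tn y)%:E).
Proof.
apply/measurable_EFinP; apply: measurable_funM; first exact: mind (measurable_slab k).
exact: measurableT_comp (mind mE) (measurable_setc1 k t).
Qed.

Let mG : measurable_fun setT (fun y : B => (G y)%:E).
Proof.
apply/measurable_EFinP; apply: measurable_funM; first exact: mind (measurable_slab k).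
by apply: measurable_funM; [apply: measurableT_comp (mind mE) _|apply: measurableT_comp mphi _];
  exact: measurable_setc1.
Qed.

Let mSet h : measurable ([set y : B | slab k y /\ shift_diff E (h *: e_ k) (setc k t y)] : set B).
Proof.
apply: measurableI; first exact: measurable_slab.
apply: (measurable_setT_preimage (measurable_setc1 k t)); exact: measurable_shift_diff.
Qed.

Let mSd h : measurable_fun setT (fun y : B => (Sd h y)%:E).
Proof. by apply/measurable_EFinP; exact: mind. Qed.

Let ISd h : (\int[leb]_y (Sd h y)%:E = slice_diff k E t h)%E.
Proof. by rewrite integral_indic// setIT. Qed.

Let pointwise h y : 0 < h <= u ->
  F (h, y) <= G y + (L * u) * Tn y + C * Sd h y /\
  G y <= F (h, y) + (L * u) * Tn y + C * Sd h y.
Proof.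
move=> /andP[h0 hu]; rewrite /F /G /Tn /Sd !indicE/=.
have [Sy|Sy] := boolP (y \in slab k); last first.
  rewrite !mul0r !mulr0 !add0r; rewrite mulr_ge0//; split => //.
have := lip (setc k t y) (h - u); rewrite -setcD addrA => lp.
have Lhu : L * `|h - u| <= L * u by apply: ler_wpM2l => //; rewrite ler_norml; lra.
have hE : setc k (t + h) y = setc k t y + h *: e_ k := setcD k t h y.
have /andP[p1 p2] := phi01 (setc k (t + h - u) y); have /andP[q1 q2] := phi01 (setc k t y).
have Lu0 : 0 <= L * u by rewrite mulr_ge0// ltW.
have {lp} [l1 l2] : phi (setc k (t + h - u) y) <= phi (setc k t y) + L * u /\
   phi (setc k t y) <= phi (setc k (t + h - u) y) + L * u.
  by move: (le_trans lp Lhu); rewrite ler_norml; lra.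
have Ce b : 0 <= C * (nat_of_bool b)%:R by rewrite mulr_ge0.
have [E1|E1] := boolP (setc k (t + h) y \in E); have [E2|E2] := boolP (setc k t y \in E);
  rewrite !mul1r ?mulr1 ?mulr0 ?mul0r ?addr0 ?add0r /=.
- by move: (Ce (y \in [set y : B | slab k y /\ shift_diff E (h *: e_ k) (setc k t y)])); lra.
- rewrite mem_set/= ?mulr1; first by lra.
  split; first exact: set_mem.
  by right; split; [move/mem_set; rewrite (negbTE E2)|rewrite /= -hE; exact: set_mem].
- rewrite mem_set/= ?mulr1; first by lra.
  split; first exact: set_mem.
  by left; split; [exact: set_mem|rewrite -hE => /mem_set; rewrite (negbTE E1)].
- by move: (Ce (y \in [set y : B | slab k y /\ shift_diff E (h *: e_ k) (setc k t y)])); lra.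
Qed.

Let G0 y : (0 <= (G y)%:E)%E.
Proof. by rewrite lee_fin /G !mulr_ge0// ?indicE//; have /andP[] := phi01 (setc k t y). Qed.

Let Tn0 y : (0 <= (Tn y)%:E)%E.
Proof. by rewrite lee_fin /Tn mulr_ge0// indicE. Qed.

Let Sd0 h y : (0 <= (Sd h y)%:E)%E.
Proof. by rewrite lee_fin /Sd indicE. Qed.

Let inner h : 0 < h <= u ->
  (I h <= trace_integral + (L * u)%:E * trace_mass + C%:E * slice_diff k E t h)%E /\
  (trace_integral <= I h + (L * u)%:E * trace_mass + C%:E * slice_diff k E t h)%E.
Proof.
move=> hu; rewrite -ISd.
have Lu0 : 0 <= L * u by rewrite mulr_ge0// ltW.
have mFh : measurable_fun setT (fun y : B => (F (h, y))%:E).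
  by apply/measurable_EFinP; exact: measurableT_comp mF (measurable_pair1 h).
have F0' y : (0 <= (F (h, y))%:E)%E by rewrite lee_fin.
by split; apply: le_integral_affine => // y _; rewrite -!EFinM -!EFinD lee_fin; have [] := pointwise y hu.
Qed.

(** Two errors at height [h] in []0, u]]: [phi] changes by at most [L * u], and the slices at [t]
    and [t + h] differ on a set of measure [slice_diff], where [phi] is at most [C]. Averaging the
    second one over [h] gives [slice_osc]. *)
Lemma strip_trace :
  (strip_integral <= u%:E * trace_integral + (L * u)%:E * (u%:E * trace_mass) +
     (C * u)%:E * slice_osc k E u t)%E /\
  (u%:E * trace_integral <= strip_integral + (L * u)%:E * (u%:E * trace_mass) +
     (C * u)%:E * slice_osc k E u t)%E.
Proof.
have mD : measurable (`]0%R, u]%classic : set (measurableTypeR R)) by exact: measurable_itv.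
have cstE (c : \bar R) : (0 <= c -> \int[@lebesgue_measure R]_(h in `]0%R, u]) c = u%:E * c)%E.
  by move=> c0; rewrite integral_cst//= lebesgue_measure_itv/= lte_fin u0 sube0 muleC.
have oscE : ((C * u)%:E * slice_osc k E u t =
    C%:E * \int[@lebesgue_measure R]_(h in `]0%R, u]) slice_diff k E t h)%E.
  by rewrite /slice_osc muleA -EFinM mulrK// unitfE gt_eqF.
have ti0 : (0 <= trace_integral)%E by apply: integral_ge0 => y _; exact: G0.
have tm0 : (0 <= trace_mass)%E by apply: integral_ge0 => y _; exact: Tn0.
have Lu0 : 0 <= L * u by rewrite mulr_ge0// ltW.
have msd : measurable_fun setT (slice_diff k E t : measurableTypeR R -> \bar R).
  exact: (measurableT_comp (measurable_slice_diff k mE) (@measurable_pair1 _ _ (measurableTypeR R) (measurableTypeR R) t)).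
rewrite strip_integralE oscE -(cstE _ ti0) -(cstE _ tm0).
split; apply: le_integral_affine => //; do ?[exact: measurable_funTS|exact: slice_diff_ge0].
- by move=> h; rewrite /= in_itv/= => hu; have [] := inner hu.
- by move=> h; rewrite /= in_itv/= => hu; have [] := inner hu.
Qed.

End trace.

Lemma exists_finite_pushforward d1 d2 (T1 : measurableType d1) (T2 : measurableType d2)
    (R : realType) (m : {finite_measure set T1 -> \bar R}) (g : T1 -> T2) :
  measurable_fun setT g ->
  exists q : {finite_measure set T2 -> \bar R}, (forall A, q A = m (g @^-1` A)) /\
    forall f : T2 -> R, measurable_fun setT f -> \int[q]_x f x = \int[m]_x f (g x).
Proof.
move=> mg; have [q [qE qI]] := exists_pushforward m mg.
have qT : (q setT < +oo)%E by rewrite qE preimage_setT ltey_eq fin_num_measure.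
have [q' q'E] := finite_measure_restr measurableT qT.
have q'q A : q' A = q A by rewrite q'E setIT.
exists q'; split => [A|f mf]; first by rewrite q'q qE.
have mEf : measurable_fun setT (fun x => (f x)%:E) by exact/measurable_EFinP.
rewrite /Rintegral; congr fine; rewrite [RHS]integralE [LHS]integralE.
have hp := qI _ (measurable_funepos mEf) (fun x => funepos_ge0 _ x).
have hn := qI _ (measurable_funeneg mEf) (fun x => funeneg_ge0 _ x).
have eq (h : T2 -> \bar R) : (\int[q']_x h x = \int[q]_x h x)%E.
  by apply: eq_measure_integral => A _ _; exact: q'q.
rewrite !eq hp hn.
by congr (_ - _)%E; apply: eq_integral => x _; rewrite !(funeposE, funenegE).
Qed.

Lemma integral_restr_on d (T : measurableType d) (R : realType)
    (m m' : {measure set T -> \bar R}) (D A X : set T) (f : T -> R) :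
  measurable D -> measurable A -> (forall C, m' C = m (C `&` D)) -> measurable_fun setT f ->
  A `&` D `<=` X -> (forall x, X x -> ~ (A x /\ D x) -> f x = 0) ->
  (\int[m']_x (\1_A x * f x)%:E = \int[m]_(x in X) (f x)%:E)%E.
Proof.
move=> mD mA m'E mf ADX f0; have mEf : measurable_fun setT (fun x => (f x)%:E) by exact/measurable_EFinP.
rewrite -integral_indicM//; transitivity (\int[mrestr m mD]_(x in A) (f x)%:E)%E.
  by apply: eq_measure_integral => C mC _; rewrite m'E.
rewrite integral_mrestr//; last exact: measurable_funTS.
by apply: integral_support => // x Xx AD; rewrite f0.
Qed.

(** * The gradient identity on a half-space *)

Section cut.
Variables (R : realType) (n : nat).
Local Notation V := 'rV[R]_n.
Local Notation B := (borelRn R n).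
Local Notation leb := (lebesgue_rV R n).
Local Notation e_ k := (delta_mx ord0 k : V).
Local Notation lam := (unit_measure R).
Local Notation meas := {measure set B -> \bar R}.

Definition half (k : 'I_n) (t : R) : set B := [set x | (x : V) ord0 k <= t].

Lemma measurable_half k t : measurable (half k t).
Proof.
rewrite (_ : half k t = (fun x : V => x ord0 k) @^-1` `]-oo, t]); last first.
  by apply/seteqP; split => x; rewrite /half/= in_itv.
by rewrite -[X in measurable X]setTI; exact: measurable_coord.
Qed.

Lemma sweep_cvg (m : {finite_measure set B -> \bar R}) (g : B -> R) (i : 'I_n) (u_ : nat -> R) :
  bmeas g -> (forall j, 0 < u_ j) ->
  (forall (x : V) (s : R), 0 <= s -> g (x - (s * u_ j) *: e_ i) @[j --> \oo] --> g x) ->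
  \int[lam]_s \int[m]_x g (sweep i (u_ j) (s, x)) @[j --> \oo] --> \int[m]_x g x.
Proof.
move=> bg u0 gc; have [mg [C gC]] := bg.
have mabs : measurable_fun setT (fun s : measurableTypeR R => `|s| : measurableTypeR R).
  exact: normr_measurable.
(* The absolute value makes the pointwise limit available for every [s]; it changes nothing on
   [[0, 1]], which carries [lam]. *)
pose I j (s : measurableTypeR R) := \int[m]_x g (sweep i (u_ j) (`|s|, x)).
have bF j := bmeas_fubini_F lam m (bmeas_sweep i (u_ j) bg).
have mI j : measurable_fun setT (I j) by apply: (measurableT_comp (bF j).1 mabs).
have -> : (fun j : nat => \int[lam]_s \int[m]_x g (sweep i (u_ j) (s, x))) =
    (fun j : nat => \int[lam]_s I j s).
  apply/funext => j; apply: eq_unit_Rintegral; [by case: (bF j)|exact: mI|].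
  by move=> s /andP[s0 _]; rewrite /I ger0_norm.
have -> : \int[m]_x g x = \int[lam]_s (\int[m]_x g x).
  by rewrite [RHS]Rintegral_cst// [X in _ * fine X](unit_measureT R) mulr1.
have bs j s := bmeas_pair1 (bmeas_sweep i (u_ j) bg) s.
apply: (@bmeas_dominated_convergence _ _ _ lam I _ (C * fine (m setT))) => //.
- by move=> j s; apply: bmeas_norm_le => //; exact: bs.
move=> s; apply: (@bmeas_dominated_convergence _ _ _ m _ _ C) => //.
- by move=> j; case: (bs j `|s|).
- by move=> x; exact: (gc x `|s| (normr_ge0 s)).
Qed.

Lemma lebesgue_slice_lty (O E : set V) (k : 'I_n) (t : R) :
  (exists b, forall x, O x -> `|x : V| <= b) -> measurable (E : set B) -> E `<=` O ->
  (leb (slab k `&` (setc k t : B -> B) @^-1` E) < +oo)%E.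
Proof.
move=> bO mE EO; have mT : measurable (slab k `&` (setc k t : B -> B) @^-1` E).
  by apply: measurableI; [exact: measurable_slab|exact: measurable_setT_preimage (measurable_setc1 k t) mE].
have [b Ob] := bO; apply: (@lebesgue_bounded _ _ _ (Num.max 0 (Num.max b 1))) => // y [Sy Ey].
rewrite [leLHS]/Num.Def.normr/= mx_normrE; apply: bigmax_le; first by rewrite le_max lexx.
move=> [a i] _ /=; rewrite ord1 !le_max; apply/orP; right.
have [->|ik] := eqVneq i k.
  apply/orP; right; move: Sy; rewrite /slab/= => /andP[y0 y1].
  by rewrite ger0_norm// ltW.
apply/orP; left; apply: le_trans (Ob (setc k t y) (EO _ Ey)).
by apply: le_trans (coord_le_norm _ i); rewrite mxE (negbTE ik).
Qed.

Variables (O : set V) (E : set B) (P M : 'I_n -> meas) (k : 'I_n) (t : R) (u_ : nat -> R).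
Hypotheses (oO : open O) (bO : exists b, forall x, O x -> `|x : V| <= b).
Hypotheses (mE : measurable E) (EO : E `<=` O) (gE : grad O E P M).
Hypotheses (u0 : forall j, 0 < u_ j) (uc : u_ j @[j --> \oo] --> 0).
Hypothesis osc : slice_osc k E (u_ j) t @[j --> \oo] --> 0%E.

Let mT : measurable (slab k `&` (setc k t : B -> B) @^-1` E).
Proof.
apply: measurableI; first exact: measurable_slab.
exact: measurable_setT_preimage (measurable_setc1 k t) mE.
Qed.

Let fT : (leb (slab k `&` (setc k t : B -> B) @^-1` E) < +oo)%E.
Proof. exact: lebesgue_slice_lty bO mE EO. Qed.

Let fE : (leb E < +oo)%E.
Proof. by have [b Ob] := bO; apply: (@lebesgue_bounded _ _ _ b) => // x /EO /Ob. Qed.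

Section limits.
Variables tau EL : {finite_measure set B -> \bar R}.
Hypothesis tauE : forall A, tau A = leb (A `&` (slab k `&` (setc k t : B -> B) @^-1` E)).
Hypothesis ELE : forall A, EL A = leb (A `&` E).

Let trace_int (phi : B -> R) j : R :=
  (u_ j)^-1 * \int[EL]_x (\1_(strip k t (u_ j)) x * phi ((x : V) - u_ j *: e_ k)).

Let bstrip j (phi : B -> R) : bmeas phi ->
  bmeas (fun x : B => \1_(strip k t (u_ j)) x * phi ((x : V) - u_ j *: e_ k)).
Proof.
move=> bphi; apply: bmeasM; first by apply: bmeas_indic; exact: measurable_strip.
exact: bmeas_shift.
Qed.

Let bsetc (phi : B -> R) : bmeas phi -> bmeas (fun y : B => phi (setc k t y)).
Proof.
move=> [mphi [C pC]]; split; last by exists C.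
exact: measurableT_comp mphi (measurable_setc1 k t).
Qed.

Let trace_cvg_ge0 (phi : B -> R) (C L : R) : bmeas phi -> (forall x, 0 <= phi x <= C) -> 0 <= L ->
  (forall (x : V) (h : R), `|phi (x + h *: e_ k) - phi x| <= L * `|h|) ->
  trace_int phi j @[j --> \oo] --> \int[tau]_y phi (setc k t y).
Proof.
move=> bphi p01 L0 lip; set l := \int[tau]_y _.
have lE : trace_integral E k t phi = l%:E.
  rewrite (bmeas_RintegralE tau (bsetc bphi)) (integral_restr mT tauE); last first.
    by apply/measurable_EFinP; case: (bsetc bphi).
  rewrite integral_indicM//; apply: eq_integral => y _.
  by rewrite mulrA indicI /= !indicE.
have mE' : trace_mass E k t = (fine (leb (slab k `&` (setc k t : B -> B) @^-1` E)))%:E.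
  rewrite fineK ?ge0_fin_numE//.
  rewrite -[RHS](_ : (\int[leb]_y (\1_(slab k `&` (setc k t : B -> B) @^-1` E) y)%:E)%E = _); last first.
    by rewrite integral_indic// setIT.
  by apply: eq_integral => y _; rewrite indicI /= !indicE.
set m := fine _ in mE'.
have SE j : strip_integral E k t (u_ j) phi =
    (\int[EL]_x (\1_(strip k t (u_ j)) x * phi ((x : V) - u_ j *: e_ k)))%:E.
  have [mb _] := bstrip j bphi.
  rewrite (bmeas_RintegralE EL (bstrip j bphi)) (integral_restr mE ELE).
    by rewrite integral_indicM.
  exact/measurable_EFinP.
have /fine_cvgP[oscfin oscc] := osc.
pose d j := L * u_ j * m + C * fine (slice_osc k E (u_ j) t).
have dc : d j @[j --> \oo] --> (0 : R).
  rewrite -[X in _ --> X](_ : L * 0 * m + C * 0 = 0); last by rewrite !mulr0 mul0r addr0.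
  apply: cvgD; last by apply: cvgM; [exact: cvg_cst|exact: oscc].
  by apply: cvgM; [apply: cvgM => //; exact: cvg_cst|exact: cvg_cst].
apply: (@squeeze_cvgr _ _ _ _ (fun j => l - d j) (fun j => l + d j)); last 2 first.
- by rewrite -[X in _ --> X]subr0; apply: cvgB => //; exact: cvg_cst.
- by rewrite -[X in _ --> X]addr0; apply: cvgD => //; exact: cvg_cst.
near=> j.
have fj : slice_osc k E (u_ j) t \is a fin_num by near: j.
have := strip_trace t mE (u0 j) L0 bphi p01 lip.
rewrite lE mE' SE -(fineK fj) -!EFinM -!EFinD !lee_fin => -[h1 h2].
by rewrite /trace_int ler_pdivlMl// ler_pdivrMl// /d; apply/andP; split; move: h1 h2; lra.
Unshelve. all: by end_near. Qed.

Lemma trace_cvg (f : B -> R) (C L : R) : bmeas f -> (forall x, `|f x| <= C) -> 0 <= L ->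
  (forall (x : V) (h : R), `|f (x + h *: e_ k) - f x| <= L * `|h|) ->
  trace_int f j @[j --> \oo] --> \int[tau]_y f (setc k t y).
Proof.
move=> bf fC L0 lip; have C0 : 0 <= C by rewrite (le_trans _ (fC 0)).
have bC : bmeas ((fun=> C) : B -> R) by exact: bmeas_cst.
have bfC : bmeas (fun x => f x + C) by exact: bmeasD.
have c1 : trace_int (fun x => f x + C) j @[j --> \oo] --> \int[tau]_y (f (setc k t y) + C).
  apply: (@trace_cvg_ge0 _ (C + C) L) => //.
  - by move=> x; have := fC x; rewrite ler_norml; lra.
  - by move=> x h; rewrite opprD addrACA subrr addr0.
have c2 : trace_int (fun=> C) j @[j --> \oo] --> \int[tau]_y C.
  apply: (@trace_cvg_ge0 _ C L) => //; first by rewrite C0 lexx.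
  by move=> x h; rewrite subrr normr0 mulr_ge0.
have lE : \int[tau]_y (f (setc k t y) + C) - \int[tau]_y C = \int[tau]_y f (setc k t y).
  rewrite -bmeas_RintegralB//; first by apply: eq_Rintegral => x _; rewrite addrK.
  exact: (bsetc bfC).
have c12 : trace_int (fun x => f x + C) j - trace_int (fun=> C) j @[j --> \oo] -->
    \int[tau]_y f (setc k t y) by rewrite -lE; exact: cvgB c1 c2.
apply: cvg_trans c12; apply: near_eq_cvg; apply: nearW => j.
rewrite /trace_int/= -mulrBr -bmeas_RintegralB; [|exact: (bstrip j bfC)|exact: (bstrip j bC)].
congr (_ * _); apply: eq_Rintegral => x _.
by rewrite -mulrBr addrK.
Qed.

End limits.

Let tau_finite : exists tau : {finite_measure set B -> \bar R},
  forall A, tau A = leb (A `&` (slab k `&` (setc k t : B -> B) @^-1` E)).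
Proof. exact: finite_measure_restr. Qed.

Let half_shift i (x : V) (v : R) : half k t (x - v *: e_ i) <-> x ord0 k - v * (k == i)%:R <= t.
Proof. by rewrite /half/= !mxE eqxx. Qed.

(** The half-space is closed and the shift goes downwards: a point of it stays in it, and a point
    above [t] stays above once the shift is short enough. Thus there is no exceptional set on the
    hyperplane, which [P i] and [M i] could charge. *)
Let half_cvg i (x : V) (s : R) : 0 <= s ->
  \forall j \near \oo, \1_(half k t) (x - (s * u_ j) *: e_ i) = \1_(half k t) x :> R.
Proof.
move=> s0.
have y0 j : 0 <= s * u_ j * (k == i)%:R by rewrite !mulr_ge0// ltW.
have yc : s * u_ j * (k == i)%:R @[j --> \oo] --> (0 : R).
  rewrite -[X in _ --> X](_ : s * 0 * (k == i)%:R = 0); last by rewrite mulr0 mul0r.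
  by apply: cvgM; [apply: cvgM => //; exact: cvg_cst|exact: cvg_cst].
have eqi (y : V) : (half k t y <-> half k t x) -> \1_(half k t) y = \1_(half k t) x :> R.
  by move=> yx; rewrite !indicE; congr (_%:R); congr nat_of_bool; apply/idP/idP;
    move=> /set_mem h; apply/mem_set/yx.
have [xt|xt] := leP (x ord0 k) t.
  apply: nearW => j; apply: eqi; split => // _; apply/half_shift.
  by move: (y0 j); lra.
have xt0 : 0 < x ord0 k - t by rewrite subr_gt0.
near=> j; apply: eqi; split => [/half_shift h|].
  have : s * u_ j * (k == i)%:R < x ord0 k - t.
    by near: j; exact: (cvgr_lt _ yc).
  by move: h; lra.
by rewrite /half/=; lra.
Unshelve. all: by end_near. Qed.

Lemma test_function_lipschitz (f : V -> R) i : test_function O f ->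
  exists2 L : R, 0 <= L & forall (x : V) (h : R), `|f (x + h *: e_ i) - f x| <= L * `|h|.
Proof.
move=> tf; have tdf := test_function_partial i tf.
have [L L0 dL] := test_function_bounded tdf; exists L => // x h.
have := shift_ftc i (- h) x tf; rewrite scaleNr !opprK => ->.
rewrite normrM mulrC ler_wpM2r//.
have bsw := bmeas_pair2 (bmeas_sweep i (- h) (bmeas_test tdf)) x.
rewrite -[leRHS]mulr1 -[X in _ * X]/(fine 1%E) -(unit_measureT R).
exact: bmeas_norm_le.
Qed.

(** [sweep_identity_fun] for the product [g] of [f] and the indicator of the half-space, divided by
    [u_ j]. The swept terms converge to the integrals of [g] against [P i] and [M i]. The difference
    quotient [X] of [g] splits into one of [f], which converges to the partial derivative, and the
    term [Z], which converges to the trace if [i = k] and vanishes otherwise. *)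
Lemma cut_identity (tau : {finite_measure set B -> \bar R}) (f : V -> R) (i : 'I_n) :
  (forall A, tau A = leb (A `&` (slab k `&` (setc k t : B -> B) @^-1` E))) ->
  test_function O f ->
  exists p m, [/\ (\int[P i]_(x in O `&` half k t) (f x)%:E = p%:E)%E,
    (\int[M i]_(x in O `&` half k t) (f x)%:E = m%:E)%E &
    (\int[leb]_(x in E `&` half k t) (partial i f x)%:E =
      (- (p - m) + (k == i)%:R * \int[tau]_y f (setc k t y))%:E)%E].
Proof.
move=> tauE tf; have [cK KO] := tf.2; set K := closure _ in cK KO.
have [d d0 dO] := compact_thicken cK oO KO.
have d40 : 0 < d / 4 by rewrite divr_gt0.
set U := thicken K (d / 4); set W := thicken K (d / 4 + d / 4).
have oU : open U by exact: open_thicken.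
have oW : open W by exact: open_thicken.
have rW : rel_compact_in O W.
  apply: rel_compact_thicken => //; first exact: addr_gt0.
  by rewrite (_ : _ + _ = d)//; lra.
have WO := rel_compact_in_subO rW.
have KU : K `<=` U by exact: sub_thicken.
have tU : test_function U f by split; [exact: tf.1|split].
have tdU := test_function_partial i tU.
have f0 x : ~ U x -> f x = 0 by exact: test_function_out.
have df0 x : ~ U x -> partial i f x = 0 by exact: test_function_out.
have UsubW : U `<=` W by apply: thicken_le; rewrite lerDl ltW.
have mW : measurable (W : set B) by exact: open_measurable_rV.
have mO : measurable (O : set B) by exact: open_measurable_rV.
have mH := measurable_half k t.
have [lP lM] := gE.1 i.
have [PV PVE] := finite_measure_restr mW (rc_finite lP mW rW).
have [MV MVE] := finite_measure_restr mW (rc_finite lM mW rW).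
have mEW : measurable (E `&` W) by exact: measurableI.
have fEW : (leb (E `&` W) < +oo)%E by apply: le_lt_trans fE; apply: le_measure; rewrite ?inE.
have [EV EVE] := finite_measure_restr mEW fEW.
have [EL ELE] := finite_measure_restr mE fE.
have bf := bmeas_test tf; have bdf := bmeas_test tdU.
have b1 : bmeas (\1_(half k t) : B -> R) by exact: bmeas_indic.
pose g x : R := \1_(half k t) x * f x.
have bg : bmeas (g : B -> R) by exact: bmeasM.
have gU x : ~ U x -> g x = 0 by move=> Ux; rewrite /g f0// mulr0.
have shift_cvg (x : V) (s : R) : x - (s * u_ j) *: e_ i @[j --> \oo] --> x.
  rewrite -[X in _ --> X](_ : x - (s * 0) *: e_ i = x); last by rewrite mulr0 scale0r subr0.
  apply: cvgB; first exact: cvg_cst.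
  by apply: cvgZl; apply: cvgM => //; exact: cvg_cst.
have fcvg (h : V -> R) (x : V) s : continuous h -> h (x - (s * u_ j) *: e_ i) @[j --> \oo] --> h x.
  by move=> ch; exact: (cvg_comp _ _ (shift_cvg x s) (ch x)).
have gc (x : V) (s : R) : 0 <= s -> g (x - (s * u_ j) *: e_ i) @[j --> \oo] --> g x.
  move=> s0; have c1 : \1_(half k t) x * f (x - (s * u_ j) *: e_ i) @[j --> \oo] --> g x.
    apply: cvgM; first exact: cvg_cst.
    by apply: fcvg; exact: test_function_continuous tf.
  apply: cvg_trans c1; apply: near_eq_cvg; near=> j; rewrite /g; congr (_ * _).
  by apply/esym; near: j; exact: half_cvg.
have near_small : \forall j \near \oo, u_ j < d / 4 by exact: (cvgr_lt _ uc).
pose X j := (u_ j)^-1 * (\int[EV]_x g ((x : V) - u_ j *: e_ i) - \int[EV]_x g x).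
have Xc : X j @[j --> \oo] --> \int[PV]_x g x - \int[MV]_x g x.
  have c12 : \int[lam]_s \int[PV]_x g (sweep i (u_ j) (s, x)) -
      \int[lam]_s \int[MV]_x g (sweep i (u_ j) (s, x)) @[j --> \oo] -->
      \int[PV]_x g x - \int[MV]_x g x.
    exact: cvgB (@sweep_cvg PV _ i u_ bg u0 gc) (@sweep_cvg MV _ i u_ bg u0 gc).
  apply: cvg_trans c12; apply: near_eq_cvg; near=> j.
  have UW x s : U x -> 0 <= s <= 1 -> W (x + (s * u_ j) *: e_ i).
    move=> Ux /andP[s0 s1]; apply: thicken_add => //.
    apply: le_lt_trans (norm_delta_mx _ _) _; (rewrite ger0_norm; last by rewrite mulr_ge0// ltW).
    apply: (@le_lt_trans _ _ (u_ j)); first by rewrite ler_piMl// ltW.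
    by near: j.
  have := @sweep_identity_fun _ _ O E (P i) (M i) i (u_ j) U W PV MV EV (ltW (u0 j)) mE oU oW WO
    UW PVE MVE EVE (gE.2 i) g bg gU.
  move=> H; rewrite /X; apply: (mulfI (lt0r_neq0 (u0 j))).
  rewrite [RHS]mulrA mulfV ?mul1r; last exact: lt0r_neq0.
  by rewrite /= mulrBr; move: H; lra.
pose D j (x : V) : R := (u_ j)^-1 * (f (x - u_ j *: e_ i) - f x).
have DE j x : D j x = - \int[lam]_s partial i f (x - (s * u_ j) *: e_ i).
  by rewrite /D (shift_ftc i (u_ j) x tf) mulrA mulrN mulVf ?mulN1r// lt0r_neq0.
have bD j : bmeas (D j : B -> R).
  by apply: bmeasM; [exact: bmeas_cst|apply: bmeasB => //; exact: bmeas_shift].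
have [C' C'0 dC] := test_function_bounded tdU.
have bsw j x := bmeas_pair2 (bmeas_sweep i (u_ j) bdf) x.
have Dle j x : `|D j x| <= C'.
  rewrite DE normrN -[leRHS]mulr1 -[X in _ * X]/(fine 1%E) -(unit_measureT R).
  by apply: bmeas_norm_le => //; exact: bsw.
have Dc x : D j x @[j --> \oo] --> - partial i f x.
  rewrite (_ : (fun j : nat => D j x) = (fun j : nat => - \int[lam]_s partial i f (x - (s * u_ j) *: e_ i))); last first.
    by apply/funext => j; rewrite DE.
  apply: cvgN; have -> : partial i f x = \int[lam]_s partial i f x.
    by rewrite Rintegral_cst// [X in _ * fine X](unit_measureT R) mulr1.
  apply: (@bmeas_dominated_convergence _ _ _ lam _ _ C') => //.
  - by move=> j; case: (bsw j x).
  - by move=> s; apply: fcvg; exact: test_function_continuous tdU.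
(* The remainder in the discrete Leibniz rule. The difference of the two indicators is the indicator
   of a strip of width [u_ j] when [i = k]. *)
pose Z j := (u_ j)^-1 * \int[EV]_x ((\1_(half k t) ((x : V) - u_ j *: e_ i) - \1_(half k t) x) *
  f ((x : V) - u_ j *: e_ i)).
have b1s j : bmeas (fun x : B => \1_(half k t) ((x : V) - u_ j *: e_ i) : R).
  exact: (bmeas_shift i (u_ j) b1).
have bfs j : bmeas (fun x : B => f ((x : V) - u_ j *: e_ i)) by exact: bmeas_shift.
have bgs j : bmeas (fun x : B => g ((x : V) - u_ j *: e_ i)) by exact: bmeas_shift.
have XYZ j : X j = \int[EV]_x (\1_(half k t) x * D j x) + Z j.
  rewrite /X /Z -bmeas_RintegralB// -!bmeas_RintegralZl; last 2 first.
  - by apply: bmeasM => //; exact: bmeasB.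
  - exact: bmeasB.
  rewrite -bmeas_RintegralD; last 2 first.
  - exact: bmeasM.
  - by apply: bmeasM; [exact: bmeas_cst|apply: bmeasM => //; exact: bmeasB].
  by apply: eq_Rintegral => x _; rewrite /g /D; lra.
have Yc : \int[EV]_x (\1_(half k t) x * D j x) @[j --> \oo] -->
    \int[EV]_x (\1_(half k t) x * - partial i f x).
  apply: (@bmeas_dominated_convergence _ _ _ EV _ _ C').
  - by move=> j; case: (bmeasM b1 (bD j)).
  - by case: (bmeasM b1 (bmeasN bdf)).
  - move=> j x; rewrite normrM -[leRHS]mul1r ler_pM// indicE.
    by case: (_ \in _); rewrite ?normr1 ?normr0.
  - by move=> x; apply: cvgM; [exact: cvg_cst|exact: Dc].
have Zc : Z j @[j --> \oo] --> (k == i)%:R * \int[tau]_y f (setc k t y).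
  have [ki|ki] := eqVneq k i; last first.
    rewrite mul0r (_ : Z = fun=> 0); first exact: cvg_cst.
    apply/funext => j; rewrite /Z (_ : \int[EV]_x _ = \int[EV]_x 0); last first.
      apply: eq_Rintegral => x _; rewrite (_ : \1_(half k t) (_ - _) = \1_(half k t) x) ?subrr ?mul0r//.
      rewrite !indicE; congr (_%:R); congr nat_of_bool; apply/idP/idP => /set_mem h; apply/mem_set.
        by move/half_shift: h; rewrite (negbTE ki) mulr0 subr0.
      by apply/half_shift; rewrite (negbTE ki) mulr0 subr0.
    by rewrite Rintegral_cst// mul0r mulr0.
  rewrite mul1r.
  have [C _ fC] := test_function_bounded tf.
  have [L L0 lip] := test_function_lipschitz k tf.
  have c1 := trace_cvg tauE ELE bf fC L0 lip.
  apply: cvg_trans c1; apply: near_eq_cvg; near=> j; rewrite /Z -ki; congr (_ * _).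
  have stripE (x : V) : \1_(half k t) (x - u_ j *: e_ k) - \1_(half k t) x =
      \1_(strip k t (u_ j)) x :> R.
    have e1 : (x - u_ j *: e_ k \in half k t) = (x ord0 k - u_ j <= t).
      apply/idP/idP => [/set_mem/half_shift|h]; first by rewrite eqxx mulr1.
      by apply/mem_set/half_shift; rewrite eqxx mulr1.
    have e2 : (x \in half k t) = (x ord0 k <= t) by apply/idP/idP => [/set_mem|h]//; exact/mem_set.
    have e3 : (x \in strip k t (u_ j)) = (t < x ord0 k <= t + u_ j).
      by apply/idP/idP => [/set_mem|h]//; exact/mem_set.
    rewrite !indicE e1 e2 e3 lerBlDr; have := u0 j.
    by case: (leP (x ord0 k) t) => h1; case: (leP (x ord0 k) (t + u_ j)) => h2 //=; rewrite ?subrr ?subr0// => u1; exfalso; lra.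
  under [RHS]eq_Rintegral do rewrite stripE.
  apply: EFin_inj; have bb : bmeas (fun x : B => \1_(strip k t (u_ j)) x * f ((x : V) - u_ j *: e_ k)).
    apply: bmeasM; first by apply: bmeas_indic; exact: measurable_strip.
    exact: bmeas_shift.
  rewrite !bmeas_RintegralE// (integral_restr mE ELE); last by apply/measurable_EFinP; case: bb.
  rewrite (integral_restr mEW EVE); last by apply/measurable_EFinP; case: bb.
  apply/esym; apply: integral_support => // x Ex EWx; rewrite f0 ?mulr0// => Ux; apply: EWx; split => //.
  rewrite -(subrK (u_ j *: e_ k) x); apply: thicken_add => //.
  apply: le_lt_trans (norm_delta_mx _ _) _; rewrite ger0_norm ?ltW//.
  by near: j.
have Xc' : X j @[j --> \oo] --> \int[EV]_x (\1_(half k t) x * - partial i f x) +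
    (k == i)%:R * \int[tau]_y f (setc k t y).
  rewrite (_ : (fun j : nat => X j) = (fun j : nat => \int[EV]_x (\1_(half k t) x * D j x) + Z j)); last exact/funext.
  exact: cvgD.
have key : \int[PV]_x g x - \int[MV]_x g x = \int[EV]_x (\1_(half k t) x * - partial i f x) +
    (k == i)%:R * \int[tau]_y f (setc k t y).
  exact: (cvg_unique (@Rhausdorff R) Xc Xc').
exists (\int[PV]_x g x), (\int[MV]_x g x); split.
- rewrite (bmeas_RintegralE PV bg) (integral_restr_on (X := (setI O (half k t) : set B)) mW mH PVE)//.
  + by case: bf.
  + by move=> x [Hx Wx]; split => //; exact: WO.
  + by move=> x [_ Hx] HW; apply: f0 => /UsubW Wx; exact: HW.
- rewrite (bmeas_RintegralE MV bg) (integral_restr_on (X := (setI O (half k t) : set B)) mW mH MVE)//.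
  + by case: bf.
  + by move=> x [Hx Wx]; split => //; exact: WO.
  + by move=> x [_ Hx] HW; apply: f0 => /UsubW Wx; exact: HW.
rewrite -(integral_restr_on (X := (setI E (half k t) : set B)) mEW mH EVE); last 3 first.
- by case: bdf.
- by move=> x [Hx [Ex _]].
- by move=> x [Ex Hx] HW; apply: df0 => /UsubW Wx; exact: HW.
have b1d : bmeas (fun x : B => \1_(half k t) x * partial i f x) by exact: bmeasM.
rewrite -(bmeas_RintegralE EV b1d); congr (_%:E).
have -> : \int[EV]_x (\1_(half k t) x * partial i f x) = - \int[EV]_x (\1_(half k t) x * - partial i f x).
  rewrite -mulN1r -bmeas_RintegralZl; last by apply: bmeasM => //; exact: bmeasN.
  by apply: eq_Rintegral => x _; rewrite mulrN mulN1r opprK.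
by move: key; lra.
Unshelve. all: by end_near. Qed.

End cut.

(** * Gradients of sets cut at good heights *)

Section cut_gradient.
Variables (R : realType) (n : nat).
Local Notation V := 'rV[R]_n.
Local Notation B := (borelRn R n).
Local Notation leb := (lebesgue_rV R n).
Local Notation meas := {measure set B -> \bar R}.

Lemma locally_finite_fin (O : set V) (m : {finite_measure set B -> \bar R}) : locally_finite O m.
Proof.
move=> K cK KO; rewrite ltey_eq fin_num_measure//.
exact: compact_measurable_rV.
Qed.

(** The trace is charged to only one of the two measures, and only in the direction [k]; the flag
    [c] covers both cases. *)
Lemma add_restr_measure (O : set V) (P : meas) (s : {finite_measure set B -> \bar R})
    (H : set B) (c : bool) : open O -> locally_finite O P -> measurable H ->
  exists P' : meas, [/\ forall A, (P' A = P (A `&` H) + (if c then s A else 0))%E,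
    locally_finite O P' &
    forall f p, test_function O f -> (\int[P]_(x in setI O H) (f x)%:E = p%:E)%E ->
      (\int[P']_(x in (O : set B)) (f x)%:E = (p + c%:R * \int[s]_x f x)%:E)%E].
Proof.
move=> oO lP mH; pose Q : meas := mrestr P mH.
have mO : measurable (O : set B) by exact: open_measurable_rV.
have lQ : locally_finite O Q.
  move=> K cK KO; apply: le_lt_trans (lP K cK KO).
  by apply: le_measure; rewrite ?inE; [apply: measurableI|..]; do ?exact: compact_measurable_rV.
have QI f p : test_function O f -> (\int[P]_(x in setI O H) (f x)%:E = p%:E ->
    \int[Q]_(x in (O : set B)) (f x)%:E = p%:E)%E.
  move=> tf <-; rewrite integral_mrestr//.
  by apply: measurable_funTS; apply/measurable_EFinP; case: (bmeas_test tf).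
case: c; last first.
  exists Q; split => // [A|f p tf fp]; first by rewrite adde0.
  by rewrite mul0r addr0 (QI f p).
exists (measure_add Q s); split => [A|K cK KO|f p tf fp].
- exact: measure_addE.
- rewrite [ltLHS]measure_addE lte_add_pinfty//; first exact: lQ.
  exact: locally_finite_fin KO.
have bf := bmeas_test tf.
have i1 := test_function_integrable oO lQ tf.
have i2 := test_function_integrable oO (@locally_finite_fin O s) tf.
rewrite mul1r; apply: (etrans (integral_measure_add mO i1 i2)) => /=.
rewrite (QI _ _ tf fp) EFinD (bmeas_RintegralE s bf); congr (_ + _)%E.
apply: integral_support => // x _ Ox.
by rewrite (test_function_out tf Ox).
Qed.

Definition side (k : 'I_n) (t : R) (b : bool) : set B := if b then half k t else ~` half k t.

Lemma measurable_side k t b : measurable (side k t b).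
Proof. by case: b; [|apply: measurableC]; exact: measurable_half. Qed.

Lemma integral_split (m : meas) (X H : set B) (f : V -> R) : measurable X -> measurable H ->
  measurable_fun setT (f : B -> R) ->
  (\int[m]_(x in X) (f x)%:E = \int[m]_(x in X `&` H) (f x)%:E + \int[m]_(x in X `&` ~` H) (f x)%:E)%E.
Proof.
move=> mX mH mf; rewrite -integral_setU.
- by rewrite -setIUr setUv setIT.
- exact: measurableI.
- by apply: measurableI => //; exact: measurableC.
- by apply: measurable_funTS; exact/measurable_EFinP.
- by apply/disj_setPS => x [[_ Hx] [_ Hx']].
Qed.

(** Through an upper face the indicator drops, so the trace goes to [M k]; through a lower face it
    rises, so the trace goes to [P k]. The part above the hyperplane is handled by subtracting
    [cut_identity] from the identity for [E]. *)
Lemma grad_cut (O : set V) (E : set B) (P M : 'I_n -> meas) (k : 'I_n) (t : R) (u_ : nat -> R)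
    (sg : {finite_measure set B -> \bar R}) (b : bool) :
  open O -> (exists r, forall x, O x -> `|x : V| <= r) -> measurable E -> E `<=` O ->
  grad O E P M -> (forall j, 0 < u_ j) -> u_ j @[j --> \oo] --> 0 ->
  slice_osc k E (u_ j) t @[j --> \oo] --> 0%E ->
  (forall A : set B, sg A = leb ((setc k t : B -> B) @^-1` A `&` (slab k `&` (setc k t : B -> B) @^-1` E))) ->
  exists P' M' : 'I_n -> meas, [/\ grad O (E `&` side k t b) P' M',
    forall i A, (P' i A = P i (A `&` side k t b) + (if ~~ b && (k == i) then sg A else 0))%E &
    forall i A, (M' i A = M i (A `&` side k t b) + (if b && (k == i) then sg A else 0))%E].
Proof.
move=> oO bO mE EO gE u0 uc osc sgE.
have mH := measurable_half k t; have mS := measurable_side k t b.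
have mO : measurable (O : set B) by exact: open_measurable_rV.
have exP i := add_restr_measure sg (~~ b && (k == i)) oO (gE.1 i).1 mS.
have exM i := add_restr_measure sg (b && (k == i)) oO (gE.1 i).2 mS.
have [P' P'P] := choice exP; have [M' M'P] := choice exM.
exists P', M'; split; last 2 first.
- by move=> i A; have [-> _ _] := P'P i.
- by move=> i A; have [-> _ _] := M'P i.
split => [i|i f tf]; first by have [_ ? _] := P'P i; have [_ ? _] := M'P i.
have [_ _ PI] := P'P i; have [_ _ MI] := M'P i.
pose T := slab k `&` (setc k t : B -> B) @^-1` E.
have mT : measurable T.
  by apply: measurableI; [exact: measurable_slab|exact: measurable_setT_preimage (measurable_setc1 k t) mE].
have mst := measurable_setc1 k t.
have fT : (leb T < +oo)%E by exact: lebesgue_slice_lty bO mE EO.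
have [tau tauE] := finite_measure_restr mT fT.
have bf := bmeas_test tf; have bdf := bmeas_test (test_function_partial i tf).
have sgf : \int[sg]_x f x = \int[tau]_y f (setc k t y).
  have [q [qE qI]] := exists_finite_pushforward tau mst.
  rewrite -qI; last by case: bf.
  by rewrite /Rintegral; congr fine; apply: eq_measure_integral => A mA _; exact: (etrans (sgE A) (esym (etrans (qE A) (tauE _)))).
have [p [m [pE mE' idE]]] := cut_identity oO bO mE EO gE u0 uc osc i tauE tf.
rewrite -sgf in idE; set c := \int[sg]_x f x in idE *.
case: b mS exP exM P' M' P'P M'P PI MI => /= mS exP exM P' M' P'P M'P PI MI.
  rewrite (PI f p tf pE) (MI f m tf mE') idE -EFinB -EFinN /= mul0r addr0.
  by congr (_%:E); case: (k == i) => /=; rewrite ?mulr0n ?mulr1n ?mul1r ?mul0r ?addr0; ring.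
have fP := @test_function_integrable _ _ O (P i) f oO (gE.1 i).1 tf.
have fM := @test_function_integrable _ _ O (M i) f oO (gE.1 i).2 tf.
have := gE.2 i f tf.
have iP : (\int[P i]_(x in (O : set B)) (f x)%:E \is a fin_num)%E by exact: integrable_fin_num fP.
have iM : (\int[M i]_(x in (O : set B)) (f x)%:E \is a fin_num)%E by exact: integrable_fin_num fM.
have sub (a : R) (y z : \bar R) : z \is a fin_num -> z = (a%:E + y)%E -> y = (fine z - a)%:E.
  by case: z => // z _; case: y => // y [->]; rewrite /= addrAC subrr add0r.
have mf := bf.1.
have sP := sub p _ _ iP (etrans (integral_split (P i) mO mH mf) (congr1 (adde^~ _) pE)).
have sM := sub m _ _ iM (etrans (integral_split (M i) mO mH mf) (congr1 (adde^~ _) mE')).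
rewrite -(fineK iP) -(fineK iM) -EFinB -EFinN => gEf.
have sE := sub _ _ _ (erefl : (_%:E \is a fin_num) = true) (etrans (esym gEf) (etrans (integral_split leb mE mH bdf.1) (congr1 (adde^~ _) idE))).
rewrite [LHS]sE (PI f _ tf sP) (MI f _ tf sM) -EFinB -EFinN /= mul0r addr0.
by congr (_%:E) => /=; case: (k == i) => /=; rewrite ?mulr0n ?mulr1n ?mul1r ?mul0r ?addr0; ring.
Qed.

Lemma exists_trace (O : set V) (E : set B) (k : 'I_n) (t : R) :
  (exists r, forall x, O x -> `|x : V| <= r) -> measurable E -> E `<=` O ->
  exists sg : {finite_measure set B -> \bar R}, forall A : set B,
  sg A = leb ((setc k t : B -> B) @^-1` A `&` (slab k `&` (setc k t : B -> B) @^-1` E)).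
Proof.
move=> bO mE EO; have mT : measurable (slab k `&` (setc k t : B -> B) @^-1` E).
  by apply: measurableI; [exact: measurable_slab|exact: measurable_setT_preimage (measurable_setc1 k t) mE].
have [tau tauE] := finite_measure_restr mT (lebesgue_slice_lty k t bO mE EO).
have [q [qE _]] := exists_finite_pushforward tau (measurable_setc1 k t).
by exists q => A; exact: etrans (qE A) (tauE _).
Qed.

(* [sum_E trace] is the total trace on the hyperplane [x_k = t]; by Fubini its integral in [t]
   is the total volume. *)
Lemma exists_good_cut (I : finType) (p : pred I) (O Q : set V) (E : I -> set B) (k : 'I_n) (a b L : R) :
  open O -> (exists r, forall x, O x -> `|x : V| <= r) -> measurable (Q : set B) ->
  (forall l, measurable (E l) /\ E l `<=` O) -> 0 < L -> 0 < b ->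
  (\sum_(l | p l) leb (Q `&` E l) <= b%:E)%E ->
  exists2 t, a < t < a + L &
  (forall l, exists2 u_ : nat -> R, (forall j, 0 < u_ j) /\ u_ j @[j --> \oo] --> 0 &
     slice_osc k (E l) (u_ j) t @[j --> \oo] --> 0%E) /\
  (\sum_(l | p l) leb ((setc k t : B -> B) @^-1` Q `&` (slab k `&` (setc k t : B -> B) @^-1` E l)) <=
    (2 * b / L)%:E)%E.
Proof.
move=> oO bO mQ mE L0 b0 sumb.
have fO : (leb O < +oo)%E.
  by have [r Or] := bO; apply: (@lebesgue_bounded _ _ _ r) => //; exact: open_measurable_rV.
pose g l t := leb ((setc k t : B -> B) @^-1` Q `&` (slab k `&` (setc k t : B -> B) @^-1` E l)).
pose S l := [set p : measurableTypeR R * B | slab k p.2 /\ (Q `&` E l) (setc k (0 + p.1) p.2)].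
have mS l : measurable (S l).
  apply: measurableI; first by apply: (measurable_setT_preimage measurable_snd); exact: measurable_slab.
  apply: (measurable_setT_preimage (measurable_setc k 0)).
  by apply: measurableI => //; case: (mE l).
have gE l t : g l t = (leb \o xsection (S l)) t.
  rewrite /g /=; congr (leb _); apply/seteqP; split => y; rewrite /xsection/= inE /S/= add0r.
    by move=> [? [? ?]].
  by move=> [? [? ?]].
have mg l : measurable_fun setT (g l : measurableTypeR R -> \bar R).
  by rewrite (_ : g l = leb \o xsection (S l)); [exact: measurable_fun_xsection|apply/funext => t; exact: gE].
have Ig l : (\int[@lebesgue_measure R]_t g l t = leb (Q `&` E l))%E.
  rewrite (lebesgue_slice k 0); last by apply: measurableI => //; case: (mE l).
  by apply: eq_integral => t _; rewrite gE.
pose G t := (\sum_(l | p l) g l t)%E.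
have G0 t : (0 <= G t)%E by apply: sume_ge0.
have mG : measurable_fun setT (G : measurableTypeR R -> \bar R).
  rewrite (_ : G = fun t => \sum_(l <- [seq l <- index_enum I | p l]) g l t)%E; last first.
    by apply/funext => t; rewrite big_filter.
  exact: emeasurable_sum.
have IG : (\int[@lebesgue_measure R]_t G t <= b%:E)%E.
  rewrite (_ : G = fun t => \sum_(l <- [seq l <- index_enum I | p l]) g l t)%E; last first.
    by apply/funext => t; rewrite big_filter.
  rewrite ge0_integral_sum//; apply: le_trans sumb; rewrite big_filter.
  by rewrite le_eqVlt; apply/orP; left; apply/eqP; apply: eq_bigr => l _; rewrite Ig.
have good : {ae @lebesgue_measure R, forall t, forall l, exists2 u_ : nat -> R,
    (forall j, 0 < u_ j) /\ u_ j @[j --> \oo] --> 0 &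
     slice_osc k (E l) (u_ j) t @[j --> \oo] --> 0%E}.
  apply: filter_forall => l; have [u [ub uae]] := ae_good_slices k (mE l).1 oO fO (mE l).2.
  apply: (@filterS _ _ (ae_filter_ringOfSetsType (@lebesgue_measure R)) _ _ _ uae) => t ut; exists u => //; split => [j|]; first by have /andP[] := ub j.
  apply: (@squeeze_cvgr _ _ _ _ (fun=> 0) (fun j => j.+1%:R^-1)).
  - by apply: nearW => j; have /andP[u1 u2] := ub j; rewrite ltW.
  - exact: cvg_cst.
  - exact: cvg_harmonic.
(* If no height would do, the total trace would be at least [2 * b / L] almost everywhere on an
   interval of length [L], and its integral at least [2 * b], which exceeds [b]. *)
apply: contrapT => no.
have bad : {ae @lebesgue_measure R, forall t, (`]a, (a + L)[%classic : set R) t -> ((2 * b / L)%:E <= G t)%E}.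
  apply: (@filterS _ _ (ae_filter_ringOfSetsType (@lebesgue_measure R)) _ _ _ good) => t gt; rewrite /= in_itv/= => ta; rewrite leNgt; apply/negP => Gt; apply: no.
  by exists t => //; split => //; exact: ltW.
have mI : measurable (`]a, (a + L)[%classic : set (measurableTypeR R)) by exact: measurable_itv.
have L2 : 0 <= 2 * b / L by rewrite divr_ge0 ?mulr_ge0// ltW.
have h1 : (\int[@lebesgue_measure R]_(t in `]a, (a + L)%R[) (2 * b / L)%:E <= b%:E)%E.
  apply: le_trans IG; apply: (@le_trans _ _ (\int[@lebesgue_measure R]_(t in `]a, (a + L)%R[) G t)%E).
    by apply: ae_ge0_le_integral => //; exact: measurable_funTS.
  exact: ge0_subset_integral.
move: h1; rewrite integral_cst//= lebesgue_measure_itv/= lte_fin ltrDl L0 -EFinB -EFinM lee_fin.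
rewrite (_ : a + L - a = L) ?divfK ?gt_eqF//; last by lra.
lra.
Qed.

End cut_gradient.

(** * Cutting by a cube *)

Section box_cut.
Variables (R : realType) (n : nat).
Local Notation V := 'rV[R]_n.
Local Notation B := (borelRn R n).
Local Notation leb := (lebesgue_rV R n).
Local Notation meas := {measure set B -> \bar R}.

(** One face of a cube. A cube is the intersection over the list of all [2 * n] pairs, which allows
    an induction on the faces. *)
Definition hspace (c : V) (kb : 'I_n * bool) (r : R) : set V :=
  [set x | if kb.2 then x ord0 kb.1 - c ord0 kb.1 <= r else c ord0 kb.1 - x ord0 kb.1 <= r].

Definition hspaces (c : V) (st : seq ('I_n * bool)) (r : R) : set V :=
  [set x | forall kb, kb \in st -> hspace c kb r x].

Variables (I : finType) (p : pred I) (O : set V) (E : I -> set B) (P M : I -> 'I_n -> meas).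
Variables (c : V) (Q : set B) (rho s b : R).
Hypotheses (oO : open O) (bO : exists r, forall x, O x -> `|x : V| <= r).
Hypotheses (mE : forall l, measurable (E l) /\ E l `<=` O).
Hypothesis gE : forall l, grad O (E l) (P l) (M l).
Hypotheses (mQ : measurable Q) (s0 : 0 < s) (b0 : 0 < b).
Hypothesis sumb : (\sum_(l | p l) leb (Q `&` E l) <= b%:E)%E.

(** The faces are cut one after the other, at heights common to all the [E l], since
    [exists_good_cut] controls the sum of the traces over [p]. [Sp] and [Sm] collect the traces; a
    later cut restricts the earlier ones and only lowers their mass. That they vanish off the outer
    cube will localize the cost of a competitor in [Q]. *)
Lemma box_cut (st : seq ('I_n * bool)) :
  exists (X : set B) (P' M' : I -> 'I_n -> meas) (Sp Sm : I -> 'I_n -> {finite_measure set B -> \bar R}),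
  [/\ measurable X /\ (hspaces c st rho `<=` X /\ X `<=` hspaces c st (rho + s)),
    forall l, grad O (E l `&` X) (P' l) (M' l),
    forall l i A, (P' l i A = P l i (A `&` X) + Sp l i A)%E /\ (M' l i A = M l i (A `&` X) + Sm l i A)%E,
    forall l i A, A `&` hspaces c st (rho + s) = set0 -> Sp l i A = 0%E /\ Sm l i A = 0%E &
    (\sum_(l | p l) \sum_(i < n) (Sp l i Q + Sm l i Q) <= ((size st)%:R * (2 * b / s))%:E)%E].
Proof.
elim: st => [|[k bb] st [X [P' [M' [Sp [Sm [[mX [inX Xout]] gX PM S0 Stot]]]]]]].
  have [z zE] : exists z : {finite_measure set B -> \bar R}, forall A, z A = 0%E.
    by have [z zE] := finite_measure_restr (m := mzero : meas) measurableT (ltry 0); exists z => A; rewrite zE.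
  exists setT, P, M, (fun _ _ => z), (fun _ _ => z); split => //.
  - by move=> l; rewrite setIT.
  - by move=> l i A; rewrite setIT zE !adde0.
  - by rewrite mul0r big1// => l _; rewrite big1// => i _; rewrite zE adde0.
have mEX l : measurable (E l `&` X) /\ E l `&` X `<=` O.
  by split; [apply: measurableI => //; case: (mE l)|move=> x [/(mE l).2]].
have sumb' : (\sum_(l | p l) leb (Q `&` (E l `&` X)) <= b%:E)%E.
  apply: le_trans sumb; apply: lee_sum => l _; apply: le_measure; rewrite ?inE.
  - by apply: measurableI => //; case: (mEX l).
  - by apply: measurableI => //; case: (mE l).
  - by move=> x [Qx []].
pose a := if bb then c ord0 k + rho else c ord0 k - rho - s.
have [t /andP[ta tL] [tgood ttot]] := exists_good_cut k a oO bO mQ mEX s0 b0 sumb'.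
have [sg sgE] := choice (fun l => exists_trace k t bO (mEX l).1 (mEX l).2).
have ex l := let: ex_intro2 u (conj u0 uc) osc := tgood l in
  grad_cut bb oO bO (mEX l).1 (mEX l).2 (gX l) u0 uc osc (sgE l).
have [P2 ex2] := choice ex; have {ex2} [M2 PM2] := choice ex2.
have mH := measurable_side k t bb.
pose T l i (d : bool) (S : {finite_measure set B -> \bar R}) :=
  exists S' : {finite_measure set B -> \bar R}, forall A, (S' A = S (A `&` side k t bb) + (if d && (k == i) then sg l A else 0))%E.
have exS l i d S : T l i d S.
  have [S' [S'E _ _]] := add_restr_measure (sg l) (d && (k == i)) oO (@locally_finite_fin _ _ O S) mH.
  have fS' : (S' setT < +oo)%E.
    rewrite S'E setTI lte_add_pinfty//; first by rewrite ltey_eq fin_num_measure.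
    by case: ifP => _; rewrite ?ltry// ltey_eq fin_num_measure.
  have [S2 S2E] := finite_measure_restr measurableT fS'.
  by exists S2 => A; rewrite S2E setIT S'E.
pose Sp2 l i := sval (cid (exS l i (~~ bb) (Sp l i))).
pose Sm2 l i := sval (cid (exS l i bb (Sm l i))).
have Sp2E l i A : (Sp2 l i A = Sp l i (A `&` side k t bb) + (if ~~ bb && (k == i) then sg l A else 0))%E.
  exact: (svalP (cid (exS l i (~~ bb) (Sp l i)))).
have Sm2E l i A : (Sm2 l i A = Sm l i (A `&` side k t bb) + (if bb && (k == i) then sg l A else 0))%E.
  exact: (svalP (cid (exS l i bb (Sm l i)))).
have sideE (x : V) : side k t bb x <-> if bb then x ord0 k <= t else t < x ord0 k.
  rewrite /side /half; case: bb {a ta tL ex P2 M2 PM2 mH T exS Sp2 Sm2 Sp2E Sm2E} => //=.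
  by rewrite ltNge; split => /negP.
have in1 : hspace c (k, bb) rho `<=` side k t bb.
  move=> x; rewrite /hspace/= => hx; apply/sideE; move: ta tL hx; rewrite /a.
  by case: (bb) => *; lra.
have out1 : side k t bb `<=` hspace c (k, bb) (rho + s).
  move=> x /sideE; rewrite /hspace/=; move: ta tL; rewrite /a.
  by case: (bb) => *; lra.
have hcons r : hspaces c ((k, bb) :: st) r = hspace c (k, bb) r `&` hspaces c st r.
  apply/seteqP; split => x.
    by move=> h; split => [|kb kbst]; apply: h; rewrite inE ?eqxx// kbst orbT.
  by move=> [h1 h2] kb; rewrite inE => /orP[/eqP ->//|]; exact: h2.
exists (X `&` side k t bb), P2, M2, Sp2, Sm2; split.
- split; first exact: measurableI.
  by rewrite !hcons; split => x [? ?]; split; [exact: inX|exact: in1|exact: out1|exact: Xout].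
- by move=> l; rewrite setIA; case: (PM2 l).
- move=> l i A; have [_ E1 E2] := PM2 l.
  rewrite E1 E2 Sp2E Sm2E (PM l i _).1 (PM l i _).2 -!addeA.
  by rewrite -!setIA [side _ _ _ `&` X]setIC.
- move=> l i A; rewrite hcons => A0.
  have A1 : (A `&` side k t bb) `&` hspaces c st (rho + s) = set0.
    by apply/seteqP; split => // x [[Ax Sx] hx]; rewrite -A0; split => //; split => //; exact: out1.
  have sg0 : sg l A = 0%E.
    rewrite sgE (_ : _ `&` _ = set0) ?measure0//; apply/seteqP; split => // y [Ay [_ [_ Xy]]].
    suff : (A `&` (hspace c (k, bb) (rho + s) `&` hspaces c st (rho + s))) (setc k t y) by rewrite A0.
    split; first exact: Ay.
    split; last exact: Xout.
    rewrite /hspace/= setc_coord; move: ta tL; rewrite /a.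
    by case: (bb) => *; lra.
  rewrite Sp2E Sm2E (S0 l i _ A1).1 (S0 l i _ A1).2 sg0.
  by split; case: ifP; rewrite adde0.
rewrite [size _]/= -natr1 mulrDl mul1r EFinD.
have H l : (\sum_(i < n) (Sp2 l i Q + Sm2 l i Q) <= \sum_(i < n) (Sp l i Q + Sm l i Q) + sg l Q)%E.
  have sgk : sg l Q = (\sum_(i < n) (if k == i then sg l Q else 0))%E.
    by rewrite -big_mkcond/= (eq_bigl (pred1 k)) ?big_pred1_eq// => i; rewrite /= eq_sym.
  rewrite [X in (_ <= _ + X)%E]sgk -big_split/=; apply: lee_sum => i _.
  rewrite Sp2E Sm2E addeACA; apply: leeD.
    by apply: leeD; apply: le_measure; rewrite ?inE//; exact: measurableI.
  by case: (bb); case: (k == i); rewrite /= ?adde0 ?add0e.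
apply: (le_trans (lee_sum _ (fun l _ => H l))); rewrite big_split/=; apply: leeD => //.
by apply: le_trans ttot; apply: lee_sum => l _; rewrite sgE.
Qed.

End box_cut.

Lemma exists_sum_measure_integrable d (T : measurableType d) (R : realType) (I : Type) (s : seq I)
    (m : I -> {measure set T -> \bar R}) :
  exists q : {measure set T -> \bar R}, (forall A, q A = \sum_(i <- s) m i A)%E /\
    forall (D : set T) (f : T -> \bar R), measurable D -> (forall i, (m i).-integrable D f) ->
    (\int[q]_(x in D) f x = \sum_(i <- s) \int[m i]_(x in D) f x)%E.
Proof.
suff [q [qE [_ qI]]] : exists q : {measure set T -> \bar R}, (forall A, q A = \sum_(i <- s) m i A)%E /\
    (forall (D : set T) (f : T -> \bar R), measurable D -> (forall i, (m i).-integrable D f) ->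
     measurable_fun D f -> q.-integrable D f) /\
    forall (D : set T) (f : T -> \bar R), measurable D -> (forall i, (m i).-integrable D f) ->
    (\int[q]_(x in D) f x = \sum_(i <- s) \int[m i]_(x in D) f x)%E by exists q.
elim: s => [|i s [q [qE [qf qI]]]].
  exists mzero; split => [A|]; first by rewrite big_nil.
  split => [D f mD _ mf|D f mD _]; last by rewrite big_nil integral_measure_zero.
  by apply/integrableP; split => //; rewrite integral_measure_zero.
exists (measure_add (m i) q); split => [A|].
  by rewrite big_cons; apply: (etrans (measure_addE _ _ _)); rewrite qE.
split => [D f mD mif mf|D f mD mif].
  apply/integrableP; split => //; rewrite ge0_integral_measure_add//; last first.
    exact: measurableT_comp.
  apply: lte_add_pinfty; first by have /integrableP[] := mif i.
  by have /integrableP[] := qf D f mD mif mf.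
have mf : measurable_fun D f by have /integrableP[] := mif i.
by rewrite big_cons -qI// integral_measure_add//; exact: qf.
Qed.

(** * Gradients of signed combinations of indicators *)

Section signed_sums.
Variables (R : realType) (n : nat).
Local Notation V := 'rV[R]_n.
Local Notation B := (borelRn R n).
Local Notation leb := (lebesgue_rV R n).
Local Notation meas := {measure set B -> \bar R}.

(** A negative sign exchanges the two measures of a term. Differences, disjoint unions and
    complements of sets all reduce to such combinations, which need to hold only almost
    everywhere. *)
Lemma grad_signed_sum (J : Type) (r : seq J) (e : J -> bool) (O : set V) (F : J -> set B)
    (P M : J -> 'I_n -> meas) (E : set B) :
  open O -> measurable E -> (forall j, measurable (F j)) -> (forall j, grad O (F j) (P j) (M j)) ->
  {ae leb, forall x, \1_E x = \sum_(j <- r) (-1) ^+ (~~ e j) * \1_(F j) x :> R} ->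
  exists P' M', grad O E P' M' /\ forall A : set B, measurable A -> rel_compact_in O A ->
    gradm P' M' A = \sum_(j <- r) (-1) ^+ (~~ e j) *: gradm (P j) (M j) A.
Proof.
move=> oO mE mF gF ae.
have mO : measurable (O : set B) by exact: open_measurable_rV.
pose X j i : meas := if e j then P j i else M j i.
pose Y j i : meas := if e j then M j i else P j i.
have lfX j i : locally_finite O (X j i) by rewrite /X; case: (e j); case: ((gF j).1 i).
have lfY j i : locally_finite O (Y j i) by rewrite /Y; case: (e j); case: ((gF j).1 i).
have [P' P'E] := choice (fun i => exists_sum_measure_integrable r (X^~ i)).
have [M' M'E] := choice (fun i => exists_sum_measure_integrable r (Y^~ i)).
have lf (m : J -> meas) (q : meas) : (forall j, locally_finite O (m j)) ->
    (forall A, q A = \sum_(j <- r) m j A)%E -> locally_finite O q.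
  move=> lm qE K cK KO; rewrite qE; apply: lte_sum_pinfty => j _; exact: lm.
exists P', M'; split; last first.
  move=> A mA rA; apply/rowP => i; rewrite !mxE (P'E i).1 (M'E i).1 summxE.
  have fs (m : J -> meas) : (forall j, locally_finite O (m j)) ->
      fine (\sum_(j <- r) m j A)%E = \sum_(j <- r) fine (m j A).
    move=> lm; rewrite (eq_bigr (fun j => (fine (m j A))%:E)) ?sumEFin// => j _.
    by rewrite fineK//; exact: rc_fin_num (lm j) mA rA.
  rewrite !fs// -sumrB; apply: eq_bigr => j _; rewrite !mxE /X /Y.
  by case: (e j); rewrite ?expr0 ?expr1 ?mul1r// mulN1r opprB.
split => [i|i f tf].
  by split; apply: lf (P'E i).1 || apply: lf (M'E i).1.
have tdf := test_function_partial i tf.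
rewrite (P'E i).2//; last by move=> j; exact: test_function_integrable.
rewrite (M'E i).2//; last by move=> j; exact: test_function_integrable.
have bdf := bmeas_test tdf.
have idf D : measurable D -> leb.-integrable D (fun x : B => (partial i f x)%:E).
  by move=> mD; exact: test_function_lebesgue_integrable tdf.
pose h j (x : B) : \bar R := (((-1) ^+ (~~ e j))%:E * ((EFin \o partial i f) \_ (F j)) x)%E.
have ih j : leb.-integrable setT (h j).
  apply: integrableZl => //; rewrite -integrable_mkcond//; exact: idf.
have -> : (\int[leb]_(x in E) (partial i f x)%:E = \int[leb]_x \sum_(j <- r) h j x)%E.
  rewrite integral_mkcond; apply: ae_eq_integral => //.
  - by apply/(measurable_restrictT _ _).1 => //; apply: measurable_funTS; apply/measurable_EFinP; case: bdf.
  - by apply: emeasurable_sum => j; have /integrableP[] := ih j.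
  apply: filterS ae => x + _; rewrite /patch => xE.
  have -> : (if x \in E then (partial i f x)%:E else 0%E) = (\1_E x * partial i f x)%:E.
    by rewrite indicE; case: (x \in E); rewrite ?mul1r ?mul0r.
  rewrite xE mulr_suml -sumEFin; apply: eq_bigr => j _; rewrite /h /patch/=.
  by rewrite indicE; case: (x \in F j); rewrite ?mulr1 ?mulr0 ?mul0r ?mule0 ?EFinM.
rewrite integral_sum//.
have fin (m : meas) : locally_finite O m -> (\int[m]_(x in (O : set B)) (f x)%:E)%E \is a fin_num.
  by move=> lm; apply: integrable_fin_num => //; exact: (test_function_integrable oO lm tf).
rewrite (eq_bigr (fun j => (- (fine (\int[X j i]_(x in (O : set B)) (f x)%:E) -
    fine (\int[Y j i]_(x in (O : set B)) (f x)%:E)))%:E)); last first.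
  move=> j _; rewrite /h integralZl//; last by rewrite -integrable_mkcond//; exact: idf.
  rewrite -integral_mkcond (gF j).2// /X /Y.
  have [lP lM] := (gF j).1 i.
  rewrite -(fineK (fin _ lP)) -(fineK (fin _ lM)) -EFinB -EFinN -EFinM.
  by congr (_%:E); case: (e j) => /=; rewrite ?expr0 ?expr1; ring.
rewrite sumEFin sumrN sumrB.
have sf (m : J -> meas) : (forall j, locally_finite O (m j)) ->
    (\sum_(j <- r) \int[m j]_(x in (O : set B)) (f x)%:E =
     (\sum_(j <- r) fine (\int[m j]_(x in (O : set B)) (f x)%:E))%:E)%E.
  by move=> lm; rewrite -sumEFin; apply: eq_bigr => j _; rewrite fineK// fin.
by rewrite !sf.
Qed.

End signed_sums.

(** Double counting of [D]: its measure is at least [m * m1 A] by sections over [A], and at most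
    [K * m2 H] by sections over [H]. *)
Lemma fubini_bound d1 d2 (T1 : measurableType d1) (T2 : measurableType d2) (R : realType)
    (m1 : {sigma_finite_measure set T1 -> \bar R}) (m2 : {sigma_finite_measure set T2 -> \bar R})
    (D : set (T1 * T2)) (A : set T1) (H : set T2) (m K : R) :
  measurable D -> measurable A -> measurable H -> 0 <= m -> 0 <= K ->
  (forall x, A x -> m%:E <= m2 (xsection D x))%E ->
  (forall y, H y -> m1 (ysection D y) <= K%:E)%E -> (forall p, D p -> H p.2) ->
  (m%:E * m1 A <= K%:E * m2 H)%E.
Proof.
move=> mD mA mH m0 K0 lo hi DH.
have fub : (\int[m1]_x (m2 \o xsection D) x = \int[m2]_y (m1 \o ysection D) y)%E.
  have := indic_fubini_tonelli m1 m2 mD.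
  by rewrite -indic_fubini_tonelli_FE// -indic_fubini_tonelli_GE.
have mx := measurable_fun_xsection m2 mD; have my := measurable_fun_ysection m1 mD.
rewrite -!integral_cst//; apply: (@le_trans _ _ (\int[m1]_(x in A) (m2 \o xsection D) x)%E).
  apply: ge0_le_integral => //; exact: measurable_funTS mx.
apply: (@le_trans _ _ (\int[m1]_x (m2 \o xsection D) x)%E); first exact: ge0_subset_integral.
rewrite fub -(@integral_support _ _ _ m2 H setT)//; last first.
  move=> y _ ny; rewrite /= (_ : ysection D y = set0) ?measure0//.
  by apply/seteqP; split => // x; rewrite /ysection/= inE => /DH.
apply: ge0_le_integral => //; exact: measurable_funTS my.
Qed.

(** * Isoperimetric and Poincare inequalities in cubes *)

Section isoperimetry.
Variables (R : realType) (n : nat).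
Local Notation V := 'rV[R]_n.
Local Notation B := (borelRn R n).
Local Notation leb := (lebesgue_rV R n).
Local Notation e_ k := (delta_mx ord0 k : V).
Local Notation meas := {measure set B -> \bar R}.

(** Half-open, so that the cells of a grid are disjoint. *)
Definition hcube (c : V) (r : R) : set B := hbox (fun k => c ord0 k - r) (fun k => c ord0 k + r).

Lemma hcubeP (c : V) r (x : V) : hcube c r x <-> forall k, c ord0 k - r < x ord0 k <= c ord0 k + r.
Proof. by split => h k; have := h k; rewrite in_itv. Qed.

Lemma measurable_hcube c r : measurable (hcube c r).
Proof. exact: measurable_hbox. Qed.

Lemma lebesgue_hcube c r : 0 <= r -> leb (hcube c r) = ((2 * r) ^+ n)%:E.
Proof.
move=> r0; rewrite lebesgue_hbox; last by move=> k; lra.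
congr (_%:E); rewrite (eq_bigr (fun=> 2 * r)) ?prodr_const ?card_ord// => k _; ring.
Qed.

Variables (O : set V) (E : set B) (P M : 'I_n -> meas) (c : V) (r kappa : R).
Hypotheses (oO : open O) (mE : measurable E) (gE : grad O E P M) (k0 : 0 <= kappa) (r0 : 0 < r).
Local Notation Q := (hcube c r).
Hypothesis rQ : rel_compact_in O Q.
Hypothesis bQ : forall k (F : set B), measurable F -> F `<=` Q ->
  `|fine (P k F) - fine (M k F)| <= kappa.

Let mQ : measurable (Q : set B) := measurable_hcube c r.

Let translate1 k (t : R) :
  (leb [set x : V | [/\ Q x, Q (x + t *: e_ k)%R, E x & ~ E (x + t *: e_ k)%R]] <= (`|t| * kappa)%:E)%E.
Proof.
have conv u x s : 0 <= u -> Q x -> Q (x + u *: e_ k) -> 0 <= s <= 1 -> Q (x + (s * u) *: e_ k).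
  move=> u0 /hcubeP Qx /hcubeP Qu /andP[s0 s1]; apply/hcubeP => i.
  move: (Qx i) (Qu i); rewrite !mxE eqxx /=; case: (i == k); rewrite ?mulr0 ?addr0 ?mulr1//.
  move=> /andP[h1 h2] /andP[h3 h4].
  have su : s * u <= u by rewrite ler_piMl.
  have su0 : 0 <= s * u by rewrite mulr_ge0.
  by apply/andP; split; lra.
have [t0|t0] := leP 0 t.
  rewrite ger0_norm//; apply: (translate_out oO mE gE mQ rQ t0 k0 _ (@bQ k)).
  by move=> x s; exact: conv.
(* For a negative [t] the set is a translate of the one in [translate_in] for [- t]. *)
have u0 : 0 <= - t by rewrite oppr_ge0 ltW.
rewrite ltr0_norm//.
have := @translate_in _ _ O E Q P M k (- t) kappa oO mE gE mQ rQ u0 k0 (fun x s => conv _ x s u0) (@bQ k).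
apply: le_trans; set A := (X in (_ <= leb X)%E).
have mA : measurable (A : set B).
  rewrite (_ : A = (Q `&` [set x : V | Q (x + - t *: e_ k)]) `&` ([set x : V | E (x + - t *: e_ k)] `\` E)).
    by apply: measurableI; [apply: measurableI|apply: measurableD] => //; exact: measurable_shift.
  by apply/seteqP; split => x /=; [move=> [? ? ? ?]|move=> [[? ?] [? ?]]].
rewrite -(lebesgue_translate (t *: e_ k) mA) le_eqVlt; apply/orP; left; apply/eqP.
congr (leb _); apply/seteqP; split => x /=; rewrite /A/= scaleNr addrK.
  by move=> [? ? ? ?].
by move=> [? ? ? ?].
Qed.

(** One coordinate at a time: [hs s] moves only the coordinates in [s]. As [Q] is a box, the
    intermediate points between [x] and [x + h] remain in it. *)
Lemma translate_any (h : V) :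
  (leb [set x : V | [/\ Q x, Q (x + h)%R, E x & ~ E (x + h)%R]] <= ((\sum_k `|h ord0 k|) * kappa)%:E)%E.
Proof.
pose hs (s : seq 'I_n) : V := \row_i (if i \in s then h ord0 i else 0).
pose S s := [set x : V | [/\ Q x, Q (x + h), E x & ~ E (x + hs s)]].
have mS s : measurable (S s : set B).
  rewrite (_ : S s = (Q `&` [set x : V | Q (x + h)]) `&` (E `\` [set x : V | E (x + hs s)])).
    by apply: measurableI; [apply: measurableI|apply: measurableD] => //; exact: measurable_shift.
  by apply/seteqP; split => x /=; [move=> [? ? ? ?]|move=> [[? ?] [? ?]]].
have H s : uniq s -> (leb (S s) <= ((\sum_(k <- s) `|h ord0 k|) * kappa)%:E)%E.
  elim: s => [_|k s IH /= /andP[ks us]].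
    rewrite big_nil mul0r (_ : S _ = set0) ?measure0//; apply/seteqP; split => // x [_ _ Ex].
    by rewrite (_ : hs _ = 0) ?addr0//; apply/rowP => i; rewrite !mxE.
  have hsE : hs (k :: s) = hs s + h ord0 k *: e_ k.
    apply/rowP => i; rewrite !mxE eqxx inE; have [->|ik] := eqVneq i k; rewrite /= ?mulr0 ?addr0//.
    by rewrite (negbTE ks) add0r mulr1.
  pose T := [set y : V | [/\ Q y, Q (y + h ord0 k *: e_ k)%R, E y & ~ E (y + h ord0 k *: e_ k)%R]].
  have mT : measurable (T : set B).
    rewrite (_ : T = (Q `&` [set x : V | Q (x + h ord0 k *: e_ k)]) `&` (E `\` [set x : V | E (x + h ord0 k *: e_ k)])).
      by apply: measurableI; [apply: measurableI|apply: measurableD] => //; exact: measurable_shift.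
    by apply/seteqP; split => x /=; [move=> [? ? ? ?]|move=> [[? ?] [? ?]]].
  have mT' : measurable ([set x : V | T (x + hs s)] : set B) by exact: measurable_shift.
  apply: (@le_trans _ _ (leb (S s `|` [set x : V | T (x + hs s)]))).
    apply: le_measure; rewrite ?inE; [exact: mS|exact: measurableU|].
    have between s' x : Q x -> Q (x + h) -> Q (x + hs s').
      move=> /hcubeP Qx /hcubeP Qh; apply/hcubeP => i.
      by move: (Qx i) (Qh i); rewrite !mxE; case: ifP; rewrite ?addr0.
    move=> x [Qx Qh Ex nE]; have [Es|Es] := pselect (E (x + hs s)); last by left.
    right; split => //; rewrite -?addrA -?hsE//; exact: between.
  apply: (le_trans (measureU2 leb (mS s) mT')).
  rewrite big_cons mulrDl EFinD addeC; apply: leeD; first exact: IH us.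
  by rewrite [leLHS](lebesgue_translate (hs s) mT); exact: translate1.
have := H (index_enum 'I_n) (index_enum_uniq _).
rewrite (_ : S _ = [set x : V | [/\ Q x, Q (x + h)%R, E x & ~ E (x + h)%R]])//.
rewrite /S (_ : hs _ = h)//; apply/rowP => i; by rewrite !mxE mem_index_enum.
Qed.

(** Counts the pairs [(x, h)] such that [x] is in [A] and [x + h] is in [Q] but not in [E]: for
    fixed [h] by [translate_any], for fixed [x] by the lower bound [m]. The two inequalities below
    differ only in the choice of [sg] and [m]. *)
Lemma average_bound (A : set B) (sg m : R) : measurable A -> A `<=` Q `&` E -> 0 < sg -> 0 <= m ->
  (forall x : V, A x -> m%:E <= leb [set h : V | [/\ hcube 0 sg h, Q (x + h)%R & ~ E (x + h)%R]])%E ->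
  (m%:E * leb A <= ((2 * sg) ^+ n * (n%:R * sg * kappa))%:E)%E.
Proof.
move=> mA AQE sg0 m0 H.
pose D := [set p : B * B | [/\ A p.1, hcube 0 sg p.2, Q ((p.1 : V) + p.2) & ~ E ((p.1 : V) + p.2)]].
have madd : measurable_fun setT (fun p : B * B => (p.1 : V) + p.2 : B).
  apply: measurable_fun_borelRn => i.
  apply: (eq_measurable_fun (fun p : B * B => (p.1 : V) ord0 i + (p.2 : V) ord0 i)).
    by move=> p _; rewrite mxE.
  apply: measurable_funD.
    exact: measurableT_comp (@measurable_coord R n i) measurable_fst.
  exact: measurableT_comp (@measurable_coord R n i) measurable_snd.
have mD : measurable D.
  rewrite (_ : D = (fst @^-1` A `&` snd @^-1` (hcube 0 sg)) `&` ((fun p : B * B => (p.1 : V) + p.2 : B) @^-1` (Q `\` E))).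
    apply: measurableI; [apply: measurableI|].
    - exact: measurable_setT_preimage measurable_fst mA.
    - exact: measurable_setT_preimage measurable_snd (measurable_hcube _ _).
    - by apply: measurable_setT_preimage madd _; exact: measurableD.
  by apply/seteqP; split => p /=; [move=> [? ? ? ?]|move=> [[? ?] [? ?]]].
pose K : R := n%:R * sg * kappa.
have K0 : 0 <= K by rewrite !mulr_ge0// ltW.
have mH := measurable_hcube 0 sg.
have lo (x : B) : A x -> (m%:E <= leb (xsection D x))%E.
  move=> Ax; apply: le_trans (H x Ax) _; rewrite le_eqVlt; apply/orP; left; apply/eqP.
  congr (leb _); apply/seteqP; split => y; rewrite /xsection/= inE; first by move=> [? ? ?].
  by move=> [? ? ? ?].
have hi (y : B) : hcube 0 sg y -> (leb (ysection D y) <= K%:E)%E.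
  move=> Hy; apply: (@le_trans _ _ ((\sum_k `|(y : V) ord0 k|) * kappa)%:E); last first.
    rewrite lee_fin ler_wpM2r//; apply: (@le_trans _ _ (\sum_(k < n) sg)).
      apply: ler_sum => k _; move/hcubeP: Hy => /(_ k); rewrite mxE sub0r add0r => /andP[h1 h2].
      by rewrite ler_norml h2 (ltW h1).
    by rewrite sumr_const card_ord mulr_natl.
  apply: le_trans (translate_any (y : V)); apply: le_measure; rewrite ?inE.
  - exact: measurable_ysection.
  - rewrite (_ : [set x : V | _] = (Q `&` [set x : V | Q (x + (y : V))]) `&` (E `\` [set x : V | E (x + (y : V))])).
      by apply: measurableI; [apply: measurableI|apply: measurableD] => //; exact: measurable_shift.
    by apply/seteqP; split => x /=; [move=> [? ? ? ?]|move=> [[? ?] [? ?]]].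
  by move=> x; rewrite /ysection/= inE => -[/AQE[Qx Ex] _ Qy nE].
have := fubini_bound mD mA mH m0 K0 lo hi.
rewrite [X in (_ <= _ * X)%E](lebesgue_hcube 0 (ltW sg0)) -EFinM mulrC; apply.
by move=> p [].
Qed.

(** For [x] in the smaller cube, the cube of half-side [sg] around [x] lies in [Q] and [E] fills at
    most half of it, so [m = (2 * sg) ^+ n / 2] is allowed. With [sg] of the order of the [n]-th
    root of the volume of [E] this is an isoperimetric inequality. *)
Lemma isoperimetric (sg : R) : 0 < sg -> sg <= r -> (leb (E `&` Q) + leb (E `&` Q) <= ((2 * sg) ^+ n)%:E)%E ->
  (leb (E `&` hcube c (r - sg)) <= (2 * (n%:R * sg * kappa))%:E)%E.
Proof.
move=> sg0 sgr small.
have mH := measurable_hcube 0 sg; have mEQ : measurable (E `&` Q) by exact: measurableI.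
have mA : measurable (E `&` hcube c (r - sg)) by apply: measurableI => //; exact: measurable_hcube.
have p0 : 0 < (2 * sg) ^+ n by rewrite exprn_gt0// mulr_gt0.
have m0 : 0 <= (2 * sg) ^+ n / 2 by rewrite divr_ge0// ltW.
have fEQ : leb (E `&` Q) \is a fin_num.
  rewrite ge0_fin_numE//; apply: (@le_lt_trans _ _ (leb Q)); first by apply: le_measure; rewrite ?inE.
  by rewrite [ltLHS](lebesgue_hcube c (ltW r0)) ltry.
have := @average_bound (E `&` hcube c (r - sg)) sg _ mA _ sg0 m0.
have sub : E `&` hcube c (r - sg) `<=` Q `&` E.
  move=> x [Ex /hcubeP Hx]; split => //; apply/hcubeP => k; have /andP[h1 h2] := Hx k.
  by apply/andP; split; lra.
move=> /(_ sub) H; have {}H : (((2 * sg) ^+ n / 2)%:E * leb (E `&` hcube c (r - sg)) <=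
    ((2 * sg) ^+ n * (n%:R * sg * kappa))%:E)%E.
  apply: H => x [Ex /hcubeP Hx].
  have msh : measurable ([set h : V | (E `&` Q) (h + x)] : set B) by exact: measurable_shift.
  set Y := (X in (_ <= leb X)%E).
  have HY : hcube 0 sg `<=` Y `|` [set h : V | (E `&` Q) (h + x)].
    move=> h /[dup] Hh /hcubeP hh; have Qxh : Q (x + h).
      apply/hcubeP => k; move: (Hx k) (hh k); rewrite !mxE => /andP[h1 h2] /andP[h3 h4].
      by apply/andP; split; lra.
    have [Exh|Exh] := pselect (E (x + h)); [right; rewrite /= addrC//|by left].
  have mY : measurable (Y : set B).
    rewrite (_ : Y = hcube 0 sg `&` [set h : V | (Q `\` E) (h + x)]).
      by apply: measurableI => //; apply: measurable_shift; exact: measurableD.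
    by apply/seteqP; split => h; rewrite /Y/= addrC; [move=> [? ? ?]|move=> [? [? ?]]].
  have : (leb (hcube 0 sg) <= leb Y + leb [set h : V | (E `&` Q) (h + x)%R])%E.
    apply: le_trans (measureU2 leb mY msh); apply: le_measure; rewrite ?inE//.
    exact: measurableU.
  rewrite [leLHS](lebesgue_hcube 0 (ltW sg0)) [X in (_ + X)%E](lebesgue_translate x mEQ).
  move: small; rewrite -(fineK fEQ); set l := fine _.
  case: (leb Y) => [y|_ _|]//; last by rewrite leey.
  by rewrite -!EFinD !lee_fin; lra.
rewrite -(@lee_pmul2l _ ((2 * sg) ^+ n / 2)%:E)//; last by rewrite lte_fin divr_gt0.
apply: (le_trans H); rewrite -EFinM lee_fin; set K := n%:R * sg * kappa.
by rewrite le_eqVlt; apply/orP; left; apply/eqP; field.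
Qed.

(** With [sg = 2 * r] every point of [Q] is reached from every other one, so each [x] sees the whole
    of [Q] outside [E]. *)
Lemma poincare (m : R) : 0 <= m -> (m%:E <= leb (Q `\` E))%E ->
  (m%:E * leb (E `&` Q) <= ((4 * r) ^+ n * (n%:R * (2 * r) * kappa))%:E)%E.
Proof.
move=> m0 mQE; have r2 : 0 < 2 * r by rewrite mulr_gt0.
have mQE' : measurable (Q `\` E) by exact: measurableD.
have := @average_bound (E `&` Q) (2 * r) m (measurableI _ _ mE mQ) _ r2 m0.
rewrite (_ : 2 * (2 * r) = 4 * r); last by ring.
apply; first by move=> x [].
move=> x [Ex /hcubeP Qx]; apply: (le_trans mQE).
rewrite -[leLHS](lebesgue_translate x mQE'); apply: le_measure; rewrite ?inE.
- exact: measurable_shift.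
- rewrite (_ : [set h : V | _] = hcube 0 (2 * r) `&` [set h : V | (Q `\` E) (h + x)]).
    by apply: measurableI; [exact: measurable_hcube|exact: measurable_shift].
  by apply/seteqP; split => h; rewrite /= addrC; [move=> [? ? ?]|move=> [? [? ?]]].
move=> h [Qh nE]; rewrite /= addrC; split => //.
apply/hcubeP => k; move/hcubeP: Qh => /(_ k); move: (Qx k); rewrite !mxE => /andP[h1 h2] /andP[h3 h4].
by apply/andP; split; lra.
Qed.

End isoperimetry.

(** * Decay of the volume on shrinking cubes *)

Section density.
Variables (R : realType) (n : nat).
Local Notation V := 'rV[R]_n.
Local Notation B := (borelRn R n).
Local Notation leb := (lebesgue_rV R n).

Lemma hcube_sub (c : V) (r r' : R) : r <= r' -> hcube c r `<=` hcube c r'.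
Proof.
by move=> rr x /hcubeP h; apply/hcubeP => k; have /andP[h1 h2] := h k; apply/andP; split; lra.
Qed.

(* With [beta = 1 - n (1 - alpha) > 0] and [b = (2 t)^n / 2] one has [t b^alpha <= t^beta b]:
   this is where [alpha > (n - 1) / n] is used. *)
Lemma density_scale (alpha A : R) : (0 < n)%N -> (n%:R - 1) / n%:R < alpha -> alpha <= 1 -> 0 < A ->
  exists2 eta : R, 0 < eta <= 8^-1 & forall t s : R, 0 < t -> t <= eta -> 8 * eta * s = t ->
  A * t * ((2 * t) ^+ n / 2 / s + ((2 * t) ^+ n / 2) `^ alpha) <= (2 * (t / 2)) ^+ n / 2.
Proof.
move=> n0 al1 al2 A0; have nR : 0 < n%:R :> R by rewrite ltr0n.
pose be : R := 1 - n%:R * (1 - alpha).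
have be0 : 0 < be by move: al1; rewrite ltr_pdivrMr// /be; lra.
pose q : R := (2^-1) ^+ n / 2.
have q0 : 0 < q by rewrite divr_gt0// exprn_gt0// invr_gt0.
have qA : 0 < q / A by rewrite divr_gt0.
pose eta := Num.min 8^-1 (Num.min (q / A / 64) ((q / A) `^ be^-1)).
have eta0 : 0 < eta by rewrite !lt_min invr_gt0 divr_gt0//= powR_gt0// ltr0n.
have e1 : eta <= 8^-1 by rewrite ge_min lexx.
have e2 : eta <= q / A / 64 by rewrite !ge_min lexx orbT.
have e3 : eta <= (q / A) `^ be^-1 by rewrite !ge_min lexx !orbT.
exists eta; first by rewrite eta0.
move=> t s t0 te st; set b := (2 * t) ^+ n / 2.
have tn0 : 0 < (2 * t) ^+ n by rewrite exprn_gt0// mulr_gt0.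
have b0 : 0 < b by rewrite divr_gt0.
have s0 : 0 < s by move: (t0); rewrite -st pmulr_rgt0 ?mulr_gt0.
have -> : (2 * (t / 2)) ^+ n / 2 = (q + q) * b.
  rewrite (_ : 2 * (t / 2) = (2 * t) * 2^-1); last by field.
  by rewrite exprMn /q /b; field.
rewrite mulrDr mulrDl; apply: lerD.
  rewrite (_ : A * t * (b / s) = (A * (t / s)) * b); last by field; exact: lt0r_neq0.
  apply: ler_wpM2r; first exact: ltW.
  rewrite -st mulfK ?lt0r_neq0//.
  have : A * (64 * eta) <= q.
    have -> : q = A * (64 * (q / A / 64)) by field; exact: lt0r_neq0.
    by rewrite ler_pM2l// ler_pM2l.
  by move=> h; apply: le_trans h; rewrite ler_pM2l// ler_pM2r//; lra.
have pw : t * b `^ alpha <= b * t `^ be.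
  pose cc : R := 2 ^+ n / 2.
  have cc1 : 1 <= cc.
    rewrite /cc; case: (n) n0 => // n' _; rewrite exprS mulrC mulKf//.
    by rewrite exprn_ege1// ler1n.
  have bE : b = cc * t `^ n%:R by rewrite /b /cc exprMn powR_mulrn ?ltW//; field.
  have cc0 : 0 < cc by apply: lt_le_trans cc1.
  have -> : b `^ alpha = cc `^ alpha * t `^ (n%:R * alpha).
    by rewrite bE powRM ?powR_ge0// ?ltW// powRrM.
  have -> : b * t `^ be = cc * t `^ (n%:R * alpha + 1).
    rewrite bE -mulrA -powRD; last by rewrite (gt_eqF t0) implybT.
    by congr (_ * _ `^ _); rewrite /be; ring.
  rewrite powRD; last by rewrite (gt_eqF t0) implybT.
  rewrite (powRr1 (ltW t0)) (_ : t * (cc `^ alpha * t `^ (n%:R * alpha)) =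
    cc `^ alpha * (t `^ (n%:R * alpha) * t)); last by ring.
  apply: ler_wpM2r; first by rewrite mulr_ge0 ?powR_ge0 ?ltW.
  by rewrite -[leRHS](powRr1 (ltW cc0)) ler_powR.
rewrite -mulrA; apply: (@le_trans _ _ (A * (b * t `^ be))); first by rewrite ler_pM2l.
rewrite mulrCA mulrC ler_pM2r//.
have : t `^ be <= q / A.
  apply: (@le_trans _ _ (((q / A) `^ be^-1) `^ be)).
    apply: ge0_ler_powR; rewrite ?nnegrE ?powR_ge0 ?(ltW be0) ?(ltW t0)//.
    exact: le_trans e3.
  by rewrite -powRrM mulVf ?lt0r_neq0// (powRr1 (ltW qA)).
by rewrite ler_pdivlMr// mulrC.
Qed.

(** The radius decreases from [r] to [r / 2] along [r / 2 * (1 + 2^-j)] while the volume is at most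
    [b j], a multiple of [2^-(j * n)]; [density_scale] says that one step reproduces this bound. The
    one-step estimate is a hypothesis, so that the iteration serves for a set of the partition and
    for its complement, and [eps] depends on nothing else. *)
Lemma density_iteration (alpha A : R) : (0 < n)%N -> (n%:R - 1) / n%:R < alpha -> alpha <= 1 -> 0 < A ->
  exists2 eps : R, 0 < eps & forall (E : set B) (c : V) (r : R), measurable E -> 0 < r -> r <= 1 ->
  (forall rho s sg b : R, 0 < sg -> sg <= rho -> 0 < s -> 0 < b -> rho + s <= r ->
     (leb (E `&` hcube c (rho + s)) <= b%:E)%E -> b + b <= (2 * sg) ^+ n ->
     (leb (E `&` hcube c (rho - sg)) <= (A * sg * (b / s + b `^ alpha))%:E)%E) ->
  (leb (E `&` hcube c r) <= (eps * r ^+ n)%:E)%E -> leb (E `&` hcube c (r / 2)) = 0%E.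
Proof.
move=> n0 al1 al2 A0; have [eta /andP[eta0 eta8] sc] := density_scale n0 al1 al2 A0.
exists ((2 * eta) ^+ n / 2); first by rewrite divr_gt0// exprn_gt0// mulr_gt0.
move=> E c r mE r0 r1 step init.
have mEc r' : measurable (E `&` hcube c r') by apply: measurableI => //; exact: measurable_hcube.
pose x j : R := 2^-1 ^+ j.
have x0 j : 0 < x j by rewrite exprn_gt0// invr_gt0.
have x1 j : x j <= 1 by rewrite exprn_ile1 ?invr_ge0// invf_le1 ?ler1n.
have xS j : x j.+1 = x j / 2 by rewrite /x exprS mulrC.
pose b j : R := (2 * (eta * r * x j)) ^+ n / 2.
have b0 j : 0 < b j by rewrite divr_gt0// exprn_gt0// !mulr_gt0.
have H j : (leb (E `&` hcube c (r / 2 * (1 + x j))) <= (b j)%:E)%E.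
  elim: j => [|j IH].
    rewrite /x expr0 (_ : r / 2 * (1 + 1) = r); last by field.
    apply: (le_trans init); rewrite lee_fin /b /x expr0 mulr1 le_eqVlt; apply/orP; left; apply/eqP.
    by rewrite (_ : 2 * (eta * r) = (2 * eta) * r) ?[(2 * eta * r) ^+ n]exprMn; [rewrite mulrAC|ring].
  (* [s] and [t] add up to at most [r / 4 * x j], the decrease of the radius in this step, because
     [eta <= 1/8]; [t] is matched to the volume by [b j + b j = (2 * t) ^+ n]. *)
  pose s := r / 8 * x j; pose t := eta * r * x j; pose rho := r / 2 * (1 + x j) - s.
  have rx0 : 0 < r * x j by rewrite mulr_gt0.
  have rx1 : r * x j <= r by rewrite ler_piMr// ltW.
  have t0 : 0 < t by rewrite !mulr_gt0.
  have s0 : 0 < s by rewrite !mulr_gt0// invr_gt0.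
  have te : t <= eta.
    rewrite /t -mulrA ler_piMr ?(ltW eta0)//; apply: le_trans rx1 r1.
  have ts : t <= s.
    have : 0 <= (8^-1 - eta) * (r * x j) by rewrite mulr_ge0 ?subr_ge0// ltW.
    by rewrite /t /s; lra.
  have st : 8 * eta * s = t by rewrite /s /t; field.
  have sE : s = r * x j / 8 by rewrite /s; field.
  have := step rho s t (b j) t0.
  have -> : rho + s = r / 2 * (1 + x j) by rewrite /rho subrK.
  move=> /(_ _ s0 (b0 j) _ IH _) st2.
  have h1 : t <= rho.
    apply: (le_trans ts); rewrite /rho sE (_ : r / 2 * (1 + x j) = r / 2 + r * x j / 2); last by field.
    by lra.
  have h2 : r / 2 * (1 + x j) <= r.
    by rewrite (_ : r / 2 * (1 + x j) = r / 2 + r * x j / 2); [lra|field].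
  have h3 : b j + b j <= (2 * t) ^+ n by rewrite /b -/t; lra.
  apply: (@le_trans _ _ (leb (E `&` hcube c (rho - t)))).
    apply: le_measure; rewrite ?inE; [exact: mEc|exact: mEc|].
    apply: setIS; apply: hcube_sub; rewrite xS /rho sE.
    rewrite (_ : r / 2 * (1 + x j / 2) = r / 2 + r * x j / 4); last by field.
    rewrite (_ : r / 2 * (1 + x j) = r / 2 + r * x j / 2); last by field.
    by move: ts; rewrite sE; lra.
  apply: (le_trans (st2 h1 h2 h3)); rewrite lee_fin.
  have := sc t s t0 te st; rewrite -/(b j) (_ : b j.+1 = (2 * (t / 2)) ^+ n / 2)//.
  by rewrite /b xS /t; congr (_ ^+ _ / _); field.
have le_b j : (leb (E `&` hcube c (r / 2)) <= (b j)%:E)%E.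
  apply: le_trans (H j); apply: le_measure; rewrite ?inE; [exact: mEc|exact: mEc|].
  apply: setIS; apply: hcube_sub; rewrite mulrDr mulr1 lerDl mulr_ge0 ?ltW//.
  by rewrite divr_gt0.
have bx j : b j <= b 0%N * x j.
  have bE i : b i = (2 * (eta * r)) ^+ n / 2 * x i ^+ n.
    rewrite /b (_ : 2 * (eta * r * x i) = 2 * (eta * r) * x i); last by ring.
    by rewrite exprMn mulrAC.
  rewrite !bE [x 0%N]expr0 expr1n mulr1 ler_pM2l; last first.
    by rewrite divr_gt0// exprn_gt0// !mulr_gt0.
  case: (n) n0 => // n' _; rewrite exprS ler_piMr ?(ltW (x0 _))// exprn_ile1 ?(ltW (x0 _))//.
apply/eqP; rewrite eq_le measure_ge0 andbT; apply/lee_addgt0Pr => e e0; rewrite add0e.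
have [j jP] : exists j, b 0%N * x j < e.
  have : b 0%N * x j @[j --> \oo] --> b 0%N * 0.
    apply: cvgM; first exact: cvg_cst.
    by apply: cvg_expr; rewrite ger0_norm ?invr_ge0// invf_lt1 ?ltr1n.
  rewrite mulr0 => /cvgr_lt /(_ e e0)[j _ /(_ j (leqnn j))].
  by exists j.
by apply: (le_trans (le_b j)); rewrite lee_fin (le_trans (bx j))// ltW.
Qed.

End density.

(** * Competitors and minimality *)

Section minimizer.
Variables (R : realType) (n N : nat).
Local Notation V := 'rV[R]_n.
Local Notation B := (borelRn R n).
Local Notation leb := (lebesgue_rV R n).
Local Notation meas := {measure set B -> \bar R}.
Implicit Types (W : 'I_N -> set V).

Lemma partition_unique (O : set V) W x : \sum_(i < N) \1_(W i) x = \1_O x :> R ->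
  forall l m, W l x -> W m x -> l = m.
Proof.
move=> H l m Wl Wm; apply: contrapT => /eqP lm; move: H.
rewrite (bigD1 l)//= (bigD1 m) /=; last by rewrite eq_sym.
set r := \sum_(i | _) _ => H; have r0 : 0 <= r by apply: sumr_ge0 => i _; rewrite indicE.
have : \1_O x <= 1 :> R by rewrite indicE; case: (_ \in _).
by move: H; rewrite !indicE (mem_set Wl) (mem_set Wm) /=; lra.
Qed.

Lemma partition_cover (O : set V) W x : \sum_(i < N) \1_(W i) x = \1_O x :> R -> O x ->
  exists l, W l x.
Proof.
move=> H Ox; apply: contrapT => no; move: H; rewrite indicE mem_set//= big1 => [/eqP|i _].
  by rewrite eq_sym oner_eq0.
by rewrite indicE memNset// => Wi; apply: no; exists i.
Qed.

Lemma sum_indic_unique W x l : W l x -> (forall m, W m x -> m = l) ->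
  \sum_(i < N) \1_(W i) x = 1 :> R.
Proof.
move=> Wl H; rewrite (bigD1 l)//= indicE mem_set//= big1 ?addr0// => i il.
by rewrite indicE memNset// => /H /eqP; rewrite (negbTE il).
Qed.

Lemma indic0 (A : set V) x : ~ A x -> \1_A x = 0 :> R.
Proof. by move=> Ax; rewrite indicE memNset. Qed.

Lemma indic1 (A : set V) x : A x -> \1_A x = 1 :> R.
Proof. by move=> Ax; rewrite indicE mem_set. Qed.

Variables (O : set V) (a : V -> R) (G : ('I_N -> set V) -> R) (W : 'I_N -> set V) (alpha Ca : R).
Hypotheses (oO : open O) (bO : exists r, forall x, O x -> `|x : V| <= r).
Hypotheses (ma : measurable_fun (O : set B) (a : B -> R)) (a0 : forall x, O x -> 0 < a x).
Hypotheses (al0 : 0 <= alpha) (Ca0 : 0 <= Ca).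
Hypothesis holder : forall W1 W2, weak_partition O W1 -> weak_partition O W2 ->
  (`|G W1 - G W2|%:E <= Ca%:E * (partition_dist W1 W2 `^ alpha))%E.
Hypothesis minW : is_minimizer O a G W.

Let mO : measurable (O : set B). Proof. exact: open_measurable_rV. Qed.

(** Extended by 0, so that every weighted perimeter is an integral over the whole space. *)
Definition weight : B -> \bar R := (EFin \o a) \_ O.

Let w0 x : (0 <= weight x)%E.
Proof.
rewrite /weight /patch; case: ifPn => // /set_mem Ox; rewrite lee_fin; exact/ltW/a0.
Qed.

Let mw : measurable_fun setT weight.
Proof. by apply/(measurable_restrictT _ _).1 => //; exact/measurable_EFinP. Qed.

Lemma F_wE W' : weak_partition O W' -> exists mu' : 'I_N -> meas,
  (forall k (A : set B), measurable A -> mu' k A = perimeter_measure O (W' k) A) /\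
  (F_w O a W' = \sum_(k < N) \int[mu' k]_x weight x)%E.
Proof.
move=> [wpW _].
have ex k : exists mu : meas, (forall A : set B, measurable A -> mu A = perimeter_measure O (W' k) A) /\
    (\int[perimeter_measure O (W' k)]_(x in (O : set B)) (a x)%:E = \int[mu]_x weight x)%E.
  have [mWk _ [D /is_gradient_grad[P [M [g _]]]]] := wpW k.
  have [mu [_ muE muI]] := exists_perimeter_measure oO mWk g.
  by exists mu; split => //; rewrite muI integral_mkcond.
have [mu' H] := choice ex; exists mu'; split => [k|]; first by case: (H k).
by apply: eq_bigr => k _; case: (H k).
Qed.

Variable mu : 'I_N -> meas.
Hypothesis muE : forall k (A : set B), measurable A -> mu k A = perimeter_measure O (W k) A.
Hypothesis FW : (F_w O a W = \sum_(k < N) \int[mu k]_x weight x)%E.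

Lemma trivial_partition (i : 'I_N) : weak_partition O (fun k => if k == i then O else set0).
Proof.
split => [k|].
  case: ifP => _; split => //.
  - exact: grad_lfp (grad_full oO).
  - exact: grad_lfp (grad_empty O).
exists set0; split => [||x nx]; [exact: measurable0|exact: measure0|apply: nx].
rewrite /=; have [Ox|Ox] := pselect (O x).
  rewrite (indic1 Ox); apply: (@sum_indic_unique _ _ i); first by rewrite eqxx.
  by move=> m; case: ifP => // /eqP.
by rewrite (indic0 Ox) big1// => k _; apply: indic0; case: ifP => _; [exact: Ox|case].
Qed.

(** Comparison with [trivial_partition], which has no perimeter inside [O]. Finiteness permits the
    cancellations in [comparison] and [transfer]. *)
Lemma F_w_finite : (F_w O a W < +oo)%E.
Proof.
have [N0|[i _]] : (forall i : 'I_N, False) \/ exists i : 'I_N, True.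
  case: (pselect (exists i : 'I_N, True)) => [|no]; [by right|left => i; apply: no; by exists i].
  by rewrite /F_w big1 ?ltry// => i; case: (N0 i).
have := minW.2 _ (trivial_partition i); rewrite /J_w.
have -> : F_w O a (fun k => if k == i then O else set0) = 0%E.
  rewrite /F_w big1// => k _; rewrite (@eq_measure_integral_raw _ _ _ _ (mzero : meas)).
    exact: integral_measure_zero.
  by move=> A mA; case: ifP => _; rewrite ?perimeter_full0 ?perimeter_empty0.
by rewrite add0e; case: (F_w O a W) => [r _||]; [exact: ltry|by []|by []].
Qed.

Let fin_int k (X : set B) : measurable X -> (\int[mu k]_(x in X) weight x)%E \is a fin_num.
Proof.
move=> mX; rewrite ge0_fin_numE; last exact: integral_ge0.
apply: le_lt_trans F_w_finite; rewrite FW (bigD1 k)//=.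
apply: (@le_trans _ _ (\int[mu k]_x weight x)%E); first exact: ge0_subset_integral.
by rewrite leeDl//; apply: sume_ge0 => i _; exact: integral_ge0.
Qed.

(** The perimeter of [W] outside [X] occurs on both sides of the minimality inequality and cancels,
    being finite; the Hoelder condition accounts for the change of [G]. *)
Lemma comparison W' (nu : 'I_N -> meas) (X : set B) (d : R) : weak_partition O W' -> measurable X ->
  (forall k (A : set B), measurable A ->
    perimeter_measure O (W' k) A <= mu k (A `&` ~` X) + nu k A)%E ->
  (partition_dist W W' <= d%:E)%E ->
  (\sum_(k < N) \int[mu k]_(x in X) weight x <=
   \sum_(k < N) \int[nu k]_x weight x + (Ca * d `^ alpha)%:E)%E.
Proof.
move=> wp' mX Hnu dist.
have [mu' [mu'E FW']] := F_wE wp'.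
have mXC : measurable (~` X) by exact: measurableC.
have le' k : (\int[mu' k]_x weight x <= \int[mu k]_(x in ~` X) weight x + \int[nu k]_x weight x)%E.
  rewrite -(setTI (~` X)) -(@integral_mrestr _ _ _ (mu k) _ _ mXC)//.
  rewrite -ge0_integral_measure_add//; apply: ge0_le_measure_integral => // S mS.
  by rewrite [leRHS]measure_addE [leLHS]mu'E//; exact: Hnu.
have splitI k : (\int[mu k]_x weight x = \int[mu k]_(x in X) weight x + \int[mu k]_(x in ~` X) weight x)%E.
  have mWu : measurable_fun (X `|` ~` X) weight by exact: measurable_funTS.
  have dj : [disjoint X & ~` X] by apply/disj_setPS => x [].
  by rewrite -(integral_setU _ mX mXC mWu dj) setUv.
have := minW.2 _ wp'; rewrite /J_w FW FW'.
have d0 : (0 <= partition_dist W W')%E by apply: sume_ge0.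
have [dr drE] : exists r, partition_dist W W' = r%:E.
  by move: dist d0; case: (partition_dist W W') => // r; exists r.
have Gle : G W' - G W <= Ca * d `^ alpha.
  have := holder wp' minW.1.
  have -> : partition_dist W' W = dr%:E.
    by rewrite -drE; apply: eq_bigr => i _; rewrite setUC.
  rewrite poweR_EFin -EFinM lee_fin => h; apply: le_trans (ler_norm _) _.
  apply: le_trans h _; apply: ler_wpM2l => //.
  rewrite drE !lee_fin in dist d0; apply: ge0_ler_powR; rewrite ?nnegrE//.
  exact: le_trans dist.
have [inf|] := eqVneq (\sum_(k < N) \int[nu k]_x weight x)%E +oo%E; first by rewrite inf leey.
have nu0 : (0 <= \sum_(k < N) \int[nu k]_x weight x)%E by apply: sume_ge0 => k _; exact: integral_ge0.
rewrite -ltey -(ge0_fin_numE nu0) => nufin.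
have leF : (\sum_(k < N) \int[mu' k]_x weight x <= \sum_(k < N) \int[mu k]_(x in ~` X) weight x +
    \sum_(k < N) \int[nu k]_x weight x)%E.
  by rewrite -big_split/=; apply: lee_sum => k _.
have toR (Y : set B) : measurable Y -> (\sum_(k < N) \int[mu k]_(x in Y) weight x =
    (\sum_(k < N) fine (\int[mu k]_(x in Y) weight x))%:E)%E.
  by move=> mY; rewrite -sumEFin; apply: eq_bigr => k _; rewrite fineK// fin_int.
move=> J1; have {}J1 := le_trans J1 (leeD2r (G W')%:E leF).
move: J1; rewrite (eq_bigr _ (fun k _ => splitI k)) big_split/=.
rewrite !toR// -(fineK nufin) -!EFinD !lee_fin.
by move: Gle; lra.
Qed.

Variables P M : 'I_N -> 'I_n -> meas.
Hypothesis gW : forall k, grad O (W k) (P k) (M k).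

Let mWk k : measurable (W k : set B). Proof. by case: (minW.1.1 k). Qed.
Let WO k : W k `<=` O. Proof. by case: (minW.1.1 k). Qed.

Lemma mu_ge k (F : set B) : measurable F -> rel_compact_in O F -> (gradv (P k) (M k) F <= mu k F)%E.
Proof.
move=> mF rF; rewrite muE// (perimeter_measureE _ oO (mWk k) (gW k)).
exact: le_variation (grad_charge (gW k)) mF rF.
Qed.

Definition hs_all : seq ('I_n * bool) := [seq (k, b) | k <- enum 'I_n, b <- [:: true; false]].

Lemma size_hs_all : size hs_all = (n * 2)%N.
Proof. by rewrite size_allpairs size_enum_ord. Qed.

Lemma enorm_gradm_le (Sp Sm : 'I_n -> {finite_measure set B -> \bar R}) (F : set B) : measurable F ->
  ((enorm (gradm Sp Sm F))%:E <= \sum_(i < n) (Sp i F + Sm i F))%E.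
Proof.
move=> mF; have -> : (\sum_(i < n) (Sp i F + Sm i F) = (\sum_(i < n) (fine (Sp i F) + fine (Sm i F)))%:E)%E.
  by rewrite -sumEFin; apply: eq_bigr => i _; rewrite EFinD !fineK// fin_num_measure.
rewrite lee_fin; apply: le_trans (enorm_le_sum _) _; apply: ler_sum => i _.
by rewrite mxE; apply: le_trans (ler_normB _ _) _; rewrite !ger0_norm// fine_ge0.
Qed.

Lemma in_bigsetU (p : pred 'I_N) (A : 'I_N -> set V) x :
  (\big[setU/set0]_(l < N | p l) A l) x <-> exists2 l, p l & A l x.
Proof.
split => [|[l pl Al]]; last by rewrite (bigD1 l)//=; left.
by elim/big_rec: _ => [[]|l Y pl IH [Al|/IH]//]; exists l.
Qed.

Lemma measurable_bigU (p : pred 'I_N) (A : 'I_N -> set B) : (forall l, measurable (A l)) ->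
  measurable (\big[setU/set0]_(l < N | p l) A l).
Proof.
by move=> mA; elim/big_ind: _ => [||l _]; [exact: measurable0|exact: measurableU|exact: mA].
Qed.

Lemma lebesgue_bigU (p : pred 'I_N) (A : 'I_N -> set B) : (forall l, measurable (A l)) ->
  (leb (\big[setU/set0]_(l < N | p l) A l) <= \sum_(l < N | p l) leb (A l))%E.
Proof.
move=> mA; have [] : measurable (\big[setU/set0]_(l < N | p l) A l) /\
  (leb (\big[setU/set0]_(l < N | p l) A l) <= \sum_(l < N | p l) leb (A l))%E => //.
elim/big_rec2: _ => [|l y Y pl [mY leY]]; first by rewrite measure0; split => //; exact: measurable0.
split; first exact: measurableU.
apply: (le_trans (measureU2 leb (mA l) mY)).
exact: leeD.
Qed.

(** The competitor gives to [W j] the part in [X] of every [W l] with [p l]. The measure [kappa]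
    dominates the gradient of the union of these sets, so the interfaces between them are no longer
    paid. The traces are paid twice, by the sets that lose volume and by [W j], and the volume moved
    is counted twice in [partition_dist]; hence the factors 2. [X] is chosen before [j] and [kappa],
    so that the inequalities for different [j] can be added. *)
Lemma transfer (p : pred 'I_N) (c : V) (rho s b : R) (Q : set B) :
  measurable Q -> 0 < s -> 0 < b -> hspaces c hs_all (rho + s) `<=` Q ->
  (forall x, Q x -> weight x <= 1)%E ->
  (\sum_(l < N | p l) leb (Q `&` W l) <= b%:E)%E ->
  exists X : set B, [/\ measurable X, hspaces c hs_all rho `<=` X, X `<=` Q &
   forall j (kappa : meas), ~~ p j ->
   (forall F : set B, measurable F -> rel_compact_in O F ->
     (enorm (gradm (P j) (M j) F + \sum_(l < N | p l) gradm (P l) (M l) F))%:E <= kappa F)%E ->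
   (\sum_(k < N | p k || (k == j)) \int[mu k]_(x in X) weight x <=
     \int[kappa]_(x in X) weight x +
       (2 * ((n * 2)%:R * (2 * b / s)) + Ca * (2 * b) `^ alpha)%:E)%E].
Proof.
move=> mQ s0 b0 hQ wQ sumb.
have [X [P' [M' [Sp [Sm [[mX [inX Xout]] gX PM S0 Stot]]]]]] :=
  box_cut c rho oO bO (fun l => conj (mWk l) (@WO l)) gW mQ s0 b0 sumb hs_all.
have XQ : X `<=` Q := subset_trans Xout hQ.
have mXC : measurable (~` X) by exact: measurableC.
exists X; split => // j kappa pj Hkappa.
have npj k : p k -> (k == j) = false by apply: contraTF => /eqP ->.
pose SS l i : meas := measure_add (Sp l i) (Sm l i).
have SSE l i A : (SS l i A = Sp l i A + Sm l i A)%E by exact: measure_addE.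
(* The total trace of [W l], restricted to [Q]: there the weight is at most 1, so that its weighted
   integral is bounded by its mass. *)
have [sS sSE] := choice (fun l => exists_sum_measure (enum 'I_n) xpredT (fun i => mrestr (SS l i) mQ)).
have sQ l (A : set B) : measurable A -> (sS l A = \sum_(i < n) (Sp l i A + Sm l i A))%E.
  move=> mA; rewrite (sSE l).1 big_enum/=; apply: eq_bigr => i _.
  rewrite /mrestr SSE.
  have [z1 z2] : Sp l i (A `\` Q) = 0%E /\ Sm l i (A `\` Q) = 0%E.
    by apply: S0; apply/seteqP; split => // x [[_ nQ] /hQ].
  have e1 : Sp l i A = Sp l i (A `&` Q).
    by apply: (etrans (measureDI (Sp l i) mA mQ)); apply: (etrans (congr1 (fun z => z + _)%E z1)); exact: add0e.
  have e2 : Sm l i A = Sm l i (A `&` Q).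
    by apply: (etrans (measureDI (Sm l i) mA mQ)); apply: (etrans (congr1 (fun z => z + _)%E z2)); exact: add0e.
  by rewrite e1 e2.
have grS l (F : set B) : measurable F -> ((enorm (gradm (Sp l) (Sm l) F))%:E <= sS l F)%E.
  by move=> mF; rewrite sQ//; exact: enorm_gradm_le.
have sub_rc (F A : set B) : rel_compact_in O F -> rel_compact_in O (F `&` A).
  by move=> rF; apply: rel_compact_in_sub rF => x [].
have finP k i (F : set B) : measurable F -> rel_compact_in O F ->
    P k i F \is a fin_num /\ M k i F \is a fin_num.
  by move=> mF rF; have [lP lM] := (gW k).1 i; split; apply: rc_fin_num mF rF.
have gradX l (F : set B) : measurable F -> rel_compact_in O F ->
    gradm (P' l) (M' l) F = gradm (P l) (M l) (F `&` X) + gradm (Sp l) (Sm l) F.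
  move=> mF rF; apply/rowP => i; rewrite !mxE (PM l i F).1 (PM l i F).2.
  have [f1 f2] := finP l i _ (measurableI _ _ mF mX) (sub_rc F X rF).
  by rewrite !fineD//; [ring|rewrite fin_num_measure..].
have gradS l (F : set B) : measurable F -> rel_compact_in O F ->
    gradm (P l) (M l) F = gradm (P l) (M l) (F `&` X) + gradm (P l) (M l) (F `&` ~` X).
  move=> mF rF; apply/rowP => i; rewrite !mxE.
  have [f1 f2] := finP l i _ (measurableI _ _ mF mX) (sub_rc F X rF).
  have [f3 f4] := finP l i _ (measurableI _ _ mF mXC) (sub_rc F (~` X) rF).
  rewrite (measureDI (P l i) mF mX) (measureDI (M l i) mF mX) setDE !fineD//; ring.
have [qS [qSE qSI]] := exists_sum_measure (enum 'I_N) p sS.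
pose W' k : set V := if p k then W k `\` X
  else if k == j then W j `|` \big[setU/set0]_(l < N | p l) (W l `&` X) else W k.
pose kS : meas := measure_add (mrestr kappa mX) qS.
pose mk k : meas := mrestr (mu k) mX.
have kSE A : (kS A = kappa (A `&` X) + qS A)%E by exact: measure_addE.
have kSI : (\int[kS]_x weight x = \int[kappa]_(x in X) weight x + \int[qS]_x weight x)%E.
  by rewrite /kS ge0_integral_measure_add// integral_mrestr// setTI.
(* For the indices that are not involved, [nu] puts back the perimeter in [X]; it is cancelled at
   the end as [S1]. *)
pose nu k : meas := if p k then sS k else if k == j then kS else mk k.
have mWX l : measurable (W l `&` X : set B) by exact: measurableI.
have mW' k : measurable (W' k : set B).
  rewrite /W'; case: ifP => _; first exact: measurableD.
  by case: ifP => _ //; apply: measurableU => //; exact: measurable_bigU.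
have W'O k : W' k `<=` O.
  rewrite /W'; case: ifP => _; first by move=> x [/WO].
  by case: ifP => _ x; [move=> [/WO//|/in_bigsetU[l _ [/WO]]]|move/WO].
have gW' k : exists PM' : ('I_n -> meas) * ('I_n -> meas), grad O (W' k) PM'.1 PM'.2 /\
    forall F : set B, measurable F -> rel_compact_in O F ->
    (gradv PM'.1 PM'.2 F <= mu k (F `&` ~` X) + nu k F)%E.
  have rest (F : set B) : measurable F -> rel_compact_in O F ->
      (gradv (P k) (M k) (F `&` ~` X) <= mu k (F `&` ~` X))%E.
    by move=> mF rF; apply: mu_ge; [exact: measurableI|exact: sub_rc].
  rewrite /W' /nu; have [pk|pk] := boolP (p k).
    have [|||P2 [M2 [g2 E2]]] := @grad_signed_sum R n bool [:: true; false] id O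
        (fun d => if d then W k else W k `&` X) (fun d => if d then P k else P' k)
        (fun d => if d then M k else M' k) (W k `\` X) oO (measurableD (mWk k) mX).
    - by case.
    - by case; [exact: gW|exact: gX].
    - exists set0; split => [||x nx]; [exact: measurable0|exact: measure0|apply: nx].
      rewrite /= !big_cons big_nil/= expr0 expr1 mul1r mulN1r addr0.
      have [Wx|Wx] := pselect (W k x); last first.
        by rewrite !indic0 ?subr0// => -[].
      have [Xx|Xx] := pselect (X x).
        by rewrite (indic1 Wx) (@indic1 (W k `&` X))// indic0 ?subrr// => -[].
      by rewrite (indic1 Wx) (@indic0 (W k `&` X)) ?subr0 ?indic1// => -[].
    exists (P2, M2); split => // F mF rF; rewrite /gradv E2//= !big_cons big_nil/=.
    rewrite expr0 expr1 scale1r scaleN1r addr0 gradX// (gradS k)//.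
    rewrite (_ : _ - _ = gradm (P k) (M k) (F `&` ~` X) - gradm (Sp k) (Sm k) F); last first.
      by rewrite opprD addrACA subrr add0r.
    apply: (@le_trans _ _ (gradv (P k) (M k) (F `&` ~` X) + (enorm (gradm (Sp k) (Sm k) F))%:E)%E).
      by rewrite /gradv -EFinD lee_fin; exact: enormB.
    by apply: leeD; [exact: rest|exact: grS].
  have [kj|kj] := eqVneq k j; last first.
    exists (P k, M k); split; first exact: gW.
    move=> F mF rF; apply: le_trans (mu_ge k mF rF) _.
    by rewrite (measureDI (mu k) mF mX) setDE.
  (* [None] stands for [W j] itself, [Some l] for the piece of [W l] that it receives; these are
     disjoint almost everywhere. *)
  pose r := None :: [seq Some l | l <- [seq l <- enum 'I_N | p l]].
  have rE (T : nmodType) (f : option 'I_N -> T) :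
      \sum_(o <- r) f o = f None + \sum_(l < N | p l) f (Some l).
    by rewrite /r big_cons big_map big_filter big_enum_cond/=.
  have [||||P2 [M2 [g2 E2]]] := @grad_signed_sum R n (option 'I_N) r xpredT O
      (fun o => if o is Some l then W l `&` X else W j)
      (fun o => if o is Some l then P' l else P j) (fun o => if o is Some l then M' l else M j)
      (W j `|` \big[setU/set0]_(l < N | p l) (W l `&` X)) oO.
  - by apply: measurableU => //; exact: measurable_bigU.
  - by case.
  - by case => [l|]; [exact: gX|exact: gW].
  - apply: (@filterS _ _ (ae_filter_ringOfSetsType leb) _ _ _ minW.1.2) => x Hx; rewrite rE /= expr0 mul1r.
    rewrite [X in _ = _ + X](eq_bigr (fun l => \1_(W l `&` X) x)); last by move=> l _; rewrite ?expr0 mul1r.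
    have uni := partition_unique Hx.
    have [Wx|Wx] := pselect (W j x).
      rewrite (indic1 Wx) indic1; last by left.
      rewrite big1 ?addr0// => l pl; apply: indic0 => -[Wl _].
      by have := uni _ _ Wl Wx => lj; move: pj; rewrite -lj pl.
    rewrite (indic0 Wx) add0r.
    have [[l pl [Wl Xx]]|no] := pselect (exists2 l, p l & (W l `&` X) x); last first.
      rewrite indic0; last by move=> [//|/in_bigsetU].
      by rewrite big1// => l pl; apply: indic0 => WlX; apply: no; exists l.
    rewrite indic1; last by right; apply/in_bigsetU; exists l.
    rewrite (bigD1 l)//= indic1// big1 ?addr0// => m /andP[_ ml]; apply: indic0 => -[Wm _].
    by move: ml; rewrite (uni _ _ Wm Wl) eqxx.
  exists (P2, M2); split => // F mF rF; rewrite /gradv E2//= rE /= expr0 scale1r.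
  under eq_bigr do rewrite /= ?expr0 scale1r gradX//.
  rewrite big_split/= (gradS j)//.
  set u1 := gradm (P j) (M j) (F `&` X); set u2 := gradm (P j) (M j) (F `&` ~` X).
  set u3 := \sum_(l < N | p l) _; set u4 := \sum_(l < N | p l) _.
  rewrite (_ : u1 + u2 + (u3 + u4) = u2 + ((u1 + u3) + u4)); last first.
    by rewrite [u1 + u2]addrC -!addrA.
  apply: (@le_trans _ _ ((enorm u2)%:E + ((enorm (u1 + u3))%:E + \sum_(l < N | p l) (enorm (gradm (Sp l) (Sm l) F))%:E))%E).
    rewrite sumEFin -!EFinD lee_fin; apply: le_trans (enormD _ _) _; rewrite lerD2l.
    by apply: le_trans (enormD _ _) _; rewrite lerD2l; exact: enorm_sum.
  rewrite -kj in u2 *; apply: leeD; first exact: rest.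
  rewrite kSE; apply: leeD.
    by apply: Hkappa; [exact: measurableI|exact: sub_rc].
  by rewrite qSE big_enum_cond/=; apply: lee_sum => l _; exact: grS.
have [PM' PM'E] := choice gW'.
have Hnu k (A : set B) : measurable A -> (perimeter_measure O (W' k) A <= mu k (A `&` ~` X) + nu k A)%E.
  move=> mA; rewrite (perimeter_measureE _ oO (mW' k) (PM'E k).1).
  pose q : meas := measure_add (mrestr (mu k) mXC) (nu k).
  apply: (@le_trans _ _ (q A)); last by rewrite [leLHS]measure_addE.
  apply: variation_le_measure => //; last by move=> F; exact: gradv_ge0.
  by move=> F mF rF _; rewrite [leRHS]measure_addE; apply: (PM'E k).2.
have wp' : weak_partition O W'.
  split => [k|]; first by split => //; exact: grad_lfp (PM'E k).1.
  apply: (@filterS _ _ (ae_filter_ringOfSetsType leb) _ _ _ minW.1.2) => x Hx; have [Ox|Ox] := pselect (O x); last first.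
    by rewrite (indic0 Ox) big1// => k _; apply: indic0 => /W'O.
  have uni := partition_unique Hx; have [l Wl] := partition_cover Hx Ox.
  rewrite (indic1 Ox).
  have [/andP[pl /asboolP Xx]|nX] := boolP (p l && `[< X x >]).
    apply: (@sum_indic_unique _ _ j).
      by rewrite /W' (negbTE pj) eqxx; right; apply/in_bigsetU; exists l.
    move=> m; rewrite /W'; case: ifP => pm; first by move=> [_ []].
    by case: ifP => [/eqP//|_ Wm]; move: pm; rewrite (uni _ _ Wm Wl) pl.
  have nX' : p l -> ~ X x by move=> pl Xx; move: nX; rewrite pl /= => /asboolP.
  apply: (@sum_indic_unique _ _ l).
    rewrite /W'; case: ifP => [pl|_]; first by split => //; exact: nX'.
    by case: ifP => [/eqP <-|_ //]; left.
  move=> m; rewrite /W'; case: ifP => [_ [Wm _]|pm]; first exact: uni Wm Wl.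
  case: ifP => [/eqP ->|_ Wm]; last exact: uni Wm Wl.
  move=> [Wj|/in_bigsetU[i pi [Wi Xx]]]; first exact: uni Wj Wl.
  by have il := uni _ _ Wi Wl; exfalso; apply: nX' => //; rewrite -il.
have dist : (partition_dist W W' <= (2 * b)%:E)%E.
  apply: (@le_trans _ _ (\sum_(k < N) ((if p k then leb (Q `&` W k) else 0) +
      (if k == j then \sum_(l < N | p l) leb (Q `&` W l) else 0)))%E).
    apply: lee_sum => k _; have [pk|pk] := boolP (p k).
      rewrite (npj k pk) adde0; apply: le_measure; rewrite ?inE.
      - by apply: measurableU; apply: measurableD.
      - exact: measurableI.
      rewrite /W' pk => x [[Wx nW]|[[Wx _]]//]; split => //; apply: XQ.
      by apply: contrapT => nX; apply: nW.
    rewrite add0e; have [kj|kj] := eqVneq k j; last first.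
      by rewrite /W' (negbTE pk) (negbTE kj) setDv setU0 measure0.
    apply: (@le_trans _ _ (leb (\big[setU/set0]_(l < N | p l) (W l `&` X)))).
      apply: le_measure; rewrite ?inE.
      - by apply: measurableU; apply: measurableD.
      - exact: measurable_bigU.
      rewrite /W' (negbTE pk) kj eqxx => x [[Wx nW]|[[//|//]]].
      by exfalso; apply: nW; left.
    apply: (le_trans (lebesgue_bigU _ mWX)); apply: lee_sum => l _.
    by apply: le_measure; rewrite ?inE//; [exact: measurableI|move=> x [Wx /XQ]].
  rewrite big_split/= -!big_mkcond/= big_pred1_eq mulrDl mul1r EFinD.
  exact: leeD.
have := comparison wp' mX Hnu dist.
have sSI l : p l -> (\int[sS l]_x weight x <= \sum_(i < n) (Sp l i Q + Sm l i Q))%E.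
  move=> _; rewrite (sSE l).2// big_enum/=; apply: lee_sum => i _.
  rewrite integral_mrestr// setTI -SSE.
  apply: (@le_trans _ _ (\int[SS l i]_(x in Q) 1%E)%E).
    apply: ge0_le_integral => //.
    exact: measurable_funTS.
  by rewrite integral_cst// mul1e.
have TS : (\sum_(l < N | p l) \int[sS l]_x weight x <= ((n * 2)%:R * (2 * b / s))%:E)%E.
  rewrite -size_hs_all; apply: le_trans Stot; apply: lee_sum => l pl; exact: sSI.
have nuI : (\sum_(k < N) \int[nu k]_x weight x =
    \sum_(l < N | p l) \int[sS l]_x weight x + (\int[kappa]_(x in X) weight x +
      \sum_(l < N | p l) \int[sS l]_x weight x) +
    \sum_(k < N | ~~ (p k || (k == j))) \int[mu k]_(x in X) weight x)%E.
  rewrite (bigID (fun k => p k || (k == j)))/=; congr (_ + _)%E.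
    rewrite (bigD1 j) /=; last by rewrite eqxx orbT.
    rewrite addeC; congr (_ + _)%E.
      apply: eq_big => [k|k /andP[]].
        by have [pk|pk] := boolP (p k); rewrite ?(npj k pk)//= andbN.
      by rewrite /nu; case: (p k) => //= -> .
    by rewrite /nu (negbTE pj) eqxx kSI qSI// big_enum_cond.
  apply: eq_bigr => k; rewrite negb_or => /andP[pk kj].
  by rewrite /nu (negbTE pk) (negbTE kj) /mk integral_mrestr// setTI.
rewrite nuI [X in (X <= _)%E](bigID (fun k => p k || (k == j)))/=.
set S1 := (\sum_(k < N | ~~ _) _)%E.
have S1fin : S1 \is a fin_num by apply/sum_fin_numP => k _ _; exact: fin_int.
rewrite [X in (_ <= X)%E]addeAC leeD2rE// => H; apply: (le_trans H).
rewrite [X in (X + _ <= _)%E]addeCA -addeA leeD2l// EFinD leeD2r//.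
by rewrite mulrDl mul1r EFinD leeD.
Qed.

(** The indicators add up to that of [O], which has no gradient inside [O]. This relation is the
    hypothesis of [enorm_gap]. *)
Lemma sum_gradm0 (F : set B) : measurable F -> rel_compact_in O F ->
  \sum_(k < N) gradm (P k) (M k) F = 0.
Proof.
move=> mF rF.
have [|||P2 [M2 [g2 E2]]] := @grad_signed_sum R n 'I_N (index_enum 'I_N) xpredT O W P M O oO mO.
- exact: mWk.
- exact: gW.
- apply: (@filterS _ _ (ae_filter_ringOfSetsType leb) _ _ _ minW.1.2) => x Hx.
  by rewrite -Hx; apply: eq_bigr => k _; rewrite expr0 mul1r.
have := E2 F mF rF; under eq_bigr do rewrite expr0 scale1r.
move=> <-; rewrite (@grad_unique _ _ O O O O P2 M2 (fun=> mzero) (fun=> mzero))//.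
- by apply/rowP => i; rewrite !mxE subrr.
- exact: grad_full.
- by rewrite setDv setU0 set0I measure0.
- exact: rel_compact_in_subO rF.
Qed.

Lemma weight_ge_measure k (C X : set B) (delta : R) : measurable C -> measurable X -> C `<=` X ->
  (forall x, C x -> delta%:E <= weight x)%E -> 0 <= delta ->
  (delta%:E * mu k C <= \int[mu k]_(x in X) weight x)%E.
Proof.
move=> mC mX CX wC d0; apply: (@le_trans _ _ (\int[mu k]_(x in C) weight x)%E); last first.
  by apply: ge0_subset_integral => //; exact: measurable_funTS.
rewrite -integral_cst//; apply: ge0_le_integral => //; exact: measurable_funTS.
Qed.

Definition transfer_bound (s b : R) : R := 2 * ((n * 2)%:R * (2 * b / s)) + Ca * (2 * b) `^ alpha.

Lemma measurable_hspaces c st r : measurable (hspaces c st r : set B).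
Proof.
have mh kb : measurable (hspace c kb r : set B).
  case: kb => k bb; have mk := @measurable_coord R n k.
  pose h (x : B) : R := if bb then (x : V) ord0 k - c ord0 k else c ord0 k - (x : V) ord0 k.
  have mh : measurable_fun setT h.
    by rewrite /h; case: (bb); apply: measurable_funB => //; exact: mk.
  rewrite (_ : hspace _ _ _ = h @^-1` `]-oo, r]); last first.
    by apply/seteqP; split => x; rewrite /hspace /h/= in_itv/=; case: (bb).
  by rewrite -[X in measurable X]setTI; exact: mh.
elim: st => [|kb st IH].
  by rewrite (_ : hspaces _ _ _ = setT)//; apply/seteqP; split.
rewrite (_ : hspaces _ _ _ = hspace c kb r `&` hspaces c st r); first exact: measurableI.
apply/seteqP; split => x.
  by move=> h; split => [|kb' kbst]; apply: h; rewrite inE ?eqxx// kbst orbT.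
by move=> [h1 h2] kb'; rewrite inE => /orP[/eqP ->//|]; exact: h2.
Qed.

(** * Perimeter bounds in a cube *)

Section estimates.
Variables (i : 'I_N) (c : V) (rho s b delta : R) (Q : set B).
Hypotheses (mQ : measurable Q) (s0 : 0 < s) (b0 : 0 < b) (d0 : 0 < delta).
Hypothesis hQ : hspaces c hs_all (rho + s) `<=` Q.
Hypothesis wQ : forall x, Q x -> (delta%:E <= weight x <= 1)%E.

Let T := transfer_bound s b.

(** When [W i] receives everything in [X], no interface remains there: by [sum_gradm0] the measure
    [kappa] can be 0. No factor depending on [N] appears because the traces are bounded by the total
    volume of the other sets. *)
Lemma perimeter_bound_complement : (\sum_(l < N | l != i) leb (Q `&` W l) <= b%:E)%E ->
  (\sum_(k < N) mu k (hspaces c hs_all rho) <= (delta^-1 * T)%:E)%E.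
Proof.
move=> sumb; have wQ1 x : Q x -> (weight x <= 1)%E by move=> /wQ/andP[].
have [X [mX inX XQ H]] := transfer (p := predC1 i) mQ s0 b0 hQ wQ1 sumb.
have n1 : ~~ predC1 i i by rewrite /= eqxx.
have n2 (F : set B) : measurable F -> rel_compact_in O F ->
    ((enorm (gradm (P i) (M i) F + \sum_(l < N | predC1 i l) gradm (P l) (M l) F))%:E <= (mzero : meas) F)%E.
  move=> mF rF; have := sum_gradm0 mF rF; rewrite (bigD1 i)//= => ->.
  by rewrite enorm0.
have := H i mzero n1 n2; rewrite integral_measure_zero add0e.
have -> : (\sum_(k < N | predC1 i k || (k == i)) \int[mu k]_(x in X) weight x =
    \sum_(k < N) \int[mu k]_(x in X) weight x)%E.
  by apply: eq_bigl => k /=; rewrite orNb.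
rewrite -/T => HT; rewrite EFinM lee_pdivlMl//; apply: le_trans HT.
rewrite ge0_sume_distrr//; apply: lee_sum => k _.
apply: weight_ge_measure => //; [exact: measurable_hspaces| |exact: ltW].
by move=> x /inX /XQ /wQ/andP[].
Qed.

Lemma le_variation_rc (phi psi : set V -> \bar R) (A : set B) :
  (forall F : set B, measurable F -> rel_compact_in O F -> phi F <= psi F)%E ->
  (forall F, 0 <= phi F)%E -> (variation O phi A <= variation O psi A)%E.
Proof.
move=> H phi0; apply: ge_ereal_sup => _ [F pF <-].
apply: le_trans (variation_ge psi pF); apply: lee_nneseries => k _ //.
by have [mF _ _] := pF; apply: H; case: (mF k).
Qed.

(** Here [kap j] is the perimeter of the union of [W i] and [W j]. Minimality bounds the sum of the
    two perimeters by [kap j] plus [T] for each [j]; adding these with multiplicity [N - 1], the gap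
    leaves one copy of the perimeter of [W i] bounded by the terms [T] alone. *)
Lemma perimeter_bound_self : (leb (Q `&` W i) <= b%:E)%E ->
  (mu i (hspaces c hs_all rho) <= (delta^-1 * (N.-1%:R * (N.-1%:R * T)))%:E)%E.
Proof.
move=> sumb; have wQ1 x : Q x -> (weight x <= 1)%E by move=> /wQ/andP[].
have [|X [mX inX XQ H]] := @transfer (pred1 i) c rho s b Q mQ s0 b0 hQ wQ1.
  by rewrite big_pred1_eq.
pose Pj j k : meas := measure_add (P i k) (P j k).
pose Mj j k : meas := measure_add (M i k) (M j k).
have lfj j k : locally_finite O (Pj j k) /\ locally_finite O (Mj j k).
  have [lP lM] := (gW i).1 k; have [lP' lM'] := (gW j).1 k.
  by split => K cK KO; rewrite [ltLHS]measure_addE; apply: lte_add_pinfty;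
    [exact: lP|exact: lP'|exact: lM|exact: lM'].
have chj j : subadditive_charge O (gradv (Pj j) (Mj j)) by exact: gradm_subadditive_charge.
have gradj j (F : set B) : measurable F -> rel_compact_in O F ->
    gradm (Pj j) (Mj j) F = gradm (P i) (M i) F + gradm (P j) (M j) F.
  move=> mF rF; apply/rowP => k; rewrite !mxE.
  have [lP lM] := (gW i).1 k; have [lP' lM'] := (gW j).1 k.
  have f1 := rc_fin_num lP mF rF; have f2 := rc_fin_num lM mF rF.
  have f3 := rc_fin_num lP' mF rF; have f4 := rc_fin_num lM' mF rF.
  have -> : Pj j k F = (P i k F + P j k F)%E by exact: measure_addE.
  have -> : Mj j k F = (M i k F + M j k F)%E by exact: measure_addE.
  by rewrite !fineD//; ring.
have [kap kapE] := choice (fun j => variation_measure oO (chj j)).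
have ch k := grad_charge (gW k).
have muV k A : measurable A -> mu k A = variation O (gradv (P k) (M k)) A.
  by move=> mA; rewrite muE// (perimeter_measureE _ oO (mWk k) (gW k)).
have Tj j : j != i -> (\int[mu i]_(x in X) weight x + \int[mu j]_(x in X) weight x <=
    \int[kap j]_(x in X) weight x + T%:E)%E.
  move=> ji; have := H j (kap j) ji; rewrite (bigD1 i) /=; last by rewrite eqxx.
  rewrite (big_pred1 j); last first.
    move=> k /=; have [->|ki] := eqVneq k i; first by rewrite eq_sym (negbTE ji).
    by rewrite /= andbT.
  apply=> F mF rF; rewrite big_pred1_eq addrC -gradj// kapE//.
  exact: le_variation (chj j) mF rF.
have kle j (A : set B) : measurable A -> (kap j A <= mu i A + mu j A)%E.
  move=> mA; rewrite kapE// !muV// -variationD//.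
  apply: le_variation_rc => F; last exact: gradv_ge0.
  by move=> mF rF; rewrite /gradv gradj// -EFinD lee_fin enormD.
(* Both sides of [enorm_gap] become measures, [q1] and [qm']; the multiplicity [N.-1] is written as
   a sum over ['I_N.-1] so that only sums of charges occur. *)
have [qk [qkE qkI]] := exists_sum_measure (index_enum 'I_N) (predC1 i) kap.
have [qk' [qkE' qkI']] := exists_sum_measure (index_enum 'I_N.-1) xpredT (fun=> qk).
have [qm [qmE qmI]] := exists_sum_measure (index_enum 'I_N) (predC1 i) (fun j => measure_add (mu i) (mu j)).
have [qm' [qmE' qmI']] := exists_sum_measure (index_enum 'I_N.-1) xpredT (fun=> qm).
pose q1 : meas := measure_add (mu i) qk'.
have q12 (A : set B) : measurable A -> (q1 A <= qm' A)%E.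
  move=> mA; rewrite [leLHS]measure_addE qkE' qmE' muV//.
  pose phi F := (gradv (P i) (M i) F + \sum_(m < N.-1) \sum_(j < N | predC1 i j) gradv (Pj j) (Mj j) F)%E.
  pose psi F := (\sum_(m < N.-1) \sum_(j < N | predC1 i j) (gradv (P i) (M i) F + gradv (P j) (M j) F))%E.
  have chS : subadditive_charge O (fun F => \sum_(j < N | predC1 i j) gradv (Pj j) (Mj j) F)%E.
    exact: subadditive_charge_sum.
  have chD j : subadditive_charge O (fun F => gradv (P i) (M i) F + gradv (P j) (M j) F)%E.
    exact: subadditive_chargeD.
  have chS' : subadditive_charge O (fun F => \sum_(j < N | predC1 i j) (gradv (P i) (M i) F + gradv (P j) (M j) F))%E.
    exact: subadditive_charge_sum.
  have -> : (\sum_(m <- index_enum 'I_N.-1) qm A = variation O psi A)%E.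
    rewrite /psi variation_sum//; apply: eq_bigr => m _; rewrite qmE variation_sum//.
    by apply: eq_bigr => j _; rewrite variationD// -!muV//; exact: measure_addE.
  have -> : (variation O (gradv (P i) (M i)) A + \sum_(m <- index_enum 'I_N.-1) qk A = variation O phi A)%E.
    rewrite /phi variationD//; last exact: subadditive_charge_sum.
    congr (_ + _)%E; rewrite variation_sum//; apply: eq_bigr => m _; rewrite qkE variation_sum//.
    by apply: eq_bigr => j _; rewrite kapE.
  apply: le_variation_rc => F; last first.
    rewrite /phi adde_ge0 ?gradv_ge0//; apply: sume_ge0 => m _; apply: sume_ge0 => j _.
    exact: gradv_ge0.
  move=> mF rF; rewrite /phi /psi.
  have := enorm_gap (v := fun k => gradm (P k) (M k) F) i (sum_gradm0 mF rF).
  rewrite -lee_fin EFinD; congr (_ <= _)%E.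
    congr (_ + _)%E; rewrite -[in LHS](card_ord N.-1) -sumr_const -sumEFin; apply: eq_bigr => m _.
    by rewrite -sumEFin; apply: eq_bigr => j _; rewrite /gradv gradj.
  rewrite -[in LHS](card_ord N.-1) -sumr_const -sumEFin; apply: eq_bigr => m _.
  by rewrite -sumEFin; apply: eq_bigr => j _; rewrite EFinD.
have wF (A : set B) : measurable A -> measurable_fun A weight by move=> mA; exact: measurable_funTS.
have kfin j : (\int[kap j]_(x in X) weight x)%E \is a fin_num.
  rewrite ge0_fin_numE; last exact: integral_ge0.
  apply: (@le_lt_trans _ _ (\int[measure_add (mu i) (mu j)]_(x in X) weight x)%E).
    by apply: ge0_le_measure_integral => // A mA; rewrite [leRHS]measure_addE; exact: kle.
  rewrite ge0_integral_measure_add//; last exact: wF.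
  by rewrite lte_add_pinfty// ltey_eq fin_int.
have : (\int[q1]_(x in X) weight x <= \int[qm']_(x in X) weight x)%E.
  by apply: ge0_le_measure_integral.
have wX0 : forall x, X x -> (0 <= weight x)%E by [].
have mwX := wF X mX.
rewrite ge0_integral_measure_add// (qkI' _ _ mX mwX wX0) (qmI' _ _ mX mwX wX0).
rewrite (qkI _ _ mX mwX wX0) (qmI _ _ mX mwX wX0).
have -> : (\sum_(j <- index_enum 'I_N | predC1 i j) \int[measure_add (mu i) (mu j)]_(x in X) weight x =
    (\sum_(j < N | predC1 i j) (fine (\int[mu i]_(x in X) weight x) + fine (\int[mu j]_(x in X) weight x)))%:E)%E.
  rewrite -sumEFin; apply: eq_bigr => j _; rewrite ge0_integral_measure_add//.
  by rewrite EFinD !fineK// fin_int.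
have -> : (\sum_(j <- index_enum 'I_N | predC1 i j) \int[kap j]_(x in X) weight x =
    (\sum_(j < N | predC1 i j) fine (\int[kap j]_(x in X) weight x))%:E)%E.
  by rewrite -sumEFin; apply: eq_bigr => j _; rewrite fineK// kfin.
rewrite !sumEFin !sumr_const !card_ord -{1}(fineK (fin_int i mX)) -EFinD lee_fin => gap.
have Tr j : j != i -> fine (\int[mu i]_(x in X) weight x) + fine (\int[mu j]_(x in X) weight x) <=
    fine (\int[kap j]_(x in X) weight x) + T.
  by move=> /Tj; rewrite -(fineK (fin_int i mX)) -(fineK (fin_int j mX)) -(fineK (kfin j)) -!EFinD lee_fin.
have sumT : \sum_(j < N | predC1 i j) (fine (\int[mu i]_(x in X) weight x) + fine (\int[mu j]_(x in X) weight x)) <=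
    \sum_(j < N | predC1 i j) fine (\int[kap j]_(x in X) weight x) + N.-1%:R * T.
  have <- : \sum_(j < N | predC1 i j) T = N.-1%:R * T.
    by rewrite sumr_const cardC1 card_ord mulr_natl.
  by rewrite -big_split/=; apply: ler_sum => j ji; exact: Tr.
rewrite EFinM lee_pdivlMl//.
apply: (@le_trans _ _ (\int[mu i]_(x in X) weight x)%E).
  apply: weight_ge_measure => //; [exact: measurable_hspaces| |exact: ltW].
  by move=> x /inX /XQ /wQ/andP[].
rewrite -(fineK (fin_int i mX)) lee_fin.
have := ler_wpM2l (ler0n R N.-1) sumT; rewrite mulrDr !mulr_natl => gap2.
move: (le_trans gap gap2).
by rewrite [X in _ <= X]addrC lerD2r.
Qed.

End estimates.

Lemma hs_allP (c : V) r (x : V) :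
  hspaces c hs_all r x <-> forall k, c ord0 k - r <= x ord0 k <= c ord0 k + r.
Proof.
have memh k bb : (k, bb) \in hs_all.
  by apply/allpairsP; exists (k, bb); rewrite mem_enum; split => //; case: bb.
split => [h k|h [k bb] _].
  have := h _ (memh k true); have := h _ (memh k false); rewrite /hspace/= => h1 h2.
  by apply/andP; split; lra.
by have /andP[h1 h2] := h k; rewrite /hspace; case: bb => /=; lra.
Qed.

Lemma hcube_hspaces (c : V) (r : R) : hcube c r `<=` hspaces c hs_all r.
Proof. by move=> x /hcubeP h; apply/hs_allP => k; have /andP[/ltW -> ->] := h k. Qed.

Lemma hspaces_hcube (c : V) (r r' : R) : r < r' -> hspaces c hs_all r `<=` hcube c r'.
Proof.
move=> rr x /hs_allP h; apply/hcubeP => k; have /andP[h1 h2] := h k; apply/andP; split; lra.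
Qed.

Lemma rel_compact_hcube (c : V) r : hspaces c hs_all r `<=` O -> rel_compact_in O (hcube c r).
Proof.
move=> hO; pose K := [set v : V | forall k, (`[c ord0 k - r, c ord0 k + r]%classic : set R) (v ord0 k)].
have cK : compact K.
  apply: (@rV_compact _ _ (fun k => `[c ord0 k - r, c ord0 k + r]%classic)) => k.
  exact: segment_compact.
have clK : closed K by apply: compact_closed => //; exact: norm_hausdorff.
have sub : closure (hcube c r : set V) `<=` K.
  rewrite (closure_id K).1//; apply: closure_subset => x /hcube_hspaces/hs_allP h k.
  by rewrite /= in_itv/=; exact: h.
split; first exact: subclosed_compact (@closed_closure _ _) cK sub.
move=> x /sub xK; apply: hO; apply/hs_allP => k; have := xK k.
by rewrite /= in_itv/=.
Qed.

Lemma partition_volume (p : pred 'I_N) (Q D : set B) : measurable Q -> measurable D ->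
  {ae leb, forall x, \1_D x = \sum_(l < N | p l) \1_(Q `&` W l) x :> R} ->
  (leb D = \sum_(l < N | p l) leb (Q `&` W l))%E.
Proof.
move=> mQ mD ae; have mQW l : measurable (Q `&` W l : set B) by exact: measurableI.
have m1 (A : set B) : measurable A -> measurable_fun setT (fun x : B => (\1_A x)%:E : \bar R).
  by move=> mA; apply/measurable_EFinP; exact: measurable_indic.
rewrite -[LHS](_ : (\int[leb]_x (\1_D x)%:E)%E = _); last by rewrite integral_indic// setIT.
transitivity (\int[leb]_x \sum_(l <- [seq l <- index_enum 'I_N | p l]) (\1_(Q `&` W l) x)%:E)%E.
  apply: ae_eq_integral => //; [exact: m1|by apply: emeasurable_sum => l; exact: m1|].
  apply: (@filterS _ _ (ae_filter_ringOfSetsType leb) _ _ _ ae) => x + _.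
  by rewrite big_filter sumEFin => ->.
rewrite ge0_integral_sum//.
- by rewrite big_filter; apply: eq_bigr => l _; rewrite integral_indic// setIT.
- by move=> l; exact: m1.
Qed.

Lemma complement_volume i (Q : set B) : measurable Q -> Q `<=` O ->
  (leb (Q `\` W i) = \sum_(l < N | l != i) leb (Q `&` W l))%E.
Proof.
move=> mQ QO; apply: partition_volume => //; first exact: measurableD.
apply: (@filterS _ _ (ae_filter_ringOfSetsType leb) _ _ _ minW.1.2) => x Hx.
have uni := partition_unique Hx.
have [Qx|Qx] := pselect (Q x); last first.
  by rewrite indic0 ?big1// => [l _|[]//]; apply: indic0 => -[].
have [l Wl] := partition_cover Hx (QO _ Qx).
have [Wi|Wi] := pselect (W i x).
  rewrite indic0 => [|[]//]; rewrite big1// => m mi; apply: indic0 => -[_ Wm].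
  by move: mi; rewrite (uni _ _ Wm Wi) eqxx.
rewrite indic1//; have li : l != i by apply/eqP => li; apply: Wi; rewrite -li.
rewrite (bigD1 l)//= indic1// big1 ?addr0// => m /andP[_ ml]; apply: indic0 => -[_ Wm].
by move: ml; rewrite (uni _ _ Wm Wl) eqxx.
Qed.

Lemma total_volume (Q : set B) : measurable Q -> Q `<=` O ->
  (leb Q = \sum_(l < N) leb (Q `&` W l))%E.
Proof.
move=> mQ QO; apply: partition_volume => //.
apply: (@filterS _ _ (ae_filter_ringOfSetsType leb) _ _ _ minW.1.2) => x Hx.
have [Qx|Qx] := pselect (Q x); last first.
  by rewrite indic0 ?big1// => l _; apply: indic0 => -[].
have := Hx; rewrite (indic1 (QO _ Qx)) (indic1 Qx) => <-; apply: eq_bigr => l _.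
by rewrite !indicE in_setI (mem_set Qx).
Qed.

Lemma measurable_eball (z : V) e : 0 < e -> measurable (eball z e : set B).
Proof.
move=> e0; pose f (y : B) : R := \sum_(k < n) ((y : V) ord0 k - z ord0 k) ^+ 2.
have mf : measurable_fun setT f.
  apply: measurable_sum => k; apply: measurable_funX; apply: measurable_funB => //.
  exact: measurable_coord.
have fE y : f y = enorm (y - z) ^+ 2 by rewrite sqr_enorm; apply: eq_bigr => k _; rewrite !mxE.
rewrite (_ : eball z e = f @^-1` `]-oo, (e ^+ 2)[).
  by rewrite -[X in measurable X]setTI; exact: mf.
by apply/seteqP; split => y; rewrite /eball/= in_itv/= fE ltr_pXn2r// ?nnegrE ?enorm_ge0// ltW.
Qed.

(** By [perimeter_local] the set [W l] has in [U] the perimeter of the empty set or of [O], which is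
    0, while balls around a point of the reduced boundary have positive perimeter. *)
Lemma not_reduced l (U : set V) : open U -> U `<=` O ->
  leb (W l `&` U) = 0%E \/ leb (U `\` W l) = 0%E -> forall z, U z -> ~ reduced_boundary O (W l) z.
Proof.
move=> oU UO null z Uz [Oz pos _].
have mU : measurable (U : set B) by exact: open_measurable_rV.
have /nbhs_ballP[e /= e0 eU] : nbhs z U by apply: open_nbhs_nbhs.
have eUb : eball z e `<=` U.
  move=> y ye; apply: eU; split => // a' b; rewrite ord1 /ball/= distrC.
  by have := coord_le_enorm (y - z) b; rewrite !mxE => /le_lt_trans; apply.
have me : measurable (eball z e : set B) by exact: measurable_eball.
have lW : locally_finite_perimeter O (W l) by exact: grad_lfp (gW l).
have := pos e e0; case: null => null.
  rewrite (@perimeter_local _ _ O U (W l) set0)//.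
  - by rewrite perimeter_empty0// ltxx.
  - exact: grad_lfp (grad_empty O).
  - by rewrite setD0 set0D setU0.
rewrite (@perimeter_local _ _ O U (W l) O)//.
- by rewrite perimeter_full0// ltxx.
- exact: grad_lfp (grad_full oO).
- apply/eqP; rewrite eq_le measure_ge0 andbT -null; apply: le_measure; rewrite ?inE.
  + by apply: measurableI => //; apply: measurableU; apply: measurableD.
  + exact: measurableD.
  + by move=> x [[[/WO//]|[]]].
Qed.

(** If [W k] has full measure in a ball, all other sets are null there, so no reduced boundary meets
    the ball, by [not_reduced], and none accumulates in it since it is open. *)
Lemma sharp_ball k (x : V) t : 0 < t -> ball x t `<=` O -> leb (ball x t `\` W k) = 0%E ->
  ball x t `<=` sharp O W k.
Proof.
move=> t0 bO' null y yb; have oU : open (ball x t) by exact: ball_open.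
have mU : measurable (ball x t : set B) by exact: open_measurable_rV.
have /nbhs_ballP[e /= e0 eU] : nbhs y (ball x t) by apply: open_nbhs_nbhs.
split; first exact: bO'.
  move=> [_ cl]; have [z [[l _ rz] zU]] := cl _ (open_nbhs_nbhs (conj oU yb)).
  apply: (not_reduced oU bO' _ zU) rz.
  have [->|lk] := eqVneq l k; [by right|left].
  apply/eqP; rewrite eq_le measure_ge0 andbT.
  have h : (leb (ball x t `&` W l) <= leb (ball x t `\` W k))%E.
    rewrite complement_volume// (bigD1 l)//=.
    by rewrite leeDl//; apply: sume_ge0.
  by rewrite setIC; move: h; rewrite null.
exists e; split => //; apply/eqP; rewrite eq_le measure_ge0 andbT -null.
have sub : eball y e `\` W k `<=` ball x t `\` W k.
  move=> z [ze nW]; split => //; apply: eU; split => // a' b'; rewrite ord1 /ball/= distrC.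
  by have := coord_le_enorm (z - y) b'; rewrite !mxE => /le_lt_trans; apply.
by apply: le_measure; rewrite ?inE//; apply: measurableD => //; exact: measurable_eball.
Qed.

Lemma mu_finite i (A : set B) : measurable A -> rel_compact_in O A -> mu i A \is a fin_num.
Proof.
move=> mA rA; rewrite ge0_fin_numE// muE// (perimeter_measureE _ oO (mWk i) (gW i)).
exact: perimeter_finite (gW i) mA rA.
Qed.

(** * Density estimates and cells nearly filled by one set *)

Section regularity.
Variables (O' : set V) (delta : R).
Hypotheses (O'O : O' `<=` O) (d0 : 0 < delta) (aO' : forall x, O' x -> delta <= a x <= 1).
Hypotheses (al1 : alpha <= 1) (n0 : (0 < n)%N) (aln : (n%:R - 1) / n%:R < alpha).

Let wO' x : O' x -> (delta%:E <= weight x <= 1)%E.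
Proof. by move=> O'x; rewrite /weight /patch mem_set ?lee_fin; [exact: aO'|exact: O'O]. Qed.

(** In [16 n] there are [2 n] faces, a factor 2 for traces paid twice, one from the choice of good
    heights, and one from cutting within [s / 2]. The [2 * Ca] comes from [(2 * b)^alpha]. *)
Definition perimeter_constant : R := delta^-1 * (16 * n%:R + 2 * Ca).
Local Notation K1 := perimeter_constant.

Lemma perimeter_constant_gt0 : 0 < K1.
Proof.
rewrite mulr_gt0 ?invr_gt0//; apply: ltr_wpDr; first by rewrite mulr_ge0.
by rewrite mulr_gt0// ltr0n.
Qed.

Lemma transfer_bound_le (s b : R) : 0 < s -> 0 < b ->
  delta^-1 * transfer_bound (s / 2) b <= K1 * (b / s + b `^ alpha).
Proof.
move=> s0 b0; rewrite /perimeter_constant -mulrA; apply: ler_wpM2l; first by rewrite invr_ge0 ltW.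
rewrite /transfer_bound powRM ?(ltW b0)//.
have X0 : 0 <= b / s by rewrite divr_ge0// ltW.
have -> : 2 * b / (s / 2) = 4 * (b / s) by field; exact: lt0r_neq0.
have h2 : 2 `^ alpha <= 2 :> R by rewrite -[leRHS]powRr1// ler_powR// ler1n.
have Y0 := powR_ge0 b alpha; rewrite natrM.
set X := b / s in X0 *; set Y := b `^ alpha in Y0 *; set z := 2 `^ alpha in h2 *.
have nY : 0 <= n%:R * Y by rewrite mulr_ge0.
have CX : 0 <= Ca * X by rewrite mulr_ge0.
have : 0 <= Ca * Y * (2 - z) by rewrite !mulr_ge0// subr_ge0.
move: nY CX; move: (n%:R : R) => m; lra.
Qed.

Lemma hspaces_sub (c : V) (r r' : R) : r <= r' -> hspaces c hs_all r `<=` hspaces c hs_all r'.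
Proof.
by move=> rr x /hs_allP h; apply/hs_allP => k; have /andP[h1 h2] := h k; apply/andP; split; lra.
Qed.

(** Cutting within [s / 2] leaves room to put the closed outer cube inside the half-open one in
    which volumes are measured. *)
Let box_facts (c : V) (rho s : R) : 0 < s -> hspaces c hs_all (rho + s) `<=` O' ->
  hspaces c hs_all (rho + s / 2) `<=` hcube c (rho + s) /\
  forall x, hcube c (rho + s) x -> (delta%:E <= weight x <= 1)%E.
Proof.
move=> s0 hO; split; first by apply: hspaces_hcube; lra.
by move=> x /hcube_hspaces /hO; exact: wO'.
Qed.

Lemma mu_cube_complement i (c : V) (rho s b : R) : 0 < s -> 0 < b ->
  hspaces c hs_all (rho + s) `<=` O' -> (leb (hcube c (rho + s) `\` W i) <= b%:E)%E ->
  (\sum_(k < N) mu k (hspaces c hs_all rho) <= (K1 * (b / s + b `^ alpha))%:E)%E.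
Proof.
move=> s0 b0 hO small; have [h1 h2] := box_facts s0 hO.
have s20 : 0 < s / 2 by rewrite divr_gt0.
have mQ := measurable_hcube c (rho + s).
have QO : hcube c (rho + s) `<=` O by move=> x /hcube_hspaces /hO /O'O.
rewrite (complement_volume i mQ QO) in small.
apply: (le_trans (perimeter_bound_complement mQ s20 b0 d0 h1 h2 small)).
by rewrite lee_fin transfer_bound_le.
Qed.

(** The summand 1 keeps the constant positive when [N = 1]. *)
Lemma mu_cube_self i (c : V) (rho s b : R) : 0 < s -> 0 < b ->
  hspaces c hs_all (rho + s) `<=` O' -> (leb (hcube c (rho + s) `&` W i) <= b%:E)%E ->
  (mu i (hspaces c hs_all rho) <= ((N.-1%:R ^+ 2 * K1 + 1) * (b / s + b `^ alpha))%:E)%E.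
Proof.
move=> s0 b0 hO small; have [h1 h2] := box_facts s0 hO.
have s20 : 0 < s / 2 by rewrite divr_gt0.
have mQ := measurable_hcube c (rho + s).
apply: (le_trans (perimeter_bound_self mQ s20 b0 d0 h1 h2 small)).
rewrite lee_fin (_ : delta^-1 * _ = N.-1%:R ^+ 2 * (delta^-1 * transfer_bound (s / 2) b)); last by ring.
apply: (@le_trans _ _ (N.-1%:R ^+ 2 * (K1 * (b / s + b `^ alpha)))).
  by apply: ler_wpM2l; [exact: exprn_ge0|exact: transfer_bound_le].
by rewrite [leRHS]mulrDl mulrA lerDl mul1r addr_ge0 ?powR_ge0// divr_ge0// ltW.
Qed.

Let coord_bound i k (Q : set B) (P2 M2 : 'I_n -> meas) : measurable Q -> rel_compact_in O Q ->
  (forall F : set B, measurable F -> rel_compact_in O F -> gradv P2 M2 F = gradv (P i) (M i) F) ->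
  forall F : set B, measurable F -> F `<=` Q -> `|fine (P2 k F) - fine (M2 k F)| <= fine (mu i Q).
Proof.
move=> mQ rQ gE F mF FQ; have rF := rel_compact_in_sub FQ rQ.
have := coord_le_enorm (gradm P2 M2 F) k; rewrite mxE => /le_trans; apply.
rewrite -lee_fin fineK ?mu_finite//; apply: (@le_trans _ _ (mu i F)).
  by rewrite -/(gradv P2 M2 F) gE//; exact: mu_ge.
by apply: le_measure; rewrite ?inE.
Qed.

(** What [density_iteration] provides. As a predicate on [eps] it lets the threshold be fixed before
    the partition is given. *)
Definition decays (A eps : R) : Prop := forall (E : set B) (c : V) (r : R), measurable E ->
  0 < r -> r <= 1 ->
  (forall rho s sg b : R, 0 < sg -> sg <= rho -> 0 < s -> 0 < b -> rho + s <= r ->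
     (leb (E `&` hcube c (rho + s)) <= b%:E)%E -> b + b <= (2 * sg) ^+ n ->
     (leb (E `&` hcube c (rho - sg)) <= (A * sg * (b / s + b `^ alpha))%:E)%E) ->
  (leb (E `&` hcube c r) <= (eps * r ^+ n)%:E)%E -> leb (E `&` hcube c (r / 2)) = 0%E.

(** One step of the iteration is the isoperimetric inequality with the perimeter bounded by
    minimality. [E] will be [W i] or its complement in [O], whose gradients have the same norm. *)
Let density (A0 eps : R) i (E : set B) (P2 M2 : 'I_n -> meas) (c : V) (r : R) : 0 < A0 ->
  decays (2 * n%:R * A0) eps -> measurable E -> grad O E P2 M2 ->
  (forall F : set B, measurable F -> rel_compact_in O F -> gradv P2 M2 F = gradv (P i) (M i) F) ->
  hspaces c hs_all r `<=` O' -> 0 < r -> r <= 1 ->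
  (forall rho s b, 0 < s -> 0 < b -> rho + s <= r -> (leb (E `&` hcube c (rho + s)) <= b%:E)%E ->
    (mu i (hspaces c hs_all rho) <= (A0 * (b / s + b `^ alpha))%:E)%E) ->
  (leb (E `&` hcube c r) <= (eps * r ^+ n)%:E)%E -> leb (E `&` hcube c (r / 2)) = 0%E.
Proof.
move=> A00 dec mE gE gradE hO r0 r1 KB; apply: dec => // rho s sg b sg0 sgr s0 b0 rsr small b2.
have rho0 : 0 < rho by apply: lt_le_trans sgr.
have hrho : hspaces c hs_all rho `<=` O.
  by apply: subset_trans O'O; apply: subset_trans hO; apply: hspaces_sub; lra.
have rQ := rel_compact_hcube hrho; have mQ := measurable_hcube c rho.
have small' : (leb (E `&` hcube c rho) <= b%:E)%E.
  apply: le_trans small; apply: le_measure; rewrite ?inE.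
  - exact: measurableI.
  - by apply: measurableI => //; exact: measurable_hcube.
  - by apply: setIS; apply: hcube_sub; lra.
have k0 : 0 <= fine (mu i (hcube c rho)) by rewrite fine_ge0.
have := isoperimetric oO mE gE k0 rho0 rQ (fun k => coord_bound (i := i) k mQ rQ gradE) sg0 sgr.
move=> /(_ _)/le_trans; apply.
  by apply: (le_trans (leeD small' small')); rewrite -EFinD lee_fin.
have kle : fine (mu i (hcube c rho)) <= A0 * (b / s + b `^ alpha).
  rewrite -lee_fin fineK ?mu_finite//; apply: le_trans (KB rho s b s0 b0 rsr small).
  by apply: le_measure; rewrite ?inE//; [exact: measurable_hspaces|exact: hcube_hspaces].
rewrite lee_fin (_ : 2 * n%:R * A0 * sg * (b / s + b `^ alpha) =
  2 * n%:R * sg * (A0 * (b / s + b `^ alpha))); last by ring.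
rewrite [leLHS](_ : _ = 2 * n%:R * sg * fine (mu i (hcube c rho))); last by ring.
by apply: ler_wpM2l => //; rewrite !mulr_ge0 ?(ltW sg0).
Qed.

Lemma density_self eps i (c : V) (r : R) : decays (2 * n%:R * (N.-1%:R ^+ 2 * K1 + 1)) eps ->
  hspaces c hs_all r `<=` O' -> 0 < r -> r <= 1 ->
  (leb (W i `&` hcube c r) <= (eps * r ^+ n)%:E)%E -> leb (W i `&` hcube c (r / 2)) = 0%E.
Proof.
move=> dec hO r0 r1; apply: (density (i := i) _ dec (mWk i) (gW i) _ hO r0 r1) => //.
  by rewrite ltr_wpDl// mulr_ge0 ?exprn_ge0// ltW// perimeter_constant_gt0.
move=> rho s b s0 b0 rsr small; apply: mu_cube_self => //; last by rewrite setIC.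
by apply: subset_trans hO; exact: hspaces_sub.
Qed.

Lemma density_complement eps i (c : V) (r : R) : decays (2 * n%:R * K1) eps ->
  hspaces c hs_all r `<=` O' -> 0 < r -> r <= 1 ->
  (leb (hcube c r `\` W i) <= (eps * r ^+ n)%:E)%E -> leb (hcube c (r / 2) `\` W i) = 0%E.
Proof.
move=> dec hO r0 r1; pose E : set B := O `\` W i; pose Z : 'I_n -> meas := fun=> mzero.
have mE : measurable E by exact: measurableD.
have [|||P2 [M2 [g2 E2]]] := @grad_signed_sum R n bool [:: true; false] id O
    (fun d => if d then O else W i) (fun d => if d then Z else P i)
    (fun d => if d then Z else M i) E oO mE.
- by case.
- by case; [exact: grad_full|exact: gW].
- exists set0; split => [||x nx]; [exact: measurable0|exact: measure0|apply: nx].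
  rewrite /= !big_cons big_nil/= expr0 expr1 mul1r mulN1r addr0 /E.
  have [Wx|Wx] := pselect (W i x).
    by rewrite (indic1 Wx) (indic1 (WO Wx)) indic0 ?subrr// => -[].
  have [Ox|Ox] := pselect (O x); first by rewrite (indic0 Wx) subr0 (indic1 Ox) indic1.
  by rewrite (indic0 Wx) subr0 (indic0 Ox) indic0// => -[].
have gE (F : set B) : measurable F -> rel_compact_in O F -> gradv P2 M2 F = gradv (P i) (M i) F.
  move=> mF rF; rewrite /gradv E2// !big_cons big_nil/= expr0 expr1 scale1r scaleN1r addr0.
  rewrite (_ : gradm Z Z F = 0) ?add0r ?enormN//.
  by apply/rowP => k; rewrite !mxE subrr.
have EQ r' : r' <= r -> E `&` hcube c r' = hcube c r' `\` W i.
  move=> rr; apply/seteqP; split => x; first by move=> [[_ nW] Qx].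
  move=> [Qx nW]; split => //; split => //; apply: O'O; apply: hO; apply: hcube_hspaces.
  exact: hcube_sub Qx.
rewrite -!EQ//; last by lra.
apply: (density (i := i) perimeter_constant_gt0 dec mE g2 gE hO r0 r1).
move=> rho s b s0 b0 rsr small; rewrite EQ// in small.
apply: (@le_trans _ _ (\sum_(k < N) mu k (hspaces c hs_all rho))%E).
  by rewrite (bigD1 i)//= leeDl//; apply: sume_ge0.
apply: (mu_cube_complement (i := i)) => //.
by apply: subset_trans hO; exact: hspaces_sub.
Qed.

Lemma measure_indic_sum (m : meas) (I : finType) (D : set B) (F : I -> set B) : measurable D ->
  (forall i, measurable (F i)) -> (forall x, \1_D x = \sum_i \1_(F i) x :> R) ->
  (m D = \sum_i m (F i))%E.
Proof.
move=> mD mF H.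
have m1 (A : set B) : measurable A -> measurable_fun setT (fun x : B => (\1_A x)%:E : \bar R).
  by move=> mA; apply/measurable_EFinP; exact: measurable_indic.
rewrite -[LHS](_ : (\int[m]_x (\1_D x)%:E)%E = _); last by rewrite integral_indic// setIT.
transitivity (\int[m]_x \sum_i (\1_(F i) x)%:E)%E.
  by apply: eq_integral => x _; rewrite H sumEFin.
rewrite ge0_integral_sum//; last by move=> i; exact: m1.
by apply: eq_bigr => i _; rewrite integral_indic// setIT.
Qed.

(** The first factor is the Poincare constant of a cell in which the complement of [W k] has volume
    at least [eps] times the [n]-th power of the half-side. The second one is the perimeter bound
    with the trivial volume [b = 4^n rho^n]. *)
Definition grid_constant (eps : R) : R := 4 ^+ n * (n%:R * 2) / eps * (K1 * (2 * 4 ^+ n)).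

(** The gain [1 / L] comes from the Poincare inequality in a cell being proportional to its side,
    while the perimeters in the cells add up to the perimeter in the cube, bounded independently of
    [L]. *)
Lemma grid (i0 : 'I_N) (p : pred 'I_N) (c : V) (rho eps : R) (L : nat) : (0 < L)%N -> 0 < eps ->
  0 < rho -> rho <= 1 -> hspaces c hs_all (rho + rho) `<=` O' ->
  (forall (v : V) k, p k -> hspaces v hs_all (rho / L%:R) `<=` hspaces c hs_all rho ->
    ((eps * (rho / L%:R) ^+ n)%:E <= leb (hcube v (rho / L%:R) `\` W k))%E) ->
  (\sum_(k < N | p k) leb (hcube c rho `&` W k) <= (grid_constant eps / L%:R * rho ^+ n)%:E)%E.
Proof.
move=> L0 eps0 rho0 rho1 hO bad; set tau := rho / L%:R in bad *.
have LR : 0 < L%:R :> R by rewrite ltr0n.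
have tau0 : 0 < tau by rewrite divr_gt0.
have rhoE : rho = L%:R * tau by rewrite /tau mulrC divfK// lt0r_neq0.
pose ctr (v : {ffun 'I_n -> 'I_L}) : V := \row_k (c ord0 k - rho + (2 * (v k)%:R + 1) * tau).
have ctrP v (x : V) : hcube (ctr v) tau x <->
    forall k, 2 * tau * (v k)%:R < x ord0 k - c ord0 k + rho <= 2 * tau * ((v k)%:R + 1).
  split => [/hcubeP h k|h]; [move: (h k)|apply/hcubeP => k; move: (h k)];
    rewrite mxE => /andP[h1 h2]; apply/andP; split; move: h1 h2; lra.
have vL (v : {ffun 'I_n -> 'I_L}) k : (v k)%:R + 1 <= L%:R :> R by rewrite natr1 ler_nat.
have v0 (v : {ffun 'I_n -> 'I_L}) k : 0 <= (v k)%:R :> R by [].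
have bnd (v : {ffun 'I_n -> 'I_L}) k : 0 <= tau * (v k)%:R /\ tau * ((v k)%:R + 1) <= rho.
  split; first exact: (mulr_ge0 (ltW tau0) (v0 v k)).
  by rewrite rhoE mulrC; apply: (ler_wpM2r (ltW tau0)); exact: vL.
have csub v : hcube (ctr v) tau `<=` hcube c rho.
  move=> x /ctrP h; apply/hcubeP => k; have [b1 b2] := bnd v k; have /andP[h1 h2] := h k.
  by apply/andP; split; lra.
have csub' v : hspaces (ctr v) hs_all tau `<=` hspaces c hs_all rho.
  move=> x /hs_allP h; apply/hs_allP => k; have [b1 b2] := bnd v k; move: (h k); rewrite mxE.
  by move=> /andP[h1 h2]; apply/andP; split; lra.
have cover x : hcube c rho x -> exists v, hcube (ctr v) tau x.
  move=> /hcubeP h; have ex k : exists m : 'I_L, 2 * tau * m%:R < x ord0 k - c ord0 k + rho <= 2 * tau * (m%:R + 1).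
    have /andP[h1 h2] := h k; set y := x ord0 k - c ord0 k + rho.
    have y0 : 0 < y by rewrite /y; lra.
    have y2 : y <= 2 * tau * ((L.-1)%:R + 1) by rewrite natr1 prednK// /y; move: rhoE h2; nra.
    have exm : exists m, y <= 2 * tau * (m%:R + 1) by exists L.-1.
    (* The least [m] whose upper face is not below [y]; by minimality [y] is strictly above the
       lower face. *)
    case: (ex_minnP exm) => m my mmin.
    have mL : (m < L)%N by rewrite -(prednK L0) ltnS; exact: mmin.
    exists (Ordinal mL); rewrite /= my andbT.
    case: m my mmin mL => [|m] my mmin mL; first by rewrite mulr0.
    rewrite ltNge; apply/negP => ym; have := mmin m.
    by rewrite (natr1 m) ym ltnn => /(_ isT).
  have [v vP] := choice ex; exists (finfun v); apply/ctrP => k; rewrite ffunE; exact: vP.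
have uniq_cell x v w : hcube (ctr v) tau x -> hcube (ctr w) tau x -> v = w.
  move=> /ctrP hv /ctrP hw; apply/ffunP => k; apply/val_inj/eqP; rewrite eqn_leq /=.
  have /andP[a1 a2] := hv k; have /andP[b1 b2] := hw k.
  have t2 : 0 < 2 * tau by rewrite mulr_gt0.
  have := lt_le_trans a1 b2; have := lt_le_trans b1 a2; rewrite !ltr_pM2l// !natr1 !ltr_nat !ltnS.
  by move=> -> ->.
have cells (m : meas) (X : set B) : measurable X ->
    m (hcube c rho `&` X) = (\sum_v m (hcube (ctr v) tau `&` X))%E.
  move=> mX; apply: measure_indic_sum => [|v|x].
  - by apply: measurableI => //; exact: measurable_hcube.
  - by apply: measurableI => //; exact: measurable_hcube.
  have [Xx|Xx] := pselect (X x); last by rewrite indic0 ?big1// => [v _|[]//]; apply: indic0 => -[].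
  have [cx|cx] := pselect (hcube c rho x).
    have [v vx] := cover x cx; rewrite indic1//.
    rewrite (bigD1 v)//= indic1// big1 ?addr0// => w wv; apply: indic0 => -[wx _].
    by move: wv; rewrite (uniq_cell _ _ _ wx vx) eqxx.
  by rewrite indic0 ?big1// => [v _|[]//]; apply: indic0 => -[/csub].
have hO1 : hspaces c hs_all rho `<=` O.
  by apply: subset_trans O'O; apply: subset_trans hO; apply: hspaces_sub; lra.
have rcell v : rel_compact_in O (hcube (ctr v) tau).
  by apply: rel_compact_hcube; exact: subset_trans hO1.
pose c1 : R := 4 ^+ n * (n%:R * 2) / eps.
have c10 : 0 <= c1 by rewrite /c1 !mulr_ge0 ?invr_ge0 ?exprn_ge0 ?(ltW eps0).
have one v k : p k -> (leb (hcube (ctr v) tau `&` W k) <= (c1 * tau)%:E * mu k (hcube (ctr v) tau))%E.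
  move=> pk; have mQ := measurable_hcube (ctr v) tau.
  have m0 : 0 < eps * tau ^+ n by rewrite mulr_gt0// exprn_gt0.
  have kap0 : 0 <= fine (mu k (hcube (ctr v) tau)) by rewrite fine_ge0.
  have := poincare oO (mWk k) (gW k) kap0 tau0 (rcell v)
    (fun k' => coord_bound (i := k) k' mQ (rcell v) (fun F _ _ => erefl)) (ltW m0) (bad (ctr v) k pk (csub' v)).
  rewrite -{2}(fineK (mu_finite k mQ (rcell v))) setIC -lee_pdivlMl// => /le_trans; apply.
  rewrite -!EFinM lee_fin le_eqVlt; apply/orP; left; apply/eqP.
  have T0 : tau ^+ n != 0 by rewrite expf_neq0// lt0r_neq0.
  have e0 : eps != 0 by rewrite lt0r_neq0.
  rewrite [(4 * tau) ^+ n]exprMn /c1; move: T0; set T := tau ^+ n; set F := 4 ^+ n; set kk := fine _ => T0.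
  by field; rewrite T0 e0.
have mQ := measurable_hcube c rho.
apply: (@le_trans _ _ (\sum_(k < N | p k) (c1 * tau)%:E * mu k (hcube c rho))%E).
  apply: lee_sum => k pk; rewrite cells; last exact: mWk.
  rewrite -[X in mu k X]setIT cells; last exact: measurableT.
  rewrite ge0_sume_distrr//; apply: lee_sum => v _; rewrite setIT; exact: one.
have ct0 : 0 <= c1 * tau by rewrite mulr_ge0// ltW.
rewrite -ge0_sume_distrr//.
pose b : R := (2 * (rho + rho)) ^+ n.
have b0 : 0 < b by rewrite exprn_gt0// mulr_gt0// addr_gt0.
have small : (leb (hcube c (rho + rho) `\` W i0) <= b%:E)%E.
  apply: (@le_trans _ _ (leb (hcube c (rho + rho)))).
    by apply: le_measure; rewrite ?inE//; [apply: measurableD => //|]; exact: measurable_hcube.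
  by rewrite [leLHS]lebesgue_hcube// addr_ge0// ltW.
have := mu_cube_complement rho0 b0 hO small.
set S := (\sum_(k < N) _)%E => SK.
apply: (@le_trans _ _ ((c1 * tau)%:E * (K1 * (b / rho + b `^ alpha))%:E)%E).
  apply: lee_wpmul2l; first by rewrite lee_fin.
  apply: le_trans SK; rewrite /S [leRHS](bigID p)/=.
  apply: (@le_trans _ _ (\sum_(k < N | p k) mu k (hspaces c hs_all rho))%E).
    by apply: lee_sum => k _; apply: le_measure; rewrite ?inE//; [exact: measurable_hspaces|exact: hcube_hspaces].
  by rewrite leeDl//; apply: sume_ge0.
rewrite -EFinM lee_fin /grid_constant -/c1 /tau.
have bE : b = 4 ^+ n * rho ^+ n by rewrite /b -exprMn; congr (_ ^+ _); ring.
(* Up to the constant, the left side is [rho^(n * alpha + 1)], and this exponent is at least [n]; as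
   [rho <= 1], the contribution of [G] is of the order of that of the perimeter. *)
have key : rho * b `^ alpha <= b.
  pose be : R := 1 - n%:R * (1 - alpha).
  have be0 : 0 <= be.
    by move: aln; rewrite ltr_pdivrMr ?ltr0n// /be; lra.
  have f1 : b `^ alpha <= 4 ^+ n * rho `^ (n%:R * alpha).
    rewrite bE powRM ?exprn_ge0 ?(ltW rho0)//.
    rewrite -[rho ^+ n](powR_mulrn _ (ltW rho0)) -powRrM; apply: ler_wpM2r; first exact: powR_ge0.
    have h4 : 1 <= 4 ^+ n :> R by rewrite exprn_ege1// ler1n.
    by rewrite -[leRHS]powRr1 ?exprn_ge0// ler_powR.
  apply: (@le_trans _ _ (rho * (4 ^+ n * rho `^ (n%:R * alpha)))); first by rewrite ler_pM2l.
  rewrite bE mulrCA ler_pM2l ?exprn_gt0//.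
  have -> : rho * rho `^ (n%:R * alpha) = rho ^+ n * rho `^ be.
    rewrite -{1}(powRr1 (ltW rho0)) -(powR_mulrn _ (ltW rho0)) -!powRD ?(gt_eqF rho0) ?implybT//.
    by congr (_ `^ _); rewrite /be; ring.
  rewrite ler_piMr ?exprn_ge0 ?(ltW rho0)//.
  apply: (@le_trans _ _ (1 `^ be)); last by rewrite powR1.
  by apply: ge0_ler_powR; rewrite ?nnegrE ?(ltW rho0).
have -> : c1 * (rho / L%:R) * (K1 * (b / rho + b `^ alpha)) = c1 / L%:R * K1 * (b + rho * b `^ alpha).
  by field; rewrite !lt0r_neq0.
have -> : c1 * (K1 * (2 * 4 ^+ n)) / L%:R * rho ^+ n = c1 / L%:R * K1 * (b + b).
  by rewrite bE; field; rewrite lt0r_neq0.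
apply: ler_wpM2l; last by rewrite lerD2l.
by apply: mulr_ge0; [exact: divr_ge0|exact: ltW perimeter_constant_gt0].
Qed.

Lemma sup_enorm (x z : V) t : 0 <= t -> (forall k, `|z ord0 k - x ord0 k| <= t) ->
  enorm (z - x) <= n%:R * t.
Proof.
move=> t0 h; apply: le_trans (enorm_le_sum _) _; apply: (@le_trans _ _ (\sum_(k < n) t)).
  by apply: ler_sum => k _; rewrite !mxE.
by rewrite sumr_const card_ord mulr_natl.
Qed.

Lemma hspaces_eball (x : V) (t r : R) : 0 <= t -> n%:R * t < r -> hspaces x hs_all t `<=` eball x r.
Proof.
move=> t0 tr z /hs_allP h; rewrite /eball/=; apply: le_lt_trans tr; apply: sup_enorm => // k.
by have /andP[h1 h2] := h k; rewrite ler_norml; lra.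
Qed.

Lemma ball_hcube (x : V) t : ball x t `<=` hcube x t.
Proof.
move=> z [_ zt]; apply/hcubeP => k; have := zt ord0 k; rewrite /ball/= ltr_distlC => /andP[h1 h2].
by apply/andP; split; lra.
Qed.

Lemma eball_ball (x : V) t : 0 < t -> eball x t `<=` ball x t.
Proof.
move=> t0 z zt; split => // a' b'; rewrite ord1 /ball/= distrC.
by have := coord_le_enorm (z - x) b'; rewrite !mxE => /le_lt_trans; apply.
Qed.

Lemma null_ball_sharp k (x : V) t : 0 < t -> hspaces x hs_all t `<=` O' ->
  leb (hcube x t `\` W k) = 0%E -> ball x t `<=` sharp O W k.
Proof.
move=> t0 hO null; apply: sharp_ball => //.
  by move=> y /ball_hcube /hcube_hspaces /hO /O'O.
apply/eqP; rewrite eq_le measure_ge0 andbT -null; apply: le_measure; rewrite ?inE.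
- by apply: measurableD => //; apply: open_measurable_rV; exact: ball_open.
- by apply: measurableD => //; exact: measurable_hcube.
- by move=> y [/ball_hcube].
Qed.

(** A cube of half-side [t] lies in the Euclidean ball of radius [r] if [n * t < r]; with
    [rho = r / (4 n)] this holds for the doubled cube that the perimeter bound requires. A cell has
    half-side [rho / L], and half of this is [r / (8 n L)]: the Euclidean ball of this radius lies
    in the half cell. *)
Lemma good_cube (i0 : 'I_N) (p : pred 'I_N) (x : V) (r eps : R) (L : nat) :
  decays (2 * n%:R * K1) eps -> 0 < eps -> (0 < L)%N -> 0 < r -> r <= 1 -> eball x r `<=` O' ->
  ((grid_constant eps / L%:R * (r / (4 * n%:R)) ^+ n)%:E <
    \sum_(k < N | p k) leb (hcube x (r / (4 * n%:R)) `&` W k))%E ->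
  exists k xi, [/\ p k, sharp O W k xi &
    eball xi ((8 * n%:R * L%:R)^-1 * r) `<=` sharp O W k `&` eball x r].
Proof.
move=> dec eps0 L0 r0 r1 xO big; set rho := r / (4 * n%:R) in big.
have nR : 1 <= n%:R :> R by rewrite ler1n.
have LR : 1 <= L%:R :> R by rewrite ler1n.
have nR0 : 0 < n%:R :> R by apply: lt_le_trans nR.
have LR0 : 0 < L%:R :> R by apply: lt_le_trans LR.
have rho0 : 0 < rho by rewrite divr_gt0// mulr_gt0.
have rhoE : n%:R * rho = r / 4 by rewrite /rho; field; rewrite lt0r_neq0.
have rho1 : rho <= 1.
  apply: (@le_trans _ _ (n%:R * rho)); first by rewrite ler_peMl// ltW.
  by rewrite rhoE; lra.
have hx t : 0 <= t -> t <= rho + rho -> hspaces x hs_all t `<=` eball x r.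
  move=> t0 tr; apply: hspaces_eball => //; apply: (@le_lt_trans _ _ (n%:R * (rho + rho))).
    by rewrite ler_pM2l.
  by rewrite mulrDr rhoE; lra.
have hO2 : hspaces x hs_all (rho + rho) `<=` O'.
  by apply: subset_trans xO; apply: hx => //; lra.
set tau := rho / L%:R.
have tau0 : 0 < tau by rewrite divr_gt0.
have tau1 : tau <= 1 by rewrite ler_pdivrMr// mul1r (le_trans rho1).
apply: contrapT => no; move: big; rewrite ltNge => /negP; apply.
apply: (grid i0 L0 eps0 rho0 rho1 hO2) => v k pk vx; rewrite -/tau leNgt; apply/negP => small.
apply: no; exists k, v.
have hv : hspaces v hs_all tau `<=` eball x r by apply: subset_trans vx _; apply: hx; lra.
have hvO := subset_trans hv xO.
have t20 : 0 < tau / 2 by rewrite divr_gt0.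
have hv2 : hspaces v hs_all (tau / 2) `<=` hspaces v hs_all tau by apply: hspaces_sub; lra.
have null := density_complement dec hvO tau0 tau1 (ltW small).
have bs := null_ball_sharp t20 (subset_trans hv2 hvO) null.
have -> : (8 * n%:R * L%:R)^-1 * r = tau / 2 by rewrite /tau /rho; field; rewrite !lt0r_neq0.
split => //; first by apply: bs; exact: ballxx.
move=> y /(eball_ball t20) yb; split; first exact: bs.
by apply: hv; apply: hv2; apply: hcube_hspaces; exact: ball_hcube.
Qed.

(** Otherwise [density_complement] makes [W i] fill the half cube up to a null set, which puts [x]
    in [sharp], and this set excludes [bdry]. *)
Lemma bdry_volume i (x : V) (t eps : R) : decays (2 * n%:R * K1) eps -> 0 < t -> t <= 1 ->
  hspaces x hs_all t `<=` O' -> bdry O W x ->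
  ((eps * t ^+ n)%:E < \sum_(l < N | l != i) leb (hcube x t `&` W l))%E.
Proof.
move=> dec t0 t1 hO bx; have mQ := measurable_hcube x t.
rewrite -complement_volume//; last by move=> y /hcube_hspaces /hO /O'O.
rewrite ltNge; apply/negP => small.
have t20 : 0 < t / 2 by rewrite divr_gt0.
have hO2 : hspaces x hs_all (t / 2) `<=` O' by apply: subset_trans hO; apply: hspaces_sub; lra.
have := null_ball_sharp t20 hO2 (density_complement dec hO t0 t1 small) (ballxx x t20).
by case.
Qed.

(** Otherwise [density_self] makes [W i] null near [x], and by [not_reduced] its reduced boundary
    stays away from [x]. *)
Lemma bdry_i_volume i (x : V) (t eps : R) : decays (2 * n%:R * (N.-1%:R ^+ 2 * K1 + 1)) eps ->
  0 < t -> t <= 1 -> hspaces x hs_all t `<=` O' -> bdry_i O W i x ->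
  ((eps * t ^+ n)%:E < leb (hcube x t `&` W i))%E.
Proof.
move=> dec t0 t1 hO [Ox cl]; rewrite ltNge setIC; apply/negP => small.
have t20 : 0 < t / 2 by rewrite divr_gt0.
have null := density_self dec hO t0 t1 small.
have oU : open (ball x (t / 2)) by exact: ball_open.
have UO : ball x (t / 2) `<=` O.
  by move=> y /ball_hcube /hcube_hspaces hy; apply/O'O/hO; apply: hspaces_sub hy; lra.
have [z [rz zU]] := cl _ (open_nbhs_nbhs (conj oU (ballxx x t20))).
apply: (not_reduced oU UO _ zU) rz; left.
apply/eqP; rewrite eq_le measure_ge0 andbT -null; apply: le_measure; rewrite ?inE.
- by apply: measurableI => //; exact: open_measurable_rV.
- by apply: measurableI => //; exact: measurable_hcube.
- by apply: setIS; exact: ball_hcube.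
Qed.

End regularity.

End minimizer.

(** Connectedness of the segment from [x] to [y]: its part in [A] is open in it, and also closed,
    since a point of it in the closure but not in [A] would be a boundary point at distance less
    than [r] from [x]. *)
Lemma eball_sub (R : realType) n (A : set 'rV[R]_n) (x : 'rV[R]_n) (r : R) : open A -> A x ->
  (r%:E <= eucl_dist x (boundary A))%E -> eball x r `<=` A.
Proof.
move=> oA Ax rd y xy; pose g (s : R) : 'rV[R]_n := x + s *: (y - x).
have cg : continuous g.
  by move=> s; apply: cvgD; [exact: cvg_cst|apply: cvgZl; exact: cvg_id].
have H : `[0, 1]%classic `&` g @^-1` A = `[0, 1]%classic.
  apply: (@segment_connected R 0 1).
  - by exists 0; split; [rewrite /= in_itv/= lexx ler01|rewrite /g/= scale0r addr0].
  - by exists (g @^-1` A) => //; apply: open_comp => // s _; exact: cg.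
  exists (g @^-1` (closure A)); first by apply: closed_comp => [s _|]; [exact: cg|exact: closed_closure].
  apply/seteqP; split => s [s01 As]; split => //; first exact: subset_closure.
  apply: contrapT => nA; have : (eucl_dist x (boundary A) <= (enorm (g s - x))%:E)%E.
    by apply: ereal_inf_lbound; exists (g s) => //; split => // /interior_subset.
  move: s01; rewrite /= in_itv/= => /andP[s0 s1] /(le_trans rd); rewrite lee_fin leNgt => /negP; apply.
  apply: le_lt_trans xy; rewrite /g addrAC subrr add0r.
  rewrite -(ler_pXn2r (n := 2))// ?nnegrE ?enorm_ge0// !sqr_enorm; apply: ler_sum => k _.
  by rewrite mxE exprMn ler_piMl ?sqr_ge0// exprn_ile1.
have : (`[0, 1]%classic : set R) 1 by rewrite /= in_itv/= ler01 lexx.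
by rewrite -H => -[_]; rewrite /g/= scale1r addrC subrK.
Qed.

Theorem theorem6p1 (R : realType) (n : nat) (alpha Calpha delta : R) :
  (0 < n)%N ->
  (n%:R - 1) / n%:R < alpha -> alpha <= 1 ->
  0 <= Calpha ->
  0 < delta ->
  exists2 C1 : R, 1 <= C1 &
  forall N : nat, (0 < N)%N ->
  exists2 C2 : R, 1 <= C2 &
  forall (Omega : set 'rV[R]_n) (a : 'rV[R]_n -> R) (G : ('I_N -> set 'rV[R]_n) -> R)
    (Omega' : set 'rV[R]_n) (W : 'I_N -> set 'rV[R]_n),
  open Omega -> connected Omega -> Omega !=set0 -> bounded_set Omega ->
  measurable_fun (Omega : set (borelRn R n)) (a : borelRn R n -> R) ->
  (forall x, Omega x -> 0 < a x) ->
  (forall W1 W2, weak_partition Omega W1 -> weak_partition Omega W2 ->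
     (`|G W1 - G W2|%:E <= Calpha%:E * (partition_dist W1 W2 `^ alpha))%E) ->
  open Omega' -> Omega' `<=` Omega ->
  (forall x, Omega' x -> delta <= a x <= 1) ->
  is_minimizer Omega a G W ->
  (forall (x : 'rV[R]_n) (r : R),
     bdry Omega W x -> Omega' x ->
     0 < r -> (r%:E <= mine 1 (eucl_dist x (boundary Omega')))%E ->
     exists i j : 'I_N, i != j /\
     exists xi xj : 'rV[R]_n, [/\
       sharp Omega W i xi, sharp Omega W j xj,
       eball xi (C1^-1 * r) `<=` sharp Omega W i `&` eball x r &
       eball xj (C1^-1 * r) `<=` sharp Omega W j `&` eball x r])
  /\
  (forall (i : 'I_N) (x : 'rV[R]_n) (r : R),
     bdry_i Omega W i x -> Omega' x ->
     0 < r -> (r%:E <= mine 1 (eucl_dist x (boundary Omega')))%E ->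
     exists2 xi : 'rV[R]_n, sharp Omega W i xi &
       eball xi (C2^-1 * r) `<=` sharp Omega W i `&` eball x r).
Proof.
move=> n0 al1 al2 Ca0 d0.
have nR : 1 <= n%:R :> R by rewrite ler1n.
have nR0 : 0 < n%:R :> R by apply: lt_le_trans nR.
have al0 : 0 <= alpha.
  by apply: le_trans (ltW al1); rewrite divr_ge0 ?subr_ge0// ltW.
have K0 := perimeter_constant_gt0 Ca0 d0 n0.
set K := perimeter_constant n Calpha delta in K0.
have A0 : 0 < 2 * n%:R * K by rewrite mulr_gt0// mulr_gt0.
have [eps eps0 dec] := density_iteration n0 al1 al2 A0.
set Cg := grid_constant n Calpha delta eps.
have Cg0 : 0 <= Cg.
  rewrite /Cg /grid_constant -/K; apply: mulr_ge0.
    by apply: divr_ge0; [apply: mulr_ge0; [exact: exprn_ge0|rewrite mulr_ge0// ltW]|exact: ltW].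
  by apply: mulr_ge0; [exact: ltW|apply: mulr_ge0 => //; exact: exprn_ge0].
have bound_gt (e : R) : 0 < e -> exists2 L : nat, (0 < L)%N & Cg / L%:R < e.
  move=> e0; have x0 : 0 <= Cg / e by rewrite divr_ge0// ltW.
  have L0 : 0 < (Num.bound (Cg / e))%:R :> R by apply: le_lt_trans x0 (archi_boundP x0).
  exists (Num.bound (Cg / e)); first by rewrite -(ltr_nat R).
  by rewrite ltr_pdivrMr// mulrC -ltr_pdivrMr//; exact: archi_boundP.
(* The bound by 1 serves the first index, where all sets compete and their total volume is that of
   the cube; the bound by [eps] serves the second one, through [bdry_volume]. *)
have m0 : 0 < Num.min 1 eps by rewrite lt_min ltr01.
have [L L0 Lb] := bound_gt _ m0.
have [L1 Le] : Cg / L%:R < 1 /\ Cg / L%:R < eps by apply/andP; rewrite -lt_min.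
have C_ge1 (L' : nat) : (0 < L')%N -> 1 <= 8 * n%:R * L'%:R :> R.
  by move=> L'0; rewrite -!natrM ler1n !muln_gt0 n0.
exists (8 * n%:R * L%:R); first exact: C_ge1.
move=> N N0.
(* From here on the constants depend on [N], through the perimeter bound of [mu_cube_self]. *)
have A20 : 0 < 2 * n%:R * (N.-1%:R ^+ 2 * K + 1).
  rewrite mulr_gt0 ?(mulr_gt0 _ nR0)//; apply: ltr_wpDl => //.
  by apply: mulr_ge0; [exact: exprn_ge0|exact: ltW].
have [eps2 eps20 dec2] := density_iteration n0 al1 al2 A20.
have [L2 L20 Lb2] := bound_gt _ eps20.
exists (8 * n%:R * L2%:R); first exact: C_ge1.
move=> Omega a G Omega' W oO _ _ bO ma a0 holder oO' O'O aO' minW.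
have bO' : exists r, forall x, Omega x -> `|x| <= r.
  have [M [_ HM]] := bO; exists (M + 1) => x Ox; apply: HM => //; lra.
have [mu [muE FW]] := F_wE a oO minW.1.
have exg k : exists PM : ('I_n -> {measure set (borelRn R n) -> \bar R}) *
    ('I_n -> {measure set (borelRn R n) -> \bar R}), grad Omega (W k) PM.1 PM.2.
  by have [_ _ [D /is_gradient_grad[P [M [g _]]]]] := minW.1.1 k; exists (P, M).
have [PM gW] := choice exg.
have facts (x : 'rV[R]_n) (r : R) : Omega' x -> 0 < r ->
    (r%:E <= mine 1 (eucl_dist x (boundary Omega')))%E ->
    [/\ r <= 1, eball x r `<=` Omega', 0 < r / (4 * n%:R), r / (4 * n%:R) <= 1 &
     hspaces x (hs_all n) (r / (4 * n%:R)) `<=` Omega'].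
  move=> O'x r0; rewrite le_min => /andP[]; rewrite lee_fin => r1 rd.
  have sub := eball_sub oO' O'x rd.
  have rho0 : 0 < r / (4 * n%:R) by rewrite divr_gt0// mulr_gt0.
  have rhoE : n%:R * (r / (4 * n%:R)) = r / 4 by field; rewrite lt0r_neq0.
  split => //.
    apply: (@le_trans _ _ (n%:R * (r / (4 * n%:R)))); first by rewrite ler_peMl// ltW.
    by rewrite rhoE; lra.
  apply: subset_trans sub; apply: hspaces_eball; first exact: ltW.
  by rewrite rhoE; lra.
split => [x r bx O'x r0 rd|i x r bx O'x r0 rd].
  have [r1 xO rho0 rho1 hO] := facts x r O'x r0 rd.
  set rho := r / (4 * n%:R) in rho0 rho1 hO.
  have rn0 : 0 < rho ^+ n by rewrite exprn_gt0.
  pose i0 : 'I_N := Ordinal N0.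
  have good p := @good_cube R n N Omega a G W alpha Calpha oO bO' ma a0 al0 Ca0 holder minW mu muE FW
    (fun k => (PM k).1) (fun k => (PM k).2) gW Omega' delta O'O d0 aO' al2 n0 al1 i0 p x r eps L dec eps0 L0 r0 r1 xO.
  have [|i [xi [_ si bi]]] := good xpredT.
    have QO : hcube x rho `<=` Omega by move=> y /hcube_hspaces /hO /O'O.
    rewrite -/rho -(total_volume minW (measurable_hcube x rho) QO) lebesgue_hcube ?(ltW rho0)//.
    rewrite lte_fin -/rho [(2 * rho) ^+ n]exprMn ltr_pM2r//; apply: (lt_le_trans L1).
    by rewrite exprn_ege1// ler1n.
  have [|j [xj [ji sj bj]]] := good (predC1 i).
    apply: (@le_lt_trans _ _ (eps * rho ^+ n)%:E).
      by rewrite lee_fin -/rho -/Cg ler_wpM2r// ltW.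
    exact: (@bdry_volume R n N Omega a G W alpha Calpha oO bO' ma a0 al0 Ca0 holder minW mu muE FW
      (fun k => (PM k).1) (fun k => (PM k).2) gW Omega' delta O'O d0 aO' al2 n0 i x rho eps dec rho0 rho1 hO bx).
  exists i, j; split; first by rewrite eq_sym.
  by exists xi, xj; split.
have [r1 xO rho0 rho1 hO] := facts x r O'x r0 rd.
set rho := r / (4 * n%:R) in rho0 rho1 hO.
have [|k [xi [/eqP ki si bi]]] := @good_cube R n N Omega a G W alpha Calpha oO bO' ma a0 al0 Ca0 holder minW mu muE FW
    (fun k => (PM k).1) (fun k => (PM k).2) gW Omega' delta O'O d0 aO' al2 n0 al1 i (pred1 i) x r eps L2 dec eps0 L20 r0 r1 xO.
  rewrite big_pred1_eq; apply: (@le_lt_trans _ _ (eps2 * rho ^+ n)%:E).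
    by rewrite lee_fin -/rho -/Cg ler_wpM2r// ltW// exprn_gt0.
  exact: (@bdry_i_volume R n N Omega a G W alpha Calpha oO bO' ma a0 al0 Ca0 holder minW mu muE FW
    (fun k => (PM k).1) (fun k => (PM k).2) gW Omega' delta O'O d0 aO' al2 n0 i x rho eps2 dec2 rho0 rho1 hO bx).
by exists xi; [rewrite -ki|rewrite -ki].
Qed.
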